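(* Let $\omega<s$. Suppose that the standing assumptions (1)-(3) of the context hold, that $\bar a_2,\bar b_2\neq0$ and $\partial_\omega\|U_0\|_{L^2}^2>0$, that $\lambda_0\in i(\omega,s)$ is a simple zero of $E_{\mathrm B}(\lambda)$ with $E_{\mathrm A}(\lambda_0),E_{\mathrm C}(\lambda_0)\neq0$, and that $\Delta_1(\lambda_0)\neq0$ and $\mathcal I_2(\lambda_0)\neq0$. Then for $\epsilon>0$ sufficiently small, $\mathcal L_\epsilon$ has no eigenvalue in a neighborhood of $\lambda=\lambda_0$.
   Context: Setting. Fix real constants $\omega,s>0$ and a function $F:\mathbb R\times\mathbb R\times\mathbb R\to\mathbb R$, $(\zeta_1,\zeta_2,\mu)\mapsto F(\zeta_1,\zeta_2;\mu)$, with real parameter $\mu$; $\partial_jF$ ($j=1,2$) is the derivative in the $j$-th argument. The coupled nonlinear Schrödinger equations are $$i\partial_tu+\partial_x^2u+\partial_1F(|u|^2,|v|^2;\mu)u=0,\quad i\partial_tv+\partial_x^2v+\partial_2F(|u|^2,|v|^2;\mu)v=0.$$ A real-valued solution $(U,V)$, with $U(x),V(x)\to0$ as $x\to\pm\infty$ (a homoclinic solution), of the stationary system $$-U''+\omega U-\partial_1F(U^2,V^2;\mu)U=0,\quad -V''+sV-\partial_2F(U^2,V^2;\mu)V=0$$ gives the solitary wave $(e^{i\omega t}U(x),e^{ist}V(x))$. Standing assumptions. (1) $F$ is $C^3$ and $F(0,0;\mu)=\partial_1F(0,0;\mu)=\partial_2F(0,0;\mu)=0$, $\partial_\mu F(\zeta,0;\mu)=0$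 for all $\zeta,\mu\in\mathbb R$. One writes $\partial_1^jF(\zeta,0)$ for $\partial_1^jF(\zeta,0;\mu)$. (2) $-U''+\omega U-\partial_1F(U^2,0)U=0$ has a homoclinic solution $U_0\not\equiv0$ with $\lim_{x\to\pm\infty}U_0(x)=0$ and $U_0'(0)=0$; it is taken positive, even, with $U_0'(x)<0$ for $x>0$. It depends on $\omega$, and $\partial_\omega\|U_0\|_{L^2}^2$ is the derivative of $\|U_0\|_{L^2(\mathbb R)}^2$ in $\omega$ along this family. (3) At $\mu=0$ the equation $-\delta V''+s\,\delta V-\partial_2F(U_0(x)^2,0;0)\delta V=0$ has a nonzero bounded solution $V_1(x)$ with $\lim_{x\to\pm\infty}V_1(x)=0$. Bifurcated waves. Let $\phi_{11},\phi_{12}$ solve $-\phi''+\omega\phi-\bigl(2\partial_1^2F(U_0^2,0)U_0^2+\partial_1F(U_0^2,0)\bigr)\phi=0$ with $\phi_{11}(0)=1,\phi_{11}'(0)=0$, $\phi_{12}(0)=0,\phi_{12}'(0)=1$; let $g=\partial_1\partial_2F(U_0^2,0;0)U_0V_1^2$, $U_2(x)=-\phi_{11}(x)\int_x^\infty\phi_{12}g\,dy-\phi_{12}(x)\int_0^x\phi_{11}g\,dy$, and $$\bar a_2=-\int_{\mathbb R}\partial_2\partial_\mu F(U_0^2,0;0)V_1^2\,dx,\quad \bar b_2=-2\int_{\mathbb R}\partial_1\partial_2F(U_0^2,0;0)U_0U_2V_1^2\,dx-\int_{\mathbb R}\partial_2^2F(U_0^2,0;0)V_1^4\,dx.$$ If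 $\bar a_2,\bar b_2\ne0$, a pitchfork bifurcation of $(U_0,0)$ occurs at $\mu=0$: for small $\epsilon>0$ and $\mu=\bar\mu\epsilon^2$, $\bar\mu=-\bar b_2/\bar a_2$, there are homoclinic solutions $(U_\epsilon,V_\epsilon)$ with $U_\epsilon=U_0+\epsilon^2U_2+O(\epsilon^4)$, $V_\epsilon=\pm(\epsilon V_1+O(\epsilon^3))$, giving the bifurcated solitary waves $(e^{i\omega t}U_\epsilon,e^{ist}V_\epsilon)$. Linearized operator. The linearized operator $\mathcal L:H^2(\mathbb R,\mathbb C^4)\subset L^2(\mathbb R,\mathbb C^4)\to L^2(\mathbb R,\mathbb C^4)$ around $(e^{i\omega t}U,e^{ist}V)$ is $$\mathcal L=-i\Sigma_3\left[-\partial_x^2I_4+\begin{pmatrix}\omega I_2&O_2\\O_2&sI_2\end{pmatrix}-\begin{pmatrix}B_{11}&B_{12}\\ B_{21}&B_{22}\end{pmatrix}\right],$$ with $\sigma_1=\begin{pmatrix}0&1\\1&0\end{pmatrix}$, $\sigma_3=\mathrm{diag}(1,-1)$, $\Sigma_3=\mathrm{diag}(\sigma_3,\sigma_3)$, and, all derivatives of $F$ being evaluated at $(U(x)^2,V(x)^2;\mu)$, $B_{11}=\partial_1^2F\,U^2(I_2+\sigma_1)+\partial_1F\,I_2$, $B_{12}=B_{21}=\partial_1\partial_2F\,UV(I_2+\sigma_1)$, $B_{22}=\partial_2^2F\,V^2(I_2+\sigma_1)+\partial_2F\,I_2$. $\mathcal L_\epsilon$ is the linearized operator around the bifurcated wave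 (with $\mu=\bar\mu\epsilon^2$). Jost solutions and Evans functions at $\epsilon=0$ (so $\mu=0$). Let $\nu_1=\sqrt{\omega-i\lambda}$, $\nu_2=\sqrt{\omega+i\lambda}$, $\nu_3=\sqrt{s-i\lambda}$, $\nu_4=\sqrt{s+i\lambda}$ with $-3\pi/4<\arg\nu_1,\arg\nu_3<\pi/4$ and $-\pi/4<\arg\nu_2,\arg\nu_4<3\pi/4$. Consider (A) $-p''+\omega p-\partial_1^2F(U_0^2,0)U_0^2(p+q)-\partial_1F(U_0^2,0)p=i\lambda p$, $\ -q''+\omega q-\partial_1^2F(U_0^2,0)U_0^2(p+q)-\partial_1F(U_0^2,0)q=-i\lambda q$; (B) $-p''+sp-\partial_2F(U_0^2,0;0)p=-i\lambda p$; (C) $-p''+sp-\partial_2F(U_0^2,0;0)p=i\lambda p$. Let $(p_j,q_j)(x,\lambda)$, $j=1,2,5,6$, be solutions of (A) such that $e^{-\nu_1x}(p_1,q_1,p_1',q_1')\to(1,0,\nu_1,0)$ and $e^{-\nu_2x}(p_2,q_2,p_2',q_2')\to(0,1,0,\nu_2)$ as $x\to-\infty$, and $e^{\nu_1x}(p_5,q_5,p_5',q_5')\to(1,0,-\nu_1,0)$ and $e^{\nu_2x}(p_6,q_6,p_6',q_6')\to(0,1,0,-\nu_2)$ as $x\to+\infty$. Let $p_4,p_8$ solve (B) and $p_3,p_7$ solve (C), with $e^{-\nu_jx}(p_j,p_j')\to(1,\nu_j)$ as $x\to-\infty$ for $j=3,4$ and $e^{\nu_jx}(p_{j+4},p_{j+4}')\to(1,-\nu_j)$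 as $x\to+\infty$ for $j=3,4$. All are chosen analytic in $\lambda$ near $\lambda_0$. Define $$E_{\mathrm A}(\lambda)=\det\begin{pmatrix}p_1&p_2&p_5&p_6\\ q_1&q_2&q_5&q_6\\ p_1'&p_2'&p_5'&p_6'\\ q_1'&q_2'&q_5'&q_6'\end{pmatrix}(0,\lambda),\quad E_{\mathrm B}(\lambda)=\det\begin{pmatrix}p_4&p_8\\ p_4'&p_8'\end{pmatrix}(0,\lambda),\quad E_{\mathrm C}(\lambda)=\det\begin{pmatrix}p_3&p_7\\ p_3'&p_7'\end{pmatrix}(0,\lambda).$$ For $j=1,2$ let $$\Delta_j(\lambda)=p_j(0,\lambda)p_j'(0,\lambda)+q_j(0,\lambda)q_j'(0,\lambda),$$ $$\mathcal I_j(\lambda)=\int_{-\infty}^\infty\partial_1\partial_2F(U_0(x)^2,0;0)U_0(x)V_1(x)\bigl(p_j(x,\lambda)+q_j(x,\lambda)\bigr)p_4(x,\lambda)\,dx.$$ Normalization: for $\lambda_0\in i(\omega,s)$, $(p_1,q_1)$ is uniquely determined and one takes $(p_5,q_5)(x)=(p_1,q_1)(-x)$; $(p_2,q_2)$ is determined only up to adding multiples of $(p_1,q_1)$, and when $\Delta_1(\lambda_0)\ne0$ it is fixed uniquely by the requirement $p_2'p_5+q_2'q_5-p_2p_5'-q_2q_5'=0$ (this expression is independent of $x$). $\mathcal I_2$ is formed with this choice. *)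

(* Defs.v *)
From HB Require Import structures.
From mathcomp Require Import all_boot all_order all_algebra.
From mathcomp Require Import all_classical all_reals all_analysis.
From mathcomp Require Import complex.
Set Implicit Arguments.
Unset Strict Implicit.
Unset Printing Implicit Defensive.
Import Order.TTheory GRing.Theory Num.Theory numFieldNormedType.Exports.
Local Open Scope ring_scope.
Local Open Scope complex_scope.
Local Open Scope classical_set_scope.

(* [R[i]^o] carries the normed topology of the complex field: it is written
   wherever a neighbourhood, a limit or a complex derivative is meant. *)

Definition twice_derivable (R : realType) (f : R -> R) : Prop :=
  (forall x, derivable f x 1) /\ (forall x, derivable f^`() x 1).

Definition vanishes_at_infty (R : realType) (f : R -> R) : Prop :=
  (f x @[x --> -oo] --> (0 : R)) /\ (f x @[x --> +oo] --> (0 : R)).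

Definition oriented_int (R : realType) (a b : R) (f : R -> R) : R :=
  if a <= b then \int[lebesgue_measure]_(y in `[a, b]) f y
  else - \int[lebesgue_measure]_(y in `[b, a]) f y.

(* Derivatives and integrals of functions from the real line to the complex
   field are taken on real and imaginary parts. *)
Definition cderivable (R : realType) (f : R -> R[i]) (x : R) : Prop :=
  derivable (fun y => complex.Re (f y)) x 1 /\
  derivable (fun y => complex.Im (f y)) x 1.

Definition cderive (R : realType) (f : R -> R[i]) (x : R) : R[i] :=
  (fun y => complex.Re (f y))^`() x +i* (fun y => complex.Im (f y))^`() x.

Definition ctwice_derivable (R : realType) (f : R -> R[i]) : Prop :=
  (forall x, cderivable f x) /\ (forall x, cderivable (cderive f) x).

Definition cint (R : realType) (f : R -> R[i]) : R[i] :=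
  (\int[lebesgue_measure]_x complex.Re (f x)) +i*
  (\int[lebesgue_measure]_x complex.Im (f x)).

Definition cexp (R : realType) (z : R[i]) : R[i] :=
  (expR (complex.Re z))%:C * (cos (complex.Im z) +i* sin (complex.Im z)).

Definition sqrt_branch (R : realType) (th1 th2 : R) (z nu : R[i]) : Prop :=
  nu ^+ 2 = z /\
  exists r th : R,
    [/\ 0 < r, th1 < th, th < th2 & nu = r%:C * (cos th +i* sin th)].

Definition D1 (R : realType) (F : R -> R -> R -> R) : R -> R -> R -> R :=
  fun z1 z2 m => (fun z => F z z2 m)^`() z1.
Definition D2 (R : realType) (F : R -> R -> R -> R) : R -> R -> R -> R :=
  fun z1 z2 m => (fun z => F z1 z m)^`() z2.
Definition Dmu (R : realType) (F : R -> R -> R -> R) : R -> R -> R -> R :=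
  fun z1 z2 m => (fun z => F z1 z2 z)^`() m.

Fixpoint Ck (R : realType) (k : nat) (F : R -> R -> R -> R) : Prop :=
  continuous (fun z : R * R * R => F z.1.1 z.1.2 z.2) /\
  match k with
  | 0%N => True
  | k'.+1 =>
      (forall z1 z2 m, [/\ derivable (fun z => F z z2 m) z1 1,
                           derivable (fun z => F z1 z m) z2 1 &
                           derivable (fun z => F z1 z2 z) m 1]) /\
      [/\ Ck k' (D1 F), Ck k' (D2 F) & Ck k' (Dmu F)]
  end.

Definition nonlinearity (R : realType) (F : R -> R -> R -> R) : Prop :=
  [/\ Ck 3 F,
      forall m, [/\ F 0 0 m = 0, D1 F 0 0 m = 0 & D2 F 0 0 m = 0] &
      forall z m, Dmu F z 0 m = 0].

Definition homoclinic (R : realType) (F : R -> R -> R -> R) (omega s m : R)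
    (U V : R -> R) : Prop :=
  [/\ twice_derivable U /\ twice_derivable V,
      forall x, - U^`(2)%classic x + omega * U x
                - D1 F (U x ^+ 2) (V x ^+ 2) m * U x = 0,
      forall x, - V^`(2)%classic x + s * V x
                - D2 F (U x ^+ 2) (V x ^+ 2) m * V x = 0 &
      vanishes_at_infty U /\ vanishes_at_infty V].

(* As [F z 0 m] does not depend on [m], the derivatives of [F z 0 m] in [z]
   are evaluated at [m = 0] here and below. *)
Definition fundamental_wave (R : realType) (F : R -> R -> R -> R) (omega : R)
    (U : R -> R) : Prop :=
  [/\ twice_derivable U,
      forall x, - U^`(2)%classic x + omega * U x - D1 F (U x ^+ 2) 0 0 * U x = 0,
      vanishes_at_infty U,
      U^`()%classic 0 = 0 &
      [/\ forall x, 0 < U x,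
          forall x, U (- x) = U x &
          forall x, 0 < x -> U^`()%classic x < 0]].

Definition L2_norm_sq (R : realType) (f : R -> R) : R :=
  fine ('N[lebesgue_measure]_2%:E[EFin \o f])%E ^+ 2.

Definition bounded_mode (R : realType) (F : R -> R -> R -> R) (s : R)
    (U0 V1 : R -> R) : Prop :=
  [/\ twice_derivable V1,
      forall x, - V1^`(2)%classic x + s * V1 x - D2 F (U0 x ^+ 2) 0 0 * V1 x = 0,
      exists x, V1 x != 0,
      exists M, forall x, `|V1 x| <= M &
      vanishes_at_infty V1].

Definition variational_sol (R : realType) (F : R -> R -> R -> R) (omega : R)
    (U0 phi : R -> R) : Prop :=
  twice_derivable phi /\
  forall x, - phi^`(2)%classic x + omega * phi x
            - (2 * D1 (D1 F) (U0 x ^+ 2) 0 0 * U0 x ^+ 2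
               + D1 F (U0 x ^+ 2) 0 0) * phi x = 0.

Definition U2_forcing (R : realType) (F : R -> R -> R -> R)
    (U0 V1 : R -> R) (x : R) : R :=
  D1 (D2 F) (U0 x ^+ 2) 0 0 * U0 x * V1 x ^+ 2.

Definition U2 (R : realType) (F : R -> R -> R -> R)
    (U0 V1 phi11 phi12 : R -> R) (x : R) : R :=
  - phi11 x * (\int[lebesgue_measure]_(y in `[x, +oo[)
                  (phi12 y * U2_forcing F U0 V1 y))
  - phi12 x * oriented_int 0 x (fun y => phi11 y * U2_forcing F U0 V1 y).

Definition a2bar (R : realType) (F : R -> R -> R -> R) (U0 V1 : R -> R) : R :=
  - \int[lebesgue_measure]_x (D2 (Dmu F) (U0 x ^+ 2) 0 0 * V1 x ^+ 2).

Definition b2bar (R : realType) (F : R -> R -> R -> R)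
    (U0 V1 phi11 phi12 : R -> R) : R :=
  - (2 * \int[lebesgue_measure]_x
       (D1 (D2 F) (U0 x ^+ 2) 0 0 * U0 x * U2 F U0 V1 phi11 phi12 x
        * V1 x ^+ 2))
  - \int[lebesgue_measure]_x (D2 (D2 F) (U0 x ^+ 2) 0 0 * V1 x ^+ 4).

Definition mubar (R : realType) (F : R -> R -> R -> R)
    (U0 V1 phi11 phi12 : R -> R) : R :=
  - b2bar F U0 V1 phi11 phi12 / a2bar F U0 V1.

(* [b] selects the sign of the V-component; the remainders are uniform
   in x. *)
Definition bifurcated_waves (R : realType) (F : R -> R -> R -> R)
    (omega s : R) (U0 V1 phi11 phi12 : R -> R) (b : bool)
    (U V : R -> R -> R) : Prop :=
  exists C : R, \forall eps \near 0^'+,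
    homoclinic F omega s (mubar F U0 V1 phi11 phi12 * eps ^+ 2)
      (U eps) (V eps) /\
    forall x,
      `|U eps x - (U0 x + eps ^+ 2 * U2 F U0 V1 phi11 phi12 x)| <= C * eps ^+ 4
      /\ `|V eps x - (-1) ^+ b * (eps * V1 x)| <= C * eps ^+ 3.

(* On the line, C^1 test functions give the same weak derivatives as smooth
   ones. *)
Definition test_function (R : realType) (phi : R -> R) : Prop :=
  [/\ forall x, derivable phi x 1, continuous phi^`() &
      exists M, forall x, M < `|x| -> phi x = 0].

Definition weak_derivative (R : realType) (f g : R -> R) : Prop :=
  forall phi : R -> R, test_function phi ->
    \int[lebesgue_measure]_x (f x * phi^`()%classic x) =
    - \int[lebesgue_measure]_x (g x * phi x).

Definition L2_vector (R : realType) (n : nat) (psi : R -> 'cV[R[i]]_n) : Prop :=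
  forall k : 'I_n,
    (fun x => complex.Re (psi x k 0)) \in Lfun lebesgue_measure 2%:E /\
    (fun x => complex.Im (psi x k 0)) \in Lfun lebesgue_measure 2%:E.

Definition weak_derivative_vector (R : realType) (n : nat)
    (psi chi : R -> 'cV[R[i]]_n) : Prop :=
  forall k : 'I_n,
    weak_derivative (fun x => complex.Re (psi x k 0))
                    (fun x => complex.Re (chi x k 0)) /\
    weak_derivative (fun x => complex.Im (psi x k 0))
                    (fun x => complex.Im (chi x k 0)).

Definition H2_vector (R : realType) (n : nat)
    (psi psi2 : R -> 'cV[R[i]]_n) : Prop :=
  exists psi1 : R -> 'cV[R[i]]_n,
    [/\ L2_vector psi, L2_vector psi1, L2_vector psi2,
        weak_derivative_vector psi psi1 & weak_derivative_vector psi1 psi2].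

Definition sigma1 (R : realType) : 'M[R[i]]_2 :=
  \matrix_(j < 2, k < 2) (j != k)%:R.
Definition sigma3 (R : realType) : 'M[R[i]]_2 :=
  \matrix_(j < 2, k < 2) (if j == k then (-1) ^+ j else 0).
Definition Sigma3 (R : realType) : 'M[R[i]]_(2 + 2) :=
  block_mx (sigma3 R) 0 0 (sigma3 R).

Definition linearized_potential (R : realType) (F : R -> R -> R -> R) (m : R)
    (U V : R -> R) (x : R) : 'M[R[i]]_(2 + 2) :=
  let ev (G : R -> R -> R -> R) : R := G (U x ^+ 2) (V x ^+ 2) m in
  let B11 := (ev (D1 (D1 F)) * U x ^+ 2)%:C *: (1%:M + sigma1 R)
             + (ev (D1 F))%:C *: 1%:M in
  let B12 := (ev (D1 (D2 F)) * U x * V x)%:C *: (1%:M + sigma1 R) in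
  let B22 := (ev (D2 (D2 F)) * V x ^+ 2)%:C *: (1%:M + sigma1 R)
             + (ev (D2 F))%:C *: 1%:M in
  block_mx B11 B12 B12 B22.

Definition linearized_op (R : realType) (F : R -> R -> R -> R)
    (omega s m : R) (U V : R -> R) (psi psi2 : R -> 'cV[R[i]]_(2 + 2)) (x : R) :
    'cV[R[i]]_(2 + 2) :=
  - 'i%C *: (Sigma3 R *m
    (- psi2 x
     + block_mx (omega%:C)%:M 0 0 (s%:C)%:M *m psi x
     - linearized_potential F m U V x *m psi x)).

Definition linearized_eigenvalue (R : realType) (F : R -> R -> R -> R)
    (omega s m : R) (U V : R -> R) (lam : R[i]) : Prop :=
  exists psi psi2 : R -> 'cV[R[i]]_(2 + 2),
    [/\ H2_vector psi psi2,
        ~ {ae lebesgue_measure, forall x : R, psi x = 0} &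
        {ae lebesgue_measure, forall x : R,
          linearized_op F omega s m U V psi psi2 x = lam *: psi x}].

Definition solution_A (R : realType) (F : R -> R -> R -> R) (omega : R)
    (U0 : R -> R) (lam : R[i]) (p q : R -> R[i]) : Prop :=
  let c11 x := (D1 (D1 F) (U0 x ^+ 2) 0 0 * U0 x ^+ 2)%:C in
  let c1 x := (D1 F (U0 x ^+ 2) 0 0)%:C in
  [/\ ctwice_derivable p, ctwice_derivable q,
      forall x, - cderive (cderive p) x + omega%:C * p x
                - c11 x * (p x + q x) - c1 x * p x = 'i%C * lam * p x &
      forall x, - cderive (cderive q) x + omega%:C * q x
                - c11 x * (p x + q x) - c1 x * q x = - ('i%C * lam * q x)].

(* [kappa] is [- i lam] for p4 and p8, and [i lam] for p3 and p7. *)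
Definition solution_BC (R : realType) (F : R -> R -> R -> R) (s : R)
    (U0 : R -> R) (kappa : R[i]) (p : R -> R[i]) : Prop :=
  ctwice_derivable p /\
  forall x, - cderive (cderive p) x + s%:C * p x
            - (D2 F (U0 x ^+ 2) 0 0)%:C * p x = kappa * p x.

(* [c] is 1 or 0, according to the entry of the limit vector. *)
Definition left_asymptotics (R : realType) (nu c : R[i]) (f : R -> R[i]) :
    Prop :=
  (cexp (- nu * x%:C) * f x @[x --> -oo] --> (c : R[i]^o)) /\
  (cexp (- nu * x%:C) * cderive f x @[x --> -oo] --> (c * nu : R[i]^o)).

Definition right_asymptotics (R : realType) (nu c : R[i]) (f : R -> R[i]) :
    Prop :=
  (cexp (nu * x%:C) * f x @[x --> +oo] --> (c : R[i]^o)) /\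
  (cexp (nu * x%:C) * cderive f x @[x --> +oo] --> (- (c * nu) : R[i]^o)).

Definition analytic_near (R : realType) (lam0 : R[i])
    (p : R[i] -> R -> R[i]) : Prop :=
  \forall lam \near (lam0 : R[i]^o), forall x : R,
    derivable ((fun l => p l x) : R[i]^o -> R[i]^o) lam 1 /\
    derivable ((fun l => cderive (p l) x) : R[i]^o -> R[i]^o) lam 1.

Definition jost_solutions_A (R : realType) (F : R -> R -> R -> R) (omega : R)
    (U0 : R -> R) (lam0 : R[i]) (nu1 nu2 : R[i] -> R[i])
    (p1 q1 p2 q2 p5 q5 p6 q6 : R[i] -> R -> R[i]) : Prop :=
  [/\ \forall lam \near (lam0 : R[i]^o),
        [/\ solution_A F omega U0 lam (p1 lam) (q1 lam),
            left_asymptotics (nu1 lam) 1 (p1 lam) &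
            left_asymptotics (nu1 lam) 0 (q1 lam)] /\
        [/\ solution_A F omega U0 lam (p2 lam) (q2 lam),
            left_asymptotics (nu2 lam) 0 (p2 lam) &
            left_asymptotics (nu2 lam) 1 (q2 lam)],
      \forall lam \near (lam0 : R[i]^o),
        [/\ solution_A F omega U0 lam (p5 lam) (q5 lam),
            right_asymptotics (nu1 lam) 1 (p5 lam) &
            right_asymptotics (nu1 lam) 0 (q5 lam)] /\
        [/\ solution_A F omega U0 lam (p6 lam) (q6 lam),
            right_asymptotics (nu2 lam) 0 (p6 lam) &
            right_asymptotics (nu2 lam) 1 (q6 lam)],
      [/\ analytic_near lam0 p1, analytic_near lam0 q1,
          analytic_near lam0 p2 & analytic_near lam0 q2] &
      [/\ analytic_near lam0 p5, analytic_near lam0 q5,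
          analytic_near lam0 p6 & analytic_near lam0 q6]].

Definition jost_solutions_BC (R : realType) (F : R -> R -> R -> R) (s : R)
    (U0 : R -> R) (lam0 : R[i]) (kappa nu : R[i] -> R[i])
    (pm pp : R[i] -> R -> R[i]) : Prop :=
  [/\ \forall lam \near (lam0 : R[i]^o),
        [/\ solution_BC F s U0 (kappa lam) (pm lam),
            left_asymptotics (nu lam) 1 (pm lam),
            solution_BC F s U0 (kappa lam) (pp lam) &
            right_asymptotics (nu lam) 1 (pp lam)],
      analytic_near lam0 pm & analytic_near lam0 pp].

Definition evans_A (R : realType)
    (p1 q1 p2 q2 p5 q5 p6 q6 : R[i] -> R -> R[i]) (lam : R[i]) : R[i] :=
  let rows := [::
    [:: p1 lam 0; p2 lam 0; p5 lam 0; p6 lam 0];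
    [:: q1 lam 0; q2 lam 0; q5 lam 0; q6 lam 0];
    [:: cderive (p1 lam) 0; cderive (p2 lam) 0;
        cderive (p5 lam) 0; cderive (p6 lam) 0];
    [:: cderive (q1 lam) 0; cderive (q2 lam) 0;
        cderive (q5 lam) 0; cderive (q6 lam) 0]] in
  \det (\matrix_(j < 4, k < 4) nth 0 (nth [::] rows j) k).

Definition evans_BC (R : realType) (pm pp : R[i] -> R -> R[i]) (lam : R[i]) :
    R[i] :=
  let rows := [:: [:: pm lam 0; pp lam 0];
                  [:: cderive (pm lam) 0; cderive (pp lam) 0]] in
  \det (\matrix_(j < 2, k < 2) nth 0 (nth [::] rows j) k).

Definition simple_zero (R : realType) (E : R[i] -> R[i]) (lam0 : R[i]) : Prop :=
  [/\ \forall lam \near (lam0 : R[i]^o), derivable (E : R[i]^o -> R[i]^o) lam 1,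
      E lam0 = 0 &
      (E : R[i]^o -> R[i]^o)^`() lam0 != 0].

Definition Delta (R : realType) (p q : R[i] -> R -> R[i]) (lam : R[i]) : R[i] :=
  p lam 0 * cderive (p lam) 0 + q lam 0 * cderive (q lam) 0.

Definition I_integral (R : realType) (F : R -> R -> R -> R) (U0 V1 : R -> R)
    (p q p4 : R[i] -> R -> R[i]) (lam : R[i]) : R[i] :=
  cint (fun x => (D1 (D2 F) (U0 x ^+ 2) 0 0 * U0 x * V1 x)%:C
                 * (p lam x + q lam x) * p4 lam x).

(* Main.v *)
Require Import Defs.
From HB Require Import structures.
From mathcomp Require Import all_boot all_order all_algebra.
From mathcomp Require Import all_classical all_reals all_analysis.
From mathcomp Require Import measurable_realfun complex ring lra.
Set Implicit Arguments.
Unset Strict Implicit.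
Unset Printing Implicit Defensive.
Import Order.TTheory GRing.Theory Num.Theory numFieldNormedType.Exports.
Local Open Scope ring_scope.
Local Open Scope complex_scope.
Local Open Scope classical_set_scope.

(* An eigenfunction with components (p, q, r, w) for an eigenvalue near lambda_0
   has weak derivatives only, so it is first shown to be C^2; it and the waves
   decay exponentially, or tend to zero while oscillating at frequencies bounded
   away from 0. Comparing it on each half-line with the solutions at epsilon = 0,
   whose data at 0 span the space because E_A, E_C are nonzero and E_B has a
   zero, leaves only the w-component of order one: p, q, r are O(epsilon) times
   the norm. If Re lambda > 0, the vanishing of the integral of
   |p|^2 + |r|^2 - |q|^2 - |w|^2 (the Krein signature) contradicts this; complex
   conjugation covers Re lambda < 0. If Re lambda = 0, the function w is close to
   a nonzero multiple of p_4, and the pairing of (p, q) with (p_2, q_2), which is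
   zero at infinity, equals epsilon I_2 times that multiple up to o(epsilon):
   the radiation coefficient I_2 would have to vanish. *)

(** * Calculus on the line *)

(** The obstacle is that lambda_0 lies inside the continuous spectrum of the (p, q) block: q has no
    decay rate that is uniform near lambda_0, so a direct comparison in norm fails. What stays
    uniform is the outgoing combination q' + kappa q, with kappa^2 the perturbed coefficient and Re
    kappa >= 0: it decays like the potentials, and two outgoing functions have a small Wronskian far
    out. Four such Wronskians, taken at 0, determine the Cauchy data. For Re lambda > 0 the Krein
    identity carries the factor Re lambda, which may be arbitrarily small. Dividing the current by
    it leaves an almost monotone quantity whose gain is bounded below independently of Re lambda.
    For Re lambda = 0 the eigenfunction may be taken real, and for a real outgoing function the two
    parts of q' + kappa q control q' and q separately, so (p, q) decays exponentially and can be
    paired with any bounded solution. The normalization of (p_2, q_2), with Delta_1 nonzero, is what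
    keeps that solution bounded at +infinity. *)

Section Calculus.
Variable R : realType.
Implicit Types f g : R -> R.

Definition dv f (x l : R) := is_derive x (1 : R) f l.

Lemma dv_eq f x l l' : dv f x l -> l = l' -> dv f x l'.
Proof. by move=> ? <-. Qed.
Lemma dv_cst (c x : R) : dv (fun=> c) x 0.
Proof. exact: is_derive_cst. Qed.
Lemma dv_id x : dv (fun y => y) x 1.
Proof. exact: is_derive_id. Qed.
Lemma dvD f g x a c : dv f x a -> dv g x c -> dv (fun y => f y + g y) x (a + c).
Proof. by move=> ? ?; exact: is_deriveD. Qed.
Lemma dvN f x a : dv f x a -> dv (fun y => - f y) x (- a).
Proof. by move=> ?; exact: is_deriveN. Qed.
Lemma dvM f g x a c : dv f x a -> dv g x c ->
  dv (fun y => f y * g y) x (f x * c + a * g x).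
Proof.
move=> hf hg; apply: (dv_eq (l := f x *: c + g x *: a)); first exact: (is_deriveM hf hg).
by rewrite /GRing.scale /= (mulrC (g x)).
Qed.
Lemma dvX f n x a : dv f x a -> dv (fun y => f y ^+ n.+1) x (n.+1%:R * f x ^+ n * a).
Proof.
elim: n => [h|n ih h].
  by apply: (dv_eq (l := a)); [exact: h|rewrite expr0 !mul1r].
apply: (dv_eq (l := f x * (n.+1%:R * f x ^+ n * a) + a * f x ^+ n.+1)).
  exact: (dvM h (ih h)).
by rewrite [in RHS]exprS -[n.+2%:R]natr1 exprS; ring.
Qed.
Lemma dv_comp f g x a c : dv f (g x) a -> dv g x c -> dv (fun y => f (g y)) x (a * c).
Proof. by move=> ? ?; exact: is_derive1_comp. Qed.
Lemma dv_expR f x a : dv f x a -> dv (fun y => expR (f y)) x (expR (f x) * a).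
Proof. move=> ?; apply: (dv_comp (f := expR)) => //; exact: is_derive_expR. Qed.
Lemma dv_atan f x a : dv f x a -> dv (fun y => atan (f y)) x ((1 + f x ^+ 2)^-1 * a).
Proof. move=> ?; apply: (dv_comp (f := atan)) => //; exact: is_derive1_atan. Qed.
Lemma dv_refl f l x : dv f (- x) l -> dv (fun y => f (- y)) x (- l).
Proof.
move=> h; apply: (dv_eq (l := l * -1)); last by rewrite mulrN1.
by apply: dv_comp => //; apply: dvN; exact: dv_id.
Qed.

Lemma dv_cont f x l : dv f x l -> {for x, continuous f}.
Proof. by move=> [h _]; apply: differentiable_continuous; apply/derivable1_diffP. Qed.

Lemma dv_mvt f f1 a c : a <= c -> (forall x, a <= x <= c -> dv f x (f1 x)) ->
  exists2 z, a <= z <= c & f c - f a = f1 z * (c - a).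
Proof.
move=> ac h; have [||z] := @MVT_segment R f f1 a c ac.
- by move=> x; rewrite in_itv /= => /andP[? ?]; apply: h; rewrite !ltW.
- apply: continuous_in_subspaceT => x; rewrite inE /= in_itv /= => hx.
  exact: dv_cont (h _ hx).
- by rewrite in_itv /= => hz e; exists z.
Qed.

Lemma dv_mono f f1 a c : a <= c -> (forall x, a <= x <= c -> dv f x (f1 x)) ->
  (forall x, a <= x <= c -> 0 <= f1 x) -> f a <= f c.
Proof.
move=> ac h h0; have [z hz e] := dv_mvt ac h.
by rewrite -subr_ge0 e mulr_ge0 // ?h0 // subr_ge0.
Qed.

Lemma dv_gain f f1 a c m : a <= c -> (forall x, a <= x <= c -> dv f x (f1 x)) ->
  (forall x, a <= x <= c -> m <= f1 x) -> f a + m * (c - a) <= f c.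
Proof.
move=> ac h h0; have [z hz e] := dv_mvt ac h.
by rewrite -lerBrDl e ler_wpM2r ?h0 // subr_ge0.
Qed.

Lemma dv_lip f f1 a c K : a <= c -> (forall x, a <= x <= c -> dv f x (f1 x)) ->
  (forall x, a <= x <= c -> `|f1 x| <= K) -> `|f c - f a| <= K * (c - a).
Proof.
move=> ac h h0; have [z hz ->] := dv_mvt ac h.
by rewrite normrM (ger0_norm (_ : 0 <= c - a)) ?subr_ge0 // ler_wpM2r ?h0 // subr_ge0.
Qed.

(** One-sided on purpose: estimates are proved on the right half-line and carried to the left by the
    reflection [x |-> - x]. *)
Definition vanish f := forall e, 0 < e -> exists X, forall x, X <= x -> `|f x| <= e.

Lemma vanishD f g : vanish f -> vanish g -> vanish (fun x => f x + g x).
Proof.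
move=> hf hg e e0; have e2 : 0 < e / 2 by rewrite divr_gt0.
have [X hX] := hf _ e2; have [Y hY] := hg _ e2.
exists (Num.max X Y) => x; rewrite ge_max => /andP[hx hy].
by rewrite (splitr e); apply: le_trans (ler_normD _ _) _; apply: lerD; [exact: hX|exact: hY].
Qed.

Lemma vanish_le f g X0 : (forall x, X0 <= x -> `|f x| <= `|g x|) -> vanish g -> vanish f.
Proof.
move=> h hg e e0; have [X hX] := hg _ e0.
exists (Num.max X X0) => x; rewrite ge_max => /andP[hx hy].
exact: le_trans (h _ hy) (hX _ hx).
Qed.

Lemma vanishM_bnd f g X0 K : (forall x, X0 <= x -> `|f x| <= K) -> vanish g ->
  vanish (fun x => f x * g x).
Proof.
move=> h hg e e0; have K1 : 0 < `|K| + 1 by rewrite ltr_wpDl.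
have [X hX] := hg (e / (`|K| + 1)) (divr_gt0 e0 K1).
exists (Num.max X X0) => x; rewrite ge_max => /andP[hx hy].
rewrite normrM -[e](divfK (lt0r_neq0 K1)) mulrC ler_pM ?hX //.
apply: le_trans (h _ hy) _; apply: le_trans (ler_norm K) _; by rewrite lerDl.
Qed.

Lemma vanishN f : vanish f -> vanish (fun x => - f x).
Proof. by apply: (vanish_le (X0 := 0)) => x _; rewrite normrN. Qed.

Lemma vanishZ c f : vanish f -> vanish (fun x => c * f x).
Proof. exact: (@vanishM_bnd (fun=> c) f 0 `|c|). Qed.

Lemma vanishX f n : vanish f -> vanish (fun x => f x ^+ n.+1).
Proof.
move=> h; elim: n => [|n ih]; first by move: h; apply: (vanish_le (X0 := 0)) => x; rewrite expr1.
have [X hX] := h 1 ltr01.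
have : vanish (fun x => f x * f x ^+ n.+1) by exact: (@vanishM_bnd f _ X 1).
by apply: (vanish_le (X0 := 0)) => x _; rewrite exprS.
Qed.

Lemma vanish_bnd f : vanish f -> exists2 X, 0 <= X & exists K, forall x, X <= x -> `|f x| <= K.
Proof.
move=> /(_ 1 ltr01)[X hX]; exists (Num.max X 0); first by rewrite le_max lexx orbT.
by exists 1 => x; rewrite ge_max => /andP[hx _]; exact: hX.
Qed.

(** A positive value would force a positive interior maximum [c], since [f] starts nonpositive and
    vanishes at infinity. There the first derivative is zero and the second positive, so [f] still
    increases just to the right of [c]. Convexity is asked only where [f] is positive, which allows
    a barrier to be subtracted. *)
Lemma max_principle f f1 f2 a :
  (forall x, a <= x -> dv f x (f1 x)) -> (forall x, a <= x -> dv f1 x (f2 x)) ->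
  vanish f -> f a <= 0 -> (forall x, a < x -> 0 < f x -> 0 < f2 x) ->
  forall x, a <= x -> f x <= 0.
Proof.
move=> d1 d2 hv fa hpos x1 ax1; rewrite leNgt; apply/negP => fx1.
have [X hX] := hv (f x1 / 2) (divr_gt0 fx1 (ltr0n _ 2)).
(* Beyond [X] the values are at most half of [f x1], so the maximum over [[a, b]] is not attained at
   [b]. *)
pose b := Num.max (X + 1) (x1 + 1).
have Xb : X < b by rewrite lt_max ltrDl ltr01.
have x1b : x1 < b by rewrite lt_max !ltrDl ltr01 orbT.
have ab : a <= b by apply: le_trans ax1 (ltW _).
have [|c] := @EVT_max R f a b ab.
  apply: continuous_in_subspaceT => x; rewrite inE /= in_itv /= => /andP[hx _].
  exact: dv_cont (d1 _ hx).
rewrite in_itv /= => /andP[ac cb] cmax.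
have fc : f x1 <= f c by apply: cmax; rewrite in_itv /= ax1 ltW.
have fc0 : 0 < f c by apply: lt_le_trans fx1 fc.
have ac' : a < c.
  by rewrite lt_neqAle ac andbT; apply/negP => /eqP e; move: fc0; rewrite -e ltNge fa.
have cb' : c < b.
  rewrite lt_neqAle cb andbT; apply/negP => /eqP e.
  have := hX b (ltW Xb); rewrite -e (ger0_norm (ltW fc0)) => h.
  have : f x1 <= f x1 / 2 by apply: le_trans fc h.
  lra.
have dc0 : f1 c = 0.
  have h : is_derive c (1:R) f 0.
    apply: (derive1_at_max ab).
    - by move=> t; rewrite in_itv /= => /andP[/ltW /d1 [] //].
    - by rewrite in_itv /= ac' cb'.
    - by move=> t; rewrite in_itv /= => /andP[h1 h2]; apply: cmax; rewrite in_itv /= !ltW.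
  have [_ <-] := d1 _ ac; by rewrite (@derive_val _ _ _ _ _ _ _ h).
have f2c := hpos _ ac' fc0.
(* No continuity of [f2] is assumed: the sign of [f1] to the right of [c] is read off the difference
   quotient of [f1] at [c]. *)
have [d [d0 hd]] : exists d, 0 < d /\ forall h, 0 < h -> h < d -> 0 < f1 (c + h).
  have [hd hv2] := d2 _ ac.
  have hlim : h^-1 *: (f1 (h *: 1 + c) - f1 c) @[h --> (0:R)^'] --> f2 c.
    by have := hd; rewrite -hv2 /derivable => /cvg_ex [l hl]; rewrite /derive (cvg_lim _ hl).
  have /cvgrPdist_lt /(_ _ f2c) := hlim.
  move=> [d /= d0 hball].
  exists d; split => // h h0 hlt.
  have : ball (0:R) d h by rewrite /ball /= sub0r normrN gtr0_norm.
  move=> /hball /(_ (lt0r_neq0 h0)) /=; rewrite /GRing.scale /= mulr1 dc0 subr0 addrC.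
  move=> hh; have : 0 < h^-1 * f1 (c + h).
    move: hh; rewrite ltr_norml => /andP[_]; rewrite (addrC c h); lra.
  by rewrite pmulr_rgt0 ?invr_gt0.
pose h := Num.min d (b - c) / 2.
have m0 : 0 < Num.min d (b - c) by rewrite lt_min d0 subr_gt0.
have h0 : 0 < h by rewrite divr_gt0.
have hd' : h < d.
  have : Num.min d (b - c) <= d by rewrite ge_min lexx. rewrite /h; lra.
have hb : c + h <= b.
  have : Num.min d (b - c) <= b - c by rewrite ge_min lexx orbT. rewrite /h; lra.
have [|||z hz e] := @MVT R f f1 c (c + h).
- by rewrite ltrDl.
- by move=> x; rewrite in_itv /= => /andP[hx _]; apply: d1; rewrite (le_trans ac) ?ltW.
- apply: continuous_in_subspaceT => x; rewrite inE /= in_itv /= => /andP[hx _].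
  by apply: dv_cont (d1 _ _); apply: le_trans hx.
- move: hz; rewrite in_itv /= => /andP[cz zh].
  have : 0 < f1 (c + (z - c)) by apply: hd; lra.
  rewrite addrCA subrr addr0 => f1z.
  have : f (c + h) <= f c by apply: cmax; rewrite in_itv /= hb andbT; lra.
  have : 0 < f (c + h) - f c by rewrite e mulr_gt0 //; lra.
  lra.
Qed.

(** The function [expR (- (K * x)) * (f x + G / K)] is nonincreasing; adding [G / K] turns the
    affine inequality into a homogeneous one. *)
Lemma gronwall f f1 K G X : 0 < K -> 
  (forall x, 0 <= x <= X -> dv f x (f1 x)) ->
  (forall x, 0 <= x <= X -> f1 x <= K * f x + G) ->
  forall x, 0 <= x <= X -> f x + G / K <= expR (K * x) * (f 0 + G / K).
Proof.
move=> K0 d h x /andP[x0 xX].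
pose g y := - (expR (- (K * y)) * (f y + G / K)).
pose g1 y := expR (- (K * y)) * (K * f y + G - f1 y).
have hg : g 0 <= g x.
  apply: (@dv_mono g g1 _ _ x0) => y /andP[y0 yx].
  - apply: dv_eq.
      apply: dvN; apply: dvM.
        by apply: dv_expR; apply: dvN; apply: dvM; [exact: dv_cst|exact: dv_id].
      apply: dvD; last exact: dv_cst.
      by apply: d; rewrite y0 (le_trans yx).
    by rewrite /g1; field; rewrite gt_eqF.
  - by rewrite /g1 mulr_ge0 ?expR_ge0 // subr_ge0 h // y0 (le_trans yx).
move: hg; rewrite /g lerN2 mulr0 oppr0 expR0 mul1r => hg.
by rewrite -(ler_pM2l (expR_gt0 (- (K * x)))) mulrA -expRD addNr expR0 mul1r.
Qed.

End Calculus.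

Ltac rng := cbv beta; ring.
Ltac dvt := lazymatch goal with
| |- dv (fun y => y) _ _ => apply: dv_id
| |- dv (fun y => GRing.add (@?f y) (@?g y)) ?x _ => apply: (@dvD _ f g x); dvt
| |- dv (fun y => GRing.opp (@?f y)) ?x _ => apply: (@dvN _ f x); dvt
| |- dv (fun y => GRing.mul (@?f y) (@?g y)) ?x _ => apply: (@dvM _ f g x); dvt
| |- dv (fun y => GRing.exp (@?f y) _.+1) ?x _ => apply: (@dvX _ f _ x); dvt
| |- dv (fun y => expR (@?f y)) ?x _ => apply: (@dv_expR _ f x); dvt
| _ => first [exact: dv_cst | eassumption | idtac]
end.

(** * Half-line estimates *)

Section HalfLine.
Variable R : realType.
Implicit Types f g : R -> R.

Lemma vanish_expR (c : R) : 0 < c -> vanish (fun x => expR (- (c * x))).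
Proof.
move=> c0 e e0; exists (c^-1 * e^-1) => x hx.
rewrite ger0_norm ?expR_ge0 // expRN -[e]invrK lef_pV2 ?posrE ?expR_gt0 ?invr_gt0 //.
have h : e^-1 <= c * x by rewrite -ler_pdivrMl.
have := expR_ge1Dx (c * x); lra.
Qed.

(** The barrier has second derivative [4 * gam ^+ 2] times itself, hence at most [al] times, so the
    maximum principle applies to the difference. The inequality on [f2] is needed only above the
    barrier. The rate is [2 * gam] because [f] will be a square or a sum of squares. *)
Lemma decay_le f f1 f2 (x0 gam al K : R) :
  0 < gam -> 0 < al -> 4 * gam ^+ 2 <= al -> 0 <= K ->
  (forall x, x0 <= x -> dv f x (f1 x)) -> (forall x, x0 <= x -> dv f1 x (f2 x)) ->
  vanish f -> f x0 <= K ->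
  (forall x, x0 < x -> K * expR (- (2 * gam * (x - x0))) < f x -> al * f x <= f2 x) ->
  forall x, x0 <= x -> f x <= K * expR (- (2 * gam * (x - x0))).
Proof.
move=> g0 al0 gal K0 d1 d2 vf fx0 hf.
pose E x := expR (- (2 * gam * (x - x0))).
have E0 x : 0 < E x by exact: expR_gt0.
have dE x : dv E x (- (2 * gam) * E x).
  by apply: dv_eq; [rewrite /E; dvt|rewrite /E; rng].
have := @max_principle R (fun x => f x - K * E x)
  (fun x => f1 x + K * (2 * gam * E x)) (fun x => f2 x - K * (4 * gam ^+ 2 * E x)) x0.
move=> H x hx; rewrite -subr_le0; apply: H => {x hx}//.
- move=> x hx; have h := d1 _ hx; have h' := dE x.
  by apply: dv_eq; [dvt; dvt|rng].
- move=> x hx; have h := d2 _ hx; have h' := dE x.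
  by apply: dv_eq; [dvt; dvt|rng].
- apply: vanishD => //; apply: vanishN; apply: vanishZ.
  have : vanish (fun x => expR (2 * gam * x0) * expR (- ((2 * gam) * x))).
    by apply/vanishZ/vanish_expR; lra.
  by apply: (vanish_le (X0 := x0)) => x _; rewrite /E -expRD; rewrite le_eqVlt; apply/orP; left; apply/eqP; congr (`|expR _|); ring.
- by rewrite /E subrr mulr0 oppr0 expR0 mulr1 subr_le0.
- move=> x hx; rewrite subr_gt0 => h; have := hf _ hx h.
  have h1 : al * (K * E x) < al * f x by rewrite ltr_pM2l.
  have h2 : 4 * gam ^+ 2 * (K * E x) <= al * (K * E x).
    by rewrite ler_wpM2r // mulr_ge0 // ltW.
  by move=> h3; rewrite subr_gt0; apply: lt_le_trans h3; apply: le_lt_trans h1; lra.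
Qed.

(* [z1 + i z2] solves z'' = (al + i be) z up to a decaying error; as [al > 0]
   the solution tending to zero is controlled by its value at [x0]. *)
Lemma hyperbolic_tail (z1 z2 dz1 dz2 ddz1 ddz2 : R -> R) (x0 gam a0 al be K H : R) :
  0 < gam -> 0 < a0 -> a0 <= al -> 4 * gam ^+ 2 <= a0 -> 0 <= K -> 0 <= H ->
  (forall x, dv z1 x (dz1 x)) -> (forall x, dv z2 x (dz2 x)) ->
  (forall x, dv dz1 x (ddz1 x)) -> (forall x, dv dz2 x (ddz2 x)) ->
  vanish z1 -> vanish z2 -> `|z1 x0| <= K -> `|z2 x0| <= K ->
  (forall x, x0 <= x -> `|ddz1 x - (al * z1 x - be * z2 x)| <= H * expR (- (gam * (x - x0)))) ->
  (forall x, x0 <= x -> `|ddz2 x - (al * z2 x + be * z1 x)| <= H * expR (- (gam * (x - x0)))) ->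
  forall x, x0 <= x ->
    `|z1 x| <= (2 * K + 3 * H / a0) * expR (- (gam * (x - x0))) /\
    `|z2 x| <= (2 * K + 3 * H / a0) * expR (- (gam * (x - x0))).
Proof.
move=> g0 a00 ha0 hg K0 H0 d1 d2 dd1 dd2 v1 v2 b1 b2 e1 e2.
(* The term [2 * K] puts the barrier above the value at [x0]. Since [3 * H <= a0 * B], above the
   barrier [a0 ^+ 2 * f] is at least 9 H^2 E^2, which beats the 8 H^2 E^2 needed to absorb the
   errors. *)
set B := 2 * K + 3 * H / a0.
have HB : 3 * H / a0 <= B by rewrite /B; lra.
have Ha0 : 0 <= 3 * H / a0 by apply: divr_ge0; [exact: mulr_ge0|exact: ltW].
have B0 : 0 <= B by rewrite /B; lra.
have HB' : 3 * H <= a0 * B by rewrite [leRHS]mulrC -ler_pdivrMr.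
pose E x := expR (- (gam * (x - x0))).
have E0 x : 0 < E x by exact: expR_gt0.
have EE x : expR (- (2 * gam * (x - x0))) = E x ^+ 2.
  by rewrite expr2 -expRD; congr expR; ring.
have main x : x0 <= x -> z1 x ^+ 2 + z2 x ^+ 2 <= B ^+ 2 * E x ^+ 2.
  rewrite -EE => hx.
  apply: (@decay_le (fun x => z1 x ^+ 2 + z2 x ^+ 2)
    (fun x => 2 * (z1 x * dz1 x + z2 x * dz2 x))
    (fun x => 2 * (dz1 x ^+ 2 + dz2 x ^+ 2) + 2 * (z1 x * ddz1 x + z2 x * ddz2 x))
    x0 gam a0 (B ^+ 2)) => // {x hx}.
  - exact: sqr_ge0.
  - move=> x _; have h1 := d1 x; have h2 := d2 x.
    by apply: dv_eq; [dvt; dvt|rng].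
  - move=> x _; have h1 := d1 x; have h2 := d2 x; have h3 := dd1 x; have h4 := dd2 x.
    by apply: dv_eq; [dvt; dvt|rng].
  - by apply: vanishD; apply: vanishX.
  - have h1 : z1 x0 ^+ 2 <= K ^+ 2 by rewrite -(real_normK (num_real _)) lerXn2r ?nnegrE.
    have h2 : z2 x0 ^+ 2 <= K ^+ 2 by rewrite -(real_normK (num_real (z2 _))) lerXn2r ?nnegrE.
    have h3 : (2 * K) ^+ 2 <= B ^+ 2.
      by rewrite lerXn2r ?nnegrE ?mulr_ge0 // /B lerDl.
    have : 0 <= K ^+ 2 by exact: sqr_ge0.
    by move: h3; rewrite exprMn; lra.
  - move=> x /ltW hx; rewrite EE => hf.
    have {}e1 := e1 _ hx; have {}e2 := e2 _ hx.
    rewrite -/(E x) in e1 e2.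
    set r1 := ddz1 x - _ in e1; set r2 := ddz2 x - _ in e2.
    have -> : ddz1 x = al * z1 x - be * z2 x + r1 by rewrite /r1; ring.
    have -> : ddz2 x = al * z2 x + be * z1 x + r2 by rewrite /r2; ring.
    set f := z1 x ^+ 2 + z2 x ^+ 2 in hf *.
    have s1 : r1 ^+ 2 <= (H * E x) ^+ 2.
      by rewrite -(real_normK (num_real _)) lerXn2r ?nnegrE // mulr_ge0 // ltW.
    have s2 : r2 ^+ 2 <= (H * E x) ^+ 2.
      by rewrite -(real_normK (num_real r2)) lerXn2r ?nnegrE // mulr_ge0 // ltW.
    have s3 : (3 * H * E x) ^+ 2 <= (a0 * B * E x) ^+ 2.
      rewrite lerXn2r ?nnegrE ?mulr_ge0 // ?mulr_ge0 ?(ltW (E0 x)) ?(ltW a00) //.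
      by rewrite ler_wpM2r // ltW.
    have s4 : a0 ^+ 2 * (B ^+ 2 * E x ^+ 2) <= a0 ^+ 2 * f.
      by rewrite ler_wpM2l ?sqr_ge0 // ltW.
    have s5 : a0 * f <= al * f by rewrite ler_wpM2r // addr_ge0 // sqr_ge0.
    (* Young's inequality written with squares: the errors cost at most [a0 * f] out of the
       available [2 * al * f]. The coupling [be] cancels between the two components. *)
    have s6 : 0 <= (a0 * z1 x + 2 * r1) ^+ 2 by exact: sqr_ge0.
    have s7 : 0 <= (a0 * z2 x + 2 * r2) ^+ 2 by exact: sqr_ge0.
    have s8 : 0 <= dz1 x ^+ 2 by exact: sqr_ge0.
    have s9 : 0 <= dz2 x ^+ 2 by exact: sqr_ge0.
    have s10 : - (a0 * f) <= 2 * (z1 x * r1 + z2 x * r2).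
      rewrite -(ler_pM2l a00).
      have : 8 * (r1 ^+ 2 + r2 ^+ 2) <= 2 * (a0 ^+ 2 * f).
        move: s1 s2 s3 s4; rewrite !exprMn; set h := H ^+ 2 * E x ^+ 2.
        have h0 : 0 <= h by rewrite mulr_ge0 // sqr_ge0.
        rewrite -[3 ^+ 2 * _ * _]mulrA -/h; lra.
      by move: s6 s7; rewrite /f; lra.
    by move: s5 s8 s9 s10; rewrite /f; lra.
move=> x hx; have hm := main _ hx.
have BE : 0 <= B * E x by rewrite mulr_ge0 // ltW.
split; rewrite -(@ler_pXn2r _ 2) ?nnegrE ?mulr_ge0 // ?(ltW (E0 _)) //
  real_normK ?num_real // exprMn; apply: le_trans hm.
  by rewrite lerDl sqr_ge0.
by rewrite lerDr sqr_ge0.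
Qed.

Definition hyp2 (a c : R) := Num.sqrt (a ^+ 2 + c ^+ 2).

Lemma hyp2_ge0 a c : 0 <= hyp2 a c. Proof. exact: sqrtr_ge0. Qed.
Lemma hyp2_le a c : hyp2 a c <= `|a| + `|c|.
Proof.
rewrite -(@ler_pXn2r _ 2) ?nnegrE ?hyp2_ge0 // sqr_sqrtr ?addr_ge0 ?sqr_ge0 //.
rewrite -(real_normK (num_real a)) -(real_normK (num_real c)).
by have := mulr_ge0 (normr_ge0 a) (normr_ge0 c); rewrite sqrrD -mulr_natl; lra.
Qed.
Lemma hyp2_gel a c : `|a| <= hyp2 a c.
Proof.
rewrite -(@ler_pXn2r _ 2) ?nnegrE ?hyp2_ge0 // sqr_sqrtr ?addr_ge0 ?sqr_ge0 //.
by rewrite real_normK ?num_real // lerDl sqr_ge0.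
Qed.
Lemma hyp2_ger a c : `|c| <= hyp2 a c.
Proof. by rewrite /hyp2 addrC; exact: hyp2_gel. Qed.

(** The Euclidean norm is not differentiable at 0, so [e ^+ 2] is added under the root; the
    derivative of the result is at most [2 * h], and [e] is arbitrary. The factor 2 bounds the sum
    of the two moduli by twice the norm. *)
Lemma norm_growth (u1 u2 v1 v2 G h : R -> R) (a c : R) : a <= c ->
  (forall x, a <= x <= c -> dv u1 x (v1 x)) -> (forall x, a <= x <= c -> dv u2 x (v2 x)) ->
  (forall x, a <= x <= c -> dv G x (h x)) -> (forall x, a <= x <= c -> 0 <= h x) ->
  (forall x, a <= x <= c -> u1 x * v1 x + u2 x * v2 x <= (`|u1 x| + `|u2 x|) * h x) ->
  hyp2 (u1 c) (u2 c) <= hyp2 (u1 a) (u2 a) + 2 * (G c - G a).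
Proof.
move=> ac d1 d2 dG h0 H; apply/ler_addgt0Pr => e e0.
pose s x := Num.sqrt (u1 x ^+ 2 + u2 x ^+ 2 + e ^+ 2).
have e2 : 0 < e ^+ 2 by rewrite exprn_gt0.
have p0 x : 0 < u1 x ^+ 2 + u2 x ^+ 2 + e ^+ 2 by rewrite ltr_wpDl // addr_ge0 // sqr_ge0.
have s0 x : 0 < s x by rewrite sqrtr_gt0.
have hs x : hyp2 (u1 x) (u2 x) <= s x by rewrite ler_wsqrtr // lerDl ltW.
have hs' x : s x <= hyp2 (u1 x) (u2 x) + e.
  rewrite -(@ler_pXn2r _ 2) ?nnegrE ?addr_ge0 ?hyp2_ge0 ?(ltW (s0 x)) ?(ltW e0) //.
  rewrite (sqr_sqrtr (ltW (p0 x))) sqrrD sqr_sqrtr ?addr_ge0 ?sqr_ge0 //.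
  have := mulr_ge0 (hyp2_ge0 (u1 x) (u2 x)) (ltW e0); rewrite -mulr_natl; lra.
have : 2 * G a - s a <= 2 * G c - s c.
  apply: (@dv_mono R (fun x => 2 * G x - s x)
    (fun x => 2 * h x - (u1 x * v1 x + u2 x * v2 x) / s x)) => //.
  - move=> x hx; have h1 := d1 _ hx; have h2 := d2 _ hx; have h3 := dG _ hx.
    have h4 : dv s x ((2 * s x)^-1 * (2 * (u1 x * v1 x + u2 x * v2 x))).
      apply: (dv_comp (f := Num.sqrt) (g := fun x => u1 x ^+ 2 + u2 x ^+ 2 + e ^+ 2)).
        exact: is_derive1_sqrt.
      by apply: dv_eq; [dvt; dvt|rng].
    apply: dv_eq; [dvt; dvt|]; cbv beta; field. by rewrite gt_eqF.
  - move=> x hx; rewrite subr_ge0 ler_pdivrMr //.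
    apply: le_trans (H _ hx) _; rewrite mulrAC ler_wpM2r ?h0 //.
    have := le_trans (hyp2_gel (u1 x) (u2 x)) (hs x).
    have := le_trans (hyp2_ger (u1 x) (u2 x)) (hs x). lra.
have := hs c; have := hs' a; lra.
Qed.

Lemma norm_growth_rev (u1 u2 v1 v2 G h : R -> R) (a c : R) : a <= c ->
  (forall x, a <= x <= c -> dv u1 x (v1 x)) -> (forall x, a <= x <= c -> dv u2 x (v2 x)) ->
  (forall x, a <= x <= c -> dv G x (h x)) -> (forall x, a <= x <= c -> 0 <= h x) ->
  (forall x, a <= x <= c -> - ((`|u1 x| + `|u2 x|) * h x) <= u1 x * v1 x + u2 x * v2 x) ->
  hyp2 (u1 a) (u2 a) <= hyp2 (u1 c) (u2 c) + 2 * (G c - G a).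
Proof.
move=> ac d1 d2 dG h0 H.
have flip x : - c <= x <= - a -> a <= - x <= c by move=> /andP[? ?]; apply/andP; split; lra.
have := @norm_growth (fun x => u1 (- x)) (fun x => u2 (- x)) (fun x => - v1 (- x))
  (fun x => - v2 (- x)) (fun x => - G (- x)) (fun x => h (- x)) (- c) (- a).
rewrite !opprK => W.
have -> : G c - G a = - G a + G c by ring.
apply: W => //; first lra.
- by move=> x /flip /d1 /dv_refl.
- by move=> x /flip /d2 /dv_refl.
- by move=> x /flip /dG /dv_refl /dvN; rewrite opprK.
- by move=> x /flip /h0.
- by move=> x /flip /H; lra.
Qed.

Lemma exp_primitive (c gam x : R) : gam != 0 ->
  dv (fun x => - (c / gam * expR (- (gam * x)))) x (c * expR (- (gam * x))).
Proof. by move=> g0; apply: dv_eq; [dvt|cbv beta; field]. Qed.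

(* [q1 + i q2] solves q'' = kap^2 q up to a decaying error, with
   [kap = k1 + i k2] and [k1 >= 0]: the quantity q' + kap q only grows, so it
   is controlled from infinity. *)
Lemma outgoing_bound (q1 q2 dq1 dq2 ddq1 ddq2 : R -> R) (gam k1 k2 H : R) :
  0 < gam -> 0 <= k1 -> 0 <= H ->
  (forall x, dv q1 x (dq1 x)) -> (forall x, dv q2 x (dq2 x)) ->
  (forall x, dv dq1 x (ddq1 x)) -> (forall x, dv dq2 x (ddq2 x)) ->
  vanish q1 -> vanish q2 -> vanish dq1 -> vanish dq2 ->
  (forall x, 0 <= x -> `|ddq1 x - ((k1 ^+ 2 - k2 ^+ 2) * q1 x - 2 * k1 * k2 * q2 x)|
     <= H * expR (- (gam * x))) ->
  (forall x, 0 <= x -> `|ddq2 x - ((k1 ^+ 2 - k2 ^+ 2) * q2 x + 2 * k1 * k2 * q1 x)|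
     <= H * expR (- (gam * x))) ->
  forall x, 0 <= x ->
    hyp2 (dq1 x + k1 * q1 x - k2 * q2 x) (dq2 x + k1 * q2 x + k2 * q1 x)
      <= 2 * H / gam * expR (- (gam * x)).
Proof.
move=> g0 k10 H0 d1 d2 dd1 dd2 v1 v2 w1 w2 e1 e2 x x0.
pose g1 x := dq1 x + k1 * q1 x - k2 * q2 x.
pose g2 x := dq2 x + k1 * q2 x + k2 * q1 x.
rewrite -/(g1 x) -/(g2 x).
have vg1 : vanish g1.
  by apply: vanishD; [apply: vanishD => //|apply: vanishN]; apply: vanishZ.
have vg2 : vanish g2.
  by apply: vanishD; [apply: vanishD => //|]; apply: vanishZ.
apply/ler_addgt0Pr => e e0.
have e2' : 0 < e / 2 by lra.
have [X1 hX1] := vg1 _ e2'; have [X2 hX2] := vg2 _ e2'.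
pose c := Num.max x (Num.max X1 X2).
have xc : x <= c by rewrite le_max lexx.
have : hyp2 (g1 c) (g2 c) <= e.
  apply: le_trans (hyp2_le _ _) _; rewrite [e]splitr lerD //.
    by apply: hX1; rewrite !le_max lexx orbT.
  by apply: hX2; rewrite !le_max lexx !orbT.
have := @norm_growth_rev g1 g2
  (fun x => ddq1 x + k1 * dq1 x - k2 * dq2 x) (fun x => ddq2 x + k1 * dq2 x + k2 * dq1 x)
  (fun x => - (H / gam * expR (- (gam * x)))) (fun x => H * expR (- (gam * x))) x c xc.
have dq : forall y, x <= y <= c -> 0 <= y by move=> y /andP[? _]; exact: le_trans x0 _.
move=> hh; have {hh} := hh _ _ _ _ _ => hh.
have : hyp2 (g1 x) (g2 x) <= hyp2 (g1 c) (g2 c) +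
   2 * (- (H / gam * expR (- (gam * c))) - - (H / gam * expR (- (gam * x)))).
  apply: hh.
  - move=> y _; have h1 := d1 y; have h2 := d2 y; have h3 := dd1 y.
    by apply: dv_eq; [rewrite /g1; dvt|rng].
  - move=> y _; have h1 := d1 y; have h2 := d2 y; have h3 := dd2 y.
    by apply: dv_eq; [rewrite /g2; dvt|rng].
  - by move=> y _; apply: exp_primitive; rewrite gt_eqF.
  - by move=> y _; rewrite mulr_ge0 ?expR_ge0.
  - move=> y /dq y0; have {}e1 := e1 _ y0; have {}e2 := e2 _ y0.
    set r1 := ddq1 y - _ in e1; set r2 := ddq2 y - _ in e2.
    set h := H * _ in e1 e2 *.
    have -> : ddq1 y = (k1 ^+ 2 - k2 ^+ 2) * q1 y - 2 * k1 * k2 * q2 y + r1 by rewrite /r1; ring.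
    have -> : ddq2 y = (k1 ^+ 2 - k2 ^+ 2) * q2 y + 2 * k1 * k2 * q1 y + r2 by rewrite /r2; ring.
    have s1 : - (`|g1 y| * h) <= g1 y * r1.
      apply: lerNnormlW; rewrite normrM; exact: ler_wpM2l.
    have s2 : - (`|g2 y| * h) <= g2 y * r2.
      apply: lerNnormlW; rewrite normrM; exact: ler_wpM2l.
    (* Up to the error g' = kappa g, so the contribution of [k1] to the derivative of |g|^2 is
       nonnegative. *)
    have s3 : 0 <= k1 * (g1 y ^+ 2 + g2 y ^+ 2) by rewrite mulr_ge0 // addr_ge0 // sqr_ge0.
    move: s1 s2 s3; rewrite mulrDl /g1 /g2; lra.
have E0 : 0 <= H / gam * expR (- (gam * c)) by rewrite mulr_ge0 ?expR_ge0 // divr_ge0 // ltW.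
rewrite -!mulrA in E0 *; lra.
Qed.

(** By the mean value theorem [f1] equals a difference of two values of [f] somewhere in
    [[x, x + 1]], and [f2] bounds the change of [f1] from there back to [x]. *)
Lemma interp_bound f f1 f2 (x A B : R) : (forall y, dv f y (f1 y)) -> (forall y, dv f1 y (f2 y)) ->
  (forall y, x <= y <= x + 1 -> `|f y| <= A) -> (forall y, x <= y <= x + 1 -> `|f2 y| <= B) ->
  `|f1 x| <= 2 * A + B.
Proof.
move=> d1 d2 hA hB.
have x1 : x <= x + 1 by lra.
have [z /andP[z1 z2] e] := dv_mvt x1 (fun y _ => d1 y).
have h1 : `|f1 z| <= 2 * A.
  have -> : f1 z = f (x + 1) - f x by rewrite e; ring.
  apply: le_trans (ler_normB _ _) _.
  have := hA x; have := hA (x + 1). rewrite !lexx x1 /= => a c. have := a isT; have := c isT; lra.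
have B0 : 0 <= B by apply: le_trans (hB x _); rewrite ?normr_ge0 // lexx.
have h2 : `|f1 z - f1 x| <= B * (z - x).
  apply: (@dv_lip R f1 f2) => // y /andP[y1 y2]; apply: hB; rewrite y1; lra.
have h3 : B * (z - x) <= B by apply: ler_piMr => //; lra.
have -> : f1 x = f1 z - (f1 z - f1 x) by ring.
apply: le_trans (ler_normB _ _) _; lra.
Qed.

(** Here [k1 + i k2] is the square root of - k0^2 - t + i rho in the right half-plane: the perturbed
    exponent of the oscillating component, close to [i k0]. The sign of [rho] gives that of [k1]. *)
Lemma sqrt_near (k0 e : R) : 0 < k0 -> 0 < e -> exists2 thr, 0 < thr <= 1 &
  forall t rho, `|t| <= thr -> 0 <= rho <= thr -> exists k1 k2,
    [/\ 0 <= k1 <= e, `|k0 - k2| <= e, k1 ^+ 2 - k2 ^+ 2 = - k0 ^+ 2 - t & 2 * k1 * k2 = rho].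
Proof.
move=> k00 e0.
have k02 : 0 < k0 ^+ 2 by rewrite exprn_gt0.
(* In turn: a bound by 1, [k0 ^+ 2 + t] kept above [k0 ^+ 2 / 2], the bound [k1 <= e], and the
   shares of [t] and of [k1 ^+ 2] in the estimate of [k0 - k2]. *)
pose c := Num.min (Num.min 1 (k0 ^+ 2 / 2)) (Num.min (e * k0) (Num.min (e * k0 / 2) (e * k0 * k0 ^+ 2 / 2))).
have c0 : 0 < c by rewrite !lt_min ltr01 !divr_gt0 ?mulr_gt0.
exists c; first by rewrite c0 /= !ge_min lexx.
move=> t rho; rewrite !le_min => /andP[/andP[t1 t2] /and3P[t3 t4 t5]] /andP[r0 /andP[/andP[r1 r2] /and3P[r3 r4 r5]]].
pose d := k0 ^+ 2 + t; pose m := Num.sqrt (d ^+ 2 + rho ^+ 2); pose u := (m + d) / 2.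
have d0 : k0 ^+ 2 / 2 <= d by move: t2; rewrite ler_norml /d => /andP[]; lra.
have dpos : 0 <= d by lra.
have md : d <= m.
  by rewrite -(ger0_norm dpos) -sqrtr_sqr ler_wsqrtr // lerDl sqr_ge0.
have mm : m ^+ 2 = d ^+ 2 + rho ^+ 2 by rewrite sqr_sqrtr // addr_ge0 ?sqr_ge0.
have ud : d <= u by rewrite /u; lra.
have u0 : 0 < u by lra.
pose k2 := Num.sqrt u; have k20 : 0 < k2 by rewrite sqrtr_gt0.
have k22 : k2 ^+ 2 = u by rewrite sqr_sqrtr // ltW.
have hk2 : k0 / 2 <= k2.
  rewrite -(@ler_pXn2r _ 2) ?nnegrE ?(ltW k20) ?divr_ge0 ?(ltW k00) // k22.
  rewrite exprMn; have : (2^-1 : R) ^+ 2 = 4^-1 by field. move=> ->; lra.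
pose k1 := rho / (2 * k2).
have k10 : 0 <= k1 by rewrite divr_ge0 // mulr_ge0 // ltW.
have k1r : k1 * k0 <= rho.
  rewrite /k1 mulrAC ler_pdivrMr ?mulr_gt0 // ler_wpM2l //; lra.
have k1e : k1 <= e by rewrite -(ler_pM2r k00); apply: le_trans k1r _.
have eq1 : k1 ^+ 2 - k2 ^+ 2 = - k0 ^+ 2 - t.
  have -> : - k0 ^+ 2 - t = - d by rewrite /d; ring.
  have uu : u * (u - d) = rho ^+ 2 / 4.
    have -> : u * (u - d) = (m ^+ 2 - d ^+ 2) / 4 by rewrite /u; field.
    by rewrite mm; field.
  have -> : k1 ^+ 2 = u - d.
    rewrite /k1 exprMn exprVn exprMn k22; have -> : rho ^+ 2 = 4 * (u * (u - d)) by rewrite uu; field.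
    by field; rewrite gt_eqF.
  by rewrite k22; ring.
exists k1, k2; split=> //.
- by rewrite k10.
- rewrite -(ler_pM2r k00).
  have h : `|k0 - k2| * (k0 + k2) = `|k1 ^+ 2 + t|.
    rewrite -[k0 + k2]ger0_norm ?addr_ge0 ?ltW // -normrM -[RHS]normrN.
    congr (`|_|); have -> : t = - k0 ^+ 2 - (k1 ^+ 2 - k2 ^+ 2) by rewrite eq1; ring.
    ring.
  have h1 : `|k0 - k2| * k0 <= `|k0 - k2| * (k0 + k2) by rewrite ler_wpM2l // lerDl ltW.
  apply: le_trans h1 _; rewrite h; apply: le_trans (ler_normD _ _) _.
  rewrite ger0_norm ?sqr_ge0 //.
  have : k1 ^+ 2 <= e * k0 / 2.
    rewrite -(ler_pM2r k02); apply: le_trans (_ : rho * 1 <= _); last first.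
      rewrite mulr1; lra.
    apply: le_trans (_ : rho * rho <= _); last by rewrite ler_wpM2l.
    rewrite -exprMn expr2; apply: ler_pM => //; rewrite mulr_ge0 // ltW //.
  lra.
- by rewrite /k1; field; rewrite gt_eqF.
Qed.

End HalfLine.

(** * Systems with one decaying and one oscillating component *)

Section System.
Variable R : realType.

(* Index [c]: the two components, [false] with exponential decay at infinity
   and [true] with oscillations; index [k]: real ([false]) and imaginary
   ([true]) parts. *)
Implicit Types y dy ddy S dS : bool -> bool -> R -> R.

Variables (A0 k0 gam v : R) (V : bool -> bool -> R -> R).

Definition base c := if c then - k0 ^+ 2 else A0.

Definition lin y c k x := base c * y c k x - V c false x * y false k x
   - V c true x * y true k x.

(** Multiplication of the first component by t - i rho and of the second by its opposite, in real
    and imaginary parts: the effect of moving the spectral parameter from lambda_0 by rho + i t. *)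
Definition shift t rho y c k x :=
  (if c then - t else t) * y c k x
  + (if c (+) k then rho else - rho) * - y c (~~ k) x.

Definition forced t rho Phi y dy ddy :=
  [/\ forall c k x, dv (y c k) x (dy c k x),
      forall c k x, dv (dy c k) x (ddy c k x),
      forall c k x, 0 <= x ->
        `|ddy c k x - (lin y c k x + shift t rho y c k x)| <= Phi * expR (- (gam * x)),
      forall c k, vanish (y c k) & forall c k, vanish (dy c k)].

Definition refsol S dS :=
  (forall c k x, dv (S c k) x (dS c k x)) /\
  (forall c k x, dv (dS c k) x (lin S c k x)).

(** Radiation condition: the last two limits are the real and imaginary parts of S' + i k0 S for the
    oscillating component. It is the unperturbed form of q' + kappa q, at kappa = i k0. *)
Definition outgoing S dS :=
  [/\ exists2 K, 0 <= K & forall c k x, 0 <= x -> `|S c k x| <= K,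
      forall k, vanish (S false k), forall k, vanish (dS false k),
      vanish (fun x => dS true false x - k0 * S true true x) &
      vanish (fun x => dS true true x + k0 * S true false x)].

(** Part [j] of [S] against part [k] of [y]. The complex pairing built from these is bilinear,
    without conjugation, so that it is conserved by the symmetric system. *)
Definition wron S dS j y dy k x :=
  dS false j x * y false k x - S false j x * dy false k x
  + (dS true j x * y true k x - S true j x * dy true k x).

Definition wron_re S dS y dy x := wron S dS false y dy false x - wron S dS true y dy true x.
Definition wron_im S dS y dy x := wron S dS false y dy true x + wron S dS true y dy false x.

Hypotheses (A00 : 0 < A0) (k00 : 0 < k0) (gam0 : 0 < gam) (gamA : 8 * gam ^+ 2 <= A0)
  (v0 : 0 <= v) (hV : forall c c' x, 0 <= x -> `|V c c' x| <= v * expR (- (gam * x)))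
  (Vsym : forall x, V true false x = V false true x).

Let E x := expR (- (gam * x)).
Let E0 x : 0 <= E x. Proof. exact: expR_ge0. Qed.
Let E1 x : 0 <= x -> E x <= 1.
Proof. by move=> x0; rewrite /E -expR0 ler_expR oppr_le0 mulr_ge0 // ltW. Qed.

Let Vv c c' x : 0 <= x -> `|V c c' x| <= v.
Proof.
by move=> x0; apply: le_trans (hV _ _ x0) _; apply: ler_piMr => //; exact: E1.
Qed.

Lemma norm_base c : `|base c| <= A0 + k0 ^+ 2.
Proof.
have h : 0 <= k0 ^+ 2 by exact: sqr_ge0.
case: c => /=; first by rewrite normrN ger0_norm // lerDr ltW.
by rewrite ger0_norm ?lerDl // ltW.
Qed.

Lemma shift_le t rho y c k x Y : 0 <= rho -> (forall c k, `|y c k x| <= Y) ->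
  `|shift t rho y c k x| <= (`|t| + rho) * Y.
Proof.
move=> r0 hY; rewrite /shift mulrDl; apply: le_trans (ler_normD _ _) _.
apply: lerD; rewrite normrM; apply: ler_pM => //; rewrite ?normrN //.
  by case: c; rewrite ?normrN.
by case: (c (+) k); rewrite ?normrN ger0_norm.
Qed.

Lemma lin_le y c k x Y : 0 <= x -> (forall c k, `|y c k x| <= Y) ->
  `|lin y c k x| <= (A0 + k0 ^+ 2 + 2 * v) * Y.
Proof.
move=> x0 hY; have Y0 : 0 <= Y by apply: le_trans (hY c k).
have h1 : `|base c * y c k x| <= (A0 + k0 ^+ 2) * Y.
  by rewrite normrM ler_pM // norm_base.
have h2 : `|V c false x * y false k x| <= v * Y by rewrite normrM ler_pM // Vv.
have h3 : `|V c true x * y true k x| <= v * Y by rewrite normrM ler_pM // Vv.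
rewrite /lin; apply: le_trans (ler_normB _ _) _.
have := ler_normB (base c * y c k x) (V c false x * y false k x); lra.
Qed.

Lemma forced_dy t rho Phi y dy ddy Y : `|t| <= 1 -> 0 <= rho <= 1 -> 0 <= Phi ->
  forced t rho Phi y dy ddy -> (forall c k x, 0 <= x -> `|y c k x| <= Y) ->
  forall c k x, 0 <= x -> `|dy c k x| <= (A0 + k0 ^+ 2 + 2 * v + 4) * (Y + Phi).
Proof.
move=> t1 /andP[r0 r1] P0 [d1 d2 e _ _] hY c k x x0.
have Y0 : 0 <= Y by apply: le_trans (hY c k x x0).
set L := A0 + k0 ^+ 2 + 2 * v.
have L0 : 0 <= L by rewrite /L !addr_ge0 ?sqr_ge0 ?mulr_ge0 // ltW.
have : `|dy c k x| <= 2 * Y + ((L + 2) * Y + Phi).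
  apply: (@interp_bound R (y c k) (dy c k) (ddy c k)) => //.
    by move=> z /andP[z0 _]; apply: hY; exact: le_trans z0.
  move=> z /andP[xz _]; have z0 : 0 <= z by exact: le_trans xz.
  have hz : forall c k, `|y c k z| <= Y by move=> *; exact: hY.
  have := e c k z z0; set r := ddy c k z - _ => hr.
  have -> : ddy c k z = lin y c k z + shift t rho y c k z + r by rewrite /r; ring.
  apply: le_trans (ler_normD _ _) _; apply: lerD; last first.
    by apply: le_trans hr _; apply: ler_piMr => //; exact: E1.
  apply: le_trans (ler_normD _ _) _; rewrite mulrDl; apply: lerD; first exact: lin_le.
  apply: le_trans (shift_le t c k r0 hz) _; rewrite ler_wpM2r //; lra.
move=> h; apply: le_trans h _; have : 0 <= (L + 2) * Phi by rewrite mulr_ge0 // addr_ge0.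
lra.
Qed.

Let amgm (a m c M : R) : `|m| <= M -> 2 * (a * (m * c)) <= M * (a ^+ 2 + c ^+ 2).
Proof.
move=> hm; have M0 : 0 <= M by apply: le_trans hm.
have h1 : 2 * (a * (m * c)) <= `|m| * (a ^+ 2 + c ^+ 2).
  have [m0|m0] := leP 0 m.
    rewrite (ger0_norm m0).
    have -> : 2 * (a * (m * c)) = m * (2 * a * c) by ring.
    by apply: ler_wpM2l => //; have := sqr_ge0 (a - c); lra.
  rewrite (ltr0_norm m0).
  have -> : 2 * (a * (m * c)) = - m * (- (2 * a * c)) by ring.
  by apply: ler_wpM2l; [lra|]; have := sqr_ge0 (a + c); lra.
by apply: le_trans h1 _; apply: ler_wpM2r => //; rewrite addr_ge0 // sqr_ge0.
Qed.

(** Gronwall for the sum of squares of all components and their derivatives. Only the residual of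
    the equation on [[0, X]] enters, and the constant depends on [X] and the coefficients alone;
    with zero data and zero residual this is uniqueness. *)
Lemma growth_bound X : exists2 D, 1 <= D & forall y dy ddy d G, 0 <= d -> 0 <= G ->
  (forall c k x, dv (y c k) x (dy c k x)) -> (forall c k x, dv (dy c k) x (ddy c k x)) ->
  (forall c k x, 0 <= x <= X -> `|ddy c k x - lin y c k x| <= G) ->
  (forall c k, `|y c k 0| <= d) -> (forall c k, `|dy c k 0| <= d) ->
  forall c k x, 0 <= x <= X ->
    `|y c k x| <= D * (3 * d + 2 * G) /\ `|dy c k x| <= D * (3 * d + 2 * G).
Proof.
pose K := A0 + k0 ^+ 2 + 4 * v + 2.
have k20 : 0 <= k0 ^+ 2 by exact: sqr_ge0.
have hA := A00; have hv := v0.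
have K1 : 1 <= K by rewrite /K; lra.
exists (expR (K * `|X|)).
  by rewrite -expR0 ler_expR mulr_ge0 //; lra.
move=> y dy ddy d G d0 G0 d1 d2 he y0 dy0.
pose F x := (y false false x ^+ 2 + y false true x ^+ 2 + y true false x ^+ 2 + y true true x ^+ 2)
  + (dy false false x ^+ 2 + dy false true x ^+ 2 + dy true false x ^+ 2 + dy true true x ^+ 2).
pose T c k x := 2 * (y c k x * dy c k x) + 2 * (dy c k x * ddy c k x).
pose F1 x := T false false x + T false true x + T true false x + T true true x.
have dF x : dv F x (F1 x).
  apply: dv_eq.
    rewrite /F.
    by apply: dvD; (apply: dvD; [apply: dvD; [apply: dvD|]|]); apply: dvX; [apply: d1|apply: d1|apply: d1|apply: d1|apply: d2|apply: d2|apply: d2|apply: d2].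
  by rewrite /F1 /T; rng.
have T_le c k x : 0 <= x <= X -> T c k x <= y c k x ^+ 2 + dy c k x ^+ 2 +
   ((A0 + k0 ^+ 2) * (dy c k x ^+ 2 + y c k x ^+ 2) + v * (dy c k x ^+ 2 + y false k x ^+ 2)
    + v * (dy c k x ^+ 2 + y true k x ^+ 2) + (dy c k x ^+ 2 + G ^+ 2)).
  move=> hx; have := he c k x hx; set r := ddy c k x - _ => hr.
  have x0 : 0 <= x by case/andP: hx.
  have r2 : r ^+ 2 <= G ^+ 2.
    by rewrite -(real_normK (num_real r)) lerXn2r ?nnegrE.
  have e : ddy c k x = lin y c k x + r by rewrite /r; ring.
  have h1 := amgm (dy c k x) (y c k x) (norm_base c).
  have nv c' : `|- V c c' x| <= v by rewrite normrN Vv.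
  have h2 := amgm (dy c k x) (y false k x) (nv false).
  have h3 := amgm (dy c k x) (y true k x) (nv true).
  have h4 := sqr_ge0 (y c k x - dy c k x).
  have h5 := sqr_ge0 (r - dy c k x).
  by rewrite /T e /lin; lra.
have hF1 x : 0 <= x <= X -> F1 x <= K * F x + 4 * G ^+ 2.
  move=> hx; have := T_le false false _ hx; have := T_le false true _ hx.
  have := T_le true false _ hx; have := T_le true true _ hx.
  have n c k : 0 <= v * (y c k x ^+ 2) by rewrite mulr_ge0 // sqr_ge0.
  have n' c k : 0 <= v * (dy c k x ^+ 2) by rewrite mulr_ge0 // sqr_ge0.
  have m c k : 0 <= (A0 + k0 ^+ 2) * (y c k x ^+ 2).
    by rewrite mulr_ge0 ?sqr_ge0 // addr_ge0 // ltW.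
  have n2 c k : 0 <= y c k x ^+ 2 by exact: sqr_ge0.
  have := n false false; have := n false true; have := n true false; have := n true true.
  have := n' false false; have := n' false true; have := n' true false; have := n' true true.
  have := n2 false false; have := n2 false true; have := n2 true false; have := n2 true true.
  rewrite /F1 /K /F; lra.
have hF x : 0 <= x <= X -> F x <= (expR (K * `|X|) * (3 * d + 2 * G)) ^+ 2.
  move=> hx; have K0 : 0 < K by lra.
  have hg := gronwall K0 (fun x _ => dF x) hF1 hx.
  have hd c k : y c k 0 ^+ 2 <= d ^+ 2.
    by rewrite -(real_normK (num_real _)) lerXn2r ?nnegrE.
  have hd' c k : dy c k 0 ^+ 2 <= d ^+ 2.
    by rewrite -(real_normK (num_real _)) lerXn2r ?nnegrE.
  have F0 : F 0 <= 8 * d ^+ 2.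
    have := hd false false; have := hd false true; have := hd true false; have := hd true true.
    have := hd' false false; have := hd' false true; have := hd' true false; have := hd' true true.
    by rewrite /F; lra.
  have G2 : 4 * G ^+ 2 / K <= 4 * G ^+ 2.
    by apply: ler_piMr; [rewrite mulr_ge0 ?sqr_ge0|rewrite invf_le1].
  have G3 : 0 <= 4 * G ^+ 2 / K by rewrite divr_ge0 ?mulr_ge0 ?sqr_ge0 // ltW.
  apply: (@le_trans _ _ (F x + 4 * G ^+ 2 / K)); first by rewrite lerDl.
  apply: le_trans hg _.
  have dG : F 0 + 4 * G ^+ 2 / K <= (3 * d + 2 * G) ^+ 2.
    have := mulr_ge0 d0 G0; have := sqr_ge0 d; lra.
  have e1 : expR (K * x) <= expR (K * `|X|).
    rewrite ler_expR ler_wpM2l ?(ltW K0) //; case/andP: hx => _ h.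
    by apply: le_trans h (ler_norm _).
  have e2 : 1 <= expR (K * `|X|) by rewrite -expR0 ler_expR mulr_ge0 // ltW.
  rewrite exprMn; apply: (@le_trans _ _ (expR (K * x) * (3 * d + 2 * G) ^+ 2)).
    by apply: ler_wpM2l => //; exact: expR_ge0.
  apply: ler_wpM2r; first exact: sqr_ge0.
  apply: le_trans e1 _; rewrite expr2; apply: ler_peMr => //; exact: expR_ge0.
have nn c k x : [/\ 0 <= y c k x ^+ 2 & 0 <= dy c k x ^+ 2] by split; exact: sqr_ge0.
move=> c k x hx; have := hF x hx.
have DG0 : 0 <= expR (K * `|X|) * (3 * d + 2 * G) by rewrite mulr_ge0 ?expR_ge0 //; lra.
have [n1 m1] := nn false false x; have [n2 m2] := nn false true x.
have [n3 m3] := nn true false x; have [n4 m4] := nn true true x.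
move=> h; split; rewrite -(@ler_pXn2r _ 2) ?nnegrE // real_normK ?num_real //;
  apply: le_trans h; rewrite /F; move: n1 n2 n3 n4 m1 m2 m3 m4; case: c; case: k; clear -A00 k00 gam0 gamA v0 hV Vsym E0 E1 Vv; lra.
Qed.

(** Symmetry of [V] cancels the potential and [S] solves the equation exactly, so only the residual
    of [y] survives. *)
Lemma wron_dv S dS y dy ddy j k x : refsol S dS ->
  (forall c k x, dv (y c k) x (dy c k x)) -> (forall c k x, dv (dy c k) x (ddy c k x)) ->
  dv (wron S dS j y dy k) x
    (- (S false j x * (ddy false k x - lin y false k x)
        + S true j x * (ddy true k x - lin y true k x))).
Proof.
move=> [s1 s2] d1 d2; apply: dv_eq.
  rewrite /wron; apply: dvD; (apply: dvD; [|apply: dvN]); apply: dvM;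
    [exact: s2|exact: d1|exact: s1|exact: d2|exact: s2|exact: d1|exact: s1|exact: d2].
by rewrite /lin Vsym; ring.
Qed.

(** Both functions are outgoing, [S] for the exponent [i k0] and [y] for the nearby kappa, so at a
    far point [X] the oscillating terms of their Wronskian almost cancel and the decaying ones are
    small. Going back to 0 adds the shift and the forcing integrated over [[0, X]]. *)
Lemma pairing_small S dS th : refsol S dS -> outgoing S dS -> 0 < th ->
  exists2 thr, 0 < thr <= 1 & exists2 C, 0 <= C &
  forall t rho Phi Y y dy ddy, `|t| <= thr -> 0 <= rho <= thr -> 0 <= Phi ->
    forced t rho Phi y dy ddy -> (forall c k x, 0 <= x -> `|y c k x| <= Y) ->
    `|wron_re S dS y dy 0| <= th * Y + C * Phi /\
    `|wron_im S dS y dy 0| <= th * Y + C * Phi.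
Proof.
move=> href [[K K0 hK] vS vdS vr vi] th0.
have hA := A00; have hv := v0.
set L := A0 + k0 ^+ 2 + 2 * v + 4.
have L4 : 4 <= L by have := sqr_ge0 k0; rewrite /L; lra.
pose M1 := 2 * (1 + L) + 4 * K + 8 * K * (2 * v + 1) / gam + 2.
have M10 : 0 < M1.
  have : 0 <= 8 * K * (2 * v + 1) / gam.
    apply: divr_ge0; last exact: ltW.
    by apply: mulr_ge0; [exact: mulr_ge0|lra].
  by rewrite /M1; lra.
(* Order of choice: [e] from [th], then [X] from [e], then [thr] from [X], because the shift makes
   the pairing drift over [[0, X]] by a multiple of [thr * K * X * Y]. *)
pose e := th / (2 * M1).
have e0 : 0 < e by rewrite divr_gt0 // mulr_gt0.
have eM : e * M1 = th / 2 by rewrite /e; field; rewrite gt_eqF.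
clearbody e.
have [X [X0 [hX1 [hX2 hX3]]]] : exists X, 0 <= X /\
   (forall k, `|S false k X| <= e /\ `|dS false k X| <= e) /\
   (`|dS true false X - k0 * S true true X| <= e /\ `|dS true true X + k0 * S true false X| <= e) /\
   E X <= e.
  have [X1 h1] := vS false e e0; have [X2 h2] := vS true e e0.
  have [X3 h3] := vdS false e e0; have [X4 h4] := vdS true e e0.
  have [X5 h5] := vr e e0; have [X6 h6] := vi e e0.
  have [X7 h7] := vanish_expR gam0 e0.
  exists (Num.max 0 (Num.max X1 (Num.max X2 (Num.max X3 (Num.max X4 (Num.max X5 (Num.max X6 X7))))))).
  set m := Num.max 0 _.
  have hm : [/\ 0 <= m, X1 <= m, X2 <= m & X3 <= m] /\ [/\ X4 <= m, X5 <= m, X6 <= m & X7 <= m].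
    by rewrite /m !le_max !lexx !orbT.
  case: hm => [[? ? ? ?] [? ? ? ?]]; split=> //; split; last split; last first.
  - by rewrite -[E m]ger0_norm //; exact: h7.
  - by split; [exact: h5|exact: h6].
  - by case; split; [exact: h2|exact: h4|exact: h1|exact: h3].
have [thr0 /andP[thr00 thr01] hsq] := sqrt_near k00 e0.
pose thr := Num.min thr0 (th / (16 * (K + 1) * (X + 1))).
have KX : 0 < 16 * (K + 1) * (X + 1) by rewrite !mulr_gt0 //; lra.
have thrpos : 0 < thr by rewrite lt_min thr00 divr_gt0.
have thr_le : thr <= thr0 by rewrite ge_min lexx.
have thr_KX : thr * (16 * (K + 1) * (X + 1)) <= th.
  by rewrite -ler_pdivlMr // ge_min lexx orbT.
clearbody thr.
exists thr; first by rewrite thrpos /=; lra.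
exists (th + 4 * K * X); first by apply: addr_ge0; [exact: ltW|rewrite !mulr_ge0].
move=> t rho Phi Y y dy ddy ht /andP[r0 hr] P0 hF hY.
have Y0 : 0 <= Y by apply: le_trans (hY false false 0 _).
have [d1 d2 he vy vdy] := hF.
have t1 : `|t| <= 1 by apply: le_trans ht (le_trans thr_le thr01).
have r1 : 0 <= rho <= 1 by rewrite r0 /=; apply: le_trans hr (le_trans thr_le thr01).
have hdy := forced_dy t1 r1 P0 hF hY.
rewrite -/L in hdy.
have YP0 : 0 <= Y + Phi by exact: addr_ge0.
have KG : forall j k, `|wron S dS j y dy k X - wron S dS j y dy k 0|
    <= 2 * K * (2 * thr * Y + Phi) * X.
  move=> j k; rewrite -[X in _ * X]subr0.
  apply: (@dv_lip R _ (fun x => - (S false j x * (ddy false k x - lin y false k x)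
        + S true j x * (ddy true k x - lin y true k x)))) => // x /andP[x0 xX].
    exact: wron_dv.
  have hc c : `|S c j x * (ddy c k x - lin y c k x)| <= K * (2 * thr * Y + Phi).
    rewrite normrM; apply: ler_pM => //; first exact: hK.
    have -> : ddy c k x - lin y c k x = (ddy c k x - (lin y c k x + shift t rho y c k x))
       + shift t rho y c k x by ring.
    apply: le_trans (ler_normD _ _) _; rewrite addrC; apply: lerD.
      apply: le_trans (shift_le t c k r0 (fun c k => hY c k x x0)) _.
      by apply: ler_wpM2r => //; lra.
    by apply: le_trans (he _ _ _ x0) _; apply: ler_piMr => //; exact: E1.
  rewrite normrN; apply: le_trans (ler_normD _ _) _.
  by have := hc false; have := hc true; clear -A00 k00 gam0 gamA v0 hV Vsym E0 E1 Vv; lra.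
have [k1 [k2 [/andP[k10 k1e] k2e kk1 kk2]]] : exists k1 k2,
    [/\ 0 <= k1 <= e, `|k0 - k2| <= e, k1 ^+ 2 - k2 ^+ 2 = - k0 ^+ 2 - t & 2 * k1 * k2 = rho].
  by apply: hsq; [exact: le_trans ht thr_le|rewrite r0 /=; exact: le_trans hr thr_le].
pose H := 2 * v * Y + Phi.
have H0 : 0 <= H by rewrite /H addr_ge0 // !mulr_ge0.
have hQ c k x : 0 <= x ->
   `|ddy c k x - (base c * y c k x + shift t rho y c k x)| <= H * E x.
  move=> x0.
  have -> : ddy c k x - (base c * y c k x + shift t rho y c k x) =
    (ddy c k x - (lin y c k x + shift t rho y c k x)) - V c false x * y false k x - V c true x * y true k x.
    by rewrite /lin; ring.
  have n c' : `|V c c' x * y c' k x| <= v * Y * E x.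
    by rewrite normrM mulrAC; apply: ler_pM => //; [exact: hV|exact: hY].
  apply: le_trans (ler_normB _ _) _; apply: le_trans (lerD (ler_normB _ _) (lexx _)) _.
  by have := n false; have := n true; have := he c k x x0; rewrite /H /E; clear -A00 k00 gam0 gamA v0 hV Vsym E0 E1 Vv; lra.
have hout := @outgoing_bound R (y true false) (y true true) (dy true false) (dy true true)
  (ddy true false) (ddy true true) gam k1 k2 H gam0 k10 H0 (d1 true false) (d1 true true)
  (d2 true false) (d2 true true) (vy _ _) (vy _ _) (vdy _ _) (vdy _ _).
have {hout} hout : hyp2 (dy true false X + k1 * y true false X - k2 * y true true X)
  (dy true true X + k1 * y true true X + k2 * y true false X) <= 2 * H / gam * E X.
  apply: hout => // x x0.
    rewrite kk1 kk2 -/(E x); apply: le_trans (hQ true false x x0).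
    by rewrite /shift /=; rewrite le_eqVlt; apply/orP; left; apply/eqP; congr `|_|; ring.
  rewrite kk1 kk2 -/(E x); apply: le_trans (hQ true true x x0).
  by rewrite /shift /=; rewrite le_eqVlt; apply/orP; left; apply/eqP; congr `|_|; ring.
have {}hout : hyp2 (dy true false X + k1 * y true false X - k2 * y true true X)
  (dy true true X + k1 * y true true X + k2 * y true false X) <= 2 * (2 * v + 1) / gam * e * (Y + Phi).
  apply: le_trans hout _.
  have h1 : H <= (2 * v + 1) * (Y + Phi).
    by rewrite /H; have := mulr_ge0 v0 P0; move: Y0; clear -A00 k00 gam0 gamA v0 hV Vsym E0 E1 Vv; lra.
  have -> : 2 * (2 * v + 1) / gam * e * (Y + Phi) = 2 / gam * ((2 * v + 1) * (Y + Phi) * e) by ring.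
  have -> : 2 * H / gam * E X = 2 / gam * (H * E X) by ring.
  by apply: ler_wpM2l; [rewrite divr_ge0 // ltW|apply: ler_pM].
(* [g1 + i g2] is q' + kappa q at [X], and [o1 + i o2] below is S' + i k0 S. Once both derivatives
   are eliminated, the Wronskian of the oscillating components contains only o q, S g and (kappa - i
   k0) S q, all small. *)
set g1 := dy true false X + _ - _ in hout; set g2 := dy true true X + _ + _ in hout.
set G := 2 * (2 * v + 1) / gam * e * (Y + Phi) in hout.
have hg1 : `|g1| <= G by apply: le_trans hout; exact: hyp2_gel.
have hg2 : `|g2| <= G by apply: le_trans hout; exact: hyp2_ger.
have edy1 : dy true false X = g1 - k1 * y true false X + k2 * y true true X by rewrite /g1; ring.
have edy2 : dy true true X = g2 - k1 * y true true X - k2 * y true false X by rewrite /g2; ring.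
case: hX2; set o1 := dS true false X - _; set o2 := dS true true X + _ => ho1 ho2.
have edS1 : dS true false X = o1 + k0 * S true true X by rewrite /o1; ring.
have edS2 : dS true true X = o2 - k0 * S true false X by rewrite /o2; ring.
have bprod (a c A C : R) : `|a| <= A -> `|c| <= C -> `|a * c| <= A * C.
  by move=> ? ?; rewrite normrM; apply: ler_pM.
have hP j k : `|dS false j X * y false k X - S false j X * dy false k X| <= (1 + L) * e * (Y + Phi).
  have [s1 s2] := hX1 j.
  apply: le_trans (ler_normB _ _) _.
  have h1 := bprod _ _ _ _ s2 (hY false k X X0).
  have h2 := bprod _ _ _ _ s1 (hdy false k X X0).
  by have := mulr_ge0 (ltW e0) P0; move: h1 h2; clear -A00 k00 gam0 gamA v0 hV Vsym E0 E1 Vv; lra.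
have hQre : `|(dS true false X * y true false X - S true false X * dy true false X)
   - (dS true true X * y true true X - S true true X * dy true true X)|
   <= (4 * K + 8 * K * (2 * v + 1) / gam + 2) * e * (Y + Phi).
  rewrite edy1 edy2 edS1 edS2.
  have -> : ((o1 + k0 * S true true X) * y true false X - S true false X * (g1 - k1 * y true false X + k2 * y true true X))
   - ((o2 - k0 * S true false X) * y true true X - S true true X * (g2 - k1 * y true true X - k2 * y true false X))
   = o1 * y true false X - o2 * y true true X
     + (k0 - k2) * (S true true X * y true false X + S true false X * y true true X)
     + k1 * (S true false X * y true false X - S true true X * y true true X)
     - (S true false X * g1 - S true true X * g2) by ring.
  have h1 := bprod _ _ _ _ ho1 (hY true false X X0).
  have h2 := bprod _ _ _ _ ho2 (hY true true X X0).
  have h3 : `|S true true X * y true false X + S true false X * y true true X| <= 2 * K * Y.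
    apply: le_trans (ler_normD _ _) _.
    have := bprod _ _ _ _ (hK true true X X0) (hY true false X X0).
    have := bprod _ _ _ _ (hK true false X X0) (hY true true X X0); clear -A00 k00 gam0 gamA v0 hV Vsym E0 E1 Vv; lra.
  have h4 : `|S true false X * y true false X - S true true X * y true true X| <= 2 * K * Y.
    apply: le_trans (ler_normB _ _) _.
    have := bprod _ _ _ _ (hK true true X X0) (hY true true X X0).
    have := bprod _ _ _ _ (hK true false X X0) (hY true false X X0); clear -A00 k00 gam0 gamA v0 hV Vsym E0 E1 Vv; lra.
  have h5 := bprod _ _ _ _ k2e h3.
  have h6 : `|k1 * (S true false X * y true false X - S true true X * y true true X)| <= e * (2 * K * Y).
    by apply: bprod => //; rewrite ger0_norm.
  have h7 := bprod _ _ _ _ (hK true false X X0) hg1.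
  have h8 := bprod _ _ _ _ (hK true true X X0) hg2.
  apply: le_trans (ler_normB _ _) _.
  apply: le_trans (lerD (ler_normD _ _) (ler_normB _ _)) _.
  apply: le_trans (lerD (lerD (ler_normD _ _) (lexx _)) (lexx _)) _.
  apply: le_trans (lerD (lerD (lerD (ler_normB _ _) (lexx _)) (lexx _)) (lexx _)) _.
  have eK : 0 <= e * K * Phi by rewrite !mulr_ge0 // ?(ltW e0).
  have eP : 0 <= e * Phi by rewrite mulr_ge0 // ?(ltW e0).
  have KG0 : 0 <= K * G by apply: mulr_ge0 => //; apply: le_trans hg1.
  have -> : (4 * K + 8 * K * (2 * v + 1) / gam + 2) * e * (Y + Phi) = 4 * K * e * (Y + Phi) + 4 * (K * G) + 2 * e * (Y + Phi).
    by rewrite /G; ring.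
  by move: h1 h2 h5 h6 h7 h8 eK eP KG0; clear -A00 k00 gam0 gamA v0 hV Vsym E0 E1 Vv; lra.
have hQim : `|(dS true false X * y true true X - S true false X * dy true true X)
   + (dS true true X * y true false X - S true true X * dy true false X)|
   <= (4 * K + 8 * K * (2 * v + 1) / gam + 2) * e * (Y + Phi).
  rewrite edy1 edy2 edS1 edS2.
  have -> : ((o1 + k0 * S true true X) * y true true X - S true false X * (g2 - k1 * y true true X - k2 * y true false X))
   + ((o2 - k0 * S true false X) * y true false X - S true true X * (g1 - k1 * y true false X + k2 * y true true X))
   = o1 * y true true X + o2 * y true false X
     + (k0 - k2) * (S true true X * y true true X - S true false X * y true false X)
     + k1 * (S true false X * y true true X + S true true X * y true false X)
     - (S true false X * g2 + S true true X * g1) by ring.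
  have h1 := bprod _ _ _ _ ho1 (hY true true X X0).
  have h2 := bprod _ _ _ _ ho2 (hY true false X X0).
  have h3 : `|S true true X * y true true X - S true false X * y true false X| <= 2 * K * Y.
    apply: le_trans (ler_normB _ _) _.
    have := bprod _ _ _ _ (hK true true X X0) (hY true true X X0).
    have := bprod _ _ _ _ (hK true false X X0) (hY true false X X0); clear -A00 k00 gam0 gamA v0 hV Vsym E0 E1 Vv; lra.
  have h4 : `|S true false X * y true true X + S true true X * y true false X| <= 2 * K * Y.
    apply: le_trans (ler_normD _ _) _.
    have := bprod _ _ _ _ (hK true true X X0) (hY true false X X0).
    have := bprod _ _ _ _ (hK true false X X0) (hY true true X X0); clear -A00 k00 gam0 gamA v0 hV Vsym E0 E1 Vv; lra.
  have h5 := bprod _ _ _ _ k2e h3.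
  have h6 : `|k1 * (S true false X * y true true X + S true true X * y true false X)| <= e * (2 * K * Y).
    by apply: bprod => //; rewrite ger0_norm.
  have h7 := bprod _ _ _ _ (hK true false X X0) hg2.
  have h8 := bprod _ _ _ _ (hK true true X X0) hg1.
  apply: le_trans (ler_normB _ _) _.
  apply: le_trans (lerD (ler_normD _ _) (ler_normD _ _)) _.
  apply: le_trans (lerD (lerD (ler_normD _ _) (lexx _)) (lexx _)) _.
  apply: le_trans (lerD (lerD (lerD (ler_normD _ _) (lexx _)) (lexx _)) (lexx _)) _.
  have eK : 0 <= e * K * Phi by rewrite !mulr_ge0 // ?(ltW e0).
  have eP : 0 <= e * Phi by rewrite mulr_ge0 // ?(ltW e0).
  have KG0 : 0 <= K * G by apply: mulr_ge0 => //; apply: le_trans hg1.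
  have -> : (4 * K + 8 * K * (2 * v + 1) / gam + 2) * e * (Y + Phi) = 4 * K * e * (Y + Phi) + 4 * (K * G) + 2 * e * (Y + Phi).
    by rewrite /G; ring.
  by move: h1 h2 h5 h6 h7 h8 eK eP KG0; clear -A00 k00 gam0 gamA v0 hV Vsym E0 E1 Vv; lra.
have fin : e * M1 * (Y + Phi) + 4 * K * (2 * thr * Y + Phi) * X <= th * Y + (th + 4 * K * X) * Phi.
  rewrite eM.
  have h1 : 8 * K * X * thr <= th / 2.
    have h2 : 0 <= thr * K by rewrite mulr_ge0 // ltW.
    have h3 : 0 <= thr * X by rewrite mulr_ge0 // ltW.
    by move: thr_KX h2 h3 thrpos; clear -A00 k00 gam0 gamA v0 hV Vsym E0 E1 Vv; lra.
  have h2 : 8 * K * X * thr * Y <= th / 2 * Y by apply: ler_wpM2r.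
  have h3 : 0 <= th * Phi by rewrite mulr_ge0 // ltW.
  by move: h2 h3; clear -A00 k00 gam0 gamA v0 hV Vsym E0 E1 Vv; lra.
split; apply: le_trans fin.
  have -> : wron_re S dS y dy 0 = wron_re S dS y dy X
    - (wron S dS false y dy false X - wron S dS false y dy false 0)
    + (wron S dS true y dy true X - wron S dS true y dy true 0) by rewrite /wron_re; ring.
  apply: le_trans (ler_normD _ _) _; apply: le_trans (lerD (ler_normB _ _) (lexx _)) _.
  have := KG false false; have := KG true true.
  have : `|wron_re S dS y dy X| <= e * M1 * (Y + Phi).
    have -> : wron_re S dS y dy X = (dS false false X * y false false X - S false false X * dy false false X)
      - (dS false true X * y false true X - S false true X * dy false true X)
      + ((dS true false X * y true false X - S true false X * dy true false X)
   - (dS true true X * y true true X - S true true X * dy true true X)).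
      by rewrite /wron_re /wron; ring.
    apply: le_trans (ler_normD _ _) _; apply: le_trans (lerD (ler_normB _ _) (lexx _)) _.
    by have := hP false false; have := hP true true; move: hQre; rewrite /M1; clear -A00 k00 gam0 gamA v0 hV Vsym E0 E1 Vv; lra.
  by clear -A00 k00 gam0 gamA v0 hV Vsym E0 E1 Vv; lra.
have -> : wron_im S dS y dy 0 = wron_im S dS y dy X
    - (wron S dS false y dy true X - wron S dS false y dy true 0)
    - (wron S dS true y dy false X - wron S dS true y dy false 0) by rewrite /wron_im; ring.
apply: le_trans (ler_normB _ _) _; apply: le_trans (lerD (ler_normB _ _) (lexx _)) _.
have := KG false true; have := KG true false.
have : `|wron_im S dS y dy X| <= e * M1 * (Y + Phi).
  have -> : wron_im S dS y dy X = (dS false false X * y false true X - S false false X * dy false true X)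
      + (dS false true X * y false false X - S false true X * dy false false X)
      + ((dS true false X * y true true X - S true false X * dy true true X)
   + (dS true true X * y true false X - S true true X * dy true false X)).
    by rewrite /wron_im /wron; ring.
  apply: le_trans (ler_normD _ _) _; apply: le_trans (lerD (ler_normD _ _) (lexx _)) _.
  by have := hP false true; have := hP true false; move: hQim; rewrite /M1; clear -A00 k00 gam0 gamA v0 hV Vsym E0 E1 Vv; lra.
by clear -A00 k00 gam0 gamA v0 hV Vsym E0 E1 Vv; lra.
Qed.

End System.

(** * Propagation of small data along a half-line *)

Section Propagation.
Variable R : realType.
Implicit Types y dy ddy S dS : bool -> bool -> R -> R.
Variables (A0 k0 gam v : R) (V : bool -> bool -> R -> R).
Hypotheses (A00 : 0 < A0) (k00 : 0 < k0) (gam0 : 0 < gam) (gamA : 8 * gam ^+ 2 <= A0)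
  (v0 : 0 <= v) (hV : forall c c' x, 0 <= x -> `|V c c' x| <= v * expR (- (gam * x))).

Let E x := expR (- (gam * x)).

Lemma expR_le1 x : 0 <= x -> expR (- (gam * x)) <= 1.
Proof. by move=> x0; rewrite -expR0 ler_expR oppr_le0 mulr_ge0 // ltW. Qed.

(** The potential decays like the forcing, so it may be counted as forcing at the price of a
    multiple of [Y]; the tail estimates then see constant coefficients. *)
Lemma forced_free t rho Phi Y y dy ddy : forced A0 k0 gam V t rho Phi y dy ddy ->
  (forall c k x, 0 <= x -> `|y c k x| <= Y) ->
  forall c k x, 0 <= x -> `|ddy c k x - (base A0 k0 c * y c k x + shift t rho y c k x)|
     <= (2 * v * Y + Phi) * E x.
Proof.
move=> [_ _ he _ _] hY c k x x0.
have -> : ddy c k x - (base A0 k0 c * y c k x + shift t rho y c k x) =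
    (ddy c k x - (lin A0 k0 V y c k x + shift t rho y c k x)) - V c false x * y false k x - V c true x * y true k x.
  by rewrite /lin; ring.
have n c' : `|V c c' x * y c' k x| <= v * Y * E x.
  by rewrite normrM mulrAC; apply: ler_pM => //; [exact: hV|exact: hY].
apply: le_trans (ler_normB _ _) _; apply: le_trans (lerD (ler_normB _ _) (lexx _)) _.
by have := n false; have := n true; have := he c k x x0; rewrite /E; lra.
Qed.

(** Beyond some [X] the potential is too small to matter, and on [[0, X]] Gronwall carries the small
    data. The point is the factor 1/2: the bound [Y] improves itself, and can later be eliminated.
    The thresholds are fixed before [C1], which may depend on them. *)
Lemma propagation : exists2 th, 0 < th & exists2 thr, 0 < thr <= 1 &
  forall C1, 0 <= C1 -> exists2 C2, 0 <= C2 &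
  forall t rho Phi Y y dy ddy, `|t| <= thr -> 0 <= rho <= thr -> 0 <= Phi ->
    forced A0 k0 gam V t rho Phi y dy ddy -> (forall c k x, 0 <= x -> `|y c k x| <= Y) ->
    (forall c k, `|y c k 0| <= th * Y + C1 * Phi) ->
    (forall c k, `|dy c k 0| <= th * Y + C1 * Phi) ->
    forall c k x, 0 <= x -> `|y c k x| <= Y / 2 + C2 * Phi.
Proof.
have hA := A00; have hv := v0; have hg := gam0.
have A20 : 0 < A0 / 2 by lra.
(* [6 / A0] is the constant of the hyperbolic tail with [A0 / 2]; [4 / gam ^+ 2] is that of the
   oscillating one, where the forcing is integrated twice. *)
pose m := 6 / A0 + 4 / gam ^+ 2.
have q6 : 0 <= 6 / A0 by apply: divr_ge0 => //; exact: ltW.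
have q4 : 0 <= 4 / gam ^+ 2 by apply: divr_ge0 => //; exact: sqr_ge0.
have m0 : 0 <= m by exact: addr_ge0.
pose e := (8 * (m + 1) * (v + 1))^-1.
have e0 : 0 < e by rewrite invr_gt0 !mulr_gt0 //; lra.
have e1 : 2 * m * v * e <= 4^-1.
  rewrite /e ler_pdivrMr; last by rewrite !mulr_gt0 //; lra.
  have := mulr_ge0 m0 v0; lra.
have [X X0 hX] : exists2 X, 0 <= X & E X <= e /\ E X <= 1.
  have [X hX] := vanish_expR gam0 e0.
  exists (Num.max 0 X); first by rewrite le_max lexx.
  split; last by apply: expR_le1; rewrite le_max lexx.
  by rewrite -[E _]ger0_norm ?expR_ge0 //; apply: hX; rewrite le_max lexx orbT.
have [hXe hX1] := hX.
have [D D1 hD] := @growth_bound R A0 k0 gam v V A00 gam0 v0 hV X.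
have D0 : 0 < D by lra.
have [thr0 /andP[thr00 thr01] hsq] := sqrt_near k00 ltr01.
pose thr := Num.min thr0 (Num.min (A0 / 2) (64 * D)^-1).
have thrpos : 0 < thr by rewrite !lt_min thr00 A20 invr_gt0 mulr_gt0.
have thr_le : thr <= thr0 by rewrite ge_min lexx.
have thr_A : thr <= A0 / 2 by rewrite !ge_min lexx orbT.
have thr_D : thr * (64 * D) <= 1 by rewrite -ler_pdivlMr ?mulr_gt0 // div1r !ge_min lexx !orbT.
clearbody thr e.
exists (48 * D)^-1; first by rewrite invr_gt0 mulr_gt0.
exists thr; first by rewrite thrpos /=; lra.
move=> C1 C10; exists (2 * D * (3 * C1 + 2) + m).
  by apply: addr_ge0 => //; rewrite !mulr_ge0 //; move: D0 C10; clear -A00 k00 gam0 gamA v0 hV; lra.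
move=> t rho Phi Y y dy ddy ht /andP[r0 hr] P0 hF hY hy0 hdy0.
have Y0 : 0 <= Y by apply: le_trans (hY false false 0 _).
have [d1 d2 he vy vdy] := hF.
set th := (48 * D)^-1 in hy0 hdy0.
have th0 : 0 <= th by rewrite invr_ge0 mulr_ge0 // ltW.
have thD : th * (48 * D) = 1 by rewrite mulVf // gt_eqF // mulr_gt0.
clearbody th.
pose d := th * Y + C1 * Phi.
have d0 : 0 <= d by apply: addr_ge0; exact: mulr_ge0.
pose G := Phi + 2 * thr * Y.
have G0 : 0 <= G by apply: addr_ge0 => //; apply: mulr_ge0 => //; move: thrpos; clear -A00 k00 gam0 gamA v0 hV; lra.
have hK c k x : 0 <= x <= X -> `|y c k x| <= D * (3 * d + 2 * G).
  move=> hx; have [] // := hD y dy ddy d G d0 G0 d1 d2 _ hy0 hdy0 c k x hx.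
  move=> {hx}{}c {}k {}x /andP[x0 xX].
  have -> : ddy c k x - lin A0 k0 V y c k x = (ddy c k x - (lin A0 k0 V y c k x + shift t rho y c k x))
       + shift t rho y c k x by ring.
  apply: le_trans (ler_normD _ _) _; apply: lerD.
    by apply: le_trans (he _ _ _ x0) _; apply: ler_piMr => //; exact: expR_le1.
  apply: le_trans (shift_le t c k r0 (fun c k => hY c k x x0)) _.
  by apply: ler_wpM2r => //; move: ht hr; clear -A00 k00 gam0 gamA v0 hV; lra.
set K := D * (3 * d + 2 * G) in hK.
have K0 : 0 <= K by rewrite /K mulr_ge0 //; move: D0 d0 G0; clear -A00 k00 gam0 gamA v0 hV; lra.
have hfree := forced_free hF hY.
pose H := (2 * v * Y + Phi) * E X.
have vY : 0 <= 2 * v * Y by rewrite !mulr_ge0.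
have H0 : 0 <= H by rewrite mulr_ge0 ?expR_ge0 // addr_ge0.
have EE x : (2 * v * Y + Phi) * E x = H * expR (- (gam * (x - X))).
  by rewrite /H /E -[RHS]mulrA -expRD; congr (_ * expR _); ring.
(* The share of [Y] is 1/8 from the data, 1/8 from the shift on [[0, X]] and 1/4 from the potential
   beyond [X]. *)
have final : 2 * K + m * H <= Y / 2 + (2 * D * (3 * C1 + 2) + m) * Phi.
  have h1 : m * H <= m * (2 * v * Y * e + Phi).
    apply: ler_wpM2l => //; rewrite /H mulrDl; apply: lerD; first exact: ler_wpM2l.
    exact: ler_piMr.
  have h2 : 2 * m * v * e * Y <= 4^-1 * Y by exact: ler_wpM2r.
  have h3 : thr * (64 * D) * Y <= Y by exact: ler_piMl.
  have h4 : th * (48 * D) * Y = Y by rewrite thD mul1r.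
  by move: h1 h2 h3 h4; rewrite /K /d /G; clear -A00 k00 gam0 gamA v0 hV; lra.
have tail c k x : X <= x -> `|y c k x| <= 2 * K + m * H.
  move=> Xx; have x0 : 0 <= x by exact: le_trans X0 Xx.
  have XX : 0 <= X <= X by rewrite X0 lexx.
  have gap : 0 <= x - X by rewrite subr_ge0.
  case: c.
    have [k1 [k2 [/andP[k10 k1e] k2e kk1 kk2]]] : exists k1 k2,
      [/\ 0 <= k1 <= 1, `|k0 - k2| <= 1, k1 ^+ 2 - k2 ^+ 2 = - k0 ^+ 2 - t & 2 * k1 * k2 = rho].
      by apply: hsq; [exact: le_trans ht thr_le|rewrite r0 /=; exact: le_trans hr thr_le].
    have hout := @outgoing_bound R (y true false) (y true true) (dy true false) (dy true true)
      (ddy true false) (ddy true true) gam k1 k2 (2 * v * Y + Phi) gam0 k10 (addr_ge0 vY P0) (d1 true false) (d1 true true)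
      (d2 true false) (d2 true true) (vy _ _) (vy _ _) (vdy _ _) (vdy _ _).
    have {}hout : forall x, 0 <= x -> hyp2 (dy true false x + k1 * y true false x - k2 * y true true x)
      (dy true true x + k1 * y true true x + k2 * y true false x) <= 2 * (2 * v * Y + Phi) / gam * E x.
      apply: hout => z z0.
        rewrite kk1 kk2; apply: le_trans (hfree true false z z0).
        rewrite /shift /=; rewrite le_eqVlt; apply/orP; left; apply/eqP; congr `|_|; ring.
      rewrite kk1 kk2; apply: le_trans (hfree true true z z0).
      rewrite /shift /=; rewrite le_eqVlt; apply/orP; left; apply/eqP; congr `|_|; ring.
    pose c := 2 * (2 * v * Y + Phi) / gam.
    have c0 : 0 <= c by rewrite divr_ge0 ?mulr_ge0 ?addr_ge0 // ltW.
    (* Since q' + kappa q decays, q satisfies a first-order equation in which [k1] has the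
       favourable sign: from [X] on its norm grows by an integrable amount only. *)
    have : hyp2 (y true false x) (y true true x) <= hyp2 (y true false X) (y true true X)
        + 2 * (- (c / gam * E x) - - (c / gam * E X)).
      apply: (@norm_growth R (y true false) (y true true) (dy true false) (dy true true)
        (fun x => - (c / gam * E x)) (fun x => c * E x)) => //.
      - by move=> z _; apply: exp_primitive; rewrite gt_eqF.
      - by move=> z _; rewrite mulr_ge0 ?expR_ge0.
      move=> z /andP[Xz zx]; have z0 : 0 <= z by exact: le_trans X0 Xz.
      have := hout z z0; rewrite -/c.
      set g1 := dy true false z + _ - _; set g2 := dy true true z + _ + _ => hg12.
      have b1 : `|g1| <= c * E z by apply: le_trans hg12; exact: hyp2_gel.
      have b2 : `|g2| <= c * E z by apply: le_trans hg12; exact: hyp2_ger.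
      have -> : dy true false z = g1 - k1 * y true false z + k2 * y true true z by rewrite /g1; ring.
      have -> : dy true true z = g2 - k1 * y true true z - k2 * y true false z by rewrite /g2; ring.
      have n1 : y true false z * g1 <= `|y true false z| * (c * E z).
        by apply: le_trans (ler_norm _) _; rewrite normrM ler_wpM2l.
      have n2 : y true true z * g2 <= `|y true true z| * (c * E z).
        by apply: le_trans (ler_norm _) _; rewrite normrM ler_wpM2l.
      have n3 : 0 <= k1 * (y true false z ^+ 2 + y true true z ^+ 2).
        by rewrite mulr_ge0 // addr_ge0 // sqr_ge0.
      by move: n1 n2 n3; clear -A00 k00 gam0 gamA v0 hV; lra.
    move=> hh.
    have h1 : `|y true k x| <= hyp2 (y true false x) (y true true x).
      by case: k; [exact: hyp2_ger|exact: hyp2_gel].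
    have h2 : hyp2 (y true false X) (y true true X) <= 2 * K.
      apply: le_trans (hyp2_le _ _) _; have := hK true false X XX; have := hK true true X XX; clear -A00 k00 gam0 gamA v0 hV; lra.
    have h3 : 0 <= c / gam * E x by rewrite mulr_ge0 ?expR_ge0 // divr_ge0 // ltW.
    have h4 : 2 * (c / gam * E X) <= m * H.
      have -> : 2 * (c / gam * E X) = 4 / gam ^+ 2 * H.
        by rewrite /c /H; field; rewrite gt_eqF.
      by apply: ler_wpM2r => //; rewrite /m lerDr.
    by move: hh h1 h2 h3 h4; clear -A00 k00 gam0 gamA v0 hV; lra.
  have tA : A0 / 2 <= A0 + t by move: (thr_A) (ht); rewrite ler_norml => h /andP[]; move: h; clear -A00 k00 gam0 gamA v0 hV; lra.
  have gA : 4 * gam ^+ 2 <= A0 / 2 by move: (gamA); clear -A00 k00 gam0 gamA v0 hV; lra.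
  have hhyp := @hyperbolic_tail R (y false false) (y false true) (dy false false) (dy false true)
    (ddy false false) (ddy false true) X gam (A0 / 2) (A0 + t) (- rho) K H gam0 A20 tA gA K0 H0
    (d1 _ _) (d1 _ _) (d2 _ _) (d2 _ _) (vy _ _) (vy _ _) (hK false false X XX) (hK false true X XX).
  have [h1 h2] : `|y false false x| <= (2 * K + 3 * H / (A0 / 2)) * expR (- (gam * (x - X))) /\
     `|y false true x| <= (2 * K + 3 * H / (A0 / 2)) * expR (- (gam * (x - X))).
    apply: hhyp => // z Xz; have z0 : 0 <= z by exact: le_trans X0 Xz.
      rewrite -EE; apply: le_trans (hfree false false z z0).
      rewrite /shift /=; rewrite le_eqVlt; apply/orP; left; apply/eqP; congr `|_|; ring.
    rewrite -EE; apply: le_trans (hfree false true z z0).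
    rewrite /shift /=; rewrite le_eqVlt; apply/orP; left; apply/eqP; congr `|_|; ring.
  have h3 : (2 * K + 3 * H / (A0 / 2)) * expR (- (gam * (x - X))) <= 2 * K + m * H.
    have -> : 3 * H / (A0 / 2) = 6 / A0 * H by field; rewrite gt_eqF.
    apply: le_trans (_ : 2 * K + 6 / A0 * H <= _).
      apply: ler_piMr; last exact: expR_le1.
      by apply: addr_ge0; exact: mulr_ge0.
    by apply: lerD => //; apply: ler_wpM2r => //; rewrite /m lerDl.
  by case: k; [apply: le_trans h2 h3|apply: le_trans h1 h3].
move=> c k x x0; apply: le_trans final.
have [xX|Xx] := leP x X; last by apply: tail; exact: ltW.
apply: le_trans (hK c k x _) _; first by rewrite x0.
have := mulr_ge0 m0 H0; move: K0; clear -A00 k00 gam0 gamA v0 hV; lra.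
Qed.

End Propagation.

(** * From the half-lines to the line *)

Section Line.
Variable R : realType.
Implicit Types y dy ddy S dS : bool -> bool -> R -> R.

Definition refl y c k x := y c k (- x).
(** Meant for the derivative of a reflected family, hence the sign. *)
Definition reflN y c k x := - y c k (- x).

Lemma continuous_bounded (f f1 : R -> R) a c : (forall x, dv f x (f1 x)) ->
  exists2 K, 0 <= K & forall x, a <= x <= c -> `|f x| <= K.
Proof.
move=> d; have [ac|ca] := leP a c; last first.
  by exists 0 => // x /andP[h1 h2]; have := le_trans h1 h2; rewrite leNgt ca.
have cf : {within `[a, c], continuous f}.
  by apply: continuous_subspaceT => x; exact: dv_cont (d x).
have [z1 _ h1] := EVT_max ac cf; have [z2 _ h2] := EVT_min ac cf.
exists (`|f z1| + `|f z2|) => // x hx.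
have xi : x \in `[a, c]%R by rewrite in_itv /=.
have := h1 _ xi; have := h2 _ xi; have := ler_norm (f z1).
have := ler_norm (- f z2); rewrite normrN => a1 a2 a3 a4.
by rewrite ler_norml; apply/andP; split; have := normr_ge0 (f z1); have := normr_ge0 (f z2); lra.
Qed.

Lemma vanish2_bounded (f f1 : R -> R) : (forall x, dv f x (f1 x)) ->
  vanish f -> vanish (fun x => f (- x)) -> exists2 K, 0 <= K & forall x, `|f x| <= K.
Proof.
move=> d v1 v2; have [X1 h1] := v1 1 ltr01; have [X2 h2] := v2 1 ltr01.
have [K K0 hK] := continuous_bounded (- X2) X1 d.
exists (K + 1) => [|x]; first by rewrite addr_ge0.
have [x1|x1] := leP X1 x; first by apply: le_trans (h1 _ x1) _; rewrite lerDr.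
have [x2|x2] := leP x (- X2).
  by rewrite -[x]opprK; apply: le_trans (h2 _ _) _; [lra|rewrite lerDr].
by apply: le_trans (hK _ _) _; [apply/andP; split; exact: ltW|rewrite lerDl].
Qed.

Lemma bounded4 (P : set R) y : (forall c k, exists2 K, 0 <= K & forall x, P x -> `|y c k x| <= K) ->
  exists2 K, 0 <= K & forall c k x, P x -> `|y c k x| <= K.
Proof.
move=> b.
have [Ka a0 ha] := b false false; have [Kb b0 hb] := b false true.
have [Kc c0 hc] := b true false; have [Kd d0 hd] := b true true.
exists (Ka + Kb + (Kc + Kd)); first by rewrite !addr_ge0.
case; case=> x Px.
- by apply: le_trans (hd x Px) _; lra.
- by apply: le_trans (hc x Px) _; lra.
- by apply: le_trans (hb x Px) _; lra.
- by apply: le_trans (ha x Px) _; lra.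
Qed.

Section Reflection.
Variables (A0 k0 gam : R) (V : bool -> bool -> R -> R).

Definition forced2 t rho Phi y dy ddy :=
  [/\ forall c k x, dv (y c k) x (dy c k x),
      forall c k x, dv (dy c k) x (ddy c k x),
      forall c k x,
        `|ddy c k x - (lin A0 k0 V y c k x + shift t rho y c k x)| <= Phi * expR (- (gam * `|x|)),
      forall c k, vanish (y c k) /\ vanish (refl y c k) &
      forall c k, vanish (dy c k) /\ vanish (refl dy c k)].

Lemma forced2_right t rho Phi y dy ddy : forced2 t rho Phi y dy ddy ->
  forced A0 k0 gam V t rho Phi y dy ddy.
Proof.
move=> [d1 d2 he h1 h2]; split => //.
- by move=> c k x x0; have := he c k x; rewrite (ger0_norm x0).
- by move=> c k; case: (h1 c k).
- by move=> c k; case: (h2 c k).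
Qed.

Lemma forced2_left t rho Phi y dy ddy : forced2 t rho Phi y dy ddy ->
  forced A0 k0 gam (refl V) t rho Phi (refl y) (reflN dy) (refl ddy).
Proof.
move=> [d1 d2 he h1 h2]; split => //.
- by move=> c k x; apply: dv_refl.
- by move=> c k x; apply: dv_eq; [apply: dvN; apply: dv_refl; exact: d2|rewrite opprK].
- by move=> c k x x0; have := he c k (- x); rewrite normrN (ger0_norm x0).
- by move=> c k; case: (h1 c k).
- by move=> c k; apply: vanishN; case: (h2 c k).
Qed.

Lemma refsol_refl S dS : refsol A0 k0 V S dS -> refsol A0 k0 (refl V) (refl S) (reflN dS).
Proof.
move=> [h1 h2]; split=> c k x; first exact: dv_refl.
by apply: dv_eq; [apply: dvN; apply: dv_refl; exact: h2|rewrite opprK].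
Qed.

End Reflection.

Lemma wron_re_refl S dS y dy :
  wron_re (refl S) (reflN dS) (refl y) (reflN dy) 0 = - wron_re S dS y dy 0.
Proof. by rewrite /wron_re /wron /refl /reflN oppr0; ring. Qed.
Lemma wron_im_refl S dS y dy :
  wron_im (refl S) (reflN dS) (refl y) (reflN dy) 0 = - wron_im S dS y dy 0.
Proof. by rewrite /wron_im /wron /refl /reflN oppr0; ring. Qed.

Variables (A0 k0 gam v : R) (V : bool -> bool -> R -> R).
Hypotheses (A00 : 0 < A0) (k00 : 0 < k0) (gam0 : 0 < gam) (gamA : 8 * gam ^+ 2 <= A0)
  (v0 : 0 <= v) (hV : forall c c' x, `|V c c' x| <= v * expR (- (gam * `|x|)))
  (Vsym : forall x, V true false x = V false true x).

Let hVr c c' x : 0 <= x -> `|V c c' x| <= v * expR (- (gam * x)).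
Proof. by move=> x0; have := hV c c' x; rewrite (ger0_norm x0). Qed.
Let hVl c c' x : 0 <= x -> `|refl V c c' x| <= v * expR (- (gam * x)).
Proof. by move=> x0; have := hV c c' (- x); rewrite normrN (ger0_norm x0). Qed.

Definition small_pairing S dS y dy B := `|wron_re S dS y dy 0| <= B /\ `|wron_im S dS y dy 0| <= B.

(* The data at 0 of a decaying solution are determined by the pairings with
   the two solutions that are outgoing at each end; the error is therefore
   controlled by the forcing alone. *)
Lemma forced_small Sr dSr Sr' dSr' Sl dSl Sl' dSl' Cd : 0 <= Cd ->
  refsol A0 k0 V Sr dSr -> outgoing k0 Sr dSr ->
  refsol A0 k0 V Sr' dSr' -> outgoing k0 Sr' dSr' ->
  refsol A0 k0 V Sl dSl -> outgoing k0 (refl Sl) (reflN dSl) ->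
  refsol A0 k0 V Sl' dSl' -> outgoing k0 (refl Sl') (reflN dSl') ->
  exists2 thr, 0 < thr <= 1 & exists2 C, 0 <= C &
  forall t rho Phi y dy ddy, `|t| <= thr -> 0 <= rho <= thr -> 0 <= Phi ->
    forced2 A0 k0 gam V t rho Phi y dy ddy ->
    (forall B, 0 <= B -> small_pairing Sr dSr y dy B -> small_pairing Sr' dSr' y dy B ->
       small_pairing Sl dSl y dy B -> small_pairing Sl' dSl' y dy B ->
       (forall c k, `|y c k 0| <= Cd * B /\ `|dy c k 0| <= Cd * B)) ->
    forall c k x, `|y c k x| <= C * Phi.
Proof.
move=> Cd0 r1 o1 r2 o2 r3 o3 r4 o4.
have [th1 th10 [t1 ht1 H1]] := propagation A00 k00 gam0 gamA v0 hVr.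
have [th2 th20 [t2 ht2 H2]] := propagation A00 k00 gam0 gamA v0 hVl.
(* [Cd] amplifies the pairings into data at 0, so the pairings must be smaller by this factor than
   the data that [propagation] accepts. *)
pose th := Num.min th1 th2 / (Cd + 1).
have Cd1 : 0 < Cd + 1 by rewrite ltr_wpDl.
have th0 : 0 < th by rewrite divr_gt0 // lt_min th10 th20.
have Vsl x : refl V true false x = refl V false true x by rewrite /refl Vsym.
have [u1 hu1 [D1 D10 K1]] := pairing_small A00 k00 gam0 v0 hVr Vsym r1 o1 th0.
have [u2 hu2 [D2 D20 K2]] := pairing_small A00 k00 gam0 v0 hVr Vsym r2 o2 th0.
have [u3 hu3 [D3 D30 K3]] := pairing_small A00 k00 gam0 v0 hVl Vsl (refsol_refl r3) o3 th0.
have [u4 hu4 [D4 D40 K4]] := pairing_small A00 k00 gam0 v0 hVl Vsl (refsol_refl r4) o4 th0.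
have [C1 C10 {}H1] := H1 _ (mulr_ge0 Cd0 (addr_ge0 (addr_ge0 D10 D20) (addr_ge0 D30 D40))).
have [C2 C20 {}H2] := H2 _ (mulr_ge0 Cd0 (addr_ge0 (addr_ge0 D10 D20) (addr_ge0 D30 D40))).
pose thr := Num.min (Num.min t1 t2) (Num.min (Num.min u1 u2) (Num.min u3 u4)).
have thr0 : 0 < thr.
  rewrite !lt_min; case/andP: ht1 => -> _; case/andP: ht2 => -> _; case/andP: hu1 => -> _.
  by case/andP: hu2 => -> _; case/andP: hu3 => -> _; case/andP: hu4 => -> _.
have thr1 : thr <= 1 by apply: le_trans (_ : t1 <= 1); [rewrite /thr !ge_min lexx|case/andP: ht1].
exists thr; first by rewrite thr0.
exists (2 * (C1 + C2)); first by rewrite mulr_ge0 // addr_ge0.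
move=> t rho Phi y dy ddy ht /andP[rho0 hrho] P0 F2 hCd.
have Fr := forced2_right F2; have Fl := forced2_left F2.
have le6 z : z <= thr -> [/\ z <= t1, z <= t2 & [/\ z <= u1, z <= u2, z <= u3 & z <= u4]].
  by rewrite /thr !le_min => /andP[/andP[-> ->] /andP[/andP[-> ->] /andP[-> ->]]].
have [tt1 tt2 [tu1 tu2 tu3 tu4]] := le6 _ ht.
have [rt1 rt2 [ru1 ru2 ru3 ru4]] := le6 _ hrho.
have step Y : (forall c k x, `|y c k x| <= Y) ->
  forall c k x, `|y c k x| <= Y / 2 + (C1 + C2) * Phi.
  move=> hY; have Y0 : 0 <= Y by apply: le_trans (hY false false 0).
  set B := th * Y + (D1 + D2 + (D3 + D4)) * Phi.
  have B0 : 0 <= B.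
    by apply: addr_ge0; apply: mulr_ge0 => //; [exact: ltW|rewrite !addr_ge0].
  have DP : [/\ 0 <= D1 * Phi, 0 <= D2 * Phi, 0 <= D3 * Phi & 0 <= D4 * Phi].
    by rewrite !mulr_ge0.
  have [q1 q2 q3 q4] := DP.
  have [B1 B2 B3 B4] : [/\ th * Y + D1 * Phi <= B, th * Y + D2 * Phi <= B,
      th * Y + D3 * Phi <= B & th * Y + D4 * Phi <= B].
    by rewrite /B; move: q1 q2 q3 q4; clear; split; lra.
  have data c k : `|y c k 0| <= Cd * B /\ `|dy c k 0| <= Cd * B.
    apply: hCd => //.
    - have [|h1 h2] := K1 t rho Phi Y y dy ddy tu1 _ P0 Fr (fun c k x _ => hY c k x).
        by rewrite rho0.
      by split; [apply: le_trans h1 B1|apply: le_trans h2 B1].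
    - have [|h1 h2] := K2 t rho Phi Y y dy ddy tu2 _ P0 Fr (fun c k x _ => hY c k x).
        by rewrite rho0.
      by split; [apply: le_trans h1 B2|apply: le_trans h2 B2].
    - have [|] := K3 t rho Phi Y _ _ _ tu3 _ P0 Fl (fun c k x _ => hY c k (- x)).
        by rewrite rho0.
      rewrite wron_re_refl wron_im_refl !normrN => h1 h2.
      by split; [apply: le_trans h1 B3|apply: le_trans h2 B3].
    - have [|] := K4 t rho Phi Y _ _ _ tu4 _ P0 Fl (fun c k x _ => hY c k (- x)).
        by rewrite rho0.
      rewrite wron_re_refl wron_im_refl !normrN => h1 h2.
      by split; [apply: le_trans h1 B4|apply: le_trans h2 B4].
  have Cdth : Cd * th <= Num.min th1 th2.
    rewrite /th mulrCA; apply: ler_piMr.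
      by rewrite le_min !ltW.
    by rewrite ler_pdivrMr // mul1r lerDl.
  have Cdth1 : Cd * B <= th1 * Y + Cd * (D1 + D2 + (D3 + D4)) * Phi.
    rewrite /B mulrDr [Cd * (th * Y)]mulrA [Cd * (_ * Phi)]mulrA lerD2r.
    by apply: ler_wpM2r => //; apply: le_trans Cdth _; rewrite ge_min lexx.
  have Cdth2 : Cd * B <= th2 * Y + Cd * (D1 + D2 + (D3 + D4)) * Phi.
    rewrite /B mulrDr [Cd * (th * Y)]mulrA [Cd * (_ * Phi)]mulrA lerD2r.
    by apply: ler_wpM2r => //; apply: le_trans Cdth _; rewrite ge_min lexx orbT.
  have n1 : 0 <= C1 * Phi by exact: mulr_ge0.
  have n2 : 0 <= C2 * Phi by exact: mulr_ge0.
  have dat c k : [/\ `|y c k 0| <= Cd * B & `|dy c k 0| <= Cd * B] by have [] := data c k.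
  move=> c k x; have [x0|x0] := leP 0 x.
    apply: le_trans (_ : Y / 2 + C1 * Phi <= _); last by rewrite mulrDl addrA lerDl.
    apply: (H1 t rho Phi Y y dy ddy) => //; rewrite ?rho0 //.
      by move=> c' k'; have [h _] := dat c' k'; apply: le_trans h Cdth1.
    by move=> c' k'; have [_ h] := dat c' k'; apply: le_trans h Cdth1.
  apply: le_trans (_ : Y / 2 + C2 * Phi <= _); last by rewrite mulrDl [C1 * Phi + _]addrC addrA lerDl.
  have -> : y c k x = refl y c k (- x) by rewrite /refl opprK.
  apply: (H2 t rho Phi Y (refl y) (reflN dy) (refl ddy)) => //; rewrite ?rho0 //.
  - by move=> c' k' z _; exact: hY.
  - by move=> c' k'; rewrite /refl oppr0; have [h _] := dat c' k'; apply: le_trans h Cdth2.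
  - by move=> c' k'; rewrite /reflN oppr0 normrN; have [_ h] := dat c' k'; apply: le_trans h Cdth2.
  - by rewrite oppr_ge0 ltW.
(* Decay at both ends gives some finite bound, so the supremum exists; [step] applied to it absorbs
   half of it and leaves a bound by [Phi] alone. *)
have [K K0 hK] : exists2 K, 0 <= K & forall c k x, `|y c k x| <= K.
  have [d1 _ _ vv _] := F2.
  have [c k|K K0 hK] := @bounded4 setT y.
    by have [w1 w2] := vv c k; have [K K0 hK] := vanish2_bounded (d1 c k) w1 w2; exists K.
  by exists K => // c k x; exact: hK.
pose Sup : set R := [set z | exists c k x, z = `|y c k x|].
have Sup0 : Sup !=set0 by exists `|y false false 0|, false, false, 0.
have SupK : ubound Sup K by move=> _ [c [k [x ->]]].
have hs : has_sup Sup by split => //; exists K.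
have hsup c k x : `|y c k x| <= sup Sup.
  by apply: ub_le_sup; [exists K|exists c, k, x].
have : sup Sup <= sup Sup / 2 + (C1 + C2) * Phi.
  by apply: ge_sup => // _ [c [k [x ->]]]; exact: step.
by move=> h c k x; have := hsup c k x; move: h; clear -A00 k00 gam0 gamA v0 hV Vsym hVr hVl; lra.
Qed.

(** With [rho = 0] the exponent kappa = i k2 is purely imaginary and q is real, so the real and
    imaginary parts of q' + kappa q are q' and k2 q. The bound on the outgoing quantity controls
    both, and the oscillating component decays exponentially as well. *)
Lemma real_decay : exists2 thr, 0 < thr <= 1 & exists2 C, 0 <= C &
  forall t Phi Y y dy ddy, `|t| <= thr -> 0 <= Phi ->
    forced A0 k0 gam V t 0 Phi y dy ddy -> (forall c x, y c true x = 0) ->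
    (forall c k x, 0 <= x -> `|y c k x| <= Y) ->
    forall c x, 0 <= x -> `|y c false x| <= C * (Y + Phi) * expR (- (gam * x)) /\
      `|dy c false x| <= C * (Y + Phi) * expR (- (gam * x)).
Proof.
have A20 : 0 < A0 / 2 by rewrite divr_gt0.
have [thr0 /andP[thr00 thr01] hsq] := sqrt_near k00 (divr_gt0 k00 (ltr0n R 2)).
pose thr := Num.min thr0 (A0 / 2).
have thrpos : 0 < thr by rewrite !lt_min thr00 A20.
have thr_le : thr <= thr0 by rewrite ge_min lexx.
have thr_A : thr <= A0 / 2 by rewrite !ge_min lexx orbT.
clearbody thr.
exists thr; first by rewrite thrpos /=; lra.
pose c1 := 2 * (2 * v + 1) / gam.
have c10 : 0 <= c1 by rewrite /c1; apply: divr_ge0; [apply: mulr_ge0 => //; rewrite addr_ge0 // mulr_ge0|exact: ltW].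
pose Cq := c1 + c1 / (k0 / 2).
have Cq0 : 0 <= Cq by apply: addr_ge0 => //; apply: divr_ge0 => //; apply: divr_ge0 => //; exact: ltW.
pose m := 2 + 6 * (2 * v + 1) / A0.
have m0 : 0 <= m.
  apply: addr_ge0 => //; apply: divr_ge0; last exact: ltW.
  by apply: mulr_ge0 => //; rewrite addr_ge0 // mulr_ge0.
pose L := A0 + 1 + (2 * v + 1).
have L0 : 0 <= L by have := A00; have := v0; rewrite /L; lra.
pose Cp := (2 + A0 + 1) * m + (2 * v + 1).
have Cp0 : 0 <= Cp.
  have h := A00; have h' := v0.
  by rewrite /Cp; apply: addr_ge0; [apply: mulr_ge0 => //|]; lra.
exists (Cq + (m + Cp)); first by apply: addr_ge0 => //; exact: addr_ge0.
move=> t Phi Y y dy ddy ht P0 F yim hY.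
have Y0 : 0 <= Y by apply: le_trans (hY false false 0 _).
have [d1 d2 he vy vdy] := F.
have hfree := forced_free hVr F hY.
pose H := 2 * v * Y + Phi.
have H0 : 0 <= H by rewrite /H addr_ge0 // !mulr_ge0.
have HY : H <= (2 * v + 1) * (Y + Phi).
  by rewrite /H; have := mulr_ge0 v0 P0; lra.
have YP : 0 <= Y + Phi by exact: addr_ge0.
have hq x : 0 <= x -> `|y true false x| <= Cq * (Y + Phi) * expR (- (gam * x)) /\
      `|dy true false x| <= Cq * (Y + Phi) * expR (- (gam * x)).
  move=> x0.
  have [k1 [k2 [/andP[k10 k1e] k2e kk1 kk2]]] : exists k1 k2,
      [/\ 0 <= k1 <= k0 / 2, `|k0 - k2| <= k0 / 2, k1 ^+ 2 - k2 ^+ 2 = - k0 ^+ 2 - t & 2 * k1 * k2 = 0].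
    by apply: hsq; [exact: le_trans thr_le|rewrite lexx ltW].
  have k20 : k0 / 2 <= k2 by move: k2e; rewrite ler_norml => /andP[_]; lra.
  have k2p : 0 < k2 by apply: lt_le_trans k20; rewrite divr_gt0.
  have k1z : k1 = 0 by move/eqP: kk2; rewrite !mulf_eq0 pnatr_eq0 (gt_eqF k2p) /= orbF => /eqP.
  have := @outgoing_bound R (y true false) (y true true) (dy true false) (dy true true)
      (ddy true false) (ddy true true) gam k1 k2 H gam0 k10 H0 (d1 true false) (d1 true true)
      (d2 true false) (d2 true true) (vy _ _) (vy _ _) (vdy _ _) (vdy _ _).
  move=> W; have {}W := W _ _ x x0.
  have {W} : hyp2 (dy true false x + k1 * y true false x - k2 * y true true x)
    (dy true true x + k1 * y true true x + k2 * y true false x) <= 2 * H / gam * expR (- (gam * x)).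
    apply: W => z z0.
      rewrite kk1 kk2; apply: le_trans (hfree true false z z0).
      rewrite /shift /= yim; rewrite le_eqVlt; apply/orP; left; apply/eqP; congr `|_|; ring.
    rewrite kk1 kk2; apply: le_trans (hfree true true z z0).
    rewrite /shift /= yim; rewrite le_eqVlt; apply/orP; left; apply/eqP; congr `|_|; ring.
  have dyim z : dy true true z = 0.
    have h := d1 true true z.
    have h' : dv (y true true) z 0.
      have -> : y true true = fun=> 0 by apply/funext => u; rewrite yim.
      exact: dv_cst.
    by have [_ <-] := h; have [_ <-] := h'.
  rewrite k1z yim dyim !mul0r !mulr0 !addr0 !subr0 add0r => W.
  have Wc : 2 * H / gam * expR (- (gam * x)) <= c1 * (Y + Phi) * expR (- (gam * x)).
    apply: ler_wpM2r; first exact: expR_ge0.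
    have -> : 2 * H / gam = 2 / gam * H by ring.
    have -> : c1 * (Y + Phi) = 2 / gam * ((2 * v + 1) * (Y + Phi)) by rewrite /c1; ring.
    by apply: ler_wpM2l => //; apply: divr_ge0 => //; exact: ltW.
  have E0 := expR_ge0 (- (gam * x)).
  have q2 : 0 <= c1 / (k0 / 2) * (Y + Phi) * expR (- (gam * x)).
    by do 2 (apply: mulr_ge0 => //); apply: divr_ge0 => //; apply: divr_ge0 => //; exact: ltW.
  have q1 : 0 <= c1 * (Y + Phi) * expR (- (gam * x)).
    by apply: mulr_ge0 => //; exact: mulr_ge0.
  have Cqe : Cq * (Y + Phi) * expR (- (gam * x)) = c1 * (Y + Phi) * expR (- (gam * x))
     + c1 / (k0 / 2) * (Y + Phi) * expR (- (gam * x)) by rewrite /Cq; ring.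
  rewrite Cqe; split; last first.
    by have := le_trans (hyp2_gel _ _) (le_trans W Wc); move: q2; clear -A00 k00 gam0 gamA v0 hV Vsym hVr hVl; lra.
  have := le_trans (hyp2_ger _ _) (le_trans W Wc).
  rewrite normrM (gtr0_norm k2p) => hk.
  apply: le_trans (_ : c1 / (k0 / 2) * (Y + Phi) * expR (- (gam * x)) <= _); last by rewrite lerDr.
  have k02 : 0 < k0 / 2 by rewrite divr_gt0.
  have -> : c1 / (k0 / 2) * (Y + Phi) * expR (- (gam * x)) = (c1 * (Y + Phi) * expR (- (gam * x))) / (k0 / 2) by ring.
  rewrite ler_pdivlMr // mulrC; apply: le_trans hk; exact: ler_wpM2r.
have tA : A0 / 2 <= A0 + t by move: ht; rewrite ler_norml => /andP[]; lra.
have tA' : `|A0 + t| <= A0 + 1.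
  by apply: le_trans (ler_normD _ _) _; rewrite (ger0_norm (ltW A00)); lra.
have gA : 4 * gam ^+ 2 <= A0 / 2 by have := gamA; lra.
have hp x : 0 <= x -> `|y false false x| <= m * (Y + Phi) * expR (- (gam * x)).
  move=> x0.
  have := @hyperbolic_tail R (y false false) (y false true) (dy false false) (dy false true)
    (ddy false false) (ddy false true) 0 gam (A0 / 2) (A0 + t) 0 Y H gam0 A20 tA gA Y0 H0
    (d1 _ _) (d1 _ _) (d2 _ _) (d2 _ _) (vy _ _) (vy _ _) (hY false false 0 (lexx _)) (hY false true 0 (lexx _)).
  move=> W; have {}W := W _ _ x x0.
  have [] : `|y false false x| <= (2 * Y + 3 * H / (A0 / 2)) * expR (- (gam * (x - 0))) /\
     `|y false true x| <= (2 * Y + 3 * H / (A0 / 2)) * expR (- (gam * (x - 0))).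
    apply: W => z z0; rewrite subr0.
      apply: le_trans (hfree false false z z0).
      rewrite /shift /= yim; rewrite le_eqVlt; apply/orP; left; apply/eqP; congr `|_|; ring.
    apply: le_trans (hfree false true z z0).
    rewrite /shift /= yim; rewrite le_eqVlt; apply/orP; left; apply/eqP; congr `|_|; ring.
  rewrite subr0 => h _; apply: le_trans h _; apply: ler_wpM2r; first exact: expR_ge0.
  have -> : 3 * H / (A0 / 2) = 6 / A0 * H by field; rewrite gt_eqF.
  have -> : m * (Y + Phi) = 2 * (Y + Phi) + 6 / A0 * ((2 * v + 1) * (Y + Phi)) by rewrite /m; ring.
  apply: lerD; first by rewrite mulrDr lerDl mulr_ge0.
  by apply: ler_wpM2l => //; apply: divr_ge0 => //; exact: ltW.
have hdp x : 0 <= x -> `|dy false false x| <= Cp * (Y + Phi) * expR (- (gam * x)).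
  move=> x0.
  have mono z : x <= z -> expR (- (gam * z)) <= expR (- (gam * x)).
    by move=> xz; rewrite ler_expR lerN2 ler_wpM2l // ltW.
  have : `|dy false false x| <= 2 * (m * (Y + Phi) * expR (- (gam * x)))
      + ((A0 + 1) * (m * (Y + Phi) * expR (- (gam * x))) + (2 * v + 1) * (Y + Phi) * expR (- (gam * x))).
    apply: (@interp_bound R (y false false) (dy false false) (ddy false false)) => //.
      move=> z /andP[xz _]; have z0 : 0 <= z by exact: le_trans xz.
      by apply: le_trans (hp z z0) _; apply: ler_wpM2l; [exact: mulr_ge0|exact: mono].
    move=> z /andP[xz _]; have z0 : 0 <= z by exact: le_trans xz.
    have := hfree false false z z0; set r := ddy false false z - _ => hr.
    have -> : ddy false false z = (A0 + t) * y false false z + r by rewrite /r /shift /= yim; ring.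
    apply: le_trans (ler_normD _ _) _; apply: lerD.
      rewrite normrM; apply: ler_pM => //.
      by apply: le_trans (hp z z0) _; apply: ler_wpM2l; [exact: mulr_ge0|exact: mono].
    apply: le_trans hr _; rewrite -/H; by apply: ler_pM => //; rewrite ?expR_ge0 // mono.
  by move=> h; apply: le_trans h _; rewrite /Cp le_eqVlt; apply/orP; left; apply/eqP; ring.
have mon (a c x : R) : 0 <= x -> 0 <= c -> a * (Y + Phi) * expR (- (gam * x)) <= (a + c) * (Y + Phi) * expR (- (gam * x)).
  move=> x0 c0; apply: ler_wpM2r; first exact: expR_ge0.
  by apply: ler_wpM2r => //; rewrite lerDl.
case=> x x0.
  by have [h1 h2] := hq x x0; split; [apply: le_trans h1 _|apply: le_trans h2 _]; apply: mon => //; exact: addr_ge0.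
split; [apply: le_trans (hp x x0) _|apply: le_trans (hdp x x0) _].
  by have := mon m (Cq + Cp) x x0 (addr_ge0 Cq0 Cp0); rewrite addrCA.
by have := mon Cp (Cq + m) x x0 (addr_ge0 Cq0 m0); rewrite [Cq + (m + Cp)]addrA [(Cq + m) + Cp]addrC.
Qed.

End Line.

Ltac nn := first [ done | assumption | apply: ltW; assumption | exact: expR_ge0 | exact: sqr_ge0
  | apply: addr_ge0; nn | apply: mulr_ge0; nn | apply: divr_ge0; nn | apply: exprn_ge0; nn ].

Ltac pp := first [ done | assumption | exact: expR_gt0 | apply: mulr_gt0; pp | apply: divr_gt0; pp
  | rewrite invr_gt0; pp | apply: exprn_gt0; pp | apply: addr_gt0; pp | apply: ltr_wpDl; [nn|pp] ].

Lemma norm_atan_le2 (R : realType) (u : R) : `|atan u| <= 2.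
Proof.
have h3 := @pihalf_lt2 R; have h2 := atan_ltpi2 u; have h1 := atan_gtNpi2 u.
rewrite ler_norml; apply/andP; split; apply: ltW; last by apply: (lt_trans h2).
by apply: lt_trans h1; rewrite ltrN2.
Qed.

Lemma gain_absurd (R : realType) (G x1 x2 Q a1 a2 x3 x4 : R) : 0 < G ->
  x2 + Q * a2 <= x3 -> x4 <= x1 + Q * a1 -> x3 + G <= x4 -> `|x1| <= G / 16 -> `|x2| <= G / 16 ->
  Q * (a1 - a2) <= 4 * Q -> 4 * Q <= G / 2 -> False.
Proof.
rewrite !ler_norml => g0 h1 h2 h3 /andP[_ h4] /andP[h5 _] h6 h7; lra.
Qed.

(** * Krein signature *)

Section Eigen.
Variable R : realType.
Implicit Types y dy z dz S dS : bool -> bool -> R -> R.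

Definition vanish2 (f : R -> R) := vanish f /\ vanish (fun x => f (- x)).

(** Entries of the block a (I + sigma_1) + c I. *)
Definition sympot (a c : R -> R) (i j : bool) (x : R) := if i == j then a x + c x else a x.
(** A scalar equation stored in the first component of a two-component system, so that the estimates
    for systems also serve for r and w. *)
Definition scalpot (d : R -> R) (i j : bool) (x : R) := if i || j then 0 else d x.

(** [y] holds (p, q) and [z] holds (r, w). The constants are the coefficients at infinity for
    lambda_0; only that of q, [- k0 ^+ 2], is negative. The coupling of the two pairs goes through
    [b] alone. *)
Definition eigen (A1 A2 A3 k0 t rho : R) (a c b d1 d2 : R -> R) y dy z dz :=
  [/\ forall i k x, dv (y i k) x (dy i k x) /\ dv (z i k) x (dz i k x),
      forall i k x, dv (dy i k) x (lin A1 k0 (sympot a c) y i k x + shift t rho y i k x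
         - b x * (z false k x + z true k x)),
      forall i k x, dv (dz i k) x ((if i then A3 else A2) * z i k x + shift t rho z i k x
         - sympot d1 d2 i false x * z false k x - sympot d1 d2 i true x * z true k x
         - b x * (y false k x + y true k x)) &
      forall i k, [/\ vanish2 (y i k), vanish2 (dy i k), vanish2 (z i k) & vanish2 (dz i k)]].

(* [sg] is the sign of the bifurcated second component. *)
Definition close_pot (gam K eps sg : R) (a0 c0 d0 b0 a c b d1 d2 : R -> R) :=
  forall x, [/\ `|a x - a0 x| <= K * eps * expR (- (gam * `|x|)),
    `|c x - c0 x| <= K * eps * expR (- (gam * `|x|)),
    `|d1 x| <= K * eps * expR (- (gam * `|x|)) /\
    `|d2 x - d0 x| <= K * eps * expR (- (gam * `|x|)),
    `|b x| <= K * eps * expR (- (gam * `|x|)) &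
    `|b x - sg * eps * b0 x| <= K * eps ^+ 2 * expR (- (gam * `|x|))].

(** Quantitative nondegeneracy at 0: the pairings with two right and two left solutions determine
    the Cauchy data. A nonzero Evans function provides it. *)
Definition ctrl Cd Sr dSr Sr' dSr' Sl dSl Sl' dSl' y dy :=
  forall B, 0 <= B -> small_pairing Sr dSr y dy B -> small_pairing Sr' dSr' y dy B ->
       small_pairing Sl dSl y dy B -> small_pairing Sl' dSl' y dy B ->
       forall i k, `|y i k 0| <= Cd * B /\ `|dy i k 0| <= Cd * B.

Definition outgoing_ref A k0 V Sr dSr Sl dSl :=
  [/\ refsol A k0 V Sr dSr, @outgoing R k0 Sr dSr,
      refsol A k0 V Sl dSl & outgoing k0 (refl Sl) (reflN dSl)].

Definition pad (u : bool -> R -> R) (i k : bool) (x : R) := if i then 0 else u k x.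

Lemma prod_le (a c A C e : R) : 0 <= e -> `|a| <= A * e -> `|c| <= C -> `|a * c| <= A * C * e.
Proof. by move=> e0 h1 h2; rewrite normrM mulrAC; exact: ler_pM. Qed.

Section Perturb.
Variables (A1 A2 A3 k0 gam v K : R) (a0 c0 d0 b0 : R -> R).
Hypotheses (A10 : 0 < A1) (A20 : 0 < A2) (A30 : 0 < A3) (k00 : 0 < k0) (gam0 : 0 < gam)
  (gamA1 : 8 * gam ^+ 2 <= A1) (gamA2 : 8 * gam ^+ 2 <= A2) (gamA3 : 8 * gam ^+ 2 <= A3)
  (v0 : 0 <= v) (K0 : 0 <= K)
  (ha0 : forall x, `|a0 x| <= v * expR (- (gam * `|x|)))
  (hc0 : forall x, `|c0 x| <= v * expR (- (gam * `|x|)))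
  (hd0 : forall x, `|d0 x| <= v * expR (- (gam * `|x|)))
  (hb0 : forall x, `|b0 x| <= v * expR (- (gam * `|x|))).
Variables (S1 dS1 S2 dS2 S5 dS5 S6 dS6 S3 dS3 S7 dS7 : bool -> bool -> R -> R) (Cd : R).
Hypotheses (Cd0 : 0 <= Cd)
  (h15 : outgoing_ref A1 k0 (sympot a0 c0) S5 dS5 S1 dS1)
  (h26 : outgoing_ref A1 k0 (sympot a0 c0) S6 dS6 S2 dS2)
  (hctrlA : forall y dy, ctrl Cd S5 dS5 S6 dS6 S1 dS1 S2 dS2 y dy)
  (h37 : outgoing_ref A2 k0 (scalpot d0) S7 dS7 S3 dS3)
  (hctrlC : forall u du, ctrl Cd S7 dS7 S7 dS7 S3 dS3 S3 dS3 (pad u) (pad du)).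

Let E (x : R) := expR (- (gam * `|x|)).
Let E0 x : 0 <= E x. Proof. exact: expR_ge0. Qed.
Let E1 x : E x <= 1.
Proof. by rewrite /E -expR0 ler_expR oppr_le0 mulr_ge0 // ltW. Qed.

Lemma sympot_le a c m i j x : 0 <= m -> `|a x| <= m * E x -> `|c x| <= m * E x ->
  `|sympot a c i j x| <= 2 * m * E x.
Proof.
move=> m0 h1 h2; rewrite /sympot; case: ifP => _.
  by apply: le_trans (ler_normD _ _) _; lra.
by apply: le_trans h1 _; apply: ler_wpM2r => //; lra.
Qed.

(** Relative to the unperturbed system there are five extra products, each at most [K * eps * N]
    times the weight: the changes of [a] and [c], and the coupling [b], which is itself of order
    eps. *)
Lemma eigen_forced_y t rho eps sg a c b d1 d2 y dy z dz N : 0 <= eps -> 0 <= N ->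
  close_pot gam K eps sg a0 c0 d0 b0 a c b d1 d2 ->
  eigen A1 A2 A3 k0 t rho a c b d1 d2 y dy z dz ->
  (forall i k x, `|y i k x| <= N /\ `|z i k x| <= N) ->
  forced2 A1 k0 gam (sympot a0 c0) t rho (5 * K * eps * N) y dy
    (fun i k x => lin A1 k0 (sympot a c) y i k x + shift t rho y i k x
         - b x * (z false k x + z true k x)).
Proof.
move=> eps0 N0 hcl [dd d2y _ vv] hN.
split=> //; [by move=> i k x; case: (dd i k x)| | |]; last 2 first.
- by move=> i k; case: (vv i k) => -[].
- by move=> i k; case: (vv i k) => _ [].
move=> i k x.
have [h1 h2 _ h4 _] := hcl x.
have [n1 n2] := hN false k x; have [n3 n4] := hN true k x; have [n5 n6] := hN i k x.
have -> : lin A1 k0 (sympot a c) y i k x + shift t rho y i k x - b x * (z false k x + z true k x)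
   - (lin A1 k0 (sympot a0 c0) y i k x + shift t rho y i k x)
   = - ((a x - a0 x) * y false k x + (a x - a0 x) * y true k x + (c x - c0 x) * y i k x
      + b x * z false k x + b x * z true k x).
  by rewrite /lin /sympot; case: (i) => /=; ring.
rewrite normrN.
have m1 := prod_le (E0 x) h1 n1; have m2 := prod_le (E0 x) h1 n3.
have m3 := prod_le (E0 x) h2 n5; have m4 := prod_le (E0 x) h4 n2.
have m5 := prod_le (E0 x) h4 n4.
have -> : 5 * K * eps * N * expR (- (gam * `|x|)) = K * eps * N * E x + K * eps * N * E x
  + K * eps * N * E x + K * eps * N * E x + K * eps * N * E x by rewrite /E; ring.
do 4 (apply: le_trans (ler_normD _ _) _; apply: lerD => //).
Qed.

Lemma eigen_forced_r t rho eps sg a c b d1 d2 y dy z dz N : 0 <= eps -> 0 <= N ->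
  close_pot gam K eps sg a0 c0 d0 b0 a c b d1 d2 ->
  eigen A1 A2 A3 k0 t rho a c b d1 d2 y dy z dz ->
  (forall i k x, `|y i k x| <= N /\ `|z i k x| <= N) ->
  forced2 A2 k0 gam (scalpot d0) t rho (5 * K * eps * N) (pad (z false)) (pad (dz false))
    (pad (fun k x => A2 * z false k x + shift t rho z false k x
         - sympot d1 d2 false false x * z false k x - sympot d1 d2 false true x * z true k x
         - b x * (y false k x + y true k x))).
Proof.
move=> eps0 N0 hcl [dd _ d2z vv] hN.
have v0' : vanish2 (fun=> 0 : R).
  by split=> e e0; exists 0 => x _; rewrite normr0 ltW.
split.
- by case=> k x; [exact: dv_cst|case: (dd false k x)].
- by case=> k x; [exact: dv_cst|exact: (d2z false k x)].
- case=> k x.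
    rewrite (_ : _ - _ = 0); last by rewrite /pad /lin /shift /scalpot /=; ring.
    by rewrite normr0 !mulr_ge0 ?expR_ge0.
  have [_ _ [h1 h2] h4 _] := hcl x.
  have [n1 n2] := hN false k x; have [n3 n4] := hN true k x.
  have -> : pad (fun k x => A2 * z false k x + shift t rho z false k x
         - sympot d1 d2 false false x * z false k x - sympot d1 d2 false true x * z true k x
         - b x * (y false k x + y true k x)) false k x
     - (lin A2 k0 (scalpot d0) (pad (z false)) false k x + shift t rho (pad (z false)) false k x)
   = - (d1 x * z false k x + d1 x * z true k x + (d2 x - d0 x) * z false k x
      + b x * y false k x + b x * y true k x).
    by rewrite /pad /lin /shift /sympot /scalpot /=; ring.
  rewrite normrN.
  have m1 := prod_le (E0 x) h1 n2; have m2 := prod_le (E0 x) h1 n4.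
  have m3 := prod_le (E0 x) h2 n2; have m4 := prod_le (E0 x) h4 n1.
  have m5 := prod_le (E0 x) h4 n3.
  have -> : 5 * K * eps * N * expR (- (gam * `|x|)) = K * eps * N * E x + K * eps * N * E x
    + K * eps * N * E x + K * eps * N * E x + K * eps * N * E x by rewrite /E; ring.
  by do 4 (apply: le_trans (ler_normD _ _) _; apply: lerD => //).
- by case=> k; [exact: v0'|case: (vv false k)].
- by case=> k; [exact: v0'|case: (vv false k)].
Qed.

(** The forcing of p, q and r is of order eps, and the control of their data at 0 excludes a
    homogeneous contribution. Nothing of the kind is available for w, whose unperturbed equation has
    a decaying solution. *)
Lemma small_yr : exists2 e0, 0 < e0 <= 1 & exists2 C, 0 <= C &
  forall t rho eps sg a c b d1 d2 y dy z dz N, `|t| <= e0 -> 0 <= rho <= e0 -> 0 <= eps ->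
  0 <= N ->
  close_pot gam K eps sg a0 c0 d0 b0 a c b d1 d2 ->
  eigen A1 A2 A3 k0 t rho a c b d1 d2 y dy z dz ->
  (forall i k x, `|y i k x| <= N /\ `|z i k x| <= N) ->
  forall i k x, `|y i k x| <= C * eps * N /\ `|z false k x| <= C * eps * N.
Proof.
have v2 : 0 <= 2 * v by rewrite mulr_ge0.
have hVA i j x : `|sympot a0 c0 i j x| <= 2 * v * expR (- (gam * `|x|)) by exact: sympot_le.
have hVC i j x : `|scalpot d0 i j x| <= 2 * v * expR (- (gam * `|x|)).
  rewrite /scalpot; case: ifP => _; first by rewrite normr0 mulr_ge0.
  by apply: le_trans (hd0 x) _; apply: ler_wpM2r; [exact: expR_ge0|lra].
have sA x : sympot a0 c0 true false x = sympot a0 c0 false true x by [].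
have sC x : scalpot d0 true false x = scalpot d0 false true x by [].
have [r5 o5 r1 o1] := h15; have [r6 o6 r2 o2] := h26; have [r7 o7 r3 o3] := h37.
have [t1 /andP[t10 t11] [D1 D10 H1]] := forced_small A10 k00 gam0 gamA1 v2 hVA sA Cd0 r5 o5 r6 o6 r1 o1 r2 o2.
have [t2 /andP[t20 t21] [D2 D20 H2]] := forced_small A20 k00 gam0 gamA2 v2 hVC sC Cd0 r7 o7 r7 o7 r3 o3 r3 o3.
exists (Num.min t1 t2); first by rewrite lt_min t10 t20 ge_min t11.
exists ((D1 + D2) * (5 * K)); first by rewrite mulr_ge0 ?addr_ge0 // mulr_ge0.
move=> t rho eps sg a c b d1 d2 y dy z dz N; rewrite !le_min => /andP[tt1 tt2] /and3P[rho0 rt1 rt2] eps0 N0 hcl he hN i k x.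
have P0 : 0 <= 5 * K * eps * N by rewrite !mulr_ge0.
have Fy := eigen_forced_y eps0 N0 hcl he hN.
have Fr := eigen_forced_r eps0 N0 hcl he hN.
have q1 : 0 <= D1 * (5 * K * eps * N) by exact: mulr_ge0.
have q2 : 0 <= D2 * (5 * K * eps * N) by exact: mulr_ge0.
have -> : (D1 + D2) * (5 * K) * eps * N = D1 * (5 * K * eps * N) + D2 * (5 * K * eps * N) by ring.
split.
  apply: le_trans (_ : D1 * (5 * K * eps * N) <= _); last by rewrite lerDl.
  by apply: (H1 _ _ _ _ _ _ _ _ _ Fy) => //; rewrite ?rho0 //; exact: hctrlA.
apply: le_trans (_ : D2 * (5 * K * eps * N) <= _); last by rewrite lerDr.
by apply: (H2 _ _ _ _ _ _ _ _ _ Fr _ false k x) => //; rewrite ?rho0 //; exact: hctrlC.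
Qed.

(** [N] is the supremum of all components: finite because they vanish at both ends, positive because
    the eigenfunction is not zero. Later estimates are relative to it. *)
Lemma eigen_bounded t rho a c b d1 d2 y dy z dz :
  eigen A1 A2 A3 k0 t rho a c b d1 d2 y dy z dz ->
  ~ (forall i k x, y i k x = 0 /\ z i k x = 0) ->
  exists2 N, 0 < N & (forall i k x, `|y i k x| <= N /\ `|z i k x| <= N) /\
    exists i k x, N / 2 <= `|y i k x| \/ N / 2 <= `|z i k x|.
Proof.
move=> [dd _ _ vv] nz.
have [i k|Ky Ky0 hy] := @bounded4 R setT y.
  have [vy _ _ _] := vv i k; have [Kk k0' hk] := vanish2_bounded (fun x => proj1 (dd i k x)) (proj1 vy) (proj2 vy).
  by exists Kk.
have [i k|Kz Kz0 hz] := @bounded4 R setT z.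
  have [_ _ vz _] := vv i k; have [Kk k0' hk] := vanish2_bounded (fun x => proj2 (dd i k x)) (proj1 vz) (proj2 vz).
  by exists Kk.
pose Sup : set R := [set m | exists i k x, m = `|y i k x| \/ m = `|z i k x|].
have ub : ubound Sup (Ky + Kz).
  move=> _ [i [k [x [->|->]]]].
    by apply: le_trans (hy i k x I) _; rewrite lerDl.
  by apply: le_trans (hz i k x I) _; rewrite lerDr.
have hs : has_sup Sup by split; [exists `|y false false 0|, false, false, 0; left|exists (Ky + Kz)].
have hsy i k x : `|y i k x| <= sup Sup by apply: ub_le_sup; [exists (Ky + Kz)|exists i, k, x; left].
have hsz i k x : `|z i k x| <= sup Sup by apply: ub_le_sup; [exists (Ky + Kz)|exists i, k, x; right].
have N0 : 0 < sup Sup.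
  rewrite lt_neqAle; apply/andP; split; last by apply: le_trans (hsy false false 0).
  apply/negP => /eqP e; apply: nz => i k x.
  by split; apply/eqP; rewrite -normr_le0 e.
exists (sup Sup) => //; split=> //.
have h : sup Sup - sup Sup / 2 < sup Sup by rewrite ltrBlDr ltrDl divr_gt0.
have [m [i [k [x hm]]] hlt] := sup_adherent (divr_gt0 N0 (ltr0n R 2)) hs.
exists i, k, x; have {}hlt : sup Sup / 2 <= m by apply: ltW; apply: le_lt_trans hlt; lra.
by case: hm => <-; [left|right].
Qed.

(** Replaces the exponential weight by the derivative of the bounded function [atan], so that errors
    can be added to a monotone quantity without integrating. *)
Lemma weight_atan : exists2 M, 0 <= M & forall x, E x <= M * (1 + x ^+ 2)^-1.
Proof.
have g20 : 0 < gam ^+ 2 by rewrite exprn_gt0.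
exists (1 + 4 / gam ^+ 2); first by rewrite addr_ge0 // divr_ge0 // ltW.
move=> x; have p : 0 < 1 + x ^+ 2 by rewrite ltr_pwDl // sqr_ge0.
rewrite ler_pdivlMr // /E expRN mulrC ler_pdivrMr ?expR_gt0 //.
have h : 1 + (gam * `|x|) ^+ 2 / 4 <= expR (gam * `|x|).
  have n : 0 <= gam * `|x| by rewrite mulr_ge0 // ltW.
  have -> : gam * `|x| = gam * `|x| / 2 + gam * `|x| / 2 by field.
  rewrite expRD -expr2.
  apply: le_trans (_ : (1 + gam * `|x| / 2) ^+ 2 <= _).
    by move: n; set m := gam * _; move=> n; lra.
  by rewrite lerXn2r ?nnegrE ?expR_ge0 ?expR_ge1Dx // addr_ge0 // divr_ge0.
apply: le_trans (_ : (1 + 4 / gam ^+ 2) * (1 + (gam * `|x|) ^+ 2 / 4) <= _); last first.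
  by apply: ler_wpM2l => //; rewrite addr_ge0 // divr_ge0 // ltW.
rewrite exprMn real_normK ?num_real //.
have -> : (1 + 4 / gam ^+ 2) * (1 + gam ^+ 2 * x ^+ 2 / 4) = 1 + x ^+ 2 + 4 / gam ^+ 2 + gam ^+ 2 * x ^+ 2 / 4.
  by field; rewrite gt_eqF.
rewrite -addrA lerDl addr_ge0 // ?divr_ge0 // ?(ltW g20) // mulr_ge0 ?sqr_ge0 //.
Qed.

Lemma vanish2D f g : vanish2 f -> vanish2 g -> vanish2 (fun x => f x + g x).
Proof. by move=> [? ?] [? ?]; split; exact: vanishD. Qed.
Lemma vanish2Z (m : R) f : vanish2 f -> vanish2 (fun x => m * f x).
Proof. by move=> [? ?]; split; exact: vanishZ. Qed.
Lemma vanish2M f g : vanish2 f -> vanish2 g -> vanish2 (fun x => f x * g x).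
Proof.
move=> [f1 f2] [g1 g2]; split.
  have [X _ [M hM]] := vanish_bnd f1; exact: vanishM_bnd hM g1.
have [X _ [M hM]] := vanish_bnd f2; exact: vanishM_bnd hM g2.
Qed.

(* Krein signature: the quantity |p|^2 + |r|^2 - |q|^2 - |w|^2 has zero
   integral when [rho <> 0], but for small [eps] it is dominated by the
   component w. *)
Lemma no_complex_eigen : exists2 e0, 0 < e0 <= 1 &
  forall t rho eps sg a c b d1 d2 y dy z dz, `|t| <= e0 -> 0 < rho <= e0 -> 0 <= eps <= e0 ->
  close_pot gam K eps sg a0 c0 d0 b0 a c b d1 d2 ->
  eigen A1 A2 A3 k0 t rho a c b d1 d2 y dy z dz ->
  forall i k x, y i k x = 0 /\ z i k x = 0.
Proof.
have [e1 /andP[e10 e11] [C C0 Hsm]] := small_yr.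
have [M M0 HM] := weight_atan.
(* Half of the smaller constant, so that [A1 + t] and [A2 + t] stay above [kap]. *)
pose kap := Num.min A1 A2 / 2.
have kap0 : 0 < kap by rewrite divr_gt0 // lt_min A10 A20.
have kA1 : 2 * kap <= A1 by rewrite /kap mulrC divfK // ge_min lexx.
have kA2 : 2 * kap <= A2 by rewrite /kap mulrC divfK // ge_min lexx orbT.
pose L := A3 + 5 * K + v + 4.
have L0 : 0 < L by have := A30; have := v0; have := K0; rewrite /L; lra.
pose H := 6 * (v + K) * C + 6 * K.
have H0 : 0 <= H by rewrite /H; nn.
pose Q := 8 * C * H.
have Q0 : 0 <= Q by rewrite /Q; nn.
pose gain := 2 * kap * (16)^-1 * (4 * L)^-1.
have gain0 : 0 < gain by rewrite /gain; pp.
pose e0 := Num.min (Num.min e1 kap) (Num.min (4 * (C + 1))^-1 (gain / (8 * (Q * M + 1)))).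
have QM0 : 0 <= Q * M by exact: mulr_ge0.
have e00 : 0 < e0.
  rewrite !lt_min e10 kap0 /=; apply/andP; split; pp.
have le0 : [/\ e0 <= e1, e0 <= kap, e0 <= (4 * (C + 1))^-1 & e0 <= gain / (8 * (Q * M + 1))].
  by rewrite /e0 !ge_min !lexx !orbT.
have [l1 l2 l3 l4] := le0.
have e01 : e0 <= 1 by apply: le_trans e11.
exists e0; first by rewrite e00.
have l5 : C * e0 <= 4^-1.
  apply: le_trans (ler_wpM2l C0 l3) _.
  by rewrite ler_pdivrMr ?mulr_gt0 ?ltr_wpDl //; lra.
have l6 : 4 * (Q * M * e0) <= gain / 2.
  have h8 : 0 < 8 * (Q * M + 1) by rewrite mulr_gt0 // ltr_wpDl.
  move: l4; rewrite ler_pdivlMr // => h; have := ltW e00; lra.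
have hgain : gain = 2 * kap * (16)^-1 * (4 * L)^-1 by [].
have hQ : Q = 8 * C * H by [].
have hH : H = 6 * (v + K) * C + 6 * K by [].
have hL : L = A3 + 5 * K + v + 4 by [].
clearbody e0 kap L H Q gain => {le0}.
move=> t rho eps sg a c b d1 d2 y dy z dz ht /andP[rho0 hrho] /andP[eps0 heps] hcl he.
have [//|nz] := pselect (forall i k x, y i k x = 0 /\ z i k x = 0); exfalso.
have [N N0 [hN [i0 [k [x hx]]]]] := eigen_bounded he nz.
have Nn := ltW N0.
have hs i j u : `|y i j u| <= C * eps * N /\ `|z false j u| <= C * eps * N.
  apply: (Hsm t rho eps sg a c b d1 d2 y dy z dz N _ _ eps0 Nn hcl he hN).
    exact: le_trans ht l1.
  by rewrite ltW //=; exact: le_trans hrho l1.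
have eC : C * eps * N <= N / 4.
  have : C * eps <= 4^-1 by apply: le_trans l5; exact: ler_wpM2l.
  by move=> h; apply: le_trans (ler_wpM2r Nn h) _; rewrite mulrC.
have {i0}hx : N / 2 <= `|z true k x|.
  case: hx => [h|]; first by have [g _] := hs i0 k x; exfalso; move: (le_trans h (le_trans g eC)) N0; clear -A10 A20 A30 k00 gam0 gamA1 gamA2 gamA3 v0 K0 ha0 hc0 hd0 hb0 Cd0 h15 h26 hctrlA h37 hctrlC E0 E1; lra.
  case: i0 => // h; have [_ g] := hs true k x; exfalso; move: (le_trans h (le_trans g eC)) N0; clear -A10 A20 A30 k00 gam0 gamA1 gamA2 gamA3 v0 K0 ha0 hc0 hd0 hb0 Cd0 h15 h26 hctrlA h37 hctrlC E0 E1; lra.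
have [dd d2y d2z vv] := he.
have dY i j u : dv (y i j) u (dy i j u) by case: (dd i j u).
have dZ i j u : dv (z i j) u (dz i j u) by case: (dd i j u).
have Keps : K * eps <= K by apply: ler_piMr => //; exact: le_trans heps e01.
have Kw u : K * eps * E u <= K * E u by exact: ler_wpM2r.
have vKp : 0 <= v + K by exact: addr_ge0.
have ha u : `|a u| <= (v + K) * E u.
  have -> : a u = a0 u + (a u - a0 u) by ring.
  apply: le_trans (ler_normD _ _) _; rewrite mulrDl; apply: lerD => //.
  by have [h _ _ _ _] := hcl u; apply: le_trans h (Kw u).
have hc u : `|c u| <= (v + K) * E u.
  have -> : c u = c0 u + (c u - c0 u) by ring.
  apply: le_trans (ler_normD _ _) _; rewrite mulrDl; apply: lerD => //.
  by have [_ h _ _ _] := hcl u; apply: le_trans h (Kw u).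
have hd2 u : `|d2 u| <= (v + K) * E u.
  have -> : d2 u = d0 u + (d2 u - d0 u) by ring.
  apply: le_trans (ler_normD _ _) _; rewrite mulrDl; apply: lerD => //.
  by have [_ _ [_ h] _ _] := hcl u; apply: le_trans h (Kw u).
have hd1 u : `|d1 u| <= K * eps * E u by have [_ _ [h _] _ _] := hcl u.
have hb u : `|b u| <= K * eps * E u by have [_ _ _ h _] := hcl u.
have Ku u : K * E u <= K by apply: ler_piMr.
have vKu u : (v + K) * E u <= v + K by apply: ler_piMr.
have t1 : `|t| <= 1 by apply: le_trans ht e01.
have r1 : `|rho| <= 1 by rewrite gtr0_norm //; apply: le_trans hrho e01.
have mulle (f g F : R) : `|f| <= F -> `|g| <= N -> `|f * g| <= F * N.
  by move=> ? ?; rewrite normrM; exact: ler_pM.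
have hdz u : `|dz true k u| <= L * N.
  have -> : L * N = 2 * N + (A3 + 5 * K + v + 2) * N by rewrite hL; ring.
  apply: (interp_bound (dZ true k) (d2z true k)) => [w _|w _]; first by case: (hN true k w).
  have [n1 n2] := hN false k w; have [n3 n4] := hN true k w; have [_ n5] := hN true (~~ k) w.
  have m1 : `|A3 * z true k w| <= A3 * N by apply: mulle => //; rewrite gtr0_norm.
  have m2 : `|shift t rho z true k w| <= 2 * N.
    have -> : 2 * N = N + N by ring.
    rewrite /shift; apply: le_trans (ler_normD _ _) _; apply: lerD.
      by rewrite -[N]mul1r; apply: mulle => //; rewrite normrN.
    rewrite -[N]mul1r; apply: mulle; last by rewrite normrN.
    by case: (true (+) k); rewrite ?normrN.
  have m3 : `|sympot d1 d2 true false w * z false k w| <= K * N.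
    by apply: mulle => //; apply: le_trans (hd1 w) (le_trans (Kw w) (Ku w)).
  have m4 : `|sympot d1 d2 true true w * z true k w| <= (K + (v + K)) * N.
    apply: mulle => //; apply: le_trans (ler_normD _ _) _; apply: lerD.
      by apply: le_trans (hd1 w) (le_trans (Kw w) (Ku w)).
    exact: le_trans (hd2 w) (vKu w).
  have m5 : `|b w * (y false k w + y true k w)| <= K * (2 * N).
    rewrite normrM; apply: ler_pM => //.
      by apply: le_trans (hb w) (le_trans (Kw w) (Ku w)).
    by apply: le_trans (ler_normD _ _) _; move: n1 n3; clear -A10 A20 A30 k00 gam0 gamA1 gamA2 gamA3 v0 K0 ha0 hc0 hd0 hb0 Cd0 h15 h26 hctrlA h37 hctrlC E0 E1; lra.
  apply: le_trans (ler_normB _ _) _.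
  apply: le_trans (lerD (ler_normB _ _) (lexx _)) _.
  apply: le_trans (lerD (lerD (ler_normB _ _) (lexx _)) (lexx _)) _.
  apply: le_trans (lerD (lerD (lerD (ler_normD _ _) (lexx _)) (lexx _)) (lexx _)) _.
  move: m1 m2 m3 m4 m5 => m1 m2 m3 m4 m5.
  apply: le_trans (lerD (lerD (lerD (lerD m1 m2) m3) m4) m5) _.
  by rewrite le_eqVlt; apply/orP; left; apply/eqP; ring.
(* The w-component has Lipschitz constant [L * N], so it stays above [N / 4] over this length after
   a point where it is at least [N / 2]. *)
pose ell := (4 * L)^-1.
have ell0 : 0 < ell by rewrite invr_gt0 mulr_gt0.
have hw u : x <= u <= x + ell -> N ^+ 2 / 16 <= z true k u ^+ 2.
  move=> /andP[xu ux].
  have h1 : `|z true k u - z true k x| <= L * N * (u - x).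
    by apply: (dv_lip xu (fun w _ => dZ true k w)).
  have h2 : L * N * (u - x) <= N / 4.
    have -> : N / 4 = L * N * ell by rewrite /ell; field; rewrite gt_eqF.
    by apply: ler_wpM2l; [nn|rewrite lerBlDl].
  have h3 : N / 4 <= `|z true k u|.
    have : `|z true k x| <= `|z true k u| + `|z true k u - z true k x|.
      by rewrite -[X in _ <= _ + X]normrN opprB; apply: le_trans (ler_normD _ _); rewrite addrC subrK.
    by move: hx h1 h2; clear -A10 A20 A30 k00 gam0 gamA1 gamA2 gamA3 v0 K0 ha0 hc0 hd0 hb0 Cd0 h15 h26 hctrlA h37 hctrlC E0 E1; lra.
  rewrite -(real_normK (num_real (z _ _ _))).
  have -> : N ^+ 2 / 16 = (N / 4) ^+ 2 by field.
  by rewrite lerXn2r ?nnegrE //; nn.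
(* Sum of the currents of the four components. Potentials and coupling cancel by symmetry, and the
   derivative is [rho] times the Krein density. *)
pose Z u := dy false false u * y false true u - y false false u * dy false true u
  + (dy true false u * y true true u - y true false u * dy true true u)
  + (dz false false u * z false true u - z false false u * dz false true u)
  + (dz true false u * z true true u - z true false u * dz true true u).
pose Sq (f : bool -> R -> R) u := f false u ^+ 2 + f true u ^+ 2.
have dZZ u : dv Z u (rho * (Sq (y false) u + Sq (z false) u - Sq (y true) u - Sq (z true) u)).
  have h1 := dY false false u; have h2 := dY false true u; have h3 := dY true false u; have h4 := dY true true u.
  have g1 := dZ false false u; have g2 := dZ false true u; have g3 := dZ true false u; have g4 := dZ true true u.
  have i1 := d2y false false u; have i2 := d2y false true u; have i3 := d2y true false u; have i4 := d2y true true u.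
  have j1 := d2z false false u; have j2 := d2z false true u; have j3 := d2z true false u; have j4 := d2z true true u.
  apply: dv_eq; first by rewrite /Z; dvt.
  by cbv beta; rewrite /Sq /lin /shift /sympot /=; ring.
(* [T] is the derivative of |p|^2 + |r|^2. Its own derivative contains 2 (A1 + t) |p|^2 + 2 (A2 + t)
   |r|^2, which pays for the positive part of the Krein density. *)
pose T u := 2 * (y false false u * dy false false u + y false true u * dy false true u
   + (z false false u * dz false false u + z false true u * dz false true u)).
pose ep k u := - (sympot a c false false u * y false k u + sympot a c false true u * y true k u
   + b u * z false k u + b u * z true k u).
pose er k u := - (sympot d1 d2 false false u * z false k u + sympot d1 d2 false true u * z true k u
   + b u * y false k u + b u * y true k u).
pose T1 u := 2 * (Sq (dy false) u + Sq (dz false) u)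
  + 2 * ((A1 + t) * Sq (y false) u + (A2 + t) * Sq (z false) u)
  + 2 * (y false false u * ep false u + y false true u * ep true u
   + (z false false u * er false u + z false true u * er true u)).
have dT u : dv T u (T1 u).
  have h1 := dY false false u; have h2 := dY false true u.
  have g1 := dZ false false u; have g2 := dZ false true u.
  have i1 := d2y false false u; have i2 := d2y false true u.
  have j1 := d2z false false u; have j2 := d2z false true u.
  apply: dv_eq; first by rewrite /T; dvt.
  by cbv beta; rewrite /T1 /Sq /ep /er /lin /shift /=; ring.
have CeN0 : 0 <= C * eps * N by nn.
have hep j u : `|ep j u| <= H * (eps * N) * E u.
  have [n1 n2] := hN false j u; have [n3 n4] := hN true j u.
  have [s1 s2] := hs false j u; have [s3 _] := hs true j u.
  have m1 := prod_le (E0 u) (sympot_le false false vKp (ha u) (hc u)) s1.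
  have m2 := prod_le (E0 u) (sympot_le false true vKp (ha u) (hc u)) s3.
  have m3 := prod_le (E0 u) (hb u) n2.
  have m4 := prod_le (E0 u) (hb u) n4.
  rewrite /ep normrN; apply: le_trans (ler_normD _ _) _.
  apply: le_trans (lerD (ler_normD _ _) (lexx _)) _.
  apply: le_trans (lerD (lerD (ler_normD _ _) (lexx _)) (lexx _)) _.
  apply: le_trans (lerD (lerD (lerD m1 m2) m3) m4) _.
  rewrite -subr_ge0 hH.
  set d := _ - _; have -> : d = (2 * (v + K) * C + 4 * K) * (eps * N) * E u by rewrite /d; ring.
  by nn.
have her j u : `|er j u| <= H * (eps * N) * E u.
  have [n1 n2] := hN false j u; have [n3 n4] := hN true j u.
  have [s1 s2] := hs false j u.
  have hd1' : `|d1 u| <= (v + K) * E u.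
    apply: le_trans (hd1 u) (le_trans (Kw u) _); apply: ler_wpM2r => //; by rewrite lerDr.
  have m1 := prod_le (E0 u) (sympot_le false false vKp hd1' (hd2 u)) s2.
  have m2 := prod_le (E0 u) (hd1 u) n4.
  have m3 := prod_le (E0 u) (hb u) n1.
  have m4 := prod_le (E0 u) (hb u) n3.
  rewrite /er normrN; apply: le_trans (ler_normD _ _) _.
  apply: le_trans (lerD (ler_normD _ _) (lexx _)) _.
  apply: le_trans (lerD (lerD (ler_normD _ _) (lexx _)) (lexx _)) _.
  apply: le_trans (lerD (lerD (lerD m1 m2) m3) m4) _.
  rewrite -subr_ge0 hH.
  set d := _ - _; have -> : d = (4 * (v + K) * C + 3 * K) * (eps * N) * E u by rewrite /d; ring.
  by nn.
have prodge (f g F G : R) : `|f| <= F -> `|g| <= G -> - (F * G) <= f * g.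
  by move=> h1 h2; apply: lerNnormlW; rewrite normrM; exact: ler_pM.
have hT1 u : 2 * kap * z true k u ^+ 2 - Q * (eps ^+ 2 * N ^+ 2) * E u
   <= T1 u - 2 * kap * (Sq (y false) u + Sq (z false) u - Sq (y true) u - Sq (z true) u).
  have [a1 a2] := hs false false u; have [a3 a4] := hs false true u.
  have b1 := prodge _ _ _ _ a1 (hep false u); have b2 := prodge _ _ _ _ a3 (hep true u).
  have b3 := prodge _ _ _ _ a2 (her false u); have b4 := prodge _ _ _ _ a4 (her true u).
  have S0 (f : bool -> R -> R) : 0 <= Sq f u by rewrite /Sq; nn.
  have kz : kap * z true k u ^+ 2 <= kap * Sq (z true) u.
    by apply: ler_wpM2l; [exact: ltW|]; rewrite /Sq; case: (k); rewrite ?lerDl ?lerDr sqr_ge0.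
  have tk : - kap <= t by move: (le_trans ht l2); rewrite ler_norml => /andP[].
  have c1 : 0 <= (A1 + t - kap) * Sq (y false) u by apply: mulr_ge0 => //; move: tk kA1; clear -A10 A20 A30 k00 gam0 gamA1 gamA2 gamA3 v0 K0 ha0 hc0 hd0 hb0 Cd0 h15 h26 hctrlA h37 hctrlC E0 E1; lra.
  have c2 : 0 <= (A2 + t - kap) * Sq (z false) u by apply: mulr_ge0 => //; move: tk kA2; clear -A10 A20 A30 k00 gam0 gamA1 gamA2 gamA3 v0 K0 ha0 hc0 hd0 hb0 Cd0 h15 h26 hctrlA h37 hctrlC E0 E1; lra.
  have c3 : 0 <= kap * Sq (y true) u by apply: mulr_ge0 => //; exact: ltW.
  have c4 := S0 (dy false); have c5 := S0 (dz false).
  have -> : Q * (eps ^+ 2 * N ^+ 2) * E u = 8 * (C * eps * N * (H * (eps * N) * E u)) by rewrite hQ; ring.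
  move: b1 b2 b3 b4 kz c1 c2 c3 c4 c5; rewrite /T1.
  set B := C * eps * N * _; set f1 := y false false u * _; set f2 := y false true u * _.
  set f3 := z false false u * _; set f4 := z false true u * _.
  set q1 := Sq (y false) u; set q2 := Sq (y true) u; set q3 := Sq (z false) u; set q4 := Sq (z true) u.
  set q5 := Sq (dy false) u; set q6 := Sq (dz false) u; set q7 := z true k u ^+ 2.
  clear -A10 A20 A30 k00 gam0 gamA1 gamA2 gamA3 v0 K0 ha0 hc0 hd0 hb0 Cd0 h15 h26 hctrlA h37 hctrlC E0 E1; lra.
pose QM := Q * (eps ^+ 2 * N ^+ 2) * M.
(* Dividing by [rho] is harmless, as the derivative of [Z] carries the same factor: the bounds are
   uniform as [rho] tends to 0. This quantity vanishes at both ends, yet up to the [atan] correction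
   it increases at rate at least [2 * kap * z true k u ^+ 2]. *)
pose X0 u := T u - 2 * kap / rho * Z u.
pose Xi u := X0 u + QM * atan u.
have dXi u : dv Xi u (T1 u - 2 * kap / rho * (rho * (Sq (y false) u + Sq (z false) u - Sq (y true) u - Sq (z true) u))
    + QM * (1 + u ^+ 2)^-1).
  have h1 := dT u; have h2 := dZZ u; have h3 := dv_atan (dv_id u).
  by apply: dv_eq; [rewrite /Xi /X0; dvt|cbv beta; rewrite mulr1; ring].
have hXi u : 2 * kap * z true k u ^+ 2 <= T1 u - 2 * kap / rho * (rho * (Sq (y false) u + Sq (z false) u - Sq (y true) u - Sq (z true) u))
    + QM * (1 + u ^+ 2)^-1.
  rewrite [2 * kap / rho * _]mulrA [2 * kap / rho * rho]divfK ?gt_eqF //.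
  have := hT1 u; have h : Q * (eps ^+ 2 * N ^+ 2) * E u <= QM * (1 + u ^+ 2)^-1.
    by rewrite /QM -[leRHS]mulrA; apply: ler_wpM2l; [nn|exact: HM].
  set q1 := T1 u - _; move: h; set q2 := Q * _ * E u; set q3 := QM * _; set q4 := 2 * kap * _.
  by clear -A10 A20 A30 k00 gam0 gamA1 gamA2 gamA3 v0 K0 ha0 hc0 hd0 hb0 Cd0 h15 h26 hctrlA h37 hctrlC E0 E1; lra.
have Xi0 u : 0 <= T1 u - 2 * kap / rho * (rho * (Sq (y false) u + Sq (z false) u - Sq (y true) u - Sq (z true) u))
    + QM * (1 + u ^+ 2)^-1.
  by apply: le_trans (hXi u); nn.
have vX0 : vanish2 X0.
  have vy i j : vanish2 (y i j) by case: (vv i j).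
  have vdy i j : vanish2 (dy i j) by case: (vv i j).
  have vz i j : vanish2 (z i j) by case: (vv i j).
  have vdz i j : vanish2 (dz i j) by case: (vv i j).
  have vN f : vanish2 f -> vanish2 (fun x => - f x) by move=> [? ?]; split; exact: vanishN.
  apply: vanish2D.
    by apply: vanish2Z; apply: vanish2D; apply: vanish2D; exact: vanish2M.
  apply: (vN); apply: vanish2Z.
  have vB (f1 f2 f3 f4 : R -> R) : vanish2 f1 -> vanish2 f2 -> vanish2 f3 -> vanish2 f4 ->
      vanish2 (fun x => f1 x * f2 x - f3 x * f4 x).
    by move=> ? ? ? ?; apply: vanish2D; [|apply: (vN)]; exact: vanish2M.
  rewrite /Z; apply: vanish2D; last exact: vB.
  by apply: vanish2D; last exact: vB; apply: vanish2D; exact: vB.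
have eta0 : 0 < gain * N ^+ 2 / 16 by rewrite divr_gt0 // mulr_gt0 // exprn_gt0.
have [Xa hXa] := vX0.1 _ eta0; have [Xb hXb] := vX0.2 _ eta0.
pose X := Num.max (Num.max Xa Xb) (Num.max (- x) (x + ell)).
have [Xa' Xb' X1 X2] : [/\ Xa <= X, Xb <= X, - X <= x & x + ell <= X].
  rewrite lerNl /X !le_max !lexx !orbT; split=> //.
have q1 : Xi (- X) <= Xi x by apply: (dv_mono X1 (fun u _ => dXi u)).
have q2 : Xi (x + ell) <= Xi X by apply: (dv_mono X2 (fun u _ => dXi u)).
have q3 : Xi x + 2 * kap * (N ^+ 2 / 16) * (x + ell - x) <= Xi (x + ell).
  apply: (dv_gain _ (fun u _ => dXi u)); first by rewrite lerDl ltW.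
  move=> u hu; apply: le_trans (hXi u); apply: ler_wpM2l; [nn|exact: hw].
have e3 : 2 * kap * (N ^+ 2 / 16) * (x + ell - x) = gain * N ^+ 2.
  by rewrite hgain /ell; ring.
have q4 := hXa _ Xa'; have q5 := hXb _ Xb'.
have pi4 : `|atan X| <= 2 /\ `|atan (- X)| <= 2.
  have h u : `|atan u| <= 2.
    exact: norm_atan_le2.
  by split.
have [p1 p2] := pi4.
have QMle : 4 * QM <= gain * N ^+ 2 / 2.
  have -> : 4 * QM = 4 * (Q * M * eps) * eps * N ^+ 2 by rewrite /QM; ring.
  have -> : gain * N ^+ 2 / 2 = gain / 2 * N ^+ 2 by ring.
  apply: ler_wpM2r; first nn.
  apply: le_trans (_ : 4 * (Q * M * e0) * 1 <= _); last by rewrite mulr1.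
  apply: ler_pM; [nn|nn| |exact: le_trans heps e01].
  by apply: ler_wpM2l => //; exact: ler_wpM2l.
have QM0' : 0 <= QM by rewrite /QM; nn.
have q6 : QM * (atan X - atan (- X)) <= 4 * QM.
  rewrite mulrC; apply: ler_wpM2r => //.
  have := ler_norm (atan X); have := ler_norm (- atan (- X)); rewrite normrN; move: p1 p2; clear -A10 A20 A30 k00 gam0 gamA1 gamA2 gamA3 v0 K0 ha0 hc0 hd0 hb0 Cd0 h15 h26 hctrlA h37 hctrlC E0 E1; lra.
have g0 : 0 < gain * N ^+ 2 by rewrite mulr_gt0 // exprn_gt0.
move: q3; rewrite e3 => q3.
exact: (gain_absurd g0 q1 q2 q3 q4 q5 q6 QMle).
Qed.

End Perturb.
End Eigen.

(** * Radiation *)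

Section RealEigen.
Variable R : realType.
Implicit Types y dy z dz S dS : bool -> bool -> R -> R.

Variables (A1 A2 A3 k0 gam v K : R) (a0 c0 d0 b0 : R -> R).
Hypotheses (A10 : 0 < A1) (A20 : 0 < A2) (A30 : 0 < A3) (k00 : 0 < k0) (gam0 : 0 < gam)
  (gamA1 : 8 * gam ^+ 2 <= A1) (gamA2 : 8 * gam ^+ 2 <= A2) (gamA3 : 8 * gam ^+ 2 <= A3)
  (v0 : 0 <= v) (K0 : 0 <= K)
  (ha0 : forall x, `|a0 x| <= v * expR (- (gam * `|x|)))
  (hc0 : forall x, `|c0 x| <= v * expR (- (gam * `|x|)))
  (hd0 : forall x, `|d0 x| <= v * expR (- (gam * `|x|)))
  (hb0 : forall x, `|b0 x| <= v * expR (- (gam * `|x|))).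
Variables (W dW : R -> R).
Hypotheses (dvW : forall x, dv W x (dW x)) (dvdW : forall x, dv dW x (A3 * W x - d0 x * W x))
  (vW : vanish2 W) (vdW : vanish2 dW) (W0 : W 0 ^+ 2 + dW 0 ^+ 2 != 0).

Let E (x : R) := expR (- (gam * `|x|)).
Let E0 x : 0 <= E x. Proof. exact: expR_ge0. Qed.
Let E1 x : E x <= 1.
Proof. by rewrite /E -expR0 ler_expR oppr_le0 mulr_ge0 // ltW. Qed.

Definition real_fam y := forall i x, y i true x = 0.

Definition padw (u : R -> R) (i k : bool) (x : R) := if i || k then 0 else u x.

Lemma scalpot_le i j x : `|scalpot d0 i j x| <= v * expR (- (gam * `|x|)).
Proof. by rewrite /scalpot; case: ifP => // _; rewrite normr0 mulr_ge0. Qed.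

Lemma vanish2_0 : vanish2 (fun=> 0 : R).
Proof. by split=> e e0; exists 0 => x _; rewrite normr0 ltW. Qed.

Lemma refsol_w : refsol A3 k0 (scalpot d0) (padw W) (padw dW).
Proof.
split=> -[] [] x; try exact: dv_cst; try exact: dvW;
  (apply: dv_eq; [first [exact: dv_cst | exact: dvdW]|rewrite /lin /scalpot /padw /=; ring]).
Qed.

Lemma outgoing_w : outgoing k0 (padw W) (padw dW).
Proof.
have [KW KW0 hW] := vanish2_bounded dvW vW.1 vW.2.
split.
- exists KW => // i k x _; rewrite /padw; case: ifP => // _; by rewrite normr0.
- by case; [exact: vanish2_0.1|exact: vW.1].
- by case; [exact: vanish2_0.1|exact: vdW.1].
- rewrite (_ : (fun _ => _) = fun=> 0); first exact: vanish2_0.1.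
  by apply/funext => x; rewrite /padw /=; ring.
- rewrite (_ : (fun _ => _) = fun=> 0); first exact: vanish2_0.1.
  by apply/funext => x; rewrite /padw /=; ring.
Qed.

Definition ddw (t : R) (d1 d2 b : R -> R) y z x := A3 * z true false x + shift t 0 z true false x
         - sympot d1 d2 true false x * z false false x - sympot d1 d2 true true x * z true false x
         - b x * (y false false x + y true false x).

Lemma w_error t eps sg a c b d1 d2 y dy z dz N : 0 <= eps -> 0 <= N ->
  close_pot gam K eps sg a0 c0 d0 b0 a c b d1 d2 ->
  eigen A1 A2 A3 k0 t 0 a c b d1 d2 y dy z dz ->
  (forall i k x, `|y i k x| <= N /\ `|z i k x| <= N) ->
  forall x, `|ddw t d1 d2 b y z x - ((A3 - d0 x) * z true false x - t * z true false x)| <= 5 * K * eps * N * E x.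
Proof.
move=> eps0 N0 hcl he hN x.
have [_ _ [h1 h2] h4 _] := hcl x.
have [n1 n2] := hN false false x; have [n3 n4] := hN true false x.
have -> : ddw t d1 d2 b y z x - ((A3 - d0 x) * z true false x - t * z true false x)
   = - (d1 x * z false false x + d1 x * z true false x + (d2 x - d0 x) * z true false x
      + b x * y false false x + b x * y true false x).
  by rewrite /ddw /shift /sympot /=; ring.
rewrite normrN.
have m1 := prod_le (E0 x) h1 n2; have m2 := prod_le (E0 x) h1 n4.
have m3 := prod_le (E0 x) h2 n4; have m4 := prod_le (E0 x) h4 n1.
have m5 := prod_le (E0 x) h4 n3.
have -> : 5 * K * eps * N * E x = K * eps * N * E x + K * eps * N * E x
    + K * eps * N * E x + K * eps * N * E x + K * eps * N * E x by ring.
by do 4 (apply: le_trans (ler_normD _ _) _; apply: lerD => //).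
Qed.

(** w is the second of its pair but is stored here as a first component, where the shift has the
    opposite sign; hence [- t]. *)
Lemma w_forced t eps sg a c b d1 d2 y dy z dz N : 0 <= eps -> 0 <= N ->
  close_pot gam K eps sg a0 c0 d0 b0 a c b d1 d2 ->
  eigen A1 A2 A3 k0 t 0 a c b d1 d2 y dy z dz ->
  (forall i k x, `|y i k x| <= N /\ `|z i k x| <= N) ->
  forced A3 k0 gam (scalpot d0) (- t) 0 (5 * K * eps * N) (padw (z true false)) (padw (dz true false))
    (padw (ddw t d1 d2 b y z)).
Proof.
move=> eps0 N0 hcl he hN; have hw := w_error eps0 N0 hcl he hN.
case: he => dd _ d2z vv; split.
- by case; case=> x; try exact: dv_cst; case: (dd true false x).
- by case; case=> x; try exact: dv_cst; exact: (d2z true false x).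
- have triv x : 0 <= x -> 0 <= 5 * K * eps * N * expR (- (gam * x)) by move=> _; nn.
  have zero (m x : R) : 0 <= x -> m = 0 -> `|m| <= 5 * K * eps * N * expR (- (gam * x)).
    by move=> x0 ->; rewrite normr0; exact: triv.
  case; case=> x x0; try (apply: (zero _ _ x0); rewrite /padw /lin /shift /scalpot /=; ring).
  have := hw x; rewrite /E (ger0_norm x0); congr (`|_| <= _).
  by rewrite /padw /lin /shift /scalpot /=; ring.
- by case; case; try exact: vanish2_0.1; case: (vv true false) => _ _ [].
- by case; case; try exact: vanish2_0.1; case: (vv true false) => _ _ _ [].
Qed.

Let hVr i j x : 0 <= x -> `|scalpot d0 i j x| <= v * expR (- (gam * x)).
Proof. by move=> x0; have := scalpot_le i j x; rewrite (ger0_norm x0). Qed.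
Let hVl i j x : 0 <= x -> `|refl (scalpot d0) i j x| <= v * expR (- (gam * x)).
Proof. by move=> x0; have := scalpot_le i j (- x); rewrite normrN (ger0_norm x0). Qed.

(** Both w and [W] decay to the right, so their Wronskian at 0 is small and their Cauchy data are
    nearly parallel. Projection gives [cc], and Gronwall carries the small remainder over
    [[- X, X]]. *)
Lemma w_close X th : 0 <= X -> 0 < th -> exists2 e0, 0 < e0 <= 1 &
  forall t eps sg a c b d1 d2 y dy z dz N, `|t| <= e0 -> 0 <= eps <= e0 -> 0 <= N ->
  close_pot gam K eps sg a0 c0 d0 b0 a c b d1 d2 ->
  eigen A1 A2 A3 k0 t 0 a c b d1 d2 y dy z dz -> 
  (forall i k x, `|y i k x| <= N /\ `|z i k x| <= N) ->
  exists cc, forall x, `|x| <= X -> `|z true false x - cc * W x| <= th * N.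
Proof.
move=> X0 th0.
have [Dr Dr1 Hr] := @growth_bound R A3 k0 gam v _ A30 gam0 v0 hVr X.
have [Dl Dl1 Hl] := @growth_bound R A3 k0 gam v _ A30 gam0 v0 hVl X.
pose D0 := W 0 ^+ 2 + dW 0 ^+ 2.
have D00 : 0 < D0 by rewrite lt_neqAle eq_sym W0 addr_ge0 // sqr_ge0.
pose al := (`|W 0| + `|dW 0|) / D0.
have al0 : 0 <= al by rewrite /al; nn.
pose DD := Dr + Dl.
have DD1 : 1 <= DD by rewrite /DD; lra.
have DD0 : 0 < DD by lra.
pose th1 := th / (6 * DD * (al + 1)).
have th10 : 0 < th1 by rewrite /th1; pp.
have sC x : scalpot d0 true false x = scalpot d0 false true x by [].
have [thr /andP[thr0 thr1] [C C0 HP]] := pairing_small A30 k00 gam0 v0 hVr sC refsol_w outgoing_w th10.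
pose B := DD * (15 * al * C * K + 10 * K + 2).
have B0 : 0 <= B by rewrite /B; nn.
pose e0 := Num.min thr (th / (2 * (B + 1))).
have e00 : 0 < e0 by rewrite lt_min thr0 /=; pp.
have e0thr : e0 <= thr by rewrite ge_min lexx.
have e0B : 2 * B * e0 <= th.
  apply: le_trans (_ : 2 * (B + 1) * e0 <= _).
    by apply: ler_wpM2r; [exact: ltW|lra].
  by rewrite mulrC -ler_pdivlMr ?mulr_gt0 ?ltr_wpDl // ge_min lexx orbT.
have e0_1 : e0 <= 1 by exact: le_trans thr1.
have eqth1 : 6 * DD * (al * th1) <= th.
  rewrite /th1; have -> : 6 * DD * (al * (th / (6 * DD * (al + 1)))) = th * (al / (al + 1)).
    by field; rewrite !gt_eqF //= ltr_wpDl.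
  by apply: ler_piMr; [exact: ltW|rewrite ler_pdivrMr ?ltr_wpDl // mul1r lerDl].
exists e0; first by rewrite e00.
clearbody e0 th1.
move=> t eps sg a c b d1 d2 y dy z dz N ht /andP[eps0 heps] N0 hcl he hN.
have F := w_forced eps0 N0 hcl he hN.
have P0 : 0 <= 5 * K * eps * N by nn.
have hw := w_error eps0 N0 hcl he hN.
have hNw i k x : 0 <= x -> `|padw (z true false) i k x| <= N.
  by move=> _; rewrite /padw; case: ifP => _; [rewrite normr0|case: (hN true false x)].
have [hcr _] : `|wron_re (padw W) (padw dW) (padw (z true false)) (padw (dz true false)) 0| <= th1 * N + C * (5 * K * eps * N) /\
   `|wron_im (padw W) (padw dW) (padw (z true false)) (padw (dz true false)) 0| <= th1 * N + C * (5 * K * eps * N).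
  apply: (HP _ _ _ _ _ _ _ _ _ P0 F hNw); last by rewrite lexx ltW.
  by rewrite normrN; exact: le_trans e0thr.
set w := z true false in F hNw hcr hw *; set dw := dz true false in F hcr *.
pose cr := dW 0 * w 0 - W 0 * dw 0.
have {}hcr : `|cr| <= th1 * N + C * (5 * K * eps * N).
  suff -> : cr = wron_re (padw W) (padw dW) (padw w) (padw dw) 0 by [].
  by rewrite /cr /wron_re /wron /padw /=; ring.
(* Orthogonal projection of the data of w on those of [W]; the remaining data are [dW 0] and [- W 0]
   times [cr / D0]. *)
pose cc := (w 0 * W 0 + dw 0 * dW 0) / D0.
exists cc.
pose zz x := w x - cc * W x; pose dzz x := dw x - cc * dW x.
pose ddzz x := ddw t d1 d2 b y z x - cc * (A3 * W x - d0 x * W x).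
have D0n : D0 != 0 by rewrite gt_eqF.
pose d := al * (th1 * N + C * (5 * K * eps * N)).
have bd0 : 0 <= th1 * N + C * (5 * K * eps * N) by have := ltW th10; move=> ?; nn.
have d00 : 0 <= d by rewrite /d; nn.
have alW m : `|m| <= `|W 0| + `|dW 0| -> `|m * cr / D0| <= d.
  move=> hm; have -> : m * cr / D0 = m / D0 * cr by ring.
  rewrite normrM; apply: ler_pM => //.
  by rewrite normrM normfV (gtr0_norm D00); apply: ler_wpM2r => //; rewrite invr_ge0 ltW.
have zz0 : `|zz 0| <= d.
  have -> : zz 0 = dW 0 * cr / D0 by rewrite /zz /cc /cr /D0; field; rewrite -?expr2; exact: W0.
  by apply: alW; rewrite lerDr.
have dzz0 : `|dzz 0| <= d.
  have -> : dzz 0 = - W 0 * cr / D0 by rewrite /dzz /cc /cr /D0; field; rewrite -?expr2; exact: W0.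
  by apply: alW; rewrite normrN lerDl.
pose G := (`|t| + 5 * K * eps) * N.
have G0 : 0 <= G by rewrite /G; nn.
have [dd _ d2z vv] := he.
have dvzz x : dv zz x (dzz x).
  have h1 := dvW x; have h2 : dv w x (dw x) by case: (dd true false x).
  by apply: dv_eq; [rewrite /zz; dvt|rewrite /dzz; rng].
have dvdzz x : dv dzz x (ddzz x).
  have h1 := dvdW x; have h2 := d2z true false x.
  by apply: dv_eq; [rewrite /dzz; dvt|rewrite /ddzz /ddw; rng].
have err x : `|ddzz x - (A3 * zz x - d0 x * zz x)| <= G.
  have -> : ddzz x - (A3 * zz x - d0 x * zz x) = 
    (ddw t d1 d2 b y z x - ((A3 - d0 x) * w x - t * w x)) - t * w x.
    by rewrite /ddzz /zz; ring.
  apply: le_trans (ler_normB _ _) _; have -> : G = 5 * K * eps * N + `|t| * N by (rewrite /G; ring). apply: lerD; last first.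
    by rewrite normrM; apply: ler_wpM2l => //; case: (hN true false x).
  by apply: le_trans (hw x) _; apply: ler_piMr.
have bound : DD * (3 * d + 2 * G) <= th * N.
  apply: le_trans (_ : (6 * DD * (al * th1)) / 2 * N + (2 * B * e0) / 2 * N <= _); last first.
    by rewrite -mulrDl; apply: ler_wpM2r => //; move: eqth1 e0B; clear -A10 A20 A30 k00 gam0 gamA1 gamA2 gamA3 v0 K0 ha0 hc0 hd0 hb0 dvW dvdW vW vdW W0 E0 E1 hVr hVl; lra.
  rewrite /d /G /B.
  have h1 : DD * N * 15 * al * C * K * eps <= DD * N * 15 * al * C * K * e0 by apply: ler_wpM2l => //; nn.
  have h2 : DD * N * 10 * K * eps <= DD * N * 10 * K * e0 by apply: ler_wpM2l => //; nn.
  have h3 : DD * N * 2 * `|t| <= DD * N * 2 * e0 by apply: ler_wpM2l => //; nn.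
  by move: h1 h2 h3; clear -A10 A20 A30 k00 gam0 gamA1 gamA2 gamA3 v0 K0 ha0 hc0 hd0 hb0 dvW dvdW vW vdW W0 E0 E1 hVr hVl; lra.
have nn1 : 0 <= 3 * d + 2 * G by nn.
have zero (m : R) : m = 0 -> `|m| <= G by move=> ->; rewrite normr0.
move=> x hx; apply: le_trans bound.
have [x0|x0] := leP 0 x.
  have [] := Hr (padw zz) (padw dzz) (padw ddzz) d G d00 G0 _ _ _ _ _ false false x.
  - by case; case=> u; try exact: dv_cst; exact: dvzz.
  - by case; case=> u; try exact: dv_cst; exact: dvdzz.
  - case; case=> u _; try (apply: zero; rewrite /padw /lin /scalpot /=; ring).
    by have := err u; congr (`|_| <= _); rewrite /padw /lin /scalpot /=; ring.
  - by move=> i k; rewrite /padw; case: ifP => _ //; rewrite normr0.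
  - by move=> i k; rewrite /padw; case: ifP => _ //; rewrite normr0.
  - by rewrite x0 /=; apply: le_trans hx; exact: ler_norm.
  - move=> h _; apply: le_trans h _; apply: ler_wpM2r => //; rewrite /DD; move: Dl1 Dr1; clear -A10 A20 A30 k00 gam0 gamA1 gamA2 gamA3 v0 K0 ha0 hc0 hd0 hb0 dvW dvdW vW vdW W0 E0 E1 hVr hVl; lra.
have [] := Hl (refl (padw zz)) (reflN (padw dzz)) (refl (padw ddzz)) d G d00 G0 _ _ _ _ _ false false (- x).
- by case; case=> u; apply: dv_refl; try exact: dv_cst; exact: dvzz.
- case; case=> u; apply: dv_eq; try (apply: dvN; apply: dv_refl; first [exact: dv_cst|exact: dvdzz]);
    by rewrite /refl /padw /= ?oppr0 ?opprK.
- case; case=> u _; try (apply: zero; rewrite /refl /padw /lin /scalpot /=; ring).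
  by have := err (- u); congr (`|_| <= _); rewrite /refl /padw /lin /scalpot /=; ring.
- by move=> i k; rewrite /refl oppr0 /padw; case: ifP => _ //; rewrite normr0.
- by move=> i k; rewrite /reflN oppr0 normrN /padw; case: ifP => _ //; rewrite normr0.
- by rewrite oppr_ge0 (ltW x0) /=; apply: le_trans hx; rewrite -normrN; exact: ler_norm.
- rewrite /refl opprK => h _; apply: le_trans h _; apply: ler_wpM2r => //; rewrite /DD; move: Dl1 Dr1; clear -A10 A20 A30 k00 gam0 gamA1 gamA2 gamA3 v0 K0 ha0 hc0 hd0 hb0 dvW dvdW vW vdW W0 E0 E1 hVr hVl; lra.
Qed.

End RealEigen.

Section LinearFacts.
Variable R : realType.
Implicit Types a b c d m : R.

Lemma half_le_quarter m : 0 < m -> m / 2 <= m / 4 -> False. Proof. lra. Qed.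
Lemma half_le0 m : 0 < m -> m / 2 <= 0 -> False. Proof. lra. Qed.
Lemma mul8_le3 m : 0 < m -> 8 * m <= 3 * m -> False. Proof. lra. Qed.
Lemma sixteenth_le m a b c d : a <= m -> m <= 16^-1 * c -> d <= a + b -> c / 8 <= d -> c / 16 <= b.
Proof. lra. Qed.
Lemma ler_add3 m a b c : a <= m -> b <= m -> c <= m -> a + b + c <= 3 * m. Proof. lra. Qed.
Lemma ler_add2 m a b : a <= m -> b <= m -> a + b <= 2 * m. Proof. lra. Qed.
Lemma half_ler a b m : a <= m / 2 -> m <= b + a -> m / 2 <= b. Proof. lra. Qed.
Lemma ler_add12 a b c m d : a <= m -> b <= d -> c <= d -> a + b + c <= m + 2 * d. Proof. lra. Qed.

End LinearFacts.

Section RealEigen2.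
Variable R : realType.
Implicit Types y dy z dz S dS : bool -> bool -> R -> R.

Variables (A1 A2 A3 k0 gam v K : R) (a0 c0 d0 b0 : R -> R).
Hypotheses (A10 : 0 < A1) (A20 : 0 < A2) (A30 : 0 < A3) (k00 : 0 < k0) (gam0 : 0 < gam)
  (gamA1 : 8 * gam ^+ 2 <= A1) (gamA2 : 8 * gam ^+ 2 <= A2) (gamA3 : 8 * gam ^+ 2 <= A3)
  (v0 : 0 <= v) (K0 : 0 <= K)
  (ha0 : forall x, `|a0 x| <= v * expR (- (gam * `|x|)))
  (hc0 : forall x, `|c0 x| <= v * expR (- (gam * `|x|)))
  (hd0 : forall x, `|d0 x| <= v * expR (- (gam * `|x|)))
  (hb0 : forall x, `|b0 x| <= v * expR (- (gam * `|x|))).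

Let E (x : R) := expR (- (gam * `|x|)).
Let E0 x : 0 <= E x. Proof. exact: expR_ge0. Qed.
Let E1 x : E x <= 1.
Proof. by rewrite /E -expR0 ler_expR oppr_le0 mulr_ge0 // ltW. Qed.

(** If w stayed below [N / 8] on [[- X1, X1]], the hyperbolic estimate would keep it below
    [3 / 8 * N] outside, against a value of at least [N / 2]. As [X1] is fixed in advance, the mass
    of w cannot escape to infinity as eps tends to 0. *)
Lemma w_core : exists2 X1, 0 <= X1 & exists2 e0, 0 < e0 <= 1 &
  forall t eps sg a c b d1 d2 y dy z dz N, `|t| <= e0 -> 0 <= eps <= e0 -> 0 < N ->
  close_pot gam K eps sg a0 c0 d0 b0 a c b d1 d2 ->
  eigen A1 A2 A3 k0 t 0 a c b d1 d2 y dy z dz -> 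
  (forall i k x, `|y i k x| <= N /\ `|z i k x| <= N) ->
  (exists x, N / 2 <= `|z true false x|) -> exists2 x, `|x| <= X1 & N / 8 <= `|z true false x|.
Proof.
have A3h : 0 < A3 / 2 by rewrite divr_gt0.
pose m := 6 * (v + 5 * K) / A3.
have m0 : 0 <= m by rewrite /m; nn.
have mp : 0 < (8 * (m + 1))^-1 by pp.
have [X1 X10 hX1] : exists2 X, 0 <= X & expR (- (gam * X)) <= (8 * (m + 1))^-1.
  have [X hX] := vanish_expR gam0 mp.
  exists (Num.max 0 X); first by rewrite le_max lexx.
  by rewrite -[expR _]ger0_norm ?expR_ge0 //; apply: hX; rewrite le_max lexx orbT.
have mX : m * expR (- (gam * X1)) <= 8^-1.
  apply: le_trans (ler_wpM2l m0 hX1) _; rewrite ler_pdivrMr; last by pp.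
  by rewrite mulrA mulVf ?mul1r ?lerDl // pnatr_eq0.
exists X1 => //.
pose e0 := Num.min 1 (A3 / 2).
have e00 : 0 < e0 by rewrite lt_min ltr01.
have e01 : e0 <= 1 by rewrite ge_min lexx.
have e0A : e0 <= A3 / 2 by rewrite ge_min lexx orbT.
exists e0; first by rewrite e00.
clearbody e0.
move=> t eps sg a c b d1 d2 y dy z dz N ht /andP[eps0 heps] N0 hcl he hN [x hx].
have Nn := ltW N0.
have hw := w_error eps0 Nn hcl he hN.
have [//|nex] := pselect (exists2 x, `|x| <= X1 & N / 8 <= `|z true false x|); exfalso.
have small u : `|u| <= X1 -> `|z true false u| <= N / 8.
  move=> hu; rewrite leNgt; apply/negP => h; apply: nex; exists u => //; exact: ltW.
have [dd _ d2z vv] := he.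
have [_ _ vz vdz] := vv true false.
have eps1 : eps <= 1 by exact: le_trans heps e01.
pose H := (v + 5 * K) * N * expR (- (gam * X1)).
have H0 : 0 <= H by rewrite /H; nn.
have tA : A3 / 2 <= A3 - t by have := le_trans (ler_norm t) (le_trans ht e0A); lra.
have gA : 4 * gam ^+ 2 <= A3 / 2 by have := gamA3; lra.
have N8 : 0 <= N / 8 by nn.
have err u : X1 <= `|u| -> `|ddw A3 t d1 d2 b y z u - (A3 - t) * z true false u| <= H * expR (- (gam * (`|u| - X1))).
  move=> hu.
  have -> : H * expR (- (gam * (`|u| - X1))) = v * N * E u + 5 * K * N * E u.
    rewrite /H -mulrA -expRD; have -> : - (gam * X1) + - (gam * (`|u| - X1)) = - (gam * `|u|) by ring.
    by rewrite -/(E u); ring.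
  have -> : ddw A3 t d1 d2 b y z u - (A3 - t) * z true false u =
    - (d0 u * z true false u) + (ddw A3 t d1 d2 b y z u - ((A3 - d0 u) * z true false u - t * z true false u)) by ring.
  apply: le_trans (ler_normD _ _) _; apply: lerD.
    rewrite normrN normrM mulrAC; apply: ler_pM => //; by case: (hN true false u).
  apply: le_trans (hw u) _; rewrite -/(E u); apply: ler_wpM2r => //; apply: ler_wpM2r => //.
  by apply: ler_piMr => //; nn.
have concl : 2 * (N / 8) + 3 * H / (A3 / 2) <= 3 / 8 * N.
  have -> : 3 * H / (A3 / 2) = m * expR (- (gam * X1)) * N.
    by rewrite /H /m; field; rewrite gt_eqF.
  have := ler_wpM2r Nn mX; lra.
have tail (s : R) : X1 <= s -> expR (- (gam * (s - X1))) <= 1.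
  by move=> h; rewrite -expR0 ler_expR oppr_le0 mulr_ge0 ?(ltW gam0) // subr_ge0.
have fin (s r : R) : X1 <= s -> r <= (2 * (N / 8) + 3 * H / (A3 / 2)) * expR (- (gam * (s - X1))) -> r <= 3 / 8 * N.
  move=> hs hr; apply: le_trans hr _; apply: le_trans concl; apply: ler_piMr; last exact: tail.
  by nn.
have n0 : `|(0 : R)| <= N / 8 by rewrite normr0.
have triv (s w : R) : 0 * w = 0 :> R by rewrite mul0r.
suff : `|z true false x| <= 3 / 8 * N by move: hx N0; clear -A10 A20 A30 k00 gam0 gamA1 gamA2 gamA3 v0 K0 ha0 hc0 hd0 hb0 E0 E1; lra.
have [hX|hX] := leP `|x| X1; first by apply: le_trans (small _ hX) _; lra.
(* one-sided tail, applied to w and to its reflection *)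
have side (f f1 f2 : R -> R) : (forall u, dv f u (f1 u)) -> (forall u, dv f1 u (f2 u)) -> vanish f ->
    `|f X1| <= N / 8 ->
    (forall u, X1 <= u -> `|f2 u - (A3 - t) * f u| <= H * expR (- (gam * (u - X1)))) ->
    forall u, X1 <= u -> `|f u| <= 3 / 8 * N.
  move=> df df1 vf fX hf u hu.
  have h := @hyperbolic_tail R f (fun=> 0) f1 (fun=> 0) f2 (fun=> 0) X1 gam (A3 / 2) (A3 - t) 0
    (N / 8) H gam0 A3h tA gA N8 H0 df (fun u => dv_cst 0 u) df1 (fun u => dv_cst 0 u) vf
    (vanish2_0 R).1 fX n0.
  have [] := h _ _ _ hu.
  - by move=> w hw'; rewrite mul0r subr0; exact: hf.
  - by move=> w hw'; rewrite mulr0 mul0r addr0 subr0 normr0; nn.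
  by move=> {}h _; exact: (fin u _ hu h).
have [x0|x0] := leP 0 x.
  rewrite (ger0_norm x0) in hX.
  apply: (side _ _ _ (fun u => proj2 (dd true false u)) (d2z true false) vz.1 _ _ x (ltW hX)).
    by apply: small; rewrite ger0_norm.
  move=> u hu; have u0 : 0 <= u by exact: le_trans hu.
  by have := err u; rewrite (ger0_norm u0); apply.
rewrite (ltr0_norm x0) in hX.
have -> : z true false x = (fun u => z true false (- u)) (- x) by rewrite opprK.
apply: (side (fun u => z true false (- u)) (fun u => - dz true false (- u))
  (fun u => ddw A3 t d1 d2 b y z (- u)) _ _ vz.2 _ _ (- x) (ltW hX)).
- by move=> u; apply: dv_refl; exact: (proj2 (dd true false _)).
- move=> u; apply: dv_eq; first by apply: dvN; apply: dv_refl; exact: (d2z true false).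
  by rewrite opprK.
- by apply: small; rewrite normrN ger0_norm.
move=> u hu; have u0 : 0 <= u by exact: le_trans hu.
by have := err (- u); rewrite normrN (ger0_norm u0); apply.
Qed.

Variables (S1 dS1 S2 dS2 S5 dS5 S6 dS6 S3 dS3 S7 dS7 : bool -> bool -> R -> R) (Cd : R).
Hypotheses (Cd0 : 0 <= Cd)
  (h15 : outgoing_ref A1 k0 (sympot a0 c0) S5 dS5 S1 dS1)
  (h26 : outgoing_ref A1 k0 (sympot a0 c0) S6 dS6 S2 dS2)
  (hctrlA : forall y dy, ctrl Cd S5 dS5 S6 dS6 S1 dS1 S2 dS2 y dy)
  (h37 : outgoing_ref A2 k0 (scalpot d0) S7 dS7 S3 dS3)
  (hctrlC : forall u du, ctrl Cd S7 dS7 S7 dS7 S3 dS3 S3 dS3 (pad u) (pad du)).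

Variables (W dW : R -> R).
Hypotheses (dvW : forall x, dv W x (dW x)) (dvdW : forall x, dv dW x (A3 * W x - d0 x * W x))
  (vW : vanish2 W) (vdW : vanish2 dW) (W0 : W 0 ^+ 2 + dW 0 ^+ 2 != 0).

Variables (Kb : R) (kk : bool) (J : R -> R) (I : R).
Hypotheses (Kb0 : 0 <= Kb) (hKb : forall i k x, `|S2 i k x| <= Kb /\ `|dS2 i k x| <= Kb)
  (dvJ : forall x, dv J x (b0 x * (S2 false kk x + S2 true kk x) * W x))
  (vJ : vanish (fun x => J x - J (- x) - I)) (I0 : I != 0).

(** The uniform bound of order [eps * N] is turned by [real_decay], on each half-line, into a
    pointwise exponential bound for (p, q) and its derivative. *)
Lemma y_decay : exists2 e0, 0 < e0 <= 1 & exists2 C, 0 <= C &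
  forall t eps sg a c b d1 d2 y dy z dz N, `|t| <= e0 -> 0 <= eps -> 0 <= N ->
  close_pot gam K eps sg a0 c0 d0 b0 a c b d1 d2 ->
  eigen A1 A2 A3 k0 t 0 a c b d1 d2 y dy z dz -> 
  real_fam y ->
  (forall i k x, `|y i k x| <= N /\ `|z i k x| <= N) ->
  (forall i k x, `|y i k x| <= C * eps * N /\ `|z false k x| <= C * eps * N) /\
  forall i x, `|y i false x| <= C * eps * N * E x /\ `|dy i false x| <= C * eps * N * E x.
Proof.
have [e1 /andP[e10 e11] [C C0 Hsm]] := small_yr A3 b0 A10 A20 k00 gam0 gamA1 gamA2 v0 K0 ha0 hc0 hd0 Cd0 h15 h26 hctrlA h37 hctrlC.
have v2 : 0 <= 2 * v by nn.
have hVr i j x : `|sympot a0 c0 i j x| <= 2 * v * expR (- (gam * `|x|)).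
  exact: (@sympot_le R gam a0 c0 v i j x v0 (ha0 x) (hc0 x)).
have hVl i j x : `|refl (sympot a0 c0) i j x| <= 2 * v * expR (- (gam * `|x|)).
  by have := hVr i j (- x); rewrite normrN.
have [e2 /andP[e20 _] [C2 C20 H2]] := real_decay A10 k00 gam0 gamA1 v2 hVr.
have [e3 /andP[e30 _] [C3 C30 H3]] := real_decay A10 k00 gam0 gamA1 v2 hVl.
pose e0 := Num.min e1 (Num.min e2 e3).
have e00 : 0 < e0 by rewrite !lt_min e10 e20 e30.
have [l1 l2 l3] : [/\ e0 <= e1, e0 <= e2 & e0 <= e3] by rewrite /e0 !ge_min !lexx !orbT.
exists e0; first by rewrite e00; exact: le_trans l1 e11.
clearbody e0.
exists (C + (C2 + C3) * (C + 5 * K)); first by nn.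
move=> t eps sg a c b d1 d2 y dy z dz N ht eps0 N0 hcl he yr hN.
have hs i k x : `|y i k x| <= C * eps * N /\ `|z false k x| <= C * eps * N.
  apply: (Hsm t 0 eps sg a c b d1 d2 y dy z dz N _ _ eps0 N0 hcl he hN).
    exact: le_trans ht l1.
  by rewrite lexx ltW.
have Fy := eigen_forced_y eps0 N0 hcl he hN.
have P0 : 0 <= 5 * K * eps * N by nn.
have eN : 0 <= eps * N by nn.
set CC := C + _.
have CC1 : C * eps * N <= CC * eps * N.
  rewrite -!mulrA; apply: ler_wpM2r => //; rewrite /CC lerDl; nn.
have CC2 (m : R) : 0 <= m -> C2 * (C * eps * N + 5 * K * eps * N) * m <= CC * eps * N * m.
  move=> m0; apply: ler_wpM2r => //; rewrite -subr_ge0 /CC.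
  set q := _ - _; have -> : q = C * (eps * N) + C3 * (C + 5 * K) * (eps * N) by rewrite /q; ring.
  by nn.
have CC3 (m : R) : 0 <= m -> C3 * (C * eps * N + 5 * K * eps * N) * m <= CC * eps * N * m.
  move=> m0; apply: ler_wpM2r => //; rewrite -subr_ge0 /CC.
  set q := _ - _; have -> : q = C * (eps * N) + C2 * (C + 5 * K) * (eps * N) by rewrite /q; ring.
  by nn.
split.
  by move=> i k x; have [h1 h2] := hs i k x; split; [exact: le_trans h1 CC1|exact: le_trans h2 CC1].
move=> i x.
have [x0|x0] := leP 0 x.
  have [h1 h2] := H2 t _ _ y dy _ (le_trans ht l2) P0 (forced2_right Fy) yr (fun i k x _ => proj1 (hs i k x)) i x x0.
  rewrite /E (ger0_norm x0); split; [apply: le_trans h1 _|apply: le_trans h2 _]; exact: CC2 (expR_ge0 _).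
have x0' : 0 <= - x by rewrite oppr_ge0 ltW.
have yr' i' x' : refl y i' true x' = 0 by rewrite /refl yr.
have [] := H3 t _ _ _ _ _ (le_trans ht l3) P0 (forced2_left Fy) yr' (fun i k x _ => proj1 (hs i k (- x))) i (- x) x0'.
rewrite /refl /reflN normrN !opprK => h1 h2.
rewrite /E (ltr0_norm x0); split; [apply: le_trans h1 _|apply: le_trans h2 _]; exact: CC3 (expR_ge0 _).
Qed.

Lemma pairing_end (s : bool -> bool -> R -> R) (ds : bool -> bool -> R -> R) y dy j x m :
  (forall i k, `|s i k x| <= Kb /\ `|ds i k x| <= Kb) -> 0 <= m ->
  (forall i, `|y i false x| <= m /\ `|dy i false x| <= m) ->
  `|wron s ds j y dy false x| <= 4 * Kb * m.
Proof.
move=> h m0 hy.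
have pr (f g : R) : `|f| <= Kb -> `|g| <= m -> `|f * g| <= Kb * m.
  by move=> ? ?; rewrite normrM; exact: ler_pM.
have [s1 d1] := h false j; have [s2 d2] := h true j.
have [y1 e1] := hy false; have [y2 e2] := hy true.
rewrite /wron; apply: le_trans (ler_normD _ _) _.
apply: le_trans (lerD (ler_normB _ _) (ler_normB _ _)) _.
apply: le_trans (lerD (lerD (pr _ _ d1 y1) (pr _ _ s1 e1)) (lerD (pr _ _ d2 y2) (pr _ _ s2 e2))) _.
by rewrite le_eqVlt; apply/orP; left; apply/eqP; ring.
Qed.

(* The pairing with the bounded solution [S2] vanishes at infinity, whereas
   its leading term is eps * cc * I: the radiation coefficient. *)
Lemma no_real_eigen : exists2 e0, 0 < e0 <= 1 &
  forall t eps sg a c b d1 d2 y dy z dz, `|t| <= e0 -> 0 < eps <= e0 -> `|sg| = 1 ->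
  close_pot gam K eps sg a0 c0 d0 b0 a c b d1 d2 ->
  eigen A1 A2 A3 k0 t 0 a c b d1 d2 y dy z dz -> real_fam y -> real_fam z ->
  forall i k x, y i k x = 0 /\ z i k x = 0.
Proof.
have [e1 /andP[e10 e11] [C C0 Hdec]] := y_decay.
have [X1 X10 [e2 /andP[e20 _] Hcore]] := w_core.
have [KW KW0 hW] := vanish2_bounded dvW vW.1 vW.2.
(* [c1 * N] will bound [cc] from below: at the point of [w_core] the product [cc * W] has modulus at
   least [N / 16], while [W] is bounded by [KW]. *)
pose c1 := (16 * (KW + 1))^-1.
have c10 : 0 < c1 by rewrite /c1; pp.
have I1 : 0 < `|I| by rewrite normr_gt0.
pose del := c1 * `|I| / 16.
have del0 : 0 < del by rewrite /del; pp.
have KC0 : 0 <= 8 * Kb * C by nn.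
(* [X] is fixed before [th] and [e0]: at [X] and [- X] the boundary terms are already negligible,
   and [J] has collected at least half of [I]. *)
have [X [X0 X1X hXE hXJ]] : exists X, [/\ 0 <= X, X1 <= X, 8 * Kb * C * expR (- (gam * X)) <= del &
    `|J X - J (- X) - I| <= `|I| / 2].
  have q : 0 < del / (8 * Kb * C + 1) by pp.
  have [Xa ha] := vanish_expR gam0 q; have [Xb hb] := vJ (divr_gt0 I1 (ltr0n R 2)).
  exists (Num.max (Num.max 0 X1) (Num.max Xa Xb)); set m := Num.max (Num.max 0 X1) _.
  have [m1 m2 m3 m4] : [/\ 0 <= m, X1 <= m, Xa <= m & Xb <= m] by rewrite /m !le_max !lexx !orbT.
  split=> //; last exact: hb.
  have := ha m m3; rewrite ger0_norm ?expR_ge0 // => h; apply: le_trans (ler_wpM2l KC0 h) _.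
  rewrite mulrA ler_pdivrMr ?ltr_wpDl // mulrC; apply: ler_wpM2l; [exact: ltW|by rewrite lerDl].
pose Q := 2 * X * Kb.
have Q0 : 0 <= Q by rewrite /Q; nn.
(* The value 1/16 keeps [cc * W] above [N / 16] where w is at least [N / 8]; the other bound makes
   the error from replacing w by [cc * W] cost at most [del]. *)
pose th := Num.min (16^-1) (del / (2 * (v * Q) + 1)).
have th0 : 0 < th by rewrite lt_min /=; apply/andP; split; pp.
have th16 : th <= 16^-1 by rewrite ge_min lexx.
have thQ : 2 * (v * Q) * th <= del.
  apply: le_trans (_ : (2 * (v * Q) + 1) * th <= _).
    by apply: ler_wpM2r; [exact: ltW|rewrite lerDl].
  by rewrite mulrC -ler_pdivlMr ?ge_min ?lexx ?orbT // ltr_wpDl //; nn.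
have [e3 /andP[e30 _] Hclose] := w_close A1 A2 a0 c0 b0 A30 k00 gam0 v0 K0 hd0 dvW dvdW vW vdW W0 X0 th0.
pose B := 2 * C + 8 * K * C + 2 * K.
have B0 : 0 <= B by rewrite /B; nn.
pose e0 := Num.min (Num.min e1 e2) (Num.min e3 (Num.min (4 * (C + 1))^-1 (del / (Q * B + 1)))).
have e00 : 0 < e0.
  rewrite !lt_min e10 e20 e30 /=; apply/andP; split; first pp.
  by apply: divr_gt0 => //; apply: ltr_wpDl => //; nn.
have [l1 l2 l3 l4 l5] : [/\ e0 <= e1, e0 <= e2, e0 <= e3, e0 <= (4 * (C + 1))^-1 & e0 <= del / (Q * B + 1)].
  by rewrite /e0 !ge_min !lexx !orbT.
have e01 : e0 <= 1 by exact: le_trans l1 e11.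
have QB : Q * B * e0 <= del.
  apply: le_trans (_ : (Q * B + 1) * e0 <= _).
    by apply: ler_wpM2r; [exact: ltW|rewrite lerDl].
  by rewrite mulrC -ler_pdivlMr // ltr_wpDl //; nn.
have Ce0 : C * e0 <= 4^-1.
  apply: le_trans (ler_wpM2l C0 l4) _.
  by rewrite ler_pdivrMr ?mulr_gt0 ?ltr_wpDl //; move: C0; clear -A10 A20 A30 k00 gam0 gamA1 gamA2 gamA3 v0 K0 ha0 hc0 hd0 hb0 E0 E1 Cd0 h15 h26 hctrlA h37 hctrlC dvW dvdW vW vdW W0 Kb0 hKb dvJ vJ I0; lra.
exists e0; first by rewrite e00.
have defdel : del = c1 * `|I| / 16 by [].
have defc1 : c1 * (16 * (KW + 1)) = 1 by rewrite /c1 mulVf // gt_eqF //; pp.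
have defQ : Q = 2 * X * Kb by [].
have defB : B = 2 * C + 8 * K * C + 2 * K by [].
clearbody e0 del c1 Q B th.
move=> t eps sg a c b d1 d2 y dy z dz ht /andP[eps0 heps] hsg hcl he yr zr.
have [//|nz] := pselect (forall i k x, y i k x = 0 /\ z i k x = 0); exfalso.
have [N N0 [hN [i0 [k [x hx]]]]] := eigen_bounded he nz.
have Nn := ltW N0; have en := ltW eps0.
have [hs hd] := Hdec t eps sg a c b d1 d2 y dy z dz N (le_trans ht l1) en Nn hcl he yr hN.
have eC : C * eps * N <= N / 4.
  have : C * eps <= 4^-1 by apply: le_trans Ce0; exact: ler_wpM2l.
  by move=> h; apply: le_trans (ler_wpM2r Nn h) _; rewrite mulrC.
have {i0 k x hx} hx : exists x, N / 2 <= `|z true false x|.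
  exists x; case: hx => [h|].
    have [g _] := hs i0 k x; exfalso; exact: half_le_quarter N0 (le_trans h (le_trans g eC)).
  case: i0 => [|h]; last first.
    have [_ g] := hs true k x; exfalso; exact: half_le_quarter N0 (le_trans h (le_trans g eC)).
  case: k => //; rewrite zr normr0 => h; exfalso; exact: half_le0 N0 h.
have e2' : 0 <= eps <= e2 by rewrite en /=; exact: le_trans heps l2.
have e3' : 0 <= eps <= e3 by rewrite en /=; exact: le_trans heps l3.
have [xs hxs1 hxs2] := Hcore t eps sg a c b d1 d2 y dy z dz N (le_trans ht l2) e2' N0 hcl he hN hx.
have [cc hcc] := Hclose t eps sg a c b d1 d2 y dy z dz N (le_trans ht l3) e3' Nn hcl he hN.
have ccN : c1 * N <= `|cc|.
  have h1 := hcc xs (le_trans hxs1 X1X).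
  have h2 : N / 16 <= `|cc * W xs|.
    have h3 : th * N <= 16^-1 * N by exact: ler_wpM2r.
    have h4 : `|z true false xs| <= `|z true false xs - cc * W xs| + `|cc * W xs|.
      by apply: le_trans (ler_normD _ _); rewrite subrK.
    exact: sixteenth_le h1 h3 h4 hxs2.
  have h5 : N / 16 <= `|cc| * (KW + 1).
    apply: le_trans h2 _; rewrite normrM; apply: ler_wpM2l => //.
    by apply: le_trans (hW xs) _; rewrite lerDl.
  have K1 : 0 < KW + 1 by exact: ltr_wpDl.
  rewrite -(ler_pM2r K1); apply: le_trans h5.
  have -> : c1 * N * (KW + 1) = c1 * (16 * (KW + 1)) * (N / 16) by field.
  by rewrite defc1 mul1r.
have [_ _ r2 _] := h26.
have [r2l o2] : refsol A1 k0 (sympot a0 c0) S2 dS2 /\ outgoing k0 (refl S2) (reflN dS2) by case: h26.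
have [dd d2y _ _] := he.
have dyy i j u : dv (y i j) u (dy i j u) by case: (dd i j u).
have dwr u := @wron_dv R A1 k0 (sympot a0 c0) (fun=> erefl) S2 dS2 y dy _ kk false u r2l dyy d2y.
(* The leading term of the derivative of the pairing is [sg * eps * cc] times that of [J]; it is
   subtracted here. What remains is [eps * N] times a factor made small by [e0] and [th]. *)
pose g u := wron S2 dS2 kk y dy false u - sg * eps * cc * J u.
pose g1 u := S2 false kk u * ((a u - a0 u) * y false false u + (a u - a0 u) * y true false u + (c u - c0 u) * y false false u - t * y false false u)
  + S2 true kk u * ((a u - a0 u) * y false false u + (a u - a0 u) * y true false u + (c u - c0 u) * y true false u + t * y true false u)
  + (S2 false kk u + S2 true kk u) * (b u * z false false u + (b u - sg * eps * b0 u) * z true false u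
      + sg * eps * b0 u * (z true false u - cc * W u)).
have dg u : dv g u (g1 u).
  have h1 := dwr u; have h2 := dvJ u.
  apply: dv_eq; first by rewrite /g; dvt.
  cbv beta; rewrite /g1 /lin /shift /sympot /=; ring.
pose tau := Kb * (B * e0 + 2 * v * th) * (eps * N).
have hg1 u : - X <= u <= X -> `|g1 u| <= tau.
  move=> /andP[u1 u2]; have hu : `|u| <= X by rewrite ler_norml u1.
  have [k1 k2 _ k4 k5] := hcl u.
  have [s1 _] := hKb false kk u; have [s2 _] := hKb true kk u.
  have [y1 r1] := hs false false u; have [y2 _] := hs true false u.
  have [_ w1] := hN true false u.
  have Ee (m : R) : 0 <= m -> m * E u <= m by move=> m0; exact: ler_piMr.
  have pr (f h F H : R) : `|f| <= F -> `|h| <= H -> `|f * h| <= F * H.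
    by move=> ? ?; rewrite normrM; exact: ler_pM.
  have Ke0 : 0 <= K * eps by nn.
  have {}k1 : `|a u - a0 u| <= K * eps by exact: le_trans k1 (Ee _ Ke0).
  have {}k2 : `|c u - c0 u| <= K * eps by exact: le_trans k2 (Ee _ Ke0).
  have {}k4 : `|b u| <= K * eps by exact: le_trans k4 (Ee _ Ke0).
  have {}k5 : `|b u - sg * eps * b0 u| <= K * eps ^+ 2 by apply: le_trans k5 (Ee _ _); nn.
  have k6 : `|sg * eps * b0 u| <= eps * v.
    rewrite normrM; apply: ler_pM => //; first by rewrite normrM hsg mul1r ger0_norm.
    by apply: le_trans (hb0 u) (Ee _ v0).
  have m1 := pr _ _ _ _ k1 y1; have m2 := pr _ _ _ _ k1 y2.
  have m3 := pr _ _ _ _ k2 y1; have m4 := pr _ _ _ _ k2 y2.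
  have m5 := pr _ _ _ _ ht y1; have m6 := pr _ _ _ _ ht y2.
  have m7 := pr _ _ _ _ k4 r1; have m8 := pr _ _ _ _ k5 w1.
  have m9 := pr _ _ _ _ k6 (hcc u hu).
  set P := K * eps * (C * eps * N) in m1 m2 m3 m4 m7.
  set T := e0 * (C * eps * N) in m5 m6.
  have n1 : `|(a u - a0 u) * y false false u + (a u - a0 u) * y true false u + (c u - c0 u) * y false false u - t * y false false u| <= 3 * P + T.
    apply: le_trans (ler_normB _ _) _; apply: lerD => //.
    apply: le_trans (ler_normD _ _) _; apply: le_trans (lerD (ler_normD _ _) (lexx _)) _.
    exact: ler_add3.
  have n2 : `|(a u - a0 u) * y false false u + (a u - a0 u) * y true false u + (c u - c0 u) * y true false u + t * y true false u| <= 3 * P + T.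
    apply: le_trans (ler_normD _ _) _; apply: lerD => //.
    apply: le_trans (ler_normD _ _) _; apply: le_trans (lerD (ler_normD _ _) (lexx _)) _.
    exact: ler_add3.
  have n3 : `|b u * z false false u + (b u - sg * eps * b0 u) * z true false u
      + sg * eps * b0 u * (z true false u - cc * W u)| <= P + K * eps ^+ 2 * N + eps * v * (th * N).
    apply: le_trans (ler_normD _ _) _; apply: lerD => //.
    by apply: le_trans (ler_normD _ _) _; exact: lerD.
  have s3 : `|S2 false kk u + S2 true kk u| <= 2 * Kb.
    by apply: le_trans (ler_normD _ _) _; exact: ler_add2.
  rewrite /g1; apply: le_trans (ler_normD _ _) _.
  apply: le_trans (lerD (ler_normD _ _) (lexx _)) _.
  apply: le_trans (lerD (lerD (pr _ _ _ _ s1 n1) (pr _ _ _ _ s2 n2)) (pr _ _ _ _ s3 n3)) _.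
  have hP : P <= K * C * e0 * (eps * N).
    have -> : P = K * C * (eps * N) * eps by rewrite /P; ring.
    have -> : K * C * e0 * (eps * N) = K * C * (eps * N) * e0 by ring.
    by apply: ler_wpM2l => //; nn.
  have hK : K * eps ^+ 2 * N <= K * e0 * (eps * N).
    have -> : K * eps ^+ 2 * N = K * (eps * N) * eps by ring.
    have -> : K * e0 * (eps * N) = K * (eps * N) * e0 by ring.
    by apply: ler_wpM2l => //; nn.
  apply: le_trans (_ : Kb * (8 * P + 2 * T + 2 * (K * eps ^+ 2 * N) + 2 * (eps * v * (th * N))) <= _).
    by rewrite le_eqVlt; apply/orP; left; apply/eqP; ring.
  have -> : tau = Kb * (8 * (K * C * e0 * (eps * N)) + 2 * T + 2 * (K * e0 * (eps * N)) + 2 * (eps * v * (th * N))).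
    by rewrite /tau /T defB; ring.
  by apply: ler_wpM2l => //; rewrite !lerD2r; apply: lerD; [rewrite lerD2r|]; apply: ler_wpM2l.
have XX : - X <= X by apply: (le_trans _ X0); rewrite oppr_le0.
have hg : `|g X - g (- X)| <= tau * (X - - X) by apply: (dv_lip XX (fun u _ => dg u) hg1).
have ends u : `|u| = X -> `|wron S2 dS2 kk y dy false u| <= 4 * Kb * (C * eps * N * expR (- (gam * X))).
  move=> hu; apply: pairing_end => [i j| |i]; [exact: hKb|nn|].
  by have := hd i u; rewrite /E hu.
have w1 := ends X (ger0_norm X0).
have w2 := ends (- X); rewrite normrN in w2; have {}w2 := w2 (ger0_norm X0).
have eN0 : 0 < eps * N by pp.
have J2 : `|I| / 2 <= `|J X - J (- X)|.
  have : `|I| <= `|J X - J (- X)| + `|J X - J (- X) - I|.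
    rewrite -[`|_ - I|]normrN; apply: le_trans (ler_normD _ _).
    by rewrite le_eqVlt; apply/orP; left; apply/eqP; congr `|_|; ring.
  exact: half_ler hXJ.
have key : `|cc| * `|J X - J (- X)| * eps <= tau * (X - - X) + 2 * (4 * Kb * (C * eps * N * expR (- (gam * X)))).
  have -> : `|cc| * `|J X - J (- X)| * eps = `|sg * eps * cc * (J X - J (- X))|.
    by rewrite !normrM hsg (gtr0_norm eps0); ring.
  have -> : sg * eps * cc * (J X - J (- X)) = - (g X - g (- X)) + wron S2 dS2 kk y dy false X - wron S2 dS2 kk y dy false (- X).
    by rewrite /g; ring.
  apply: le_trans (ler_normB _ _) _; apply: le_trans (lerD (ler_normD _ _) (lexx _)) _.
  by rewrite normrN; exact: ler_add12.
(* The main term is worth [8 * del], and the three errors (perturbation, approximation of w,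
   boundary terms) cost [del] each. *)
have lower : 8 * del * (eps * N) <= `|cc| * `|J X - J (- X)| * eps.
  have -> : 8 * del * (eps * N) = (c1 * N) * (`|I| / 2) * eps by rewrite defdel; field.
  apply: ler_wpM2r => //; apply: ler_pM => //; nn.
have upper : tau * (X - - X) + 2 * (4 * Kb * (C * eps * N * expR (- (gam * X)))) <= 3 * del * (eps * N).
  have -> : tau * (X - - X) + 2 * (4 * Kb * (C * eps * N * expR (- (gam * X)))) =
    (Q * B * e0 + 2 * (v * Q) * th + 8 * Kb * C * expR (- (gam * X))) * (eps * N).
    by rewrite /tau defQ; ring.
  apply: ler_wpM2r; first exact: ltW.
  exact: ler_add3.
have : 8 * del * (eps * N) <= 3 * del * (eps * N) by apply: le_trans lower (le_trans key upper).
rewrite ler_pM2r // => hh; exact: mul8_le3 del0 hh.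
Qed.

End RealEigen2.

(** * Decay of the waves *)

Section Potentials.
Variable R : realType.
Implicit Types F G : R -> R -> R -> R.

Lemma derivable_dv (f : R -> R) x : derivable f x 1 -> dv f x (f^`()%classic x).
Proof. by move=> h; rewrite derive1E; exact: derivableP. Qed.

Lemma cvgy_vanish (f : R -> R) : (f x @[x --> +oo] --> (0 : R)) -> vanish f.
Proof.
move=> h e e0; have /cvgrPdist_le/(_ e e0) := h.
move=> [X [_ /= hX]]; exists (X + 1) => x hx.
by have := hX x; rewrite sub0r normrN; apply; lra.
Qed.

Lemma cvgNy_vanish (f : R -> R) : (f x @[x --> -oo] --> (0 : R)) -> vanish (fun x => f (- x)).
Proof.
move=> h e e0; have /cvgrPdist_le/(_ e e0) := h.
move=> [X [_ /= hX]]; exists (- X + 1) => x hx.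
by have := hX (- x); rewrite sub0r normrN; apply; lra.
Qed.

Lemma infty_vanish2 (f : R -> R) : vanishes_at_infty f -> vanish2 f.
Proof. by move=> [h1 h2]; split; [exact: cvgy_vanish|exact: cvgNy_vanish]. Qed.

Lemma twice_dv (f : R -> R) : twice_derivable f ->
  (forall x, dv f x (f^`()%classic x)) /\ (forall x, dv (f^`()%classic) x (f^`(2)%classic x)).
Proof. by move=> [h1 h2]; split=> x; apply: derivable_dv; [exact: h1|exact: h2]. Qed.

Definition inbox (B z1 z2 m : R) := [/\ `|z1| <= B, `|z2| <= B & `|m| <= B].

Lemma Ck_bounded G k B : Ck k G -> exists2 K, 0 <= K & forall z1 z2 m, inbox B z1 z2 m -> `|G z1 z2 m| <= K.
Proof.
move=> hG; have {hG} hc : continuous (fun z : R * R * R => G z.1.1 z.1.2 z.2).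
  by case: k hG => [|k] [].
have [B0|B0] := leP 0 B; last first.
  by exists 0 => // z1 z2 m [h _ _]; have := le_lt_trans h B0; rewrite normr_lt0.
pose D : set (R * R * R) := (`[- B, B] `*` `[- B, B]) `*` `[- B, B].
have cD : compact D by apply: compact_setX; [apply: compact_setX|]; exact: segment_compact.
have D0 : D !=set0.
  by exists (0, 0, 0); split; [split|] => /=; rewrite in_itv /= oppr_le0 B0.
have [z1 _ h1] := compact_EVT_max D0 cD (continuous_subspaceT hc).
have [z2 _ h2] := compact_EVT_min D0 cD (continuous_subspaceT hc).
exists (`|G z1.1.1 z1.1.2 z1.2| + `|G z2.1.1 z2.1.2 z2.2|); first exact: addr_ge0.
move=> a c m [ha hc' hm].
have inD : (a, c, m) \in D.
  by rewrite inE; split; [split|] => /=; rewrite in_itv /= -ler_norml.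
have := h1 _ inD; have := h2 _ inD => /=.
set u := G a c m; set p := G _ _ _; set q := G _ _ _ => g1 g2.
rewrite ler_norml; apply/andP; split.
  by have := ler_norm (- p); rewrite normrN; have := normr_ge0 q; lra.
by have := ler_norm q; have := normr_ge0 p; lra.
Qed.

Lemma Ck_lipschitz G k B : Ck k.+1 G -> exists2 K, 0 <= K & forall z1 z2 m w1 w2 n,
  inbox B z1 z2 m -> inbox B w1 w2 n ->
  `|G z1 z2 m - G w1 w2 n| <= K * (`|z1 - w1| + `|z2 - w2| + `|m - n|).
Proof.
move=> [_ [hd [h1 h2 h3]]].
have [K1 K10 b1] := Ck_bounded B h1; have [K2 K20 b2] := Ck_bounded B h2.
have [K3 K30 b3] := Ck_bounded B h3.
exists (K1 + K2 + K3); first by rewrite !addr_ge0.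
have lip (f f1 : R -> R) (K a c : R) : (forall x, dv f x (f1 x)) -> `|a| <= B -> `|c| <= B ->
    (forall x, `|x| <= B -> `|f1 x| <= K) -> `|f a - f c| <= K * `|a - c|.
  move=> df ha hc hK.
  wlog ac : a c ha hc / c <= a.
    move=> W; have [ac|/ltW ac] := leP c a; first exact: W.
    by rewrite distrC [`|a - c|]distrC; exact: W.
  rewrite [X in _ <= _ * X]ger0_norm ?subr_ge0 //; apply: (dv_lip ac (fun x _ => df x)).
  move=> x /andP[x1 x2]; apply: hK; move: ha hc; rewrite !ler_norml => /andP[? ?] /andP[? ?].
  by apply/andP; split; lra.
move=> z1 z2 m w1 w2 n [i1 i2 i3] [j1 j2 j3].
have e1 : `|G z1 z2 m - G w1 z2 m| <= K1 * `|z1 - w1|.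
  apply: (lip (fun z => G z z2 m) (fun z => D1 G z z2 m)) => // x; last by move=> hx; exact: b1.
  by have [h _ _] := hd x z2 m; exact: (derivable_dv h).
have e2 : `|G w1 z2 m - G w1 w2 m| <= K2 * `|z2 - w2|.
  apply: (lip (fun z => G w1 z m) (fun z => D2 G w1 z m)) => // x; last by move=> hx; exact: b2.
  by have [_ h _] := hd w1 x m; exact: (derivable_dv h).
have e3 : `|G w1 w2 m - G w1 w2 n| <= K3 * `|m - n|.
  apply: (lip (fun z => G w1 w2 z) (fun z => Dmu G w1 w2 z)) => // x; last by move=> hx; exact: b3.
  by have [_ _ h] := hd w1 w2 x; exact: (derivable_dv h).
have -> : G z1 z2 m - G w1 w2 n = (G z1 z2 m - G w1 z2 m) + (G w1 z2 m - G w1 w2 m) + (G w1 w2 m - G w1 w2 n) by ring.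
apply: le_trans (ler_normD _ _) _; apply: le_trans (lerD (ler_normD _ _) (lexx _)) _.
apply: le_trans (lerD (lerD e1 e2) e3) _.
rewrite -subr_ge0; set q := _ - _.
have -> : q = (K2 + K3) * `|z1 - w1| + (K1 + K3) * `|z2 - w2| + (K1 + K2) * `|m - n| by rewrite /q; ring.
by nn.
Qed.

(** Comparison for [f ^+ 2]: where the potential is at most [al / 2], its second derivative is at
    least [al * f ^+ 2]. *)
Lemma wave_tail (f f1 q : R -> R) (al gam X M : R) : 0 < gam -> 0 < al -> 4 * gam ^+ 2 <= al ->
  (forall x, dv f x (f1 x)) -> (forall x, dv f1 x ((al - q x) * f x)) -> vanish f ->
  `|f X| <= M -> (forall x, X <= x -> `|q x| <= al / 2) ->
  forall x, X <= x -> `|f x| <= M * expR (- (gam * (x - X))).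
Proof.
move=> g0 al0 hg d1 d2 vf fX hq x hx.
have M0 : 0 <= M by apply: le_trans fX.
have := @decay_le R (fun x => f x ^+ 2) (fun x => 2 * (f x * f1 x))
  (fun x => 2 * f1 x ^+ 2 + 2 * (f x * ((al - q x) * f x))) X gam al (M ^+ 2) g0 al0 hg (sqr_ge0 _).
move=> H; have {}H := H _ _ _ _ _ x hx.
rewrite -(@ler_pXn2r _ 2) ?nnegrE ?mulr_ge0 ?expR_ge0 // real_normK ?num_real // exprMn.
have -> : expR (- (gam * (x - X))) ^+ 2 = expR (- (2 * gam * (x - X))).
  by rewrite expr2 -expRD; congr expR; ring.
apply: H.
- by move=> u _; have h := d1 u; apply: dv_eq; [dvt|cbv beta; ring].
- by move=> u _; have h := d1 u; have h' := d2 u; apply: dv_eq; [dvt|cbv beta; ring].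
- exact: vanishX.
- by rewrite -(real_normK (num_real _)) lerXn2r ?nnegrE.
move=> u /ltW hu _; have := hq u hu; rewrite ler_norml => /andP[q1 q2].
have h1 : 0 <= (al / 2 - q u) * f u ^+ 2 by apply: mulr_ge0; [lra|exact: sqr_ge0].
by have := sqr_ge0 (f1 u); lra.
Qed.

(** The amplitude is proportional to the uniform bound [M], so a component of size eps decays with
    the factor eps. *)
Lemma wave_decay (f f1 q : R -> R) (al gam X M : R) : 0 < gam -> 0 < al -> 4 * gam ^+ 2 <= al -> 0 <= X ->
  (forall x, dv f x (f1 x)) -> (forall x, dv f1 x ((al - q x) * f x)) -> vanish2 f ->
  (forall x, `|f x| <= M) -> (forall x, X <= `|x| -> `|q x| <= al / 2) ->
  forall x, `|f x| <= M * expR (gam * X) * expR (- (gam * `|x|)).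
Proof.
move=> g0 al0 hg X0 d1 d2 vf hM hq x.
have M0 : 0 <= M by apply: le_trans (hM 0).
have -> : M * expR (gam * X) * expR (- (gam * `|x|)) = M * expR (- (gam * (`|x| - X))).
  by rewrite -mulrA -expRD; congr (_ * expR _); ring.
have [hX|hX] := leP X `|x|; last first.
  apply: le_trans (hM x) _; apply: ler_peMr => //.
  by rewrite -expR0 ler_expR -mulrN mulr_ge0 ?(ltW g0) // opprB subr_ge0 ltW.
have [x0|x0] := leP 0 x.
  rewrite (ger0_norm x0) in hX *.
  by apply: (wave_tail g0 al0 hg d1 d2 vf.1 (hM X)) => // u hu; apply: hq; rewrite ger0_norm // (le_trans X0).
rewrite (ltr0_norm x0) in hX *.
have -> : f x = (fun u => f (- u)) (- x) by rewrite opprK.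
apply: (@wave_tail (fun u => f (- u)) (fun u => - f1 (- u)) (fun u => q (- u)) al) => //.
- by move=> u; apply: dv_refl.
- by move=> u; apply: dv_eq; [apply: dvN; apply: dv_refl; exact: d2|rewrite opprK].
- exact: vf.2.
- by move=> u hu; apply: hq; rewrite normrN ger0_norm // (le_trans X0).
Qed.

(** Geometric mean of a bound that is small in eps without decay and one that decays without being
    small. This is why differences of order eps^2 are recorded as [K * eps] times the weight. *)
Lemma geo_bound (q A B e eps : R) : 0 <= A -> 0 <= B -> 0 <= e -> 0 <= eps ->
  `|q| <= A * eps ^+ 2 -> `|q| <= B * e ^+ 2 -> `|q| <= (A + B) * eps * e.
Proof.
move=> A0 B0 e0 eps0 h1 h2.
rewrite -(@ler_pXn2r _ 2) ?nnegrE //; last by nn.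
apply: le_trans (_ : (A * eps ^+ 2) * (B * e ^+ 2) <= _).
  by rewrite expr2; apply: ler_pM.
rewrite -subr_ge0; set p := _ - _.
have -> : p = (A ^+ 2 + A * B + B ^+ 2) * (eps ^+ 2 * e ^+ 2) by rewrite /p; ring.
by nn.
Qed.

Lemma at_right_ex (P : R -> Prop) : (\forall e \near 0^'+, P e) ->
  exists2 e1, 0 < e1 & forall e, 0 < e -> e < e1 -> P e.
Proof.
move=> [r /= r0 hr]; exists r => // e e0 er; apply: hr => //=.
by rewrite /ball /= sub0r normrN gtr0_norm.
Qed.

Definition pot_a F (U V : R -> R) m x := D1 (D1 F) (U x ^+ 2) (V x ^+ 2) m * U x ^+ 2.
Definition pot_c F (U V : R -> R) m x := D1 F (U x ^+ 2) (V x ^+ 2) m.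
Definition pot_b F (U V : R -> R) m x := D1 (D2 F) (U x ^+ 2) (V x ^+ 2) m * U x * V x.
Definition pot_d1 F (U V : R -> R) m x := D2 (D2 F) (U x ^+ 2) (V x ^+ 2) m * V x ^+ 2.
Definition pot_d2 F (U V : R -> R) m x := D2 F (U x ^+ 2) (V x ^+ 2) m.
Definition ref_a F (U0 : R -> R) x := D1 (D1 F) (U0 x ^+ 2) 0 0 * U0 x ^+ 2.
Definition ref_c F (U0 : R -> R) x := D1 F (U0 x ^+ 2) 0 0.
Definition ref_b F (U0 V1 : R -> R) x := D1 (D2 F) (U0 x ^+ 2) 0 0 * U0 x * V1 x.
Definition ref_d F (U0 : R -> R) x := D2 F (U0 x ^+ 2) 0 0.

Lemma wave_eq (f2 al q f : R) : - f2 + al * f - q * f = 0 -> f2 = (al - q) * f.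
Proof. by move=> h; rewrite mulrBl; lra. Qed.

Lemma prod_diff (g h u w : R) : g * u - h * w = (g - h) * u + h * (u - w).
Proof. by ring. Qed.

Lemma prod3_diff (g h u w p q e : R) : g * u * p - e * (h * w * q) =
  (g - h) * (u * p) + h * ((u - w) * p) + h * (w * (p - e * q)).
Proof. by ring. Qed.

Lemma mul_le (f g A B : R) : `|f| <= A -> `|g| <= B -> `|f * g| <= A * B.
Proof. by move=> ? ?; rewrite normrM; exact: ler_pM. Qed.

(** For [a], [c] and [d2] the difference is of order eps^2 by Lipschitz continuity and the
    expansions of the waves. It is also bounded by a squared exponential, because [D1 F] and [D2 F]
    vanish at the origin and [a] contains a squared wave. The coefficients [b] and [d1] carry
    factors of the V-wave, of order eps. *)
Lemma potentials_close F (omega s gam mb : R) (U0 V1 U2f : R -> R) (b : bool) (U V : R -> R -> R) :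
  0 < omega -> 0 < s -> 0 < gam -> 4 * gam ^+ 2 <= omega -> 4 * gam ^+ 2 <= s ->
  nonlinearity F -> fundamental_wave F omega U0 -> bounded_mode F s U0 V1 ->
  (exists C, \forall eps \near 0^'+,
    homoclinic F omega s (mb * eps ^+ 2) (U eps) (V eps) /\
    forall x, `|U eps x - (U0 x + eps ^+ 2 * U2f x)| <= C * eps ^+ 4
      /\ `|V eps x - (-1) ^+ b * (eps * V1 x)| <= C * eps ^+ 3) ->
  exists v K e0, [/\ 0 <= v, 0 <= K, 0 < e0,
    forall x, [/\ `|ref_a F U0 x| <= v * expR (- (gam * `|x|)),
      `|ref_c F U0 x| <= v * expR (- (gam * `|x|)),
      `|ref_d F U0 x| <= v * expR (- (gam * `|x|)) &
      `|ref_b F U0 V1 x| <= v * expR (- (gam * `|x|))] &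
    forall eps, 0 < eps <= e0 -> let m := mb * eps ^+ 2 in
      close_pot gam K eps ((-1) ^+ b) (ref_a F U0) (ref_c F U0) (ref_d F U0) (ref_b F U0 V1)
        (pot_a F (U eps) (V eps) m) (pot_c F (U eps) (V eps) m) (pot_b F (U eps) (V eps) m)
        (pot_d1 F (U eps) (V eps) m) (pot_d2 F (U eps) (V eps) m)].
Proof.
move=> om0 s0 gam0 gom gs [hCk hF0 _] [tU0 eqU0 vU0 _ _] [tV1 eqV1 _ [M1 hM1] vV1] [C0 /at_right_ex[e1 e10 hw]].
have [CD1 CD2] : Ck 2 (D1 F) /\ Ck 2 (D2 F) by case: hCk => _ [_ [h1 h2 _]]; exact: (conj h1 h2).
have [C11 C12] : Ck 1 (D1 (D1 F)) /\ Ck 1 (D1 (D2 F)).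
  by case: CD1 => _ [_ [h1 _ _]]; case: CD2 => _ [_ [h2 _ _]]; exact: (conj h1 h2).
have C22 : Ck 1 (D2 (D2 F)) by case: CD2 => _ [_ [_ h _]]; exact: h.
pose C := `|C0|; have Cn : 0 <= C by rewrite /C.
have M10 : 0 <= M1 by apply: le_trans (hM1 0).
have [dU0 ddU0] := twice_dv tU0; have [dV1 ddV1] := twice_dv tV1.
have {}vU0 := infty_vanish2 vU0; have {}vV1 := infty_vanish2 vV1.
have [M0 M00 hM0] := vanish2_bounded dU0 vU0.1 vU0.2.
have {}hw eps : 0 < eps -> eps < e1 -> homoclinic F omega s (mb * eps ^+ 2) (U eps) (V eps) /\
    forall x, `|U eps x - (U0 x + eps ^+ 2 * U2f x)| <= C * eps ^+ 4
      /\ `|V eps x - (-1) ^+ b * (eps * V1 x)| <= C * eps ^+ 3.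
  move=> p q; have [h1 h2] := hw eps p q; split=> // x; have [h3 h4] := h2 x.
  have le (n : nat) : C0 * eps ^+ n <= C * eps ^+ n.
    by apply: ler_wpM2r; [apply: exprn_ge0; exact: ltW|exact: ler_norm].
  by split; [exact: le_trans h3 (le _)|exact: le_trans h4 (le _)].
(* U2 is bounded since U_eps - U0 is, for one fixed eps *)
have [K2 K20 hK2] : exists2 K2, 0 <= K2 & forall x, `|U2f x| <= K2.
  pose e := e1 / 2; have ep : 0 < e by rewrite divr_gt0.
  have el : e < e1 by rewrite ltr_pdivrMr // ltr_pMr // ltr1n.
  have [[[tU _] _ _ [vU _]] hU] := hw e ep el.
  have [dU _] := twice_dv tU; have {}vU := infty_vanish2 vU.
  have [Me Me0 hMe] := vanish2_bounded dU vU.1 vU.2.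
  have e2 : 0 < e ^+ 2 by rewrite exprn_gt0.
  exists ((Me + M0 + C * e ^+ 4) / e ^+ 2); first by nn.
  move=> x; rewrite ler_pdivlMr // -[X in _ * X]gtr0_norm // -normrM.
  have [h _] := hU x.
  have -> : U2f x * e ^+ 2 = U e x - U0 x - (U e x - (U0 x + e ^+ 2 * U2f x)) by ring.
  apply: le_trans (ler_normB _ _) _; apply: lerD => //.
  by apply: le_trans (ler_normB _ _) _; apply: lerD.
pose C2 := K2 + C; have C20 : 0 <= C2 by rewrite /C2; nn.
pose C3 := M1 + C; have C30 : 0 <= C3 by rewrite /C3; nn.
pose Mu := M0 + C2; have Mu0 : 0 <= Mu by rewrite /Mu; nn.
pose B := Mu ^+ 2 + C3 ^+ 2 + `|mb|; have B0 : 0 <= B by rewrite /B; nn.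
have [L1 L10 hL1] := Ck_lipschitz B CD1; have [L2 L20 hL2] := Ck_lipschitz B CD2.
have [L11 L110 hL11] := Ck_lipschitz B C11; have [L12 L120 hL12] := Ck_lipschitz B C12.
have [b11 b110 hb11] := Ck_bounded B C11; have [b12 b120 hb12] := Ck_bounded B C12.
have [b22 b220 hb22] := Ck_bounded B C22.
(* If the arguments of [D1 F] and [D2 F] add up to at most [eta], Lipschitz continuity from the
   origin makes these at most [omega / 2] and [s / 2], as [wave_decay] requires. *)
pose eta := Num.min omega s / 2 / (L1 + L2 + 1).
have L0 : 0 < L1 + L2 + 1 by apply: ltr_wpDl => //; nn.
have ms0 : 0 < Num.min omega s by rewrite lt_min om0.
have eta0 : 0 < eta by rewrite /eta; pp.
have etaL (L al : R) : 0 <= L -> L <= L1 + L2 + 1 -> Num.min omega s <= al -> L * eta <= al / 2.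
  move=> l0 lL hal; apply: le_trans (_ : (L1 + L2 + 1) * eta <= _).
    by apply: ler_wpM2r => //; exact: ltW.
  rewrite /eta mulrC divfK ?gt_eqF //; by apply: ler_wpM2r.
have [X X0 hX] : exists2 X, 0 <= X & forall x, X <= `|x| -> `|U0 x| <= eta / (2 * (Mu + 1)).
  have q : 0 < eta / (2 * (Mu + 1)) by pp.
  have [X1 h1] := vU0.1 _ q; have [X2 h2] := vU0.2 _ q.
  exists (Num.max 0 (Num.max X1 X2)); first by rewrite le_max lexx.
  move=> x; rewrite !ge_max => /and3P[_ x1 x2].
  have [x0|x0] := leP 0 x; first by apply: h1; rewrite ger0_norm in x1.
  by rewrite -[x]opprK; apply: h2; rewrite ltr0_norm in x2.
(* [T * eps ^+ 2] bounds the distance of the arguments from [(U0 ^+ 2, 0, 0)]; [T' * eps ^+ 2] is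
   what the perturbation adds to their size far out, and [e0] keeps it below [eta / 2]. *)
pose T := 2 * Mu * C2 + C3 ^+ 2 + `|mb|; have T0 : 0 <= T by rewrite /T; nn.
pose T' := C2 * Mu + C3 ^+ 2 + `|mb|; have T'0 : 0 <= T' by rewrite /T'; nn.
pose e0 := Num.min (Num.min (e1 / 2) 1) (eta / (2 * (T' + 1))).
have e00 : 0 < e0 by rewrite !lt_min ltr01 divr_gt0 //=; pp.
have [l1 l2 l3] : [/\ e0 <= e1 / 2, e0 <= 1 & e0 <= eta / (2 * (T' + 1))] by rewrite /e0 !ge_min !lexx !orbT.
clearbody e0.
pose D := (Mu + C3 + M1) * expR (gam * X).
have D0 : 0 <= D by rewrite /D; nn.
have DM (m : R) : 0 <= m -> m <= Mu + C3 + M1 -> m * expR (gam * X) <= D.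
  by move=> m0 hm; apply: ler_wpM2r => //; exact: expR_ge0.
pose E (x : R) := expR (- (gam * `|x|)).
have En x : 0 <= E x by exact: expR_ge0.
have E1 x : E x <= 1 by rewrite /E -expR0 ler_expR oppr_le0 mulr_ge0 // ltW.
have hU0Mu x : `|U0 x| <= Mu by apply: le_trans (hM0 x) _; rewrite lerDl.
have sq_le (f : R) M : `|f| <= M -> `|f ^+ 2| <= M ^+ 2.
  by move=> h; rewrite normrX lerXn2r ?nnegrE // (le_trans _ h).
have box0 x : inbox B (U0 x ^+ 2) 0 0.
  split; rewrite ?normr0 //; apply: le_trans (sq_le _ _ (hU0Mu x)) _; rewrite /B -addrA lerDl; nn.
have boxz m : `|m| <= `|mb| -> inbox B 0 0 m.
  by move=> h; split; rewrite ?normr0 //; apply: le_trans h _; rewrite /B lerDr; nn.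
have F1z m : D1 F 0 0 m = 0 by have [] := hF0 m.
have F2z m : D2 F 0 0 m = 0 by have [] := hF0 m.
have mb0 : `|(0 : R)| <= `|mb| by rewrite normr0.
have U0sq x : `|U0 x ^+ 2| <= `|U0 x| * Mu by rewrite expr2; apply: mul_le.
have hX0 x : X <= `|x| -> `|U0 x ^+ 2| <= eta.
  move=> hx; apply: le_trans (U0sq x) _.
  apply: le_trans (ler_wpM2r Mu0 (hX x hx)) _.
  rewrite mulrAC ler_pdivrMr; last by pp.
  apply: ler_wpM2l; [exact: ltW|by rewrite -subr_ge0 (_ : _ - Mu = Mu + 2) ?addr_ge0 //; ring].
have dec0 x : `|U0 x| <= D * E x.
  have h : `|U0 x| <= Mu * expR (gam * X) * E x.
    apply: (@wave_decay U0 (U0^`()%classic) (fun x => D1 F (U0 x ^+ 2) 0 0) omega gam X Mu) => //.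
      move=> u; apply: dv_eq; first exact: ddU0.
      by apply: wave_eq (eqU0 u).
    move=> u hu; have := hL1 _ _ _ _ _ _ (box0 u) (boxz 0 mb0).
    rewrite F1z !subr0 normr0 !addr0 => h; apply: le_trans h _.
    apply: le_trans (ler_wpM2l L10 (hX0 u hu)) _; apply: etaL => //; [rewrite -addrA lerDl; nn|by rewrite ge_min lexx].
  apply: le_trans h _; apply: ler_wpM2r => //; apply: DM => //; rewrite -addrA lerDl; nn.
have dec1 x : `|V1 x| <= D * E x.
  have h : `|V1 x| <= M1 * expR (gam * X) * E x.
    apply: (@wave_decay V1 (V1^`()%classic) (fun x => D2 F (U0 x ^+ 2) 0 0) s gam X M1) => //.
      move=> u; apply: dv_eq; first exact: ddV1.
      by apply: wave_eq (eqV1 u).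
    move=> u hu; have := hL2 _ _ _ _ _ _ (box0 u) (boxz 0 mb0).
    rewrite F2z !subr0 normr0 !addr0 => h; apply: le_trans h _.
    apply: le_trans (ler_wpM2l L20 (hX0 u hu)) _; apply: etaL => //; [rewrite -addrA addrC -addrA lerDl; nn|by rewrite ge_min lexx orbT].
  apply: le_trans h _; apply: ler_wpM2r => //; apply: DM => //; rewrite lerDr; nn.
have EE x : E x ^+ 2 <= E x by rewrite expr2; exact: ler_piMl.
have DE2 x : (D * E x) ^+ 2 <= D ^+ 2 * E x by rewrite exprMn; apply: ler_wpM2l => //; exact: sqr_ge0.
have D2n : 0 <= D ^+ 2 by exact: sqr_ge0.
pose v := (b11 + L1 + L2 + b12) * D ^+ 2.
have vle (m : R) x : 0 <= m -> m <= b11 + L1 + L2 + b12 -> m * (D * E x) ^+ 2 <= v * E x.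
  move=> m0 hm; apply: le_trans (ler_wpM2l m0 (DE2 x)) _; rewrite mulrA; apply: ler_wpM2r => //.
  by apply: ler_wpM2r.
pose Aa := L11 * T * Mu ^+ 2 + b11 * (2 * Mu * C2); pose Ba := 2 * b11 * D ^+ 2.
pose Ab := L12 * T * (Mu * C3) + b12 * (C2 * C3) + b12 * (Mu * C); pose Bb := 2 * b12 * D ^+ 2.
pose K := (Aa + Ba) + (L1 * T + 3 * L1 * D ^+ 2) + b22 * D ^+ 2 + (L2 * T + 3 * L2 * D ^+ 2) + b12 * D ^+ 2 + (Ab + Bb).
have Aa0 : 0 <= Aa by rewrite /Aa; nn.
have Ba0 : 0 <= Ba by rewrite /Ba; nn.
have Ab0 : 0 <= Ab by rewrite /Ab; nn.
have Bb0 : 0 <= Bb by rewrite /Bb; nn.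
exists v, K, e0; split=> //; [by rewrite /v; nn|by rewrite /K; nn| |].
  move=> x; split.
  - apply: le_trans (vle b11 x b110 _); last by rewrite -!addrA lerDl; nn.
    by apply: mul_le (hb11 _ _ _ (box0 x)) (sq_le _ _ (dec0 x)).
  - apply: le_trans (vle L1 x L10 _); last by rewrite [b11 + L1]addrC -!addrA lerDl; nn.
    have := hL1 _ _ _ _ _ _ (box0 x) (boxz 0 mb0); rewrite F1z !subr0 normr0 !addr0 => h.
    by apply: le_trans h _; apply: ler_wpM2l => //; exact: sq_le.
  - apply: le_trans (vle L2 x L20 _); last by rewrite [b11 + L1 + L2]addrC -!addrA lerDl; nn.
    have := hL2 _ _ _ _ _ _ (box0 x) (boxz 0 mb0); rewrite F2z !subr0 normr0 !addr0 => h.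
    by apply: le_trans h _; apply: ler_wpM2l => //; exact: sq_le.
  - apply: le_trans (vle b12 x b120 _); last by rewrite lerDr; nn.
    rewrite /ref_b -mulrA; apply: mul_le (hb12 _ _ _ (box0 x)) _.
    by rewrite expr2; apply: mul_le.
move=> eps /andP[eps0 heps] m x.
have epsn := ltW eps0.
have eps1 : eps <= 1 by exact: le_trans heps l2.
have el : eps < e1 by apply: le_lt_trans heps (le_lt_trans l1 _); rewrite ltr_pdivrMr // ltr_pMr // ltr1n.
have [[[tU tV] eqU eqV [vU vV]] hUV] := hw eps eps0 el.
have [dU ddU] := twice_dv tU; have [dV ddV] := twice_dv tV.
have {}vU := infty_vanish2 vU; have {}vV := infty_vanish2 vV.
have p2 : eps ^+ 2 <= eps by rewrite expr2; exact: ler_piMl.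
have p3 : eps ^+ 3 <= eps ^+ 2 by rewrite exprS; apply: ler_piMl => //; exact: sqr_ge0.
have p31 : eps ^+ 3 <= eps by exact: le_trans p3 p2.
have p4 : eps ^+ 4 <= eps ^+ 2 by rewrite [X in X <= _]exprS; apply: le_trans p3; apply: ler_piMl => //; nn.
have dUx u : `|U eps u - U0 u| <= C2 * eps ^+ 2.
  have [h _] := hUV u.
  have -> : U eps u - U0 u = eps ^+ 2 * U2f u + (U eps u - (U0 u + eps ^+ 2 * U2f u)) by ring.
  apply: le_trans (ler_normD _ _) _; rewrite /C2 mulrDl; apply: lerD.
    by rewrite mulrC; apply: mul_le => //; rewrite ger0_norm // sqr_ge0.
  by apply: le_trans h _; apply: ler_wpM2l.
have dVx u : `|V eps u - (-1) ^+ b * eps * V1 u| <= C * eps ^+ 3.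
  by have [_ h] := hUV u; rewrite -mulrA.
have hVe u : `|V eps u| <= C3 * eps.
  have -> : V eps u = (-1) ^+ b * eps * V1 u + (V eps u - (-1) ^+ b * eps * V1 u) by ring.
  apply: le_trans (ler_normD _ _) _; rewrite /C3 mulrDl; apply: lerD.
    by rewrite mulrC; apply: mul_le => //; rewrite normrM normrX normrN1 expr1n mul1r ger0_norm.
  by apply: le_trans (dVx u) _; apply: ler_wpM2l.
have hVC u : `|V eps u| <= C3 by apply: le_trans (hVe u) _; exact: ler_piMr.
have hUMu u : `|U eps u| <= Mu.
  have -> : U eps u = U0 u + (U eps u - U0 u) by ring.
  apply: le_trans (ler_normD _ _) _; apply: lerD => //; apply: le_trans (dUx u) _.
  by apply: ler_piMr => //; exact: le_trans p2 eps1.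
have hm : `|m| <= `|mb| * eps ^+ 2 by rewrite /m normrM [`|eps ^+ 2|]ger0_norm ?sqr_ge0.
have hm1 : `|m| <= `|mb| by apply: le_trans hm _; apply: ler_piMr => //; exact: le_trans p2 eps1.
have box u : inbox B (U eps u ^+ 2) (V eps u ^+ 2) m.
  split.
  - by apply: le_trans (sq_le _ _ (hUMu u)) _; rewrite /B -addrA lerDl; nn.
  - by apply: le_trans (sq_le _ _ (hVC u)) _; rewrite /B addrAC lerDr; nn.
  - by apply: le_trans hm1 _; rewrite /B lerDr; nn.
have V2 u : `|V eps u ^+ 2| <= C3 ^+ 2 * eps ^+ 2 by rewrite -exprMn; exact: sq_le.
have far u : X <= `|u| -> `|U eps u ^+ 2| + `|V eps u ^+ 2| + `|m| <= eta.
  move=> hu.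
  have q1 : `|U eps u ^+ 2| <= (eta / (2 * (Mu + 1)) + C2 * eps ^+ 2) * Mu.
    rewrite expr2; apply: mul_le => //.
    have -> : U eps u = U0 u + (U eps u - U0 u) by ring.
    by apply: le_trans (ler_normD _ _) _; apply: lerD => //; exact: hX.
  have q2 : eta / (2 * (Mu + 1)) * Mu <= eta / 2.
    rewrite mulrAC ler_pdivrMr; last by pp.
    by rewrite (_ : eta / 2 * (2 * (Mu + 1)) = eta * Mu + eta); [rewrite lerDl; exact: ltW|field].
  have q3 : T' * eps ^+ 2 <= eta / 2.
    apply: le_trans (ler_wpM2l T'0 p2) _; apply: le_trans (ler_wpM2l T'0 (le_trans heps l3)) _.
    rewrite mulrA ler_pdivrMr; last by pp.
    by rewrite (_ : eta / 2 * (2 * (T' + 1)) = T' * eta + eta); [rewrite lerDl; exact: ltW|field].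
  have q4 := V2 u; move: q1 q2 q3 q4 hm; rewrite /T'.
  clear; lra.
have decU u : `|U eps u| <= D * E u.
  have h : `|U eps u| <= Mu * expR (gam * X) * E u.
    apply: (@wave_decay (U eps) ((U eps)^`()%classic) (fun x => D1 F (U eps x ^+ 2) (V eps x ^+ 2) m) omega gam X Mu) => //.
      move=> w; apply: dv_eq; first exact: ddU.
      by apply: wave_eq (eqU w).
    move=> w hw'; have := hL1 _ _ _ _ _ _ (box w) (boxz 0 mb0).
    rewrite F1z !subr0 => h; apply: le_trans h _.
    apply: le_trans (ler_wpM2l L10 (far w hw')) _; apply: etaL => //; [rewrite -addrA lerDl; nn|by rewrite ge_min lexx].
  apply: le_trans h _; apply: ler_wpM2r => //; apply: DM => //; rewrite -addrA lerDl; nn.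
have decV u : `|V eps u| <= eps * (D * E u).
  have h : `|V eps u| <= (C3 * eps) * expR (gam * X) * E u.
    apply: (@wave_decay (V eps) ((V eps)^`()%classic) (fun x => D2 F (U eps x ^+ 2) (V eps x ^+ 2) m) s gam X (C3 * eps)) => //.
      move=> w; apply: dv_eq; first exact: ddV.
      by apply: wave_eq (eqV w).
    move=> w hw'; have := hL2 _ _ _ _ _ _ (box w) (boxz 0 mb0).
    rewrite F2z !subr0 => h; apply: le_trans h _.
    apply: le_trans (ler_wpM2l L20 (far w hw')) _; apply: etaL => //; [rewrite -addrA addrC -addrA lerDl; nn|by rewrite ge_min lexx orbT].
  apply: le_trans h _; have -> : C3 * eps * expR (gam * X) * E u = eps * ((C3 * expR (gam * X)) * E u) by ring.
  apply: ler_wpM2l => //; apply: ler_wpM2r => //; apply: DM => //.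
  by rewrite addrAC lerDr; nn.
have decV' u : `|V eps u| <= D * E u.
  by apply: le_trans (decV u) _; apply: ler_piMl => //; nn.
have dsq u : `|U eps u ^+ 2 - U0 u ^+ 2| <= 2 * Mu * C2 * eps ^+ 2.
  have -> : U eps u ^+ 2 - U0 u ^+ 2 = (U eps u - U0 u) * (U eps u + U0 u) by ring.
  have -> : 2 * Mu * C2 * eps ^+ 2 = C2 * eps ^+ 2 * (Mu + Mu) by ring.
  by apply: mul_le => //; apply: le_trans (ler_normD _ _) _; exact: lerD.
have dist u : `|U eps u ^+ 2 - U0 u ^+ 2| + `|V eps u ^+ 2 - 0| + `|m - 0| <= T * eps ^+ 2.
  have -> : T * eps ^+ 2 = 2 * Mu * C2 * eps ^+ 2 + C3 ^+ 2 * eps ^+ 2 + `|mb| * eps ^+ 2 by rewrite /T; ring.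
  by rewrite [V eps u ^+ 2 - 0]subr0 [m - 0]subr0; apply: lerD; [apply: lerD; [exact: dsq|exact: V2]|exact: hm].
have Kle (k : R) e : 0 <= e -> k <= K -> k * e <= K * e by move=> ? ?; exact: ler_wpM2r.
have sumK : [/\ Aa + Ba <= K, L1 * T + 3 * L1 * D ^+ 2 <= K, b22 * D ^+ 2 <= K, L2 * T + 3 * L2 * D ^+ 2 <= K & b12 * D ^+ 2 <= K /\ Ab + Bb <= K].
  have n1 : 0 <= Aa + Ba by nn.
  have n2 : 0 <= L1 * T + 3 * L1 * D ^+ 2 by nn.
  have n3 : 0 <= b22 * D ^+ 2 by nn.
  have n4 : 0 <= L2 * T + 3 * L2 * D ^+ 2 by nn.
  have n5 : 0 <= b12 * D ^+ 2 by nn.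
  have n6 : 0 <= Ab + Bb by nn.
  by move: n1 n2 n3 n4 n5 n6; rewrite /K; move: (Aa + Ba) (L1 * T + _) (b22 * _) (L2 * T + _) (b12 * _) (Ab + Bb);
    clear; move=> k1 k2 k3 k4 k5 k6 *; repeat split; lra.
case: sumK => s1 s2 s3 s4 [s5 s6].
have Ksc (k : R) : k <= K -> k * eps * E x <= K * eps * E x.
  by move=> hk; apply: ler_wpM2r => //; apply: ler_wpM2r.
have sqD u : `|U eps u ^+ 2| <= (D * E u) ^+ 2 by exact: sq_le.
have sqD0 u : `|U0 u ^+ 2| <= (D * E u) ^+ 2 by exact: sq_le.
have sqDV u : `|V eps u ^+ 2| <= (D * E u) ^+ 2 by exact: sq_le.
have LT (L : R) G : 0 <= L -> (forall z1 z2 m w1 w2 n, inbox B z1 z2 m -> inbox B w1 w2 n ->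
     `|G z1 z2 m - G w1 w2 n| <= L * (`|z1 - w1| + `|z2 - w2| + `|m - n|)) ->
   `|G (U eps x ^+ 2) (V eps x ^+ 2) m - G (U0 x ^+ 2) 0 0| <= L * T * eps ^+ 2.
  move=> L0' hL; apply: le_trans (hL _ _ _ _ _ _ (box x) (box0 x)) _.
  by rewrite -[leRHS]mulrA; apply: ler_wpM2l.
have diffc (L : R) G : 0 <= L -> (forall z1 z2 m w1 w2 n, inbox B z1 z2 m -> inbox B w1 w2 n ->
     `|G z1 z2 m - G w1 w2 n| <= L * (`|z1 - w1| + `|z2 - w2| + `|m - n|)) ->
   (forall m, G 0 0 m = 0) -> 
   `|G (U eps x ^+ 2) (V eps x ^+ 2) m - G (U0 x ^+ 2) 0 0| <= (L * T + 3 * L * D ^+ 2) * eps * E x.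
  move=> L0' hL Gz; apply: geo_bound => //; [nn|nn|exact: LT|].
  have g1 : `|G (U eps x ^+ 2) (V eps x ^+ 2) m| <= L * (2 * (D * E x) ^+ 2).
    have := hL _ _ _ _ _ _ (box x) (boxz m hm1); rewrite Gz subrr !subr0 normr0 addr0 => h.
    apply: le_trans h _; apply: ler_wpM2l => //.
    have -> : 2 * (D * E x) ^+ 2 = (D * E x) ^+ 2 + (D * E x) ^+ 2 by ring. by apply: lerD; [exact: sqD|exact: sqDV].
  have g2 : `|G (U0 x ^+ 2) 0 0| <= L * (D * E x) ^+ 2.
    have := hL _ _ _ _ _ _ (box0 x) (boxz 0 mb0); rewrite Gz !subr0 normr0 !addr0 => h.
    by apply: le_trans h _; apply: ler_wpM2l.
  apply: le_trans (ler_normB _ _) _; apply: le_trans (lerD g1 g2) _.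
  by rewrite le_eqVlt; apply/orP; left; apply/eqP; ring.
rewrite -/(E x); split.
- apply: le_trans (Ksc _ s1); apply: geo_bound => //.
    rewrite /pot_a /ref_a prod_diff.
    apply: le_trans (ler_normD _ _) _.
    have g1 := mul_le (LT L11 _ L110 hL11) (sq_le _ _ (hUMu x)).
    have g2 := mul_le (hb11 _ _ _ (box0 x)) (dsq x).
    apply: le_trans (lerD g1 g2) _; rewrite /Aa.
    by rewrite le_eqVlt; apply/orP; left; apply/eqP; ring.
  have g1 := mul_le (hb11 _ _ _ (box x)) (sqD x).
  have g2 := mul_le (hb11 _ _ _ (box0 x)) (sqD0 x).
  apply: le_trans (ler_normB _ _) _; apply: le_trans (lerD g1 g2) _.
  by rewrite /Ba le_eqVlt; apply/orP; left; apply/eqP; ring.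
- by apply: le_trans (Ksc _ s2); exact: diffc.
- split; last by apply: le_trans (Ksc _ s4); exact: diffc.
  apply: le_trans (Ksc _ s3).
  have g1 : `|V eps x ^+ 2| <= D ^+ 2 * (eps * E x).
    rewrite expr2; apply: le_trans (mul_le (decV x) (decV' x)) _.
    have -> : eps * (D * E x) * (D * E x) = D ^+ 2 * eps * (E x ^+ 2) by ring.
    by rewrite [leRHS]mulrA; apply: ler_wpM2l => //; nn.
  by apply: le_trans (mul_le (hb22 _ _ _ (box x)) g1) _; rewrite !mulrA.
- apply: le_trans (Ksc _ s5).
  have g1 : `|U eps x * V eps x| <= D ^+ 2 * (eps * E x).
    apply: le_trans (mul_le (decU x) (decV x)) _.
    have -> : D * E x * (eps * (D * E x)) = D ^+ 2 * eps * (E x ^+ 2) by ring.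
    by rewrite [leRHS]mulrA; apply: ler_wpM2l => //; nn.
  rewrite /pot_b -mulrA; apply: le_trans (mul_le (hb12 _ _ _ (box x)) g1) _.
  by rewrite !mulrA.
apply: le_trans (_ : (Ab + Bb) * eps ^+ 2 * E x <= _); last first.
  by apply: ler_wpM2r => //; apply: ler_wpM2r => //; exact: sqr_ge0.
(* Here the uniform bound is of order eps^3 and the decaying one of order eps times the squared
   weight; their geometric mean is eps^2 times the weight. *)
have -> : (Ab + Bb) * eps ^+ 2 * E x = (Ab * eps + Bb * eps) * eps * E x by ring.
apply: geo_bound => //; [nn|nn| |].
  rewrite /pot_b /ref_b prod3_diff.
  apply: le_trans (ler_normD _ _) _; apply: le_trans (lerD (ler_normD _ _) (lexx _)) _.
  have g1 := mul_le (LT L12 _ L120 hL12) (mul_le (hUMu x) (hVe x)).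
  have g2 := mul_le (hb12 _ _ _ (box0 x)) (mul_le (dUx x) (hVe x)).
  have g3 := mul_le (hb12 _ _ _ (box0 x)) (mul_le (hU0Mu x) (dVx x)).
  apply: le_trans (lerD (lerD g1 g2) g3) _.
  by rewrite /Ab le_eqVlt; apply/orP; left; apply/eqP; ring.
have g1 : `|pot_b F (U eps) (V eps) m x| <= b12 * (D * E x * (eps * (D * E x))).
  by rewrite /pot_b -mulrA; apply: mul_le (hb12 _ _ _ (box x)) (mul_le (decU x) (decV x)).
have g2 : `|(-1) ^+ b * eps * ref_b F U0 V1 x| <= eps * (b12 * (D * E x * (D * E x))).
  apply: mul_le; first by rewrite normrM normrX normrN1 expr1n mul1r ger0_norm.
  by rewrite /ref_b -mulrA; apply: mul_le (hb12 _ _ _ (box0 x)) (mul_le (dec0 x) (dec1 x)).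
apply: le_trans (ler_normB _ _) _; apply: le_trans (lerD g1 g2) _.
by rewrite /Bb le_eqVlt; apply/orP; left; apply/eqP; ring.
Qed.

End Potentials.

Ltac sub_itv := let y := fresh in move=> y /=; rewrite !in_itv /= => /andP[? ?]; apply/andP; split; lra.

(** * Integrals and weak derivatives *)

Section Integrals.
Variable R : realType.
Local Notation mu := (@lebesgue_measure R).
Implicit Types f g : R -> R.

Definition li f := measurable_fun setT f /\
  forall a c : R, mu.-integrable `[a, c] (EFin \o f).

Definition seg_int (a c : R) f := \int[mu]_(y in `[a, c]) f y.

Lemma li_continuous f : continuous f -> li f.
Proof.
move=> cf; split; first by apply: continuous_measurable_fun.
move=> a c; apply: continuous_compact_integrable; first exact: segment_compact.
exact: continuous_subspaceT.
Qed.

Lemma li_cst (k : R) : li (fun=> k).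
Proof. by apply: li_continuous => x; exact: cvg_cst. Qed.

Lemma li_le f g : measurable_fun setT f -> (forall x, `|f x| <= `|g x|) -> li g -> li f.
Proof.
move=> mf h [mg hg]; split=> // a c.
apply: (le_integrable _ _ _ (hg a c)) => //; last by move=> x _ /=; rewrite lee_fin.
by apply/measurable_EFinP; exact: measurable_funS mf.
Qed.

Lemma li_norm f : li f -> li (fun x => `|f x|).
Proof.
move=> [mf hf]; apply: (li_le (g := f)) => //; last by move=> x; rewrite normr_id.
exact: measurableT_comp.
Qed.

Lemma liD f g : li f -> li g -> li (fun x => f x + g x).
Proof.
move=> [mf hf] [mg hg]; split; first exact: measurable_funD.
by move=> a c; apply: (integrableD _ (hf a c) (hg a c)).
Qed.

Lemma liZ k f : li f -> li (fun x => k * f x).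
Proof.
move=> [mf hf]; split; first exact: measurable_funM.
by move=> a c; apply: (integrableZl _ k (hf a c)).
Qed.

Lemma liB f g : li f -> li g -> li (fun x => f x - g x).
Proof.
move=> hf hg; have := liD hf (liZ (-1) hg); congr li.
by apply/funext => x; rewrite mulN1r.
Qed.

Lemma li_mul f g : li f -> continuous g -> (exists K, forall x, `|g x| <= K) -> li (fun x => f x * g x).
Proof.
move=> hf cg [K hK]; apply: (li_le (g := fun x => K * f x)).
- by apply: measurable_funM; [exact: hf.1|apply: continuous_measurable_fun].
- move=> x; rewrite !normrM mulrC; apply: ler_wpM2r => //.
  by apply: le_trans (hK x) _; exact: ler_norm.
- exact: liZ.
Qed.

Lemma L2_measurable f : f \in Lfun mu 2%:E -> measurable_fun setT f.
Proof. by rewrite inE => /andP[+ _]; rewrite inE. Qed.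

Lemma L2_li f : f \in Lfun mu 2%:E -> li f.
Proof.
move=> hf; have mf := L2_measurable hf; split=> // a c.
have h1 : mu.-integrable `[a, c] (EFin \o (fun x => f x ^+ 2)).
  by apply: (@integrableS _ _ _ mu setT) => //; exact: Lfun2_integrable_sqr.
have h2 := (li_cst 1).2 a c.
have h3 : mu.-integrable `[a, c] (fun x => 1%:E + (f x ^+ 2)%:E)%E by apply: (integrableD _ h2 h1).
apply: (le_integrable _ _ _ h3) => //; first by apply/measurable_EFinP; exact: measurable_funS mf.
move=> x _ /=; rewrite lee_fin (ger0_norm (_ : 0 <= 1 + f x ^+ 2)); last first.
  by rewrite addr_ge0 ?sqr_ge0.
have := sqr_ge0 (`|f x| - 1); rewrite sqrrB real_normK ?num_real //.
by have := sqr_ge0 (f x); have := normr_ge0 (f x); lra.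
Qed.

Lemma seg_split a b c f : a <= b -> b <= c -> li f -> seg_int a c f = seg_int a b f + seg_int b c f.
Proof.
move=> ab bc [mf hf]; rewrite /seg_int.
have := @Rintegral_itvB R f (BLeft a) (BRight c) b (hf a c).
rewrite !bnd_simp => /(_ ab bc) => h.
rewrite -(@Rintegral_itv_obnd_cbnd R b (BRight c) f); first by rewrite -h addrC subrK.
by apply: integrableS (hf b c) => //; sub_itv.
Qed.

Lemma seg_ge0 a c f : (forall x, 0 <= f x) -> 0 <= seg_int a c f.
Proof. by move=> h; apply: Rintegral_ge0 => x _; exact: h. Qed.

Lemma seg_le a c f g : li f -> li g -> (forall x, a <= x <= c -> f x <= g x) ->
  seg_int a c f <= seg_int a c g.
Proof.
move=> [_ hf] [_ hg] h; apply: le_Rintegral => // x /=; rewrite in_itv /=; exact: h.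
Qed.

Lemma seg_norm a c f : li f -> `|seg_int a c f| <= seg_int a c (fun x => `|f x|).
Proof. by move=> [_ hf]; apply: le_normr_Rintegral. Qed.

Lemma seg_cst a c (k : R) : a <= c -> seg_int a c (fun=> k) = k * (c - a).
Proof.
move=> ac; rewrite /seg_int Rintegral_cst //; congr (_ * _).
have := @lebesgue_measure_itv R (Interval (BLeft a) (BRight c)); rewrite /= lte_fin => ->.
by case: ltgtP ac => //= ->; rewrite subrr.
Qed.

Lemma segD a c f g : li f -> li g -> seg_int a c (fun x => f x + g x) = seg_int a c f + seg_int a c g.
Proof. by move=> [_ hf] [_ hg]; apply: RintegralD. Qed.

Lemma segB a c f g : li f -> li g -> seg_int a c (fun x => f x - g x) = seg_int a c f - seg_int a c g.
Proof. by move=> [_ hf] [_ hg]; apply: RintegralB. Qed.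

Lemma segZ a c k f : li f -> seg_int a c (fun x => k * f x) = k * seg_int a c f.
Proof. by move=> [_ hf]; apply: RintegralZl. Qed.

Lemma seg_eq a c f g : (forall x, a <= x <= c -> f x = g x) -> seg_int a c f = seg_int a c g.
Proof. by move=> h; apply: eq_Rintegral => x; rewrite inE /= in_itv /=; exact: h. Qed.

Lemma seg_bnd a c f K : a <= c -> li f -> (forall x, a <= x <= c -> `|f x| <= K) ->
  `|seg_int a c f| <= K * (c - a).
Proof.
move=> ac hf h; apply: le_trans (seg_norm a c hf) _.
rewrite -(seg_cst K ac); apply: seg_le => //; [exact: li_norm|exact: li_cst].
Qed.

Lemma seg_mono a a' c c' f : a' <= a -> a <= c -> c <= c' -> li f -> (forall x, 0 <= f x) ->
  seg_int a c f <= seg_int a' c' f.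
Proof.
move=> h1 h2 h3 hf f0; rewrite (seg_split h1 (le_trans h2 h3) hf) (seg_split h2 h3 hf).
by have := seg_ge0 a' a f0; have := seg_ge0 c c' f0; lra.
Qed.

Lemma seg_support a c f : (forall x, ~ (a <= x <= c) -> f x = 0) -> \int[mu]_x f x = seg_int a c f.
Proof.
move=> h; rewrite /seg_int [RHS]Rintegral_mkcond; congr (Rintegral _ _ _).
apply/funext => x; rewrite /patch; case: ifPn => // /negP hx; apply: h => hx'.
by apply: hx; rewrite inE /= in_itv.
Qed.

Lemma oint_sub a c f : a <= c -> li f -> oriented_int 0 c f - oriented_int 0 a f = seg_int a c f.
Proof.
move=> ac hf; rewrite /oriented_int.
rewrite -!/(seg_int _ _ f).
have [c0|c0] := leP 0 c; have [a0|a0] := leP 0 a.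
- by rewrite (seg_split a0 ac hf) addrAC subrr add0r.
- by rewrite opprK (seg_split (ltW a0) c0 hf) addrC.
- by have := le_lt_trans (le_trans a0 ac) c0; rewrite ltxx.
- by rewrite (seg_split ac (ltW c0) hf) opprK addrC addrK.
Qed.

Lemma dv_remainder f x l :
  (forall e, 0 < e -> exists2 d, 0 < d & forall h, `|h| < d -> `|f (x + h) - f x - l * h| <= e * `|h|) ->
  dv f x l.
Proof.
move=> H; have hl : h^-1 *: (f (h *: (1:R) + x) - f x) @[h --> (0:R)^'] --> l.
  apply/cvgrPdist_le => e e0; have [d d0 hd] := H _ e0.
  exists d => //= h; rewrite /ball /= sub0r normrN => hd' h0.
  have := hd h hd'; rewrite /GRing.scale /= mulr1 (addrC h x) => hh.
  have -> : l - h^-1 * (f (x + h) - f x) = - (h^-1 * (f (x + h) - f x - l * h)) by field.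
  by rewrite normrN normrM normfV ler_pdivrMl ?normr_gt0 // [`|h| * e]mulrC.
split; first by apply/cvg_ex; exists l.
by rewrite /derive (cvg_lim _ hl).
Qed.

Lemma oint_dv f x : continuous f -> dv (fun y => oriented_int 0 y f) x (f x).
Proof.
move=> cf; have lf := li_continuous cf.
apply: dv_remainder => e e0.
have /cvgrPdist_le/(_ e e0) [d /= d0 hd] := cf x.
exists d => // h hh.
have key a c : a <= c -> `|a - x| < d -> `|c - x| < d -> `|seg_int a c f - f x * (c - a)| <= e * (c - a).
  move=> ac hx hy; rewrite -(seg_cst (f x) ac) -segB //; last exact: li_cst.
  apply: seg_bnd => //; first by apply: liB => //; exact: li_cst.
  move=> u /andP[u1 u2]; rewrite distrC; apply: hd.
  rewrite /ball /= distrC; move: hx hy; rewrite !ltr_norml; lra.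
have [h0|h0] := leP 0 h.
  have := key x (x + h); rewrite lerDl h0 subrr normr0 addrAC subrr add0r => /(_ isT d0 hh).
  by rewrite -oint_sub ?lerDl // (ger0_norm h0).
have := key (x + h) x; rewrite gerDl (ltW h0) subrr normr0 addrAC subrr add0r => /(_ isT hh d0).
rewrite -oint_sub ?gerDl ?(ltW h0) // (ltr0_norm h0).
have -> : oriented_int 0 x f - oriented_int 0 (x + h) f - f x * (x - (x + h)) =
  - (oriented_int 0 (x + h) f - oriented_int 0 x f - f x * h) by ring.
by rewrite normrN opprD addrA subrr add0r.
Qed.

(* [|g| <= (k g^2 + 1/k)] makes the primitive of an L^2 function uniformly continuous. *)
Lemma L2_seg f : f \in Lfun mu 2%:E -> exists2 N, 0 <= N &
  (forall a c, a <= c -> seg_int a c (fun x => f x ^+ 2) <= N) /\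
  forall a c k, a <= c -> 0 < k -> `|seg_int a c f| <= k * N + (c - a) / k.
Proof.
move=> hf; have lf := L2_li hf.
have hq := Lfun2_integrable_sqr hf.
have lq : li (fun x => f x ^+ 2).
  split; first by apply/measurable_EFinP; case/integrableP: hq.
  by move=> a c; apply: (@integrableS _ _ _ mu setT).
exists (\int[mu]_x f x ^+ 2); first by apply: Rintegral_ge0 => x _; exact: sqr_ge0.
have hN a c : a <= c -> seg_int a c (fun x => f x ^+ 2) <= \int[mu]_x f x ^+ 2.
  move=> ac; rewrite /seg_int /Rintegral; apply: fine_le.
  - by apply: integrable_fin_num => //; exact: lq.2.
  - exact: integrable_fin_num.
  apply: ge0_subset_integral => //; first exact: measurable_int hq.
  by move=> x _; rewrite lee_fin sqr_ge0.
split=> // a c k ac k0; apply: le_trans (seg_norm a c lf) _.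
apply: le_trans (_ : seg_int a c (fun x => k * f x ^+ 2 + k^-1) <= _); last first.
  rewrite segD ?segZ ?seg_cst //; [|exact: liZ|exact: li_cst].
  by apply: lerD; [rewrite ler_pM2l // hN|rewrite mulrC].
apply: seg_le; [exact: li_norm|by apply: liD; [exact: liZ|exact: li_cst]|].
move=> x _; have k0' : 0 <= k by exact: ltW.
have : 0 <= k * (`|f x| - k^-1) ^+ 2 by apply: mulr_ge0 => //; exact: sqr_ge0.
have -> : k * (`|f x| - k^-1) ^+ 2 = k * `|f x| ^+ 2 - 2 * `|f x| + k^-1 by field; rewrite gt_eqF.
by rewrite real_normK ?num_real //; have := normr_ge0 (f x); lra.
Qed.

Lemma L2_oint_continuous f : f \in Lfun mu 2%:E -> continuous (fun x => oriented_int 0 x f).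
Proof.
move=> hf x; have lf := L2_li hf; have [N N0 [_ hN]] := L2_seg hf.
apply/cvgrPdist_le => e e0.
(* [k * N] uses half of [e]; segments shorter than [k * (e / 2)] use the other half. *)
pose k := e / (2 * (N + 1)).
have N1 : 0 < N + 1 by rewrite ltr_wpDl.
have k0 : 0 < k by rewrite /k divr_gt0 // mulr_gt0.
have kN : k * N <= e / 2.
  rewrite /k -subr_ge0; have -> : e / 2 - e / (2 * (N + 1)) * N = e / (2 * (N + 1)) by field; rewrite gt_eqF.
  by exact: ltW.
exists (k * (e / 2)) => /=; first by rewrite mulr_gt0 // divr_gt0.
move=> y; rewrite /ball /= => hy.
have key a c : a <= c -> c - a < k * (e / 2) -> `|oriented_int 0 c f - oriented_int 0 a f| <= e.
  move=> ac hc; rewrite oint_sub //; apply: le_trans (hN _ _ k ac k0) _.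
  have : (c - a) / k <= e / 2 by rewrite ler_pdivrMr // mulrC ltW.
  lra.
have [xy|/ltW xy] := leP x y.
  by rewrite distrC; apply: key => //; move: hy; rewrite distrC ger0_norm // subr_ge0.
by apply: key => //; move: hy; rewrite ger0_norm // subr_ge0.
Qed.

(** The ball of radius [h] has measure [2 * h], so a mean deviation below [e / 2] is an integral
    below [e * h]; the endpoints do not contribute. *)
Lemma lebesgue_pt_small f x : li f -> lebesgue_pt f x -> forall e, 0 < e ->
  exists2 h0, 0 < h0 & forall h, 0 < h -> h < h0 ->
    seg_int (x - h) (x + h) (fun y => `|f y - f x|) <= e * h.
Proof.
move=> lf hx e e0.
have e4 : 0 < e / 2 by rewrite divr_gt0.
have := hx; rewrite /lebesgue_pt => /fine_cvgP[hfin /cvgrPdist_lt/(_ _ e4) hc].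
have [h1 h10 H1] := at_right_ex hfin; have [h2 h20 H2] := at_right_ex hc.
exists (Num.min h1 h2); first by rewrite lt_min h10.
move=> h h0; rewrite lt_min => /andP[hh1 hh2].
have lg : li (fun y => `|f y - f x|) by apply: li_norm; apply: liB => //; exact: li_cst.
have := H1 h h0 hh1; have := H2 h h0 hh2.
rewrite sub0r normrN /=; set d := davg f x h => hd dfin.
have hE : d = (((h *+ 2)^-1)%:E * \int[mu]_(y in ball x h) `|f y - f x|%:E)%E.
  rewrite /d /davg /iavg lebesgue_measure_ball ?(ltW h0) // inver mulrn_eq0 /= gt_eqF //.
have eS : seg_int (x - h) (x + h) (fun y => `|f y - f x|) = fine (\int[mu]_(y in ball x h) `|f y - f x|%:E)%E.
  rewrite /seg_int ball_itv.
  rewrite -(@Rintegral_itv_obnd_cbnd R (x - h) (BRight (x + h))) -?(@Rintegral_itv_bndo_bndc R (BRight (x - h)) (x + h)) //.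
    by apply: integrableS (lg.2 (x - h) (x + h)) => //; sub_itv.
  by apply: integrableS (lg.2 (x - h) (x + h)) => //; sub_itv.
have fI : (\int[mu]_(y in ball x h) `|f y - f x|%:E)%E \is a fin_num.
  apply: integrable_fin_num; first exact: measurable_ball.
  rewrite ball_itv.
  by apply: integrableS (lg.2 (x - h) (x + h)) => //; sub_itv.
move: hd; rewrite hE fineM //= -eS => hd.
have h20' : 0 < h *+ 2 by rewrite pmulrn_lgt0.
have S0 : 0 <= seg_int (x - h) (x + h) (fun y => `|f y - f x|) by apply: seg_ge0.
move: hd; rewrite ger0_norm; last by rewrite mulr_ge0 // invr_ge0 ltW.
rewrite ltr_pdivrMl // mulr2n => hd; move: hd; set S := seg_int _ _ _; lra.
Qed.

End Integrals.

(** * Weak derivatives and Lebesgue points *)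

Section WeakDerivative.
Variable R : realType.
Local Notation mu := (@lebesgue_measure R).
Implicit Types f g : R -> R.

Definition pos_part (x : R) : R := (x + `|x|) / 2.
(** A C^1 step from 0 to 1 on [[0, 2]], the primitive of the hat function [bump]. Test functions
    need only be C^1, so squares of positive parts suffice and no smooth mollifier is built. *)
Definition bump_int (u : R) := (pos_part u ^+ 2 - 2 * pos_part (u - 1) ^+ 2 + pos_part (u - 2) ^+ 2) / 2.
Definition bump (u : R) := pos_part u - 2 * pos_part (u - 1) + pos_part (u - 2).

Lemma pos_partP x : (0 <= x /\ pos_part x = x) \/ (x <= 0 /\ pos_part x = 0).
Proof.
rewrite /pos_part; have [x0|x0] := leP 0 x; [left|right]; split => //; try lra.
  by rewrite ger0_norm //; lra.
by rewrite ltr0_norm // subrr mul0r.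
Qed.

Lemma pos_part_continuous : continuous pos_part.
Proof.
move=> x; apply: cvgM; last exact: cvg_cst.
by apply: cvgD; [exact: cvg_id|exact: norm_continuous].
Qed.

Lemma pos_part_sq_dv x : dv (fun x => pos_part x ^+ 2) x (2 * pos_part x).
Proof.
apply: dv_remainder => e e0; exists e => // h he.
apply: (@le_trans _ _ (`|h| * `|h|)); last by apply: ler_wpM2r => //; exact: ltW.
rewrite -normrM -expr2 (ger0_norm (sqr_ge0 h)).
case: (pos_partP x) => -[x0 ->]; case: (pos_partP (x + h)) => -[xh ->].
- by rewrite (_ : _ - _ = h ^+ 2) ?ger0_norm ?sqr_ge0 //; ring.
- rewrite ler_norml; apply/andP; split.
    have : 0 <= x * (- (x + h)) by rewrite mulr_ge0 // oppr_ge0.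
    have : 0 <= (- (x + h)) ^+ 2 by exact: sqr_ge0.
    have : 0 <= x * - h by rewrite mulr_ge0 //; lra.
    rewrite !expr2; lra.
  by have := sqr_ge0 (x + h); rewrite !expr2; lra.
- rewrite ler_norml; have : 0 <= (- x) * (x + h) by rewrite mulr_ge0 // oppr_ge0.
  have : 0 <= (- x) * h by rewrite mulr_ge0 ?oppr_ge0 //; lra.
  have := sqr_ge0 h; have := sqr_ge0 (x + h).
  by rewrite !expr2 => *; apply/andP; split; lra.
- by rewrite expr0n /= !(mulr0, mul0r) !subr0 normr0 sqr_ge0.
Qed.

Lemma bump_int_dv u : dv bump_int u (bump u).
Proof.
have sh c : dv (fun x => pos_part (x - c) ^+ 2) u (2 * pos_part (u - c)).
  apply: dv_eq (_ : dv _ _ (2 * pos_part (u - c) * (1 - 0))) _; last by rewrite subr0 mulr1.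
  apply: (dv_comp (f := fun x => pos_part x ^+ 2) (g := fun x => x - c)); first exact: pos_part_sq_dv.
  by apply: dvD; [exact: dv_id|apply: dvN; exact: dv_cst].
have h0 := pos_part_sq_dv u; have h1 := sh 1; have h2 := sh 2.
apply: dv_eq.
  apply: dvM; last exact: dv_cst.
  apply: dvD; last exact: h2.
  apply: dvD; first exact: h0.
  by apply: dvN; apply: dvM; [exact: dv_cst|exact: h1].
by rewrite /bump; field.
Qed.

Lemma bump_continuous : continuous bump.
Proof.
have sh c : continuous (fun u : R => pos_part (u - c)).
  move=> u; apply: (@continuous_comp _ _ _ (fun u => u - c) pos_part); last exact: pos_part_continuous.
  by apply: cvgB; [exact: cvg_id|exact: cvg_cst].
move=> u; apply: cvgD; last exact: sh.
apply: cvgB; first exact: pos_part_continuous.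
by apply: cvgM; [exact: cvg_cst|exact: sh].
Qed.

Lemma pos_part_ge0 x : 0 <= x -> pos_part x = x.
Proof. by move=> h; rewrite /pos_part ger0_norm //; lra. Qed.

Lemma pos_part_le0 x : x <= 0 -> pos_part x = 0.
Proof. by move=> h; rewrite /pos_part ler0_norm // subrr mul0r. Qed.

Lemma bump_cases u : [\/ u <= 0 /\ (bump u = 0 /\ bump_int u = 0),
  0 < u < 2 /\ (0 <= bump u <= 1 /\ 0 <= bump_int u <= 1) |
  2 <= u /\ (bump u = 0 /\ bump_int u = 1)].
Proof.
rewrite /bump /bump_int; have [u0|u0] := leP u 0.
  by apply: Or31; rewrite !pos_part_le0 //; try lra; split=> //; split; rewrite ?expr2; lra.
have [u2|u2] := leP 2 u.
  by apply: Or33; rewrite !pos_part_ge0 //; try lra; split=> //; split; rewrite ?expr2; lra.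
apply: Or32; split=> //.
rewrite (@pos_part_le0 (u - 2)) ?(@pos_part_ge0 u) //; try lra.
have [u1|u1] := leP u 1; [rewrite pos_part_le0 //; try lra|rewrite pos_part_ge0 //; try lra].
  have h3 : 0 <= u * (1 - u) by rewrite mulr_ge0 //; lra.
  split; first by apply/andP; split; lra.
  by have := sqr_ge0 u; move: h3; rewrite !expr2 => *; apply/andP; split; lra.
have h3 : 0 <= (u - 1) * (2 - u) by rewrite mulr_ge0 //; lra.
split; first by apply/andP; split; lra.
by have := sqr_ge0 (u - 2); have := sqr_ge0 (u - 1); move: h3; rewrite !expr2 => *; apply/andP; split; lra.
Qed.

Lemma seg_ftc (G g : R -> R) a c : a <= c -> (forall x, dv G x (g x)) -> continuous g ->
  seg_int a c g = G c - G a.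
Proof.
move=> ac dG cg; rewrite -oint_sub //; last exact: li_continuous.
have : `|oriented_int 0 c g - G c - (oriented_int 0 a g - G a)| <= 0 * (c - a).
  apply: (@dv_lip R (fun x => oriented_int 0 x g - G x) (fun=> 0) a c 0 ac) => x _; last by rewrite normr0.
  by apply: dv_eq (_ : dv _ _ (g x - g x)) _; [apply: dvD; [exact: oint_dv|exact: dvN]|rewrite subrr].
by rewrite mul0r normr_le0 => /eqP; lra.
Qed.

Definition scaled_bump (h a x : R) := h^-1 * bump ((x - a) / h).
Definition scaled_step (h a x : R) := bump_int ((x - a) / h).

Lemma scaled_step_dv h a x : dv (scaled_step h a) x (scaled_bump h a x).
Proof.
apply: dv_eq (_ : dv _ _ (bump ((x - a) / h) * ((x - a) * 0 + (1 - 0) * h^-1))) _.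
  apply: dv_comp; first exact: bump_int_dv.
  apply: dvM; last exact: dv_cst.
  by apply: dvD; [exact: dv_id|apply: dvN; exact: dv_cst].
by rewrite /scaled_bump; ring.
Qed.

Lemma scaled_bump_continuous h a : continuous (scaled_bump h a).
Proof.
move=> x; apply: cvgM; first exact: cvg_cst.
apply: (@continuous_comp _ _ _ (fun x => (x - a) / h) bump); last exact: bump_continuous.
by apply: cvgM; [apply: cvgB; [exact: cvg_id|exact: cvg_cst]|exact: cvg_cst].
Qed.

Lemma scaled_cases h a x : 0 < h -> [\/ x <= a /\ (scaled_bump h a x = 0 /\ scaled_step h a x = 0),
  a < x < a + 2 * h /\ (0 <= scaled_bump h a x <= h^-1 /\ 0 <= scaled_step h a x <= 1) |
  a + 2 * h <= x /\ (scaled_bump h a x = 0 /\ scaled_step h a x = 1)].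
Proof.
move=> h0; rewrite /scaled_bump /scaled_step.
have e : x = a + h * ((x - a) / h) by field; rewrite gt_eqF.
set u := (x - a) / h in e *.
case: (bump_cases u) => -[hu [h1 h2]].
- apply: Or31; rewrite h1 h2 mulr0; split=> //; rewrite e gerDl pmulr_rle0 //.
- apply: Or32; case/andP: hu => u0 u2; case/andP: h1 => b0 b1; split.
    by rewrite e ltrDl ltrD2l mulr_gt0 //= (mulrC 2) ltr_pM2l.
  split=> //; rewrite mulr_ge0 ?invr_ge0 ?(ltW h0) //= -[leRHS]mulr1 ler_pM2l // invr_gt0 //.
- by apply: Or33; rewrite h1 h2 mulr0; split=> //; rewrite e lerD2l mulrC ler_pM2l.
Qed.

Lemma scaled_left h a x : 0 < h -> x <= a -> scaled_bump h a x = 0 /\ scaled_step h a x = 0.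
Proof.
move=> h0 xa; case: (scaled_cases a x h0) => -[hx [e1 e2]] //; exfalso; move: hx xa h0; clear; lra.
Qed.

Lemma scaled_right h a x : 0 < h -> a + 2 * h <= x -> scaled_bump h a x = 0 /\ scaled_step h a x = 1.
Proof.
move=> h0 xa; case: (scaled_cases a x h0) => -[hx [e1 e2]] //; exfalso; move: hx xa h0; clear; lra.
Qed.

Lemma scaled_bump_bound h a x : 0 < h -> `|scaled_bump h a x| <= h^-1.
Proof.
move=> h0; have i0 : 0 <= h^-1 by rewrite invr_ge0 ltW.
case: (scaled_cases a x h0) => -[_ [e _]]; rewrite ?e ?normr0 //.
by case/andP: e => e1 e2; rewrite ger0_norm.
Qed.

Lemma scaled_step_bound h a x : 0 < h -> 0 <= scaled_step h a x <= 1.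
Proof. by move=> h0; case: (scaled_cases a x h0) => -[_ [_ e]] //; rewrite e ?lexx ?ler01. Qed.

(** [scaled_bump] has integral 1 and is at most [h^-1], so the deviation of the average from [f a]
    is at most [h^-1] times the integral of the deviation of [f]. *)
Lemma bump_average f h a e : 0 < h -> li f ->
  seg_int (a - 2 * h) (a + 2 * h) (fun y => `|f y - f a|) <= e * (2 * h) ->
  `|seg_int a (a + 2 * h) (fun x => f x * scaled_bump h a x) - f a| <= 2 * e.
Proof.
move=> h0 lf hs; have h2 : a <= a + 2 * h by rewrite lerDl mulr_ge0 // ltW.
have lk : li (scaled_bump h a) by apply: li_continuous; exact: scaled_bump_continuous.
have lfa : li (fun x => f x - f a) by apply: liB => //; exact: li_cst.
have bk : exists K, forall x, `|scaled_bump h a x| <= K by exists h^-1 => x; exact: scaled_bump_bound.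
have e1 : f a = seg_int a (a + 2 * h) (fun x => f a * scaled_bump h a x).
  rewrite segZ // (seg_ftc h2 (scaled_step_dv h a) (@scaled_bump_continuous h a)).
  have -> : scaled_step h a (a + 2 * h) = 1.
    exact: (scaled_right h0 (lexx _)).2.
  have -> : scaled_step h a a = 0.
    exact: (scaled_left h0 (lexx _)).2.
  by rewrite subr0 mulr1.
rewrite [X in _ - X]e1 -segB //; [|exact: li_mul (@scaled_bump_continuous h a) bk|exact: liZ].
have lm : li (fun x => (f x - f a) * scaled_bump h a x) by exact: li_mul (@scaled_bump_continuous h a) bk.
rewrite (seg_eq (g := fun x => (f x - f a) * scaled_bump h a x)); last by move=> x _; rewrite mulrBl.
apply: le_trans (seg_norm _ _ lm) _.
apply: le_trans (_ : seg_int a (a + 2 * h) (fun x => h^-1 * `|f x - f a|) <= _).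
  apply: seg_le; [exact: li_norm|by apply: liZ; exact: li_norm|].
  by move=> x _; rewrite normrM mulrC ler_wpM2r // scaled_bump_bound.
rewrite segZ; last exact: li_norm.
have m : seg_int a (a + 2 * h) (fun y => `|f y - f a|) <= e * (2 * h).
  apply: le_trans hs; apply: seg_mono => //; [|exact: li_norm].
  by rewrite gerDl oppr_le0 mulr_ge0 // ltW.
by rewrite ler_pdivrMl //; move: m; set S := seg_int _ _ _; lra.
Qed.

Lemma short_average g h a e : 0 < h -> li g ->
  seg_int (a - 2 * h) (a + 2 * h) (fun y => `|g y - g a|) <= e * (2 * h) ->
  seg_int a (a + 2 * h) (fun x => `|g x|) <= (e + `|g a|) * (2 * h).
Proof.
move=> h0 lg hs; have h2 : a <= a + 2 * h by rewrite lerDl mulr_ge0 // ltW.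
have lga : li (fun x => `|g x - g a|) by apply: li_norm; apply: liB => //; exact: li_cst.
apply: le_trans (_ : seg_int a (a + 2 * h) (fun x => `|g x - g a| + `|g a|) <= _).
  apply: seg_le; [exact: li_norm|by apply: liD => //; exact: li_cst|].
  by move=> x _; rewrite -[X in `|X|](subrK (g a)) ler_normD.
rewrite segD ?seg_cst //; last exact: li_cst.
have : seg_int a (a + 2 * h) (fun y => `|g y - g a|) <= e * (2 * h).
  by apply: le_trans hs; apply: seg_mono => //; rewrite gerDl oppr_le0 mulr_ge0 // ltW.
by rewrite addrAC subrr add0r mulrDl; set S := seg_int _ _ _; lra.
Qed.

Lemma unit_dist (u v : R) : 0 <= u <= 1 -> 0 <= v <= 1 -> `|u - v| <= 1.
Proof. by move=> /andP[? ?] /andP[? ?]; rewrite ler_norml; apply/andP; split; lra. Qed.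

Lemma norm_between (a c x : R) : a <= x <= c -> `|x| <= `|a| + `|c|.
Proof.
move=> /andP[x1 x2]; rewrite ler_norml; have := ler_norm (- a); have := ler_norm c; rewrite normrN.
by have := normr_ge0 a; have := normr_ge0 c => *; apply/andP; split; lra.
Qed.

(** Tested against a plateau rising on [[a, a + 2 * h]] and falling on [[c, c + 2 * h]]: its
    derivative averages [f] near [a] and [c], and at Lebesgue points these averages tend to the
    values. The integral of [g] over the two short ramps is negligible for the same reason. *)
Lemma weak_difference f g a c : li f -> li g -> weak_derivative f g -> a < c ->
  lebesgue_pt f a -> lebesgue_pt f c -> lebesgue_pt g a -> lebesgue_pt g c ->
  f c - f a = seg_int a c g.
Proof.
move=> lf lg hw ac fa fc ga gc.
suff : `|f c - f a - seg_int a c g| <= 0 by rewrite normr_le0 subr_eq0 => /eqP.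
apply/ler_addgt0Pr => E E0; rewrite add0r.
pose e := E / 20; have e0 : 0 < e by rewrite divr_gt0.
have [h1 h10 H1] := lebesgue_pt_small lf fa e0.
have [h2 h20 H2] := lebesgue_pt_small lf fc e0.
have [h3 h30 H3] := lebesgue_pt_small lg ga e0.
have [h4 h40 H4] := lebesgue_pt_small lg gc e0.
(* [M] bounds the mean of the modulus of [g] on either ramp, so ramps shorter than [e / M]
   contribute at most [e]. *)
pose M := `|g a| + `|g c| + e + e.
have M0 : 0 < M by rewrite /M; have := normr_ge0 (g a); have := normr_ge0 (g c); lra.
pose m := Num.min (Num.min (Num.min h1 h2) (Num.min h3 h4)) (Num.min (c - a) (e / M)).
have m0 : 0 < m by rewrite !lt_min h10 h20 h30 h40 subr_gt0 ac divr_gt0.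
pose h := m / 4; have h0 : 0 < h by rewrite divr_gt0.
have hm : 2 * h < m by rewrite /h; lra.
have hh0 : 0 < 2 * h by rewrite mulr_gt0.
move: (hm); rewrite {1}/m !lt_min -!andbA => /and5P[k1 k2 k3 k4 /andP[k5 k6]].
have {}H1 := H1 _ hh0 k1; have {}H2 := H2 _ hh0 k2; have {}H3 := H3 _ hh0 k3; have {}H4 := H4 _ hh0 k4.
have B1 := bump_average h0 lf H1; have B2 := bump_average h0 lf H2.
have S3 := short_average h0 lg H3; have S4 := short_average h0 lg H4.
pose phi x := scaled_step h a x - scaled_step h c x.
pose phi' x := scaled_bump h a x - scaled_bump h c x.
have dphi x : dv phi x (phi' x) by apply: dvD; [|apply: dvN]; exact: scaled_step_dv.
have cphi' : continuous phi' by move=> x; apply: cvgB; exact: scaled_bump_continuous.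
have cphi : continuous phi by move=> x; exact: dv_cont (dphi x).
have ephi : phi^`()%classic = phi'.
  by apply/funext => x; rewrite derive1E; have [_ ->] := dphi x.
have sphi x : ~ (a <= x <= c + 2 * h) -> phi x = 0 /\ phi' x = 0.
  move=> hx; rewrite /phi /phi'; case: (ltP x a) => xa.
    have [-> ->] := scaled_left h0 (ltW xa).
    by have [-> ->] := scaled_left h0 (le_trans (ltW xa) (ltW ac)); rewrite subrr.
  have xc : c + 2 * h <= x by rewrite leNgt; apply/negP => /ltW ?; apply: hx; rewrite xa.
  have [-> ->] := scaled_right h0 xc.
  have [|-> ->] := @scaled_right h a x h0; last by rewrite !subrr.
  by apply: le_trans xc; rewrite lerD2r ltW.
have tphi : test_function phi.
  split; first by move=> x; have [] := dphi x.
    by rewrite ephi.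
  exists (`|a| + `|c + 2 * h|) => x hx; apply: (sphi x _).1 => /norm_between.
  by rewrite leNgt hx.
have aphi x : `|phi x| <= 1 by apply: unit_dist; exact: scaled_step_bound.
have bphi : exists K, forall x, `|phi x| <= K by exists 1.
have bphi' : exists K, forall x, `|phi' x| <= K.
  exists (h^-1 + h^-1) => x; apply: le_trans (ler_normB _ _) _.
  by apply: lerD; exact: scaled_bump_bound.
have := hw _ tphi; rewrite ephi.
rewrite (@seg_support _ a (c + 2 * h)); last by move=> x hx; rewrite (sphi x hx).2 mulr0.
rewrite (@seg_support _ a (c + 2 * h)); last by move=> x hx; rewrite (sphi x hx).1 mulr0.
have lf' : li (fun x => f x * phi' x) by exact: li_mul.
have lg' : li (fun x => g x * phi x) by exact: li_mul.
have i1 : a <= a + 2 * h by rewrite lerDl ltW.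
have i2 : a + 2 * h <= c by rewrite addrC -lerBrDr ltW.
have i3 : c <= c + 2 * h by rewrite lerDl ltW.
rewrite (seg_split i1 (le_trans i2 i3) lf') (seg_split i2 i3 lf').
rewrite (seg_split i1 (le_trans i2 i3) lg') (seg_split i2 i3 lg').
rewrite (@seg_eq _ a _ (fun x => f x * phi' x) (fun x => f x * scaled_bump h a x)); last first.
  by move=> x /andP[x1 x2]; rewrite /phi' (scaled_left h0 (le_trans x2 i2)).1 subr0.
rewrite (@seg_eq _ (a + 2 * h) _ (fun x => f x * phi' x) (fun x => 0)); last first.
  by move=> x /andP[x1 x2]; rewrite /phi' (scaled_left h0 x2).1 (scaled_right h0 x1).1 subrr mulr0.
rewrite (@seg_eq _ c _ (fun x => f x * phi' x) (fun x => (-1) * (f x * scaled_bump h c x))); last first.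
  move=> x /andP[x1 x2]; rewrite /phi' (scaled_right h0 (le_trans i2 x1)).1.
  by rewrite sub0r mulrN mulN1r.
rewrite (@seg_eq _ (a + 2 * h) _ (fun x => g x * phi x) g); last first.
  by move=> x /andP[x1 x2]; rewrite /phi (scaled_left h0 x2).2 (scaled_right h0 x1).2 subr0 mulr1.
rewrite segZ; last first.
  by apply: li_mul => //; [exact: scaled_bump_continuous|exists h^-1 => x; exact: scaled_bump_bound].
rewrite seg_cst // mul0r add0r mulN1r.
have G1 u : u <= u + 2 * h -> `|seg_int u (u + 2 * h) (fun x => g x * phi x)| <=
    seg_int u (u + 2 * h) (fun x => `|g x|).
  move=> hu; apply: le_trans (seg_norm _ _ lg') _; apply: seg_le; try exact: li_norm.
  by move=> x _; rewrite normrM ler_piMr.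
have {G1}[G1 G2] := (G1 a i1, G1 c i3).
have ga1 := seg_norm a (a + 2 * h) lg.
rewrite (seg_split i1 i2 lg).
have hM : M * (2 * h) <= e by rewrite mulrC -ler_pdivlMr // ltW.
have T3 : (e + `|g a|) * (2 * h) <= e.
  by apply: le_trans hM; apply: ler_wpM2r; [exact: ltW|rewrite /M; have := normr_ge0 (g c); move: e0; clear; lra].
have T4 : (e + `|g c|) * (2 * h) <= e.
  by apply: le_trans hM; apply: ler_wpM2r; [exact: ltW|rewrite /M; have := normr_ge0 (g a); move: e0; clear; lra].
have {}G1 := le_trans G1 (le_trans S3 T3); have {}G2 := le_trans G2 (le_trans S4 T4).
have {}ga1 := le_trans ga1 (le_trans S3 T3).
move: B1 B2 G1 G2 ga1 {k1 k2 k3 k4 k5 k6 H1 H2 H3 H4 S3 S4 T3 T4 hM i1 i2 i3 hm M0}.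
rewrite !ler_norml (_ : E = 20 * e); last by rewrite /e; field.
set q1 := seg_int _ _ _; set q2 := seg_int _ _ _; set q3 := seg_int _ _ _.
set q4 := seg_int _ _ _; set q5 := seg_int _ _ _; set q6 := seg_int _ _ _.
clearbody q1 q2 q3 q4 q5 q6 e.
move=> /andP[? ?] /andP[? ?] /andP[? ?] /andP[? ?] /andP[? ?] eq.
by apply/andP; split; lra.
Qed.

Lemma ae_exists (P : R -> Prop) : {ae mu, forall x, P x} -> exists x, P x.
Proof.
move=> [A [mA muA sA]]; apply: contrapT => hP.
have AT : A = setT.
  by rewrite predeqE => x; split=> // _; apply: sA => /= hx; apply: hP; exists x.
have : (mu `[0%R, 1%R] <= mu A)%E by apply: le_measure; rewrite ?inE // AT.
rewrite muA; have := @lebesgue_measure_itv R (Interval (BLeft 0) (BRight 1)).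
by rewrite /= lte_fin ltr01 => ->; rewrite -EFinD lee_fin subr0 leNgt ltr01.
Qed.

Lemma ae_and (P Q : R -> Prop) : {ae mu, forall x, P x} -> {ae mu, forall x, Q x} ->
  {ae mu, forall x, P x /\ Q x}.
Proof.
move=> hP hQ; have := negligibleU hP hQ; apply: negligibleS => x /= h.
by apply: contrapT => h'; apply: h; split; apply: contrapT => h2; apply: h'; [left|right].
Qed.

Lemma ae_sub (P Q : R -> Prop) : (forall x, P x -> Q x) -> {ae mu, forall x, P x} ->
  {ae mu, forall x, Q x}.
Proof. by move=> h hP; apply: negligibleS hP => x /= hx ?; apply: hx; exact: h. Qed.

Lemma li_locally f : li f -> locally_integrable setT f.
Proof.
move=> [mf hf]; split=> //; first exact: openT.
move=> K _ cK; have [M [_ hM]] := compact_bounded cK.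
have sK : K `<=` `[- (M + 1), M + 1].
  by move=> x Kx /=; rewrite in_itv /= -ler_norml; apply: (hM (M + 1)) => //; rewrite ltrDl.
have iK : mu.-integrable K (EFin \o f).
  by apply: integrableS (hf (- (M + 1)) (M + 1)) => //; exact: compact_measurable.
have /integrableP[_] := integrable_norm iK.
by under eq_integral do rewrite /= normr_id.
Qed.

(** Almost every point is a Lebesgue point of both functions; any one of them fixes the constant. *)
Lemma weak_primitive f g : f \in Lfun mu 2%:E -> g \in Lfun mu 2%:E -> weak_derivative f g ->
  exists c, {ae mu, forall x, f x = c + oriented_int 0 x g}.
Proof.
move=> /L2_li lf /L2_li lg hw.
have A1 := lebesgue_differentiation (li_locally lf).
have A2 := lebesgue_differentiation (li_locally lg).
have [a [fa ga]] : exists a, lebesgue_pt f a /\ lebesgue_pt g a.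
  exact: ae_exists (ae_and A1 A2).
exists (f a - oriented_int 0 a g).
apply: ae_sub (ae_and A1 A2) => x [fx gx].
have [xa|xa|->] := ltgtP x a.
- have := weak_difference lf lg hw xa fx fa gx ga; rewrite -oint_sub ?(ltW xa) //; lra.
- have := weak_difference lf lg hw xa fa fx ga gx; rewrite -oint_sub ?(ltW xa) //; lra.
- by rewrite subrK.
Qed.

End WeakDerivative.

(** * Regularity and decay of weak solutions *)

Section Regularity.
Variable R : realType.
Local Notation mu := (@lebesgue_measure R).
Implicit Types f g : R -> R.

Lemma ae_finite (J : finType) (P : J -> R -> Prop) : (forall j, {ae mu, forall x, P j x}) ->
  {ae mu, forall x, forall j, P j x}.
Proof.
move=> h; suff H (l : seq J) : {ae mu, forall x, forall j, j \in l -> P j x}.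
  by apply: ae_sub (H (enum J)) => x hx j; apply: hx; rewrite mem_enum.
elim: l => [|j l ih]; first by apply: aeW => x j.
apply: ae_sub (ae_and (h j) ih) => x [h1 h2] i; rewrite inE => /orP[/eqP ->|] //.
exact: h2.
Qed.

Lemma seg_ae a c f g : li f -> li g -> {ae mu, forall x, f x = g x} ->
  seg_int a c f = seg_int a c g.
Proof.
move=> [mf _] [mg _] h; rewrite /seg_int /Rintegral; congr fine; apply: ae_eq_integral => //.
- by apply/measurable_EFinP; exact: measurable_funS mf.
- by apply/measurable_EFinP; exact: measurable_funS mg.
- by apply: ae_sub h => x -> _.
Qed.

Lemma oint_ae f g x : li f -> li g -> {ae mu, forall x, f x = g x} ->
  oriented_int 0 x f = oriented_int 0 x g.
Proof.
by move=> lf lg h; rewrite /oriented_int -!/(seg_int _ _ _) !(seg_ae _ _ lf lg h).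
Qed.

(** Far out the bounded monotone [Psi] gains little over a unit interval, so [F ^+ 2] is small at
    some [z] of it. The derivative of [Psi + F ^+ 2] is [(F + F1) ^+ 2], hence nonnegative, and the
    smallness passes from [z] back to [x]. *)
Lemma vanish_energy (F F1 Psi : R -> R) N : (forall x, dv F x (F1 x)) ->
  (forall x, dv Psi x (F x ^+ 2 + F1 x ^+ 2)) -> (forall x, `|Psi x| <= N) -> vanish F.
Proof.
move=> d dP hN e e0.
have mono x y : x <= y -> Psi x <= Psi y.
  move=> xy; apply: (dv_mono xy (fun x _ => dP x)) => z _.
  by rewrite addr_ge0 ?sqr_ge0.
pose eta := e ^+ 2 / 2; have eta0 : 0 < eta by rewrite divr_gt0 // exprn_gt0.
have hs : has_sup (range Psi).
  split; first by exists (Psi 0), 0.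
  by exists N => _ [x _ <-]; apply: le_trans (hN x); exact: ler_norm.
have [_ [X _ <-] hX] := sup_adherent eta0 hs.
have hsup x : Psi x <= sup (range Psi) by apply: sup_upper_bound hs _ _; exists x.
exists X => x xX.
have x1 : x <= x + 1 by rewrite lerDl.
have [z /andP[z1 z2]] := dv_mvt x1 (fun u _ => dP u).
rewrite addrAC subrr add0r mulr1 => hz.
have : Psi x + F x ^+ 2 <= Psi z + F z ^+ 2.
  apply: (@dv_mono R (fun u => Psi u + F u ^+ 2) (fun u => F u ^+ 2 + F1 u ^+ 2 + 2 * F u ^+ 1 * F1 u) _ _ z1).
    by move=> u _; apply: dvD; [exact: dP|apply: dvX; exact: d].
  by move=> u _; rewrite (_ : _ + _ = (F u + F1 u) ^+ 2) ?sqr_ge0 //; ring.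
move=> hE; rewrite -(@ler_pXn2r _ 2) ?nnegrE ?(ltW e0) // real_normK ?num_real //.
have := mono _ _ z2; have := mono _ _ xX; have := hsup (x + 1); have := sqr_ge0 (F1 z).
have -> : e ^+ 2 = 2 * eta by rewrite /eta; field.
lra.
Qed.

Lemma L2_sq_seg f g : f \in Lfun mu 2%:E -> continuous g -> {ae mu, forall x, f x = g x} ->
  exists2 N, 0 <= N & forall a c, a <= c -> seg_int a c (fun x => g x ^+ 2) <= N.
Proof.
move=> hf cg h; have [N N0 [hN _]] := L2_seg hf; exists N => // a c ac.
rewrite -(@seg_ae a c (fun x => f x ^+ 2)); first exact: hN.
- have hq := Lfun2_integrable_sqr hf.
  split; first by apply/measurable_EFinP; case/integrableP: hq.
  by move=> a' c'; apply: (@integrableS _ _ _ mu setT).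
- by apply: li_continuous => x; apply: (@continuous_comp _ _ _ g (fun y => y ^+ 2)); [exact: cg|exact: exprn_continuous].
- by apply: ae_sub h => x ->.
Qed.

Lemma L2_vanish2 f f1 (F F1 : R -> R) : f \in Lfun mu 2%:E -> f1 \in Lfun mu 2%:E ->
  {ae mu, forall x, f x = F x} -> {ae mu, forall x, f1 x = F1 x} ->
  (forall x, dv F x (F1 x)) -> continuous F1 -> vanish2 F.
Proof.
move=> hf hf1 e e1 d c1; have c0 : continuous F by move=> x; exact: dv_cont (d x).
have [N N0 hN] := L2_sq_seg hf c0 e; have [M M0 hM] := L2_sq_seg hf1 c1 e1.
have cq (G : R -> R) : continuous G -> continuous (fun x : R => G x ^+ 2).
  by move=> cG x; apply: (@continuous_comp _ _ _ G (fun y => y ^+ 2)); [exact: cG|exact: exprn_continuous].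
pose E x := F x ^+ 2 + F1 x ^+ 2.
have cE : continuous E by move=> x; apply: cvgD; exact: cq.
have lE := li_continuous cE.
pose Psi x := oriented_int 0 x E.
have dPsi x : dv Psi x (E x) by exact: oint_dv.
have sE a c : a <= c -> `|seg_int a c E| <= N + M.
  move=> ac; rewrite ger0_norm; last by apply: seg_ge0 => x; rewrite addr_ge0 ?sqr_ge0.
  rewrite segD; [by apply: lerD; [exact: hN|exact: hM]|exact: li_continuous (cq _ c0)|exact: li_continuous (cq _ c1)].
have bPsi x : `|Psi x| <= N + M.
  rewrite /Psi /oriented_int; rewrite -!/(seg_int _ _ E); case: (leP 0 x) => x0; first exact: sE.
  by rewrite normrN; apply: sE; exact: ltW.
split; first exact: vanish_energy d dPsi bPsi.
apply: (@vanish_energy (fun x => F (- x)) (fun x => - F1 (- x)) (fun x => - Psi (- x)) (N + M)).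
- by move=> x; apply: dv_refl.
- by move=> x; apply: dv_eq; [apply: dvN; apply: dv_refl; exact: dPsi|rewrite /E opprK sqrrN].
- by move=> x; rewrite normrN.
Qed.

(** Bootstrap: [f] is almost everywhere the primitive of [f1], so it has a continuous representative
    [G]; then the right-hand side is continuous, [f1] agrees with a primitive of it, and [G] is C^2.
    Square integrability of all three orders gives the limits at both ends. *)
Lemma classical_solution (J : finType) (f f1 f2 : J -> R -> R) (rhs : (J -> R) -> R -> J -> R) :
  (forall j, [/\ f j \in Lfun mu 2%:E, f1 j \in Lfun mu 2%:E & f2 j \in Lfun mu 2%:E]) ->
  (forall j, weak_derivative (f j) (f1 j) /\ weak_derivative (f1 j) (f2 j)) ->
  {ae mu, forall x, forall j, f2 j x = rhs (fun i => f i x) x j} ->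
  (forall G : J -> R -> R, (forall j, continuous (G j)) ->
    forall j, continuous (fun x => rhs (fun i => G i x) x j)) ->
  exists G G1 : J -> R -> R, [/\ forall j x, dv (G j) x (G1 j x),
    forall j x, dv (G1 j) x (rhs (fun i => G i x) x j),
    {ae mu, forall x, forall j, f j x = G j x} &
    forall j, vanish2 (G j) /\ vanish2 (G1 j)].
Proof.
move=> hL hw heq hc.
have [c0 e0] : exists c0 : J -> R, forall j, {ae mu, forall x, f j x = c0 j + oriented_int 0 x (f1 j)}.
  have H j : exists c, {ae mu, forall x, f j x = c + oriented_int 0 x (f1 j)}.
    by have [h1 h2 _] := hL j; exact: weak_primitive h1 h2 (hw j).1.
  by exists (fun j => sval (cid (H j))) => j; exact: (svalP (cid (H j))).
have [c1 e1] : exists c1 : J -> R, forall j, {ae mu, forall x, f1 j x = c1 j + oriented_int 0 x (f2 j)}.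
  have H j : exists c, {ae mu, forall x, f1 j x = c + oriented_int 0 x (f2 j)}.
    by have [_ h1 h2] := hL j; exact: weak_primitive h1 h2 (hw j).2.
  by exists (fun j => sval (cid (H j))) => j; exact: (svalP (cid (H j))).
pose G j x := c0 j + oriented_int 0 x (f1 j).
have cG j : continuous (G j).
  move=> x; apply: cvgD; first exact: cvg_cst.
  by apply: L2_oint_continuous; case: (hL j).
have eG : {ae mu, forall x, forall j, f j x = G j x} by apply: ae_finite.
pose h j x := rhs (fun i => G i x) x j.
have ch j : continuous (h j) by exact: hc.
have eh j : {ae mu, forall x, f2 j x = h j x}.
  apply: ae_sub (ae_and eG heq) => x [h1 h2]; rewrite h2 /h; congr (rhs _ x j).
  by apply/funext => i; rewrite h1.
have l2 j : li (f2 j) by case: (hL j) => _ _; exact: L2_li.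
have l1 j : li (f1 j) by case: (hL j) => _ + _; exact: L2_li.
pose G1 j x := c1 j + oriented_int 0 x (h j).
have e1' j : {ae mu, forall x, f1 j x = G1 j x}.
  by apply: ae_sub (e1 j) => x ->; rewrite /G1 (oint_ae x (l2 j) (li_continuous (ch j)) (eh j)).
have dG1 j x : dv (G1 j) x (h j x).
  apply: dv_eq (_ : dv _ _ (0 + h j x)) _; last by rewrite add0r.
  by apply: dvD; [exact: dv_cst|exact: oint_dv].
have cG1 j : continuous (G1 j) by move=> x; exact: dv_cont (dG1 j x).
have dG j x : dv (G j) x (G1 j x).
  apply: dv_eq (_ : dv _ _ (0 + G1 j x)) _; last by rewrite add0r.
  have -> : G j = fun x => c0 j + oriented_int 0 x (G1 j).
    by apply/funext => u; rewrite /G (oint_ae u (l1 j) (li_continuous (cG1 j)) (e1' j)).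
  by apply: dvD; [exact: dv_cst|exact: oint_dv].
exists G, G1; split=> // j; have [h0 h1 h2] := hL j; split.
  apply: (L2_vanish2 h0 h1 _ (e1' j) (dG j) (cG1 j)).
  by apply: ae_sub eG => x.
exact: (L2_vanish2 h1 h2 (e1' j) (eh j) (dG1 j) (ch j)).
Qed.

End Regularity.

(** * The eigenvalue problem in real components *)

Section Eigenfunction.
Variable R : realType.
Local Notation mu := (@lebesgue_measure R).

Definition ord2 (i : bool) : 'I_2 := if i then lift ord0 ord0 else ord0.
(** Positions of p, q, r, w in the vector: [zc] selects the wave component, [i] the second function
    of the pair. *)
Definition comp4 (zc i : bool) : 'I_(2 + 2) := if zc then rshift 2 (ord2 i) else lshift 2 (ord2 i).
Definition part (k : bool) (z : R[i]) : R := if k then complex.Im z else complex.Re z.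

Lemma comp4_ex (j : 'I_(2 + 2)) : exists zc i, j = comp4 zc i.
Proof.
have ord2_ex (i : 'I_2) : exists k, i = ord2 k.
  case: (unliftP ord0 i) => [i' ->|->]; last by exists false.
  by exists true; rewrite /ord2 (ord1 i').
case: (fintype.splitP j) => i e; have [k ek] := ord2_ex i; [exists false, k|exists true, k];
  by apply/val_inj; rewrite /= e ek.
Qed.

Lemma ones_entry (v : 'cV[R[i]]_2) i :
  ((1%:M + sigma1 R) *m v) (ord2 i) 0 = v (ord2 false) 0 + v (ord2 true) 0.
Proof.
by rewrite !mxE !big_ord_recl big_ord0 !mxE; case: i; rewrite /= addr0 ?add0r ?addr0 !mul1r.
Qed.

Lemma sigma3_entry (v : 'cV[R[i]]_2) (i : bool) :
  (sigma3 R *m v) (ord2 i) 0 = (-1) ^+ i * v (ord2 i) 0.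
Proof.
by rewrite !mxE !big_ord_recl big_ord0 !mxE; case: i; rewrite /= ?mul0r !(addr0, add0r).
Qed.

Lemma col4 (X Y : 'cV[R[i]]_2) (zc i : bool) :
  col_mx X Y (comp4 zc i) 0 = (if zc then Y else X) (ord2 i) 0.
Proof. by rewrite /comp4; case: zc; rewrite ?col_mxEu ?col_mxEd. Qed.

Lemma diag_block_col (A D : 'M[R[i]]_2) (X Y : 'cV[R[i]]_2) :
  block_mx A 0 0 D *m col_mx X Y = col_mx (A *m X) (D *m Y).
Proof. by rewrite mul_block_col !mul0mx addr0 add0r. Qed.

Lemma block_entries (a c b d1 d2 omega s : R) (u w : 'cV[R[i]]_(2 + 2)) (lam : R[i]) :
  - 'i%C *: (Sigma3 R *m (- w + block_mx (omega%:C)%:M 0 0 (s%:C)%:M *m u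
     - block_mx (a%:C *: (1%:M + sigma1 R) + c%:C *: 1%:M) (b%:C *: (1%:M + sigma1 R))
         (b%:C *: (1%:M + sigma1 R)) (d1%:C *: (1%:M + sigma1 R) + d2%:C *: 1%:M) *m u)) = lam *: u ->
  forall zc i : bool,
  - 'i%C * ((-1) ^+ i * (- w (comp4 zc i) 0 + (if zc then s else omega)%:C * u (comp4 zc i) 0
    - ((if zc then d1 else a)%:C * (u (comp4 zc false) 0 + u (comp4 zc true) 0)
       + (if zc then d2 else c)%:C * u (comp4 zc i) 0
       + b%:C * (u (comp4 (~~ zc) false) 0 + u (comp4 (~~ zc) true) 0))))
  = lam * u (comp4 zc i) 0.
Proof.
move=> h zc i; move/matrixP/(_ (comp4 zc i) 0): h; rewrite [in RHS]mxE => <-.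
rewrite [in RHS]mxE; congr (_ * _).
rewrite /Sigma3 -(vsubmxK u) -(vsubmxK w).
set u1 := usubmx u; set u2 := dsubmx u; set w1 := usubmx w; set w2 := dsubmx w.
clearbody u1 u2 w1 w2.
have hO := ones_entry; set O := 1%:M + sigma1 R in hO *; clearbody O.
rewrite diag_block_col mul_block_col !opp_col_mx !add_col_mx diag_block_col !col4.
have DE (M N : 'cV[R[i]]_2) j : (M + N) j 0 = M j 0 + N j 0 by rewrite mxE.
have NE (M : 'cV[R[i]]_2) j : (- M) j 0 = - M j 0 by rewrite mxE.
have ZE z (M : 'cV[R[i]]_2) j : (z *: M) j 0 = z * M j 0 by rewrite mxE.
case: zc; rewrite sigma3_entry; congr (_ * _); rewrite !mulmxDl -!scalemxAl !mul1mx mul_scalar_mx;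
  rewrite !(DE, NE, ZE) !hO //=.
by rewrite [X in _ = _ - X]addrC.
Qed.

Lemma linearized_entries (F : R -> R -> R -> R) omega s m (U V : R -> R) (psi psi2 : R -> 'cV[R[i]]_(2 + 2)) x lam :
  linearized_op F omega s m U V psi psi2 x = lam *: psi x -> forall zc i : bool,
  - 'i%C * ((-1) ^+ i * (- psi2 x (comp4 zc i) 0 + (if zc then s else omega)%:C * psi x (comp4 zc i) 0
    - ((if zc then pot_d1 F U V m x else pot_a F U V m x)%:C
         * (psi x (comp4 zc false) 0 + psi x (comp4 zc true) 0)
       + (if zc then pot_d2 F U V m x else pot_c F U V m x)%:C * psi x (comp4 zc i) 0
       + (pot_b F U V m x)%:C * (psi x (comp4 (~~ zc) false) 0 + psi x (comp4 (~~ zc) true) 0))))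
  = lam * psi x (comp4 zc i) 0.
Proof. exact: block_entries. Qed.

Lemma complex_row (i : bool) (w v q v' q' : R[i]) (om a c b : R) (rho tau : R) :
  - 'i%C * ((-1) ^+ i * (- w + om%:C * v - (a%:C * q + c%:C * v' + b%:C * q'))) = (rho +i* tau) * v ->
  forall k : bool, part k w = om * part k v - a * part k q - c * part k v' - b * part k q'
    + (if i then - tau else tau) * part k v + (if i (+) k then rho else - rho) * - part (~~ k) v.
Proof.
case: w v q v' q' => [w1 w2] [v1 v2] [q1 q2] [p1 p2] [r1 r2].
case: i; rewrite ?expr1 ?expr0 ?mul1r => /eqP; rewrite eq_complex /= => /andP[/eqP e1 /eqP e2] [] /=;
  move: e1 e2; rewrite ?(mul0r, mulr0, subr0, sub0r, addr0, add0r); lra.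
Qed.

Lemma partD k (u v : R[i]) : part k (u + v) = part k u + part k v.
Proof. by case: u v k => [? ?] [? ?] []. Qed.

Lemma comp_continuous3 (G : R -> R -> R -> R) k (U V : R -> R) m : Ck k G -> continuous U -> continuous V ->
  continuous (fun x => G (U x ^+ 2) (V x ^+ 2) m).
Proof.
move=> hG cU cV; have {hG} hc : continuous (fun z : R * R * R => G z.1.1 z.1.2 z.2).
  by case: k hG => [|k] [].
have cq (W : R -> R) : continuous W -> continuous (fun x : R => W x ^+ 2).
  by move=> cG x; apply: (@continuous_comp _ _ _ W (fun y => y ^+ 2)); [exact: cG|exact: exprn_continuous].
move=> x; apply: (@continuous_comp _ _ _ (fun x => (U x ^+ 2, V x ^+ 2, m)) (fun z : R * R * R => G z.1.1 z.1.2 z.2)).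
  exact: (cvg_pair (cvg_pair (cq _ cU x) (cq _ cV x)) (cvg_cst m)).
exact: hc.
Qed.

Lemma sympot_continuous (a c : R -> R) i j : continuous a -> continuous c -> continuous (sympot a c i j).
Proof.
move=> ca cc x; rewrite /sympot; case: (i == j); last exact: ca.
by apply: cvgD; [exact: ca|exact: cc].
Qed.

(** The imaginary part of the eigenvalue is split as [tau0] plus a small [t]: [tau0] goes into the
    constant coefficients, where [omega - tau0] becomes [- k0 ^+ 2], and the rest into [shift]. *)
Lemma eigen_classical (F : R -> R -> R -> R) omega s m (U V : R -> R) (lam : R[i]) (tau0 k0 : R) :
  Ck 3 F -> continuous U -> continuous V -> k0 ^+ 2 = tau0 - omega ->
  linearized_eigenvalue F omega s m U V lam ->
  exists y dy z dz, eigen (omega + tau0) (s + tau0) (s - tau0) k0 (complex.Im lam - tau0) (complex.Re lam)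
    (pot_a F U V m) (pot_c F U V m) (pot_b F U V m) (pot_d1 F U V m) (pot_d2 F U V m) y dy z dz
    /\ ~ (forall i k x, y i k x = 0 /\ z i k x = 0).
Proof.
move=> hF cU cV hk [psi [psi2 [[psi1 [h0 h1 h2 w1 w2]] hne heq]]].
pose f (p : R -> 'cV[R[i]]_(2 + 2)) (j : bool * bool * bool) x := part j.2 (p x (comp4 j.1.1 j.1.2) 0).
set a := pot_a F U V m; set c := pot_c F U V m; set b := pot_b F U V m.
set d1 := pot_d1 F U V m; set d2 := pot_d2 F U V m.
pose P (zc : bool) := if zc then sympot d1 d2 else sympot a c.
set tau := complex.Im lam; set rho := complex.Re lam.
pose rhs (v : bool * bool * bool -> R) x (j : bool * bool * bool) :=
  let: (zc, i, k) := j in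
  (if zc then s else omega) * v j - P zc i false x * v (zc, false, k) - P zc i true x * v (zc, true, k)
  - b x * (v (~~ zc, false, k) + v (~~ zc, true, k))
  + (if i then - tau else tau) * v j + (if i (+) k then rho else - rho) * - v (zc, i, ~~ k).
have fL p : L2_vector p -> forall j, f p j \in Lfun mu 2%:E.
  by move=> hp [[zc i] []]; have [? ?] := hp (comp4 zc i).
have fW p q : weak_derivative_vector p q -> forall j, weak_derivative (f p j) (f q j).
  by move=> hp [[zc i] []]; have [? ?] := hp (comp4 zc i).
have [D1F D2F] : Ck 2 (D1 F) /\ Ck 2 (D2 F) by case: hF => _ [_ [e1 e2 _]]; exact: (conj e1 e2).
have D11F : Ck 1 (D1 (D1 F)) by case: D1F => _ [_ [e1 _ _]]; exact: e1.
have [D12F D22F] : Ck 1 (D1 (D2 F)) /\ Ck 1 (D2 (D2 F)) by case: D2F => _ [_ [e1 e2 _]]; exact: (conj e1 e2).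
have cq (W : R -> R) : continuous W -> continuous (fun x : R => W x ^+ 2).
  by move=> cG x; apply: (@continuous_comp _ _ _ W (fun y => y ^+ 2)); [exact: cG|exact: exprn_continuous].
have ca : continuous a by move=> x; apply: cvgM; [exact: (comp_continuous3 D11F cU cV)|exact: cq].
have cc : continuous c by move=> x; exact: (comp_continuous3 D1F cU cV).
have cb : continuous b.
  move=> x; apply: cvgM; last exact: cV.
  by apply: cvgM; [exact: (comp_continuous3 D12F cU cV)|exact: cU].
have cd1 : continuous d1 by move=> x; apply: cvgM; [exact: (comp_continuous3 D22F cU cV)|exact: cq].
have cd2 : continuous d2 by move=> x; exact: (comp_continuous3 D2F cU cV).
have cP zc i j : continuous (P zc i j).
  by rewrite /P; case: zc; exact: sympot_continuous.
have [||||G [G1 [dG dG1 eG vG]]] := @classical_solution R _ (f psi) (f psi1) (f psi2) rhs.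
- by move=> j; split; exact: fL.
- by move=> j; split; exact: fW.
- apply: ae_sub heq => x /(@linearized_entries F omega s m U V psi psi2) H [[zc i] k].
  have elam : lam = rho +i* tau by rewrite /rho /tau; case: (lam).
  have {}H := H zc i; rewrite [in RHS]elam in H.
  rewrite /f /rhs /= (complex_row H k) !partD.
  by case: (zc); case: (i); rewrite /P /sympot /a /b /c /d1 /d2 /=; ring.
- move=> H cH [[zc i] k] x; rewrite /rhs.
  apply: cvgD; last by apply: cvgM; [exact: cvg_cst|apply: cvgN; exact: cH].
  apply: cvgD; last by apply: cvgM; [exact: cvg_cst|exact: cH].
  apply: cvgB; last by apply: cvgM; [exact: cb|apply: cvgD; exact: cH].
  apply: cvgB; last by apply: cvgM; [exact: cP|exact: cH].
  apply: cvgB; last by apply: cvgM; [exact: cP|exact: cH].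
  by apply: cvgM; [exact: cvg_cst|exact: cH].
pose pick (H : bool * bool * bool -> R -> R) zc i k := H (zc, i, k).
exists (pick G false), (pick G1 false), (pick G true), (pick G1 true); split; last first.
  move=> hz; apply: hne; apply: ae_sub eG => x hx.
  apply/matrixP => j j'; rewrite (ord1 j') [RHS]mxE; have [zc [i ->]] := comp4_ex j.
  have h0k k : part k (psi x (comp4 zc i) 0) = 0.
    have := hx (zc, i, k); rewrite /f /= => ->.
    by have [] := hz i k x; rewrite /pick; case: (zc).
  by apply/eqP; rewrite eq_complex; apply/andP; split; apply/eqP; [exact: h0k false|exact: h0k true].
split.
- by move=> i k x; split; exact: dG.
- move=> i k x; apply: dv_eq; first exact: dG1.
  rewrite /rhs /pick /lin /base /shift /P /= hk -/tau -/rho; case: i => /=; move: (sympot _ _ _ _ _) (sympot _ _ _ _ _) (if _ then rho else - rho) => e1 e2 e3; ring.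
- move=> i k x; apply: dv_eq; first exact: dG1.
  rewrite /rhs /pick /shift /P /= -/tau -/rho; case: i => /=; move: (sympot _ _ _ _ _) (sympot _ _ _ _ _) (if _ then rho else - rho) => e1 e2 e3; ring.
- by move=> i k; have [? ?] := vG (false, i, k); have [? ?] := vG (true, i, k); split.
Qed.
End Eigenfunction.

(** * Jost solutions *)

Section Asymptotics.
Variable R : realType.
Implicit Types (z w nu c : R[i]) (f g dg : R -> R[i]).

Definition cnorm z : R := complex.Re `|z|.

Lemma cnormE z : `|z| = (cnorm z)%:C.
Proof. by rewrite /cnorm normc_def. Qed.

Lemma cnormM z w : cnorm (z * w) = cnorm z * cnorm w.
Proof. by apply: (@complexI R); rewrite -cnormE normrM !cnormE rmorphM. Qed.

Lemma cnormD z w : cnorm (z + w) <= cnorm z + cnorm w.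
Proof. by rewrite -lecR rmorphD /= -!cnormE ler_normD. Qed.

Lemma cnorm_ge0 z : 0 <= cnorm z.
Proof. by rewrite -lecR -cnormE rmorph0 normr_ge0. Qed.

Lemma cnorm0 : cnorm 0 = 0.
Proof. by rewrite /cnorm normr0. Qed.

Lemma cnormN z : cnorm (- z) = cnorm z.
Proof. by rewrite /cnorm normrN. Qed.

Lemma cnorm1 : cnorm 1 = 1.
Proof. by rewrite /cnorm normr1. Qed.

Lemma part_cnorm k z : `|part k z| <= cnorm z.
Proof.
rewrite /cnorm normc_def /= -sqrtr_sqr ler_sqrt ?addr_ge0 ?sqr_ge0 //.
by case: k; rewrite /= ?lerDl ?lerDr sqr_ge0.
Qed.

Lemma cnorm_parts z : cnorm z <= `|complex.Re z| + `|complex.Im z|.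
Proof.
rewrite /cnorm normc_def /= -(@ler_pXn2r _ 2) ?nnegrE ?sqrtr_ge0 ?addr_ge0 //.
rewrite sqr_sqrtr ?addr_ge0 ?sqr_ge0 // sqrrD !real_normK ?num_real //.
by have := mulr_ge0 (normr_ge0 (complex.Re z)) (normr_ge0 (complex.Im z)); rewrite mulr2n; lra.
Qed.

Lemma cnorm_cexp z : cnorm (cexp z) = expR (complex.Re z).
Proof.
rewrite /cexp cnormM /cnorm !normc_def /= cos2Dsin2 sqrtr1 mulr1 expr0n addr0 sqrtr_sqr.
by rewrite ger0_norm // expR_ge0.
Qed.

Lemma cvgy_cnorm g c : (g x @[x --> +oo] --> (c : R[i]^o)) ->
  forall e, 0 < e -> exists X, forall x, X <= x -> cnorm (g x - c) <= e.
Proof.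
move=> h e e0; have e0' : 0 < e%:C by rewrite ltcR.
have [X [_ /= hX]] := (@cvgrPdist_le _ _ _ _ _ (g : R -> R[i]^o) c).1 h _ e0'.
exists (X + 1) => x hx.
have := hX x; rewrite distrC cnormE lecR; apply; lra.
Qed.

Lemma cvgNy_cnorm g c : (g x @[x --> -oo] --> (c : R[i]^o)) ->
  forall e, 0 < e -> exists X, forall x, X <= x -> cnorm (g (- x) - c) <= e.
Proof.
move=> h e e0; have e0' : 0 < e%:C by rewrite ltcR.
have [X [_ /= hX]] := (@cvgrPdist_le _ _ _ _ _ (g : R -> R[i]^o) c).1 h _ e0'.
exists (- X + 1) => x hx.
have := hX (- x); rewrite distrC cnormE lecR; apply; lra.
Qed.

(** The function and its derivative are given separately, so that a left Jost solution enters
    through its reflection and both ends take the same form. *)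
Definition asym nu c g dg := forall e, 0 < e -> exists X, forall x, X <= x ->
  cnorm (cexp (nu * x%:C) * g x - c) <= e /\ cnorm (cexp (nu * x%:C) * dg x + c * nu) <= e.

Lemma right_asym nu c f : right_asymptotics nu c f -> asym nu c f (cderive f).
Proof.
move=> [/cvgy_cnorm h1 /cvgy_cnorm h2] e e0.
have [X hX] := h1 e e0; have [Y hY] := h2 e e0; exists (Num.max X Y) => x.
by rewrite ge_max => /andP[x1 x2]; have := hY _ x2; rewrite opprK; split=> //; exact: hX.
Qed.

Lemma left_asym nu c f : left_asymptotics nu c f ->
  asym nu c (fun x => f (- x)) (fun x => - cderive f (- x)).
Proof.
move=> [/cvgNy_cnorm h1 /cvgNy_cnorm h2] e e0.
have [X hX] := h1 e e0; have [Y hY] := h2 e e0; exists (Num.max X Y) => x.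
rewrite ge_max => /andP[x1 x2]; have := hX _ x1; have := hY _ x2.
rewrite rmorphN mulrNN => k1 k2; split=> //.
by rewrite mulrN -cnormN opprD opprK.
Qed.

Section Consequences.
Variables (nu c : R[i]) (g dg : R -> R[i]).
Hypotheses (nu0 : 0 <= complex.Re nu) (h : asym nu c g dg).

Lemma cnorm_expM x w : 0 <= x -> cnorm w <= cnorm (cexp (nu * x%:C) * w).
Proof.
move=> x0; rewrite cnormM cnorm_cexp ler_peMl ?cnorm_ge0 // -expR0 ler_expR.
by case: (nu) nu0 => a b /= a0; rewrite mulr0 subr0 mulr_ge0.
Qed.

Lemma asym_bounded : exists2 X, 0 <= X & exists K, forall x, X <= x -> cnorm (g x) <= K /\ cnorm (dg x) <= K.
Proof.
have [X hX] := h ltr01; exists (Num.max X 0); first by rewrite le_max lexx orbT.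
exists (1 + cnorm c + cnorm (c * nu)) => x; rewrite ge_max => /andP[x1 x0].
have [h1 h2] := hX _ x1; have := cnorm_ge0 c; have := cnorm_ge0 (c * nu).
have := cnorm_expM (g x) x0; have := cnorm_expM (dg x) x0.
have := cnormD (cexp (nu * x%:C) * g x - c) c; rewrite subrK.
have := cnormD (cexp (nu * x%:C) * dg x + c * nu) (- (c * nu)); rewrite addrK cnormN.
by move=> *; split; lra.
Qed.

(** The limits [c] and [- (c * nu)] cancel in this combination, and on the right the exponential
    factor has modulus at least 1, so it may be dropped. *)
Lemma asym_radiation k : vanish (fun x => part k (dg x + nu * g x)).
Proof.
move=> e e0; have d0 : 0 < 1 + cnorm nu by rewrite ltr_wpDr ?cnorm_ge0.
have [X hX] := h (divr_gt0 e0 d0); exists (Num.max X 0) => x; rewrite ge_max => /andP[x1 x0].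
have [h1 h2] := hX _ x1; apply: le_trans (part_cnorm _ _) _; apply: le_trans (cnorm_expM _ x0) _.
have -> : cexp (nu * x%:C) * (dg x + nu * g x) =
  (cexp (nu * x%:C) * dg x + c * nu) + nu * (cexp (nu * x%:C) * g x - c) by ring.
apply: le_trans (cnormD _ _) _; rewrite cnormM.
rewrite -[leRHS](divfK (lt0r_neq0 d0)) mulrDr mulr1; apply: lerD => //.
by rewrite mulrC; apply: ler_wpM2r => //; exact: cnorm_ge0.
Qed.

(** Either the Jost exponential itself decays, or the limit is 0 and a factor of modulus at least 1
    is dropped. *)
Lemma asym_vanish k : 0 < complex.Re nu \/ c = 0 ->
  vanish (fun x => part k (g x)) /\ vanish (fun x => part k (dg x)).
Proof.
have aux w (u : R -> R[i]) : (forall e, 0 < e -> exists X, forall x, X <= x -> cnorm (cexp (nu * x%:C) * u x - w) <= e) ->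
    0 < complex.Re nu \/ w = 0 -> vanish (fun x => part k (u x)).
  move=> H; case=> [n0|w0].
    have [X hX] := H 1 ltr01.
    have := vanishZ (1 + cnorm w) (vanish_expR n0); apply: (vanish_le (X0 := X)) => x xX.
    apply: le_trans (part_cnorm _ _) _.
    have -> : cnorm (u x) = expR (- (complex.Re nu * x)) * cnorm (cexp (nu * x%:C) * u x).
      rewrite cnormM cnorm_cexp mulrA -expRD; case: (nu) => a b /=.
      by rewrite mulr0 subr0 addNr expR0 mul1r.
    rewrite normrM (ger0_norm (expR_ge0 _)) mulrC; apply: ler_wpM2r; first exact: expR_ge0.
    have := cnormD (cexp (nu * x%:C) * u x - w) w; rewrite subrK.
    have := hX _ xX; have := ler_norm (1 + cnorm w); lra.
  move=> e e0; have [X hX] := H e e0; exists (Num.max X 0) => x; rewrite ge_max => /andP[x1 x0].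
  apply: le_trans (part_cnorm _ _) _; apply: le_trans (cnorm_expM _ x0) _.
  by have := hX _ x1; rewrite w0 subr0.
move=> hc; split.
  by apply: (aux c g) => // e e0; have [X hX] := h e0; exists X => x /hX [].
apply: (aux (- (c * nu)) dg); last by case: hc => [|->]; [left|right; rewrite mul0r oppr0].
by move=> e e0; have [X hX] := h e0; exists X => x /hX []; rewrite opprK.
Qed.

Lemma asym_nonzero : c = 1 -> exists X, forall x, X <= x -> 2^-1 <= cnorm (cexp (nu * x%:C) * g x).
Proof.
move=> c1; have [|X hX] := h (e := 2^-1); first by rewrite invr_gt0.
exists X => x /hX [h1 _]; set E := cexp _ * _ in h1 *.
have := cnormD E (- (E - c)); rewrite cnormN (_ : E - (E - c) = 1) ?cnorm1; last by rewrite c1; ring.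
by move: h1; lra.
Qed.

End Consequences.
End Asymptotics.

(** * Jost solutions as outgoing reference solutions *)

Section References.
Variable R : realType.
Implicit Types (P Q dP dQ f : R -> R[i]).

Definition two P Q (c k : bool) (x : R) := part k ((if c then Q else P) x).

Lemma complex_dv f : ctwice_derivable f -> forall k x,
  dv (fun x => part k (f x)) x (part k (cderive f x)) /\
  dv (fun x => part k (cderive f x)) x (part k (cderive (cderive f) x)).
Proof.
move=> [h1 h2] k x; have [a1 a2] := h1 x; have [b1 b2] := h2 x.
case: k; split.
- exact: (@derivable_dv R (fun y => complex.Im (f y)) x a2).
- exact: (@derivable_dv R (fun y => complex.Im (cderive f y)) x b2).
- exact: (@derivable_dv R (fun y => complex.Re (f y)) x a1).
- exact: (@derivable_dv R (fun y => complex.Re (cderive f y)) x b1).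
Qed.

Lemma solution_A_refsol (F : R -> R -> R -> R) omega U0 (lam : R[i]) k0 p q : complex.Re lam = 0 ->
  k0 ^+ 2 = complex.Im lam - omega -> solution_A F omega U0 lam p q ->
  refsol (omega + complex.Im lam) k0 (sympot (ref_a F U0) (ref_c F U0)) (two p q) (two (cderive p) (cderive q)).
Proof.
move=> lam0 hk [tp tq hp hq]; split=> c k x.
  by case: c; [have [] := complex_dv tq k x|have [] := complex_dv tp k x].
have e : 'i%C * lam = (- complex.Im lam)%:C.
  by case: lam lam0 {hk hp hq} => a b /= ->; apply/eqP; rewrite eq_complex /= !(mul0r, mulr0, mul1r, addr0, sub0r) !eqxx.
have {}hp := hp x; have {}hq := hq x; rewrite e in hp hq.
rewrite -/(ref_a F U0 x) -/(ref_c F U0 x) in hp hq.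
have [_ dp] := complex_dv tp k x; have [_ dq] := complex_dv tq k x.
have ep : part k (cderive (cderive p) x) = (omega + complex.Im lam) * part k (p x)
    - ref_a F U0 x * (part k (p x) + part k (q x)) - ref_c F U0 x * part k (p x).
  move: hp; move: (cderive (cderive p) x) (p x) (q x) => [p1 p2] [a1 a2] [b1 b2] /eqP.
  rewrite eq_complex /= => /andP[/eqP h1 /eqP h2].
  by case: k {dp dq} => /=; move: h1 h2; rewrite ?(mul0r, mulr0, subr0, addr0, add0r); lra.
have eq : part k (cderive (cderive q) x) = (omega - complex.Im lam) * part k (q x)
    - ref_a F U0 x * (part k (p x) + part k (q x)) - ref_c F U0 x * part k (q x).
  move: hq; move: (cderive (cderive q) x) (p x) (q x) => [p1 p2] [a1 a2] [b1 b2] /eqP.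
  rewrite eq_complex /= => /andP[/eqP h1 /eqP h2].
  by case: k {dp dq ep} => /=; move: h1 h2; rewrite ?(mul0r, mulr0, subr0, addr0, add0r); lra.
rewrite /lin /base /sympot; case: c => /=; rewrite ?hk.
  apply: dv_eq; first exact: dq.
  by rewrite eq /two /=; ring.
apply: dv_eq; first exact: dp.
by rewrite ep /two /=; ring.
Qed.

Lemma solution_BC_dv (F : R -> R -> R -> R) s U0 (ka : R) p : solution_BC F s U0 ka%:C p -> forall k x,
  dv (fun x => part k (p x)) x (part k (cderive p x)) /\
  dv (fun x => part k (cderive p x)) x ((s - ka) * part k (p x) - ref_d F U0 x * part k (p x)).
Proof.
move=> [tp hp] k x; have [h1 h2] := complex_dv tp k x; split=> //.
apply: dv_eq; first exact: h2.
have := hp x; rewrite -/(ref_d F U0 x).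
move: (cderive (cderive p) x) (p x) => [p1 p2] [a1 a2] /eqP.
rewrite eq_complex /= => /andP[/eqP e1 /eqP e2].
by case: k {h1 h2} => /=; move: e1 e2; rewrite ?(mul0r, mulr0, subr0, addr0, add0r); lra.
Qed.

Lemma solution_C_refsol (F : R -> R -> R -> R) s U0 (tau : R) k0 p : solution_BC F s U0 (- tau)%:C p ->
  refsol (s + tau) k0 (scalpot (ref_d F U0)) (two p (fun=> 0)) (two (cderive p) (fun=> 0)).
Proof.
move=> hp; have z k : part k (0 : R[i]) = 0 by case: k.
split=> -[] k x; rewrite /two /lin /base /scalpot /= ?z.
- exact: dv_cst.
- by have [] := solution_BC_dv hp k x.
- by apply: dv_eq; [exact: dv_cst|rewrite !mulr0 !mul0r !subr0].
- have [_ h] := solution_BC_dv hp k x; apply: dv_eq; first exact: h.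
  by rewrite opprK !mul0r subr0.
Qed.

Lemma refl_two P Q : refl (two P Q) = two (fun x => P (- x)) (fun x => Q (- x)).
Proof. by apply/funext => -[]. Qed.

Lemma partN k (z : R[i]) : part k (- z) = - part k z.
Proof. by case: z k => ? ? []. Qed.

Lemma reflN_two P Q : reflN (two P Q) = two (fun x => - P (- x)) (fun x => - Q (- x)).
Proof.
by apply/funext => -[]; apply/funext => k; apply/funext => x; rewrite /reflN /two partN.
Qed.

Lemma dv_asym_bounded (nu c : R[i]) (g dg : R -> R[i]) : 0 <= complex.Re nu -> asym nu c g dg ->
  (forall k x, dv (fun x => part k (g x)) x (part k (dg x))) ->
  exists2 K, 0 <= K & forall k x, 0 <= x -> `|part k (g x)| <= K.
Proof.
move=> n0 h d; have [X X0 [K hK]] := asym_bounded n0 h.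
have [K1 K10 h1] := continuous_bounded 0 X (fun x => d true x).
have [K2 K20 h2] := continuous_bounded 0 X (fun x => d false x).
exists (K1 + K2 + `|K|); first by rewrite !addr_ge0.
move=> k x x0; have [xX|/ltW xX] := leP X x.
  have [hg _] := hK x xX; apply: le_trans (part_cnorm _ _) _; apply: le_trans hg _.
  by have := ler_norm K; lra.
have x0X : 0 <= x <= X by rewrite x0.
have := h1 x x0X; have := h2 x x0X; have := normr_ge0 K.
by case: k; lra.
Qed.

(** Everything decays here, so the radiation condition holds whatever [k0] is. *)
Lemma outgoing_fast (A k0 : R) V (nu c c' : R[i]) P Q dP dQ : 0 < complex.Re nu ->
  refsol A k0 V (two P Q) (two dP dQ) -> asym nu c P dP -> asym nu c' Q dQ ->
  outgoing k0 (two P Q) (two dP dQ).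
Proof.
move=> n0 [d _] hP hQ; have n0' := ltW n0.
have [K1 K10 h1] := dv_asym_bounded n0' hP (d false).
have [K2 K20 h2] := dv_asym_bounded n0' hQ (d true).
have vP k := asym_vanish n0' hP k (or_introl n0); have vQ k := asym_vanish n0' hQ k (or_introl n0).
split.
- exists (K1 + K2); first by rewrite addr_ge0.
  move=> [] k x x0; [apply: le_trans (h2 k x x0) _|apply: le_trans (h1 k x x0) _]; lra.
- by move=> k; exact: (vP k).1.
- by move=> k; exact: (vP k).2.
- apply: vanishD; first exact: (vQ false).2.
  by apply: vanishN; apply: vanishZ; exact: (vQ true).1.
- apply: vanishD; first exact: (vQ true).2.
  by apply: vanishZ; exact: (vQ false).1.
Qed.

Lemma outgoing_slow (A k0 : R) V (c : R[i]) P Q dP dQ :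
  refsol A k0 V (two P Q) (two dP dQ) -> asym (0 +i* k0) 0 P dP -> asym (0 +i* k0) c Q dQ ->
  outgoing k0 (two P Q) (two dP dQ).
Proof.
move=> [d _] hP hQ; have n0 : 0 <= complex.Re (0 +i* k0) by [].
have [K1 K10 h1] := dv_asym_bounded n0 hP (d false).
have [K2 K20 h2] := dv_asym_bounded n0 hQ (d true).
have vP k := asym_vanish n0 hP k (or_intror erefl).
split.
- exists (K1 + K2); first by rewrite addr_ge0.
  move=> [] k x x0; [apply: le_trans (h2 k x x0) _|apply: le_trans (h1 k x x0) _]; lra.
- by move=> k; exact: (vP k).1.
- by move=> k; exact: (vP k).2.
- have := asym_radiation n0 hQ false; apply: (vanish_le (X0 := 0)) => x _.
  by rewrite /two partD; case: (Q x) => a b /=; rewrite mul0r sub0r.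
- have := asym_radiation n0 hQ true; apply: (vanish_le (X0 := 0)) => x _.
  by rewrite /two partD; case: (Q x) => a b /=; rewrite mul0r add0r.
Qed.

Lemma unit_control n (M : 'M[R[i]]_n) : \det M != 0 -> exists2 C : R, 0 <= C &
  forall (v : 'rV_n) B, 0 <= B -> (forall j, cnorm ((v *m M) 0 j) <= B) -> forall i, cnorm (v 0 i) <= C * B.
Proof.
move=> hM; have uM : M \in unitmx by rewrite unitmxE unitfE.
have csum (I : finType) (G : I -> R[i]) : cnorm (\sum_i G i) <= \sum_i cnorm (G i).
  elim/big_ind2: _ => [|x1 x2 y1 y2 h1 h2|//]; first by rewrite cnorm0.
  by apply: le_trans (cnormD _ _) _; exact: lerD.
exists (\sum_j \sum_i cnorm (invmx M j i)).
  by apply: sumr_ge0 => j _; apply: sumr_ge0 => i _; exact: cnorm_ge0.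
move=> v B B0 h i; have -> : v = (v *m M) *m invmx M by rewrite mulmxK.
rewrite mxE; apply: le_trans (csum _ _) _; rewrite mulr_suml; apply: ler_sum => j _.
rewrite cnormM mulrC; apply: ler_pM; rewrite ?cnorm_ge0 //.
rewrite (bigD1 i) //= lerDl; apply: sumr_ge0 => i' _; exact: cnorm_ge0.
Qed.

Definition cval (y : bool -> bool -> R -> R) c x : R[i] := y c false x +i* y c true x.

Lemma wron_complex P Q dP dQ y dy x :
  dP x * cval y false x - P x * cval dy false x + (dQ x * cval y true x - Q x * cval dy true x) =
  wron_re (two P Q) (two dP dQ) y dy x +i* wron_im (two P Q) (two dP dQ) y dy x.
Proof.
rewrite /wron_re /wron_im /wron /two /cval /=.
move: (P x) (Q x) (dP x) (dQ x) => [a1 a2] [b1 b2] [e1 e2] [g1 g2].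
by apply/eqP; rewrite eq_complex /=; apply/andP; split; apply/eqP; ring.
Qed.

Lemma pairing_cnorm P Q dP dQ y dy B : small_pairing (two P Q) (two dP dQ) y dy B ->
  cnorm (dP 0 * cval y false 0 - P 0 * cval dy false 0 + (dQ 0 * cval y true 0 - Q 0 * cval dy true 0)) <= 2 * B.
Proof.
by move=> [h1 h2]; rewrite wron_complex; apply: le_trans (cnorm_parts _) _ => /=; lra.
Qed.

Lemma cval_part y c k x : `|y c k x| <= cnorm (cval y c x).
Proof. by apply: le_trans (part_cnorm k _); case: k. Qed.

(** The columns of the Evans matrix are the Cauchy data of the Jost solutions, so the row (- y', y)
    times this matrix lists the four pairings, and its inverse recovers the data. The factor 2
    passes from the two real parts to the modulus. *)
Lemma evans_A_ctrl (p1 q1 p2 q2 p5 q5 p6 q6 : R[i] -> R -> R[i]) lam :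
  evans_A p1 q1 p2 q2 p5 q5 p6 q6 lam != 0 -> exists2 C : R, 0 <= C & forall y dy,
  ctrl C (two (p5 lam) (q5 lam)) (two (cderive (p5 lam)) (cderive (q5 lam)))
         (two (p6 lam) (q6 lam)) (two (cderive (p6 lam)) (cderive (q6 lam)))
         (two (p1 lam) (q1 lam)) (two (cderive (p1 lam)) (cderive (q1 lam)))
         (two (p2 lam) (q2 lam)) (two (cderive (p2 lam)) (cderive (q2 lam))) y dy.
Proof.
rewrite /evans_A; set M := (X in \det X); move=> /unit_control[C C0 hC]; exists (C * 2); first by rewrite mulr_ge0.
move=> y dy B B0 /pairing_cnorm h5 /pairing_cnorm h6 /pairing_cnorm h1 /pairing_cnorm h2.
pose v : 'rV[R[i]]_4 := \row_(j < 4) nth 0 [:: - cval dy false 0; - cval dy true 0; cval y false 0; cval y true 0] j.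
have {}hC := hC v (2 * B) (mulr_ge0 (ler0n _ _) B0).
have hv : forall j, cnorm ((v *m M) 0 j) <= 2 * B.
  have pf (a b c d e f g h : R[i]) : - a * b + (- c * d + (e * f + g * h)) = f * e - b * a + (h * g - d * c) by ring.
  move=> j; rewrite mxE !big_ord_recl big_ord0 !mxE /= addr0.
  case: j => -[|[|[|[|//]]]] /= _; rewrite pf //.
have {hC hv} h := hC hv.
have g3 := h (inord 0); have g4 := h (inord 1); have g1 := h (inord 2); have g2 := h (inord 3).
move: g1 g2 g3 g4; rewrite !mxE !inordK //= !cnormN !mulrA => g1 g2 g3 g4.
move=> i k; split; [apply: le_trans (cval_part y i k 0) _|apply: le_trans (cval_part dy i k 0) _]; by case: i.
Qed.

(** The scalar equation has one reference solution on each side; each is listed twice because [ctrl]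
    expects four. *)
Lemma evans_C_ctrl (p3 p7 : R[i] -> R -> R[i]) lam :
  evans_BC p3 p7 lam != 0 -> exists2 C : R, 0 <= C & forall u du,
  ctrl C (two (p7 lam) (fun=> 0)) (two (cderive (p7 lam)) (fun=> 0))
         (two (p7 lam) (fun=> 0)) (two (cderive (p7 lam)) (fun=> 0))
         (two (p3 lam) (fun=> 0)) (two (cderive (p3 lam)) (fun=> 0))
         (two (p3 lam) (fun=> 0)) (two (cderive (p3 lam)) (fun=> 0)) (pad u) (pad du).
Proof.
rewrite /evans_BC; set M := (X in \det X); move=> /unit_control[C C0 hC]; exists (C * 2); first by rewrite mulr_ge0.
move=> u du B B0 /pairing_cnorm h7 _ /pairing_cnorm h3 _.
set y := pad u in h7 h3 *; set dy := pad du in h7 h3 *.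
pose v : 'rV[R[i]]_2 := \row_(j < 2) nth 0 [:: - cval dy false 0; cval y false 0] j.
have {}hC := hC v (2 * B) (mulr_ge0 (ler0n _ _) B0).
have hv : forall j, cnorm ((v *m M) 0 j) <= 2 * B.
  have pf (a b e f g h : R[i]) : - a * b + e * f = f * e - b * a + (0 * g - 0 * h) by ring.
  move=> j; rewrite mxE !big_ord_recl big_ord0 !mxE /= addr0.
  by case: j => -[|[|//]] /= _; rewrite (pf _ _ _ _ (cval y true 0) (cval dy true 0)).
have {hC hv} h := hC hv.
have g3 := h (inord 0); have g1 := h (inord 1).
move: g1 g3; rewrite !mxE !inordK //= !cnormN !mulrA => g1 g3.
have CB : 0 <= C * 2 * B by rewrite !mulr_ge0.
case=> k; first by rewrite /y /dy /pad /= normr0.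
by split; [apply: le_trans (cval_part y false k 0) _|apply: le_trans (cval_part dy false k 0) _].
Qed.

End References.

(** * Square roots of real numbers in the two branches *)

Section Branches.
Variable R : realType.
Implicit Types z nu : R[i].

(** A real square means [cos th * sin th = 0]: the root lies on one of the axes, and the range of
    the angle decides which half. *)
Lemma sqrt_branch_parts th1 th2 z nu : sqrt_branch th1 th2 z nu -> complex.Im z = 0 ->
  exists r th, [/\ 0 < r, th1 < th /\ th < th2, complex.Re nu = r * cos th, complex.Im nu = r * sin th &
    cos th * sin th = 0 /\ complex.Re z = r ^+ 2 * (cos th ^+ 2 - sin th ^+ 2)].
Proof.
move=> [e [r [th [r0 h1 h2 enu]]]] z0; exists r, th.
have [er ei] : complex.Re nu = r * cos th /\ complex.Im nu = r * sin th.
  by rewrite enu /= !mul0r subr0 addr0.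
have : complex.Im (nu ^+ 2) = 0 by rewrite e.
have : complex.Re (nu ^+ 2) = complex.Re z by rewrite e.
case: (nu) er ei => a b /= -> -> hr hi; split=> //; split; last by rewrite -hr; ring.
apply: (mulfI (lt0r_neq0 (exprn_gt0 2 r0))); rewrite mulr0.
by move: hi; lra.
Qed.

Lemma sqrt_branch_right z nu : sqrt_branch (- (3 * pi / 4)) (pi / 4) z nu ->
  complex.Im z = 0 -> 0 < complex.Re z -> 0 < complex.Re nu.
Proof.
have p0 := pi_gt0 R.
move=> h z0 zp; have [r [th [r0 [h1 h2] -> _ [cs ez]]]] := sqrt_branch_parts h z0.
apply: mulr_gt0 => //; have [t0|t0] := leP 0 th.
  by apply: cos_gt0_pihalf; apply/andP; split; lra.
have : 0 < sin (- th) by apply: sin_gt0_pi; apply/andP; split; lra.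
rewrite sinN oppr_gt0 => sn; move/eqP: cs; rewrite mulf_eq0 (lt_eqF sn) orbF => /eqP c0.
by move: zp; rewrite ez c0 expr0n sub0r mulrN oppr_gt0 ltNge mulr_ge0 ?sqr_ge0.
Qed.

Lemma sqrt_branch_left z nu : sqrt_branch (- (pi / 4)) (3 * pi / 4) z nu ->
  complex.Im z = 0 -> 0 < complex.Re z -> 0 < complex.Re nu.
Proof.
have p0 := pi_gt0 R.
move=> h z0 zp; have [r [th [r0 [h1 h2] -> _ [cs ez]]]] := sqrt_branch_parts h z0.
apply: mulr_gt0 => //; have [t0|t0] := leP th 0.
  by apply: cos_gt0_pihalf; apply/andP; split; lra.
have sn : 0 < sin th by apply: sin_gt0_pi; apply/andP; split; lra.
move/eqP: cs; rewrite mulf_eq0 (gt_eqF sn) orbF => /eqP c0.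
by move: zp; rewrite ez c0 expr0n sub0r mulrN oppr_gt0 ltNge mulr_ge0 ?sqr_ge0.
Qed.

(** The range of the angle contains pi/2 but not - pi/2, which selects the root with positive
    imaginary part. *)
Lemma sqrt_branch_imag z nu : sqrt_branch (- (pi / 4)) (3 * pi / 4) z nu ->
  complex.Im z = 0 -> complex.Re z < 0 ->
  [/\ nu = 0 +i* complex.Im nu, 0 < complex.Im nu & complex.Im nu ^+ 2 = - complex.Re z].
Proof.
have p0 := pi_gt0 R.
move=> h z0 zp; have [r [th [r0 [h1 h2] er ei [cs ez]]]] := sqrt_branch_parts h z0.
have c0 : cos th = 0.
  move/eqP: cs; rewrite mulf_eq0 => /orP[/eqP //|/eqP s0].
  by move: zp; rewrite ez s0 expr0n subr0 ltNge mulr_ge0 ?sqr_ge0.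
have s0 : 0 < sin th.
  have [t0|t0] := leP th 0.
    by have : 0 < cos th by [apply: cos_gt0_pihalf; apply/andP; split; lra]; rewrite c0 ltxx.
  by apply: sin_gt0_pi; apply/andP; split; lra.
split.
- by case: (nu) er => a b /=; rewrite c0 mulr0 => ->.
- by rewrite ei mulr_gt0.
- by rewrite ei ez c0 expr0n sub0r mulrN opprK exprMn.
Qed.

End Branches.

(** * Uniqueness, combinations and conserved Wronskians *)

Section Linear.
Variable R : realType.
Variables (A0 k0 gam v : R) (V : bool -> bool -> R -> R).
Hypotheses (A00 : 0 < A0) (gam0 : 0 < gam) (v0 : 0 <= v)
  (hV : forall c c' x, `|V c c' x| <= v * expR (- (gam * `|x|))).
Implicit Types (P Q dP dQ : R -> R[i]).

Lemma refsol_zero_half S dS (W : bool -> bool -> R -> R) : (forall c c' x, 0 <= x -> `|W c c' x| <= v * expR (- (gam * x))) ->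
  refsol A0 k0 W S dS -> (forall c k, S c k 0 = 0 /\ dS c k 0 = 0) ->
  forall c k x, 0 <= x -> S c k x = 0 /\ dS c k x = 0.
Proof.
move=> hW [d1 d2] z c k x x0.
have [D D1 H] := @growth_bound R A0 k0 gam v W A00 gam0 v0 hW x.
have x0x : 0 <= x <= x by rewrite x0 lexx.
have [h1 h2] : `|S c k x| <= D * (3 * 0 + 2 * 0) /\ `|dS c k x| <= D * (3 * 0 + 2 * 0).
  apply: (H S dS (fun c k x => lin A0 k0 W S c k x) 0 0 (lexx 0) (lexx 0) d1 d2 _ _ _ c k x x0x).
  - by move=> c' k' x' _; rewrite subrr normr0.
  - by move=> c' k'; rewrite (z c' k').1 normr0.
  - by move=> c' k'; rewrite (z c' k').2 normr0.
move: h1 h2; rewrite !(mulr0, addr0) !normr_le0 => /eqP ? /eqP ?; by split.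
Qed.

Lemma refsol_zero S dS : refsol A0 k0 V S dS -> (forall c k, S c k 0 = 0 /\ dS c k 0 = 0) ->
  forall c k x, S c k x = 0 /\ dS c k x = 0.
Proof.
move=> h z c k x; have [x0|x0] := leP 0 x.
  apply: refsol_zero_half h z c k x x0 => c' k' x' x0'.
  by apply: le_trans (hV _ _ _) _; rewrite ger0_norm.
have x0' : 0 <= - x by rewrite oppr_ge0 ltW.
have [h1 h2] : refl S c k (- x) = 0 /\ reflN dS c k (- x) = 0.
  apply: (refsol_zero_half _ (refsol_refl h) _ c k x0').
  - by move=> c' k' u u0; apply: le_trans (hV _ _ _) _; rewrite normrN ger0_norm.
  - by move=> c' k'; rewrite /refl /reflN oppr0 (z c' k').1 (z c' k').2 oppr0.
move: h1 h2; rewrite /refl /reflN opprK => -> /eqP; rewrite oppr_eq0 => /eqP ->; by split.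
Qed.

Lemma dv_ext (f g : R -> R) x l : (forall u, f u = g u) -> dv g x l -> dv f x l.
Proof. by move=> h; have -> : f = g by apply/funext. Qed.

Lemma part_comb k (al z w : R[i]) : part k (al * z + w) = part false al * part k z +
  (if k then part true al else - part true al) * part (~~ k) z + part k w.
Proof. by case: k al z w => -[a b] [c d] [e f] /=; ring. Qed.

Lemma refsol_comb (al : R[i]) P Q dP dQ P' Q' dP' dQ' :
  refsol A0 k0 V (two P Q) (two dP dQ) -> refsol A0 k0 V (two P' Q') (two dP' dQ') ->
  refsol A0 k0 V (two (fun x => al * P x + P' x) (fun x => al * Q x + Q' x))
    (two (fun x => al * dP x + dP' x) (fun x => al * dQ x + dQ' x)).
Proof.
move=> [d1 d2] [e1 e2].
have E (p q p' q' : R -> R[i]) c k x : two (fun x => al * p x + p' x) (fun x => al * q x + q' x) c k x =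
  part false al * two p q c k x + (if k then part true al else - part true al) * two p q c (~~ k) x
  + two p' q' c k x by rewrite /two; case: c; rewrite part_comb.
have D f g h (c1 c2 : R) x a b e : dv f x a -> dv g x b -> dv h x e ->
    dv (fun x => c1 * f x + c2 * g x + h x) x (c1 * a + c2 * b + e).
  move=> hf hg hh; apply: dv_eq; first by apply: dvD hh; apply: dvD; apply: dvM; [exact: dv_cst|exact: hf|exact: dv_cst|exact: hg].
  by rewrite /=; ring.
split=> c k x; apply: (dv_ext (E _ _ _ _ c k)).
  rewrite E; exact: (D _ _ _ _ _ x _ _ _ (d1 c k x) (d1 c (~~ k) x) (e1 c k x)).
apply: dv_eq; first exact: (D _ _ _ _ _ x _ _ _ (d2 c k x) (d2 c (~~ k) x) (e2 c k x)).
by rewrite /lin !E; ring.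
Qed.

(** All coefficients are real for a purely imaginary spectral parameter. Conjugation turns an
    outgoing solution into an incoming one. *)
Lemma refsol_conj P Q dP dQ : refsol A0 k0 V (two P Q) (two dP dQ) ->
  refsol A0 k0 V (two (fun x => (P x)^*) (fun x => (Q x)^*)) (two (fun x => (dP x)^*) (fun x => (dQ x)^*)).
Proof.
move=> [d1 d2].
have E (p q : R -> R[i]) c k x : two (fun x => (p x)^*) (fun x => (q x)^*) c k x = (if k then -1 else 1) * two p q c k x.
  by rewrite /two; case: c; [case: (q x)|case: (p x)] => a b; case: k; rewrite /= ?mulN1r ?mul1r.
have D f (s : R) x a : dv f x a -> dv (fun x => s * f x) x (s * a).
  by move=> hf; apply: dv_eq; [apply: dvM; [exact: dv_cst|exact: hf]|rewrite mul0r addr0].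
split=> c k x; apply: (dv_ext (E _ _ c k)); first by rewrite E; exact: (D _ _ x _ (d1 c k x)).
by apply: dv_eq; [exact: (D _ _ x _ (d2 c k x))|rewrite /lin !E; ring].
Qed.

Lemma two_zero P Q : (forall c k x, two P Q c k x = 0) -> forall x, P x = 0 /\ Q x = 0.
Proof.
move=> h x; split; apply/eqP; rewrite eq_complex; apply/andP; split; apply/eqP.
- exact: (h false false x).
- exact: (h false true x).
- exact: (h true false x).
- exact: (h true true x).
Qed.

Lemma refsol_zero_complex P Q dP dQ : refsol A0 k0 V (two P Q) (two dP dQ) ->
  P 0 = 0 -> Q 0 = 0 -> dP 0 = 0 -> dQ 0 = 0 -> forall x, [/\ P x = 0, Q x = 0, dP x = 0 & dQ x = 0].
Proof.
move=> h p0 q0 dp0 dq0.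
have p0' k : part k (0 : R[i]) = 0 by case: k.
have z c k : two P Q c k 0 = 0 /\ two dP dQ c k 0 = 0.
  by rewrite /two; case: c; rewrite ?p0 ?q0 ?dp0 ?dq0 p0'.
have H := refsol_zero h z.
by move=> x; have [? ?] := two_zero (fun c k x => (H c k x).1) x;
  have [? ?] := two_zero (fun c k x => (H c k x).2) x.
Qed.

Hypothesis Vsym : forall x, V true false x = V false true x.

Definition cwron P Q dP dQ P' Q' dP' dQ' (x : R) : R[i] :=
  dP x * P' x - P x * dP' x + (dQ x * Q' x - Q x * dQ' x).

Lemma wron_const S dS y dy j k x : refsol A0 k0 V S dS -> refsol A0 k0 V y dy ->
  wron S dS j y dy k x = wron S dS j y dy k 0.
Proof.
move=> h [d1 d2]; have dw u : dv (wron S dS j y dy k) u 0.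
  apply: dv_eq; first by apply: (wron_dv Vsym) h d1 d2.
  by rewrite !subrr !mulr0 addr0 oppr0.
have lip a c : a <= c -> wron S dS j y dy k c = wron S dS j y dy k a.
  move=> ac; have := @dv_lip R (wron S dS j y dy k) (fun=> 0) a c 0 ac (fun u _ => dw u).
  rewrite mul0r => h'; apply/eqP; rewrite -subr_eq0 -normr_le0; apply: h' => *.
  by rewrite normr0.
by have [x0|/ltW x0] := leP 0 x; [exact: lip|symmetry; exact: lip].
Qed.

Lemma cwron_two P Q dP dQ P' Q' dP' dQ' x : cwron P Q dP dQ P' Q' dP' dQ' x =
  wron_re (two P Q) (two dP dQ) (two P' Q') (two dP' dQ') x +i*
  wron_im (two P Q) (two dP dQ) (two P' Q') (two dP' dQ') x.
Proof.
rewrite -wron_complex /cwron /cval /two /=.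
by case: (P' x) (Q' x) (dP' x) (dQ' x) => [? ?] [? ?] [? ?] [? ?].
Qed.

Lemma cwron_const P Q dP dQ P' Q' dP' dQ' x : refsol A0 k0 V (two P Q) (two dP dQ) ->
  refsol A0 k0 V (two P' Q') (two dP' dQ') ->
  cwron P Q dP dQ P' Q' dP' dQ' x = cwron P Q dP dQ P' Q' dP' dQ' 0.
Proof. by move=> h h'; rewrite !cwron_two /wron_re /wron_im !(wron_const _ _ x h h'). Qed.

End Linear.

(** * Boundedness of the normalized Jost solution (p_2, q_2) *)

Section Bounded.
Variable R : realType.
Implicit Types f g : R -> R[i].

Definition rbd f := exists K : R, forall x, 0 <= x -> cnorm (f x) <= K.

Lemma rbdD f g : rbd f -> rbd g -> rbd (fun x => f x + g x).
Proof.
move=> [K hK] [L hL]; exists (K + L) => x x0; apply: le_trans (cnormD _ _) _.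
by apply: lerD; [exact: hK|exact: hL].
Qed.

Lemma rbdZ (c : R[i]) f : rbd f -> rbd (fun x => c * f x).
Proof.
move=> [K hK]; exists (cnorm c * K) => x x0; rewrite cnormM.
by apply: ler_wpM2l; [exact: cnorm_ge0|exact: hK].
Qed.

Lemma rbd_conj f : rbd f -> rbd (fun x => (f x)^*).
Proof. by move=> [K hK]; exists K => x x0; rewrite /cnorm normcJ; exact: hK. Qed.

Lemma rbd_eventually f (h : bool -> R -> R) : (forall k x, dv (fun x => part k (f x)) x (h k x)) ->
  (exists2 X, 0 <= X & exists K, forall x, X <= x -> cnorm (f x) <= K) -> rbd f.
Proof.
move=> d [X X0 [K hK]].
have [K1 K10 h1] := continuous_bounded 0 X (fun x => d true x).
have [K2 K20 h2] := continuous_bounded 0 X (fun x => d false x).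
exists (K1 + K2 + `|K|) => x x0; have [xX|/ltW xX] := leP X x.
  by apply: le_trans (hK x xX) _; have := ler_norm K; lra.
have x0X : 0 <= x <= X by rewrite x0.
apply: le_trans (cnorm_parts _) _; have := h1 x x0X; have := h2 x x0X; have := normr_ge0 K.
by rewrite /=; lra.
Qed.

Lemma asym_rbd (nu c : R[i]) f g (h h' : bool -> R -> R) : 0 <= complex.Re nu -> asym nu c f g ->
  (forall k x, dv (fun x => part k (f x)) x (h k x)) ->
  (forall k x, dv (fun x => part k (g x)) x (h' k x)) -> rbd f /\ rbd g.
Proof.
move=> n0 ha d d'; have [X X0 [K hK]] := asym_bounded n0 ha.
by split; [apply: rbd_eventually d _|apply: rbd_eventually d' _]; exists X => //; exists K => x /hK [].
Qed.

Lemma evans_A_solve (p1 q1 p2 q2 p5 q5 p6 q6 : R[i] -> R -> R[i]) lam :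
  evans_A p1 q1 p2 q2 p5 q5 p6 q6 lam != 0 -> forall d0 d1 d2 d3 : R[i], exists a b c e,
  [/\ p1 lam 0 * a + p2 lam 0 * b + p5 lam 0 * c + p6 lam 0 * e = d0,
      q1 lam 0 * a + q2 lam 0 * b + q5 lam 0 * c + q6 lam 0 * e = d1,
      cderive (p1 lam) 0 * a + cderive (p2 lam) 0 * b + cderive (p5 lam) 0 * c + cderive (p6 lam) 0 * e = d2 &
      cderive (q1 lam) 0 * a + cderive (q2 lam) 0 * b + cderive (q5 lam) 0 * c + cderive (q6 lam) 0 * e = d3].
Proof.
rewrite /evans_A; set M := (X in \det X) => hM d0 d1 d2 d3.
have uM : M \in unitmx by rewrite unitmxE unitfE.
pose D : 'cV[R[i]]_4 := \col_(j < 4) nth 0 [:: d0; d1; d2; d3] j.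
pose w := invmx M *m D; have hw : M *m w = D by rewrite mulKVmx.
clearbody w.
exists (w ord0 0), (w (lift ord0 ord0) 0), (w (lift ord0 (lift ord0 ord0)) 0), (w (lift ord0 (lift ord0 (lift ord0 ord0))) 0).
have H (i : 'I_4) : \sum_j M i j * w j 0 = D i 0 by rewrite -hw mxE.
have H0 := H (inord 0); have H1 := H (inord 1); have H2 := H (inord 2); have H3 := H (inord 3).
split; [move: H0|move: H1|move: H2|move: H3];
  by rewrite !big_ord_recl big_ord0 !mxE inordK //= addr0 !addrA.
Qed.

(** An expansion in the four Jost solutions is paired with (p5, q5), whose data are written through
    those of (p1, q1). The pairings with 5, 6 and 2 vanish and the one with 1 is - 2 Delta_1, which
    isolates the coefficient [a]. *)
Lemma jost_algebra (P1 Q1 dP1 dQ1 P2 Q2 dP2 dQ2 P6 Q6 dP6 dQ6 a b c e : R[i]) :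
  - dP1 * (P1 * a + P2 * b + P1 * c + P6 * e) - P1 * (dP1 * a + dP2 * b + - dP1 * c + dP6 * e)
  + (- dQ1 * (Q1 * a + Q2 * b + Q1 * c + Q6 * e) - Q1 * (dQ1 * a + dQ2 * b + - dQ1 * c + dQ6 * e)) = 0 ->
  - dP1 * P6 - P1 * dP6 + (- dQ1 * Q6 - Q1 * dQ6) = 0 ->
  dP2 * P1 + dQ2 * Q1 - P2 * - dP1 - Q2 * - dQ1 = 0 ->
  a * (P1 * dP1 + Q1 * dQ1) = 0.
Proof.
move=> h1 h2 h3; apply: (@mulfI _ (2 : R[i])); first by rewrite pnatr_eq0.
rewrite mulr0; have -> : 2 * (a * (P1 * dP1 + Q1 * dQ1)) =
  - (- dP1 * (P1 * a + P2 * b + P1 * c + P6 * e) - P1 * (dP1 * a + dP2 * b + - dP1 * c + dP6 * e)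
  + (- dQ1 * (Q1 * a + Q2 * b + Q1 * c + Q6 * e) - Q1 * (dQ1 * a + dQ2 * b + - dQ1 * c + dQ6 * e)))
  + e * (- dP1 * P6 - P1 * dP6 + (- dQ1 * Q6 - Q1 * dQ6))
  - b * (dP2 * P1 + dQ2 * Q1 - P2 * - dP1 - Q2 * - dQ1) by ring.
by rewrite h1 h2 h3 !mulr0 oppr0 !addr0.
Qed.

Section JostBounded.
Variables (A0 k0 gam v : R) (V : bool -> bool -> R -> R).
Hypotheses (A00 : 0 < A0) (k00 : 0 < k0) (gam0 : 0 < gam) (v0 : 0 <= v)
  (hV : forall c c' x, `|V c c' x| <= v * expR (- (gam * `|x|)))
  (Vsym : forall x, V true false x = V false true x).
Variables (p1 q1 p2 q2 p5 q5 p6 q6 : R[i] -> R -> R[i]) (lam nu1 : R[i]).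
Let sol (p q : R[i] -> R -> R[i]) := refsol A0 k0 V (two (p lam) (q lam)) (two (cderive (p lam)) (cderive (q lam))).
Hypotheses (r1 : sol p1 q1) (r2 : sol p2 q2) (r5 : sol p5 q5) (r6 : sol p6 q6)
  (hE : evans_A p1 q1 p2 q2 p5 q5 p6 q6 lam != 0)
  (n1 : 0 < complex.Re nu1)
  (ap5 : asym nu1 1 (p5 lam) (cderive (p5 lam))) (aq5 : asym nu1 0 (q5 lam) (cderive (q5 lam)))
  (ap6 : asym (0 +i* k0) 0 (p6 lam) (cderive (p6 lam))) (aq6 : asym (0 +i* k0) 1 (q6 lam) (cderive (q6 lam)))
  (hp5 : forall x : R, p5 lam x = p1 lam (- x) /\ q5 lam x = q1 lam (- x))
  (hp2 : cderive (p2 lam) 0 * p5 lam 0 + cderive (q2 lam) 0 * q5 lam 0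
    - p2 lam 0 * cderive (p5 lam) 0 - q2 lam 0 * cderive (q5 lam) 0 = 0)
  (hD : Delta p1 q1 lam != 0).

Let W (p q p' q' : R[i] -> R -> R[i]) x := cwron (p lam) (q lam) (cderive (p lam)) (cderive (q lam))
  (p' lam) (q' lam) (cderive (p' lam)) (cderive (q' lam)) x.

Lemma cderive_reflection (f g : R -> R[i]) : (forall k x, dv (fun x => part k (f x)) x (part k (cderive f x))) ->
  (forall k x, dv (fun x => part k (g x)) x (part k (cderive g x))) ->
  (forall x, f x = g (- x)) -> cderive f 0 = - cderive g 0.
Proof.
move=> df dg h; have e k : part k (cderive f 0) = part k (- cderive g 0).
  rewrite partN.
  have [_ <-] := df k 0; have : dv (fun x => part k (g (- x))) 0 (- part k (cderive g 0)).
    by apply: (@dv_refl R (fun x => part k (g x))); rewrite oppr0.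
  by move=> [_ <-]; congr (derive _ _ _); apply/funext => x; rewrite h.
by apply/eqP; rewrite eq_complex; apply/andP; split; apply/eqP; [exact: (e false)|exact: (e true)].
Qed.

Let n1' := ltW n1.
Let n0 : 0 <= complex.Re (0 +i* k0). Proof. by []. Qed.

Let b5p := asym_rbd n1' ap5 (r5.1 false) (r5.2 false).
Let b5q := asym_rbd n1' aq5 (r5.1 true) (r5.2 true).
Let b6p := asym_rbd n0 ap6 (r6.1 false) (r6.2 false).
Let b6q := asym_rbd n0 aq6 (r6.1 true) (r6.2 true).

Lemma wron_vanish S dS (y dy : bool -> bool -> R -> R) K j k :
  (forall c k, vanish (S c k) /\ vanish (dS c k)) ->
  (forall c k x, 0 <= x -> `|y c k x| <= K /\ `|dy c k x| <= K) -> vanish (wron S dS j y dy k).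
Proof.
move=> hS hy; have m (f g : R -> R) : vanish f -> (forall x, 0 <= x -> `|g x| <= K) -> vanish (fun x : R => f x * g x).
  move=> hf hg; have := @vanishM_bnd R g f 0 K hg hf; apply: (vanish_le (X0 := 0)) => x _.
  by rewrite mulrC.
have V1 c : vanish (fun x => dS c j x * y c k x - S c j x * dy c k x).
  apply: vanishD; first by apply: m; [exact: (hS c j).2|move=> x /(hy c k)[]].
  by apply: vanishN; apply: m; [exact: (hS c j).1|move=> x /(hy c k)[]].
by apply: vanishD; exact: V1.
Qed.

(** The Wronskian is constant, and it tends to 0 because (p5, q5) decays while the other solution is
    bounded on the right. *)
Lemma wron5 (P Q dP dQ : R -> R[i]) : refsol A0 k0 V (two P Q) (two dP dQ) ->
  rbd P /\ rbd dP -> rbd Q /\ rbd dQ ->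
  cwron (p5 lam) (q5 lam) (cderive (p5 lam)) (cderive (q5 lam)) P Q dP dQ 0 = 0.
Proof.
move=> r [[K1 h1] [K2 h2]] [[K3 h3] [K4 h4]].
have v5 c k : vanish (two (p5 lam) (q5 lam) c k) /\ vanish (two (cderive (p5 lam)) (cderive (q5 lam)) c k).
  by case: c; [exact: (asym_vanish n1' aq5 k (or_introl n1))|exact: (asym_vanish n1' ap5 k (or_introl n1))].
pose K := `|K1| + `|K2| + `|K3| + `|K4|.
have b6 c k x : 0 <= x -> `|two P Q c k x| <= K /\ `|two dP dQ c k x| <= K.
  have le4 (a b c' d z : R) : z <= a \/ z <= b \/ z <= c' \/ z <= d -> z <= `|a| + `|b| + `|c'| + `|d|.
    have := ler_norm a; have := ler_norm b; have := ler_norm c'; have := ler_norm d.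
    by have := normr_ge0 a; have := normr_ge0 b; have := normr_ge0 c'; have := normr_ge0 d; lra.
  move=> x0; rewrite /two /K; case: c; split; apply: le_trans (part_cnorm _ _) _; apply: le4.
  - by right; right; left; exact: h3.
  - by right; right; right; exact: h4.
  - by left; exact: h1.
  - by right; left; exact: h2.
have w0 j k : wron (two (p5 lam) (q5 lam)) (two (cderive (p5 lam)) (cderive (q5 lam))) j
    (two P Q) (two dP dQ) k 0 = 0.
  have hv := wron_vanish j k v5 b6.
  suff : `|wron (two (p5 lam) (q5 lam)) (two (cderive (p5 lam)) (cderive (q5 lam))) j
    (two P Q) (two dP dQ) k 0| <= 0 by rewrite normr_le0 => /eqP.
  apply/ler_addgt0Pr => e e0; rewrite add0r; have [X hX] := hv e e0.
  by rewrite -(wron_const Vsym j k X r5 r); exact: hX.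
by rewrite cwron_two /wron_re /wron_im !w0 subrr addr0.
Qed.

Let cj (p : R[i] -> R -> R[i]) x := (p lam x)^*.
Let cjd (p : R[i] -> R -> R[i]) x := (cderive (p lam) x)^*.

(** Conserved flux: far to the right q6 behaves like exp (- i k0 x) while p6 decays, so the
    Wronskian with the conjugate tends to - 2 i k0. *)
Lemma wron66 : cwron (p6 lam) (q6 lam) (cderive (p6 lam)) (cderive (q6 lam)) (cj p6) (cj q6) (cjd p6) (cjd q6) 0 != 0.
Proof.
apply/eqP => w0.
have wx x : cwron (p6 lam) (q6 lam) (cderive (p6 lam)) (cderive (q6 lam)) (cj p6) (cj q6) (cjd p6) (cjd q6) x = 0.
  by rewrite (cwron_const Vsym x r6 (refsol_conj r6)).
have [X hX] := asym_nonzero aq6 erefl.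
pose S := two (p6 lam) (q6 lam); pose dS := two (cderive (p6 lam)) (cderive (q6 lam)).
have [[Kp hKp] _] := b6p; have [[K hK] _] := b6q.
have [vp vdp] : (forall k, vanish (S false k)) /\ (forall k, vanish (dS false k)).
  by split=> k; have [] := asym_vanish n0 ap6 k (or_intror erefl).
pose er x := part false (cderive (q6 lam) x + (0 +i* k0) * q6 lam x).
pose ei x := part true (cderive (q6 lam) x + (0 +i* k0) * q6 lam x).
have ver : vanish er := asym_radiation n0 aq6 false.
have vei : vanish ei := asym_radiation n0 aq6 true.
have key x : k0 * (S true false x ^+ 2 + S true true x ^+ 2) =
    (dS false true x * S false false x - dS false false x * S false true x)
    + (S true false x * ei x - S true true x * er x).
  have := wx x; rewrite /cwron /cj /cjd /er /ei /S /dS /two.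
  move: (p6 lam x) (q6 lam x) (cderive (p6 lam) x) (cderive (q6 lam) x) => [a1 a2] [b1 b2] [c1 c2] [d1 d2].
  move=> /eqP; rewrite eq_complex /= => /andP[_ /eqP].
  by rewrite ?(mul0r, mulr0, subr0, addr0, add0r, sub0r); lra.
have vS k := @vanishM_bnd R (S true k) _ 0 K (fun x x0 => le_trans (part_cnorm k _) (hK x x0)).
have : vanish (fun x => k0 * (S true false x ^+ 2 + S true true x ^+ 2)).
  have vm (f g : R -> R) : vanish f -> vanish g -> vanish (fun x : R => f x * g x).
    move=> hf hg; have [Y _ [L hL]] := vanish_bnd hf; exact: vanishM_bnd hL hg.
  have : vanish (fun x => (dS false true x * S false false x - dS false false x * S false true x)
    + (S true false x * ei x - S true true x * er x)).
    by apply: vanishD; apply: vanishD; [exact: vm|apply: vanishN; exact: vm|exact: vS|apply: vanishN; exact: vS].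
  by apply: (vanish_le (X0 := 0)) => x _; rewrite key.
move=> /(_ (k0 / 8) (divr_gt0 k00 (ltr0n _ 8)))[Y hY].
pose x := Num.max (Num.max X Y) 0.
have [xX xY x0] : [/\ X <= x, Y <= x & 0 <= x] by rewrite /x !le_max !lexx !orbT.
have := hX x xX; rewrite cnormM cnorm_cexp /= mul0r mulr0 subrr expR0 mul1r => hq2.
have := hY x xY; have nn : 0 <= S true false x ^+ 2 + S true true x ^+ 2 by rewrite addr_ge0 ?sqr_ge0.
rewrite ger0_norm; last by rewrite mulr_ge0 ?(ltW k00).
rewrite ler_pM2l //; move: hq2; rewrite /cnorm normc_def /= => hq2.
have : 2^-1 ^+ 2 <= Num.sqrt (complex.Re (q6 lam x) ^+ 2 + complex.Im (q6 lam x) ^+ 2) ^+ 2.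
  by rewrite lerXn2r ?nnegrE ?invr_ge0 ?sqrtr_ge0.
rewrite sqr_sqrtr // expr2; rewrite /S /two /=; lra.
Qed.

(** The conjugate of (p6, q6) is expanded in the four Jost solutions. The coefficient [a] of (p1,
    q1) vanishes by the normalization and Delta_1, and the coefficient [b] of (p2, q2) does not, by
    the flux. Hence (p2, q2) is a combination of solutions bounded on the right. *)
Lemma jost2_bounded : rbd (p2 lam) /\ rbd (q2 lam) /\ rbd (cderive (p2 lam)) /\ rbd (cderive (q2 lam)).
Proof.
have [a [b [c [e [e1 e2 e3 e4]]]]] := evans_A_solve hE (cj p6 0) (cj q6 0) (cjd p6 0) (cjd q6 0).
have h0 := refsol_comb (- e) r6 (refsol_comb (- c) r5 (refsol_comb (- b) r2 (refsol_comb (- a) r1 (refsol_conj r6)))).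
have H := refsol_zero_complex A00 gam0 v0 hV h0.
have comb (d z1 z2 z5 z6 : R[i]) : z1 * a + z2 * b + z5 * c + z6 * e = d ->
    - e * z6 + (- c * z5 + (- b * z2 + (- a * z1 + d))) = 0 by move=> <-; ring.
have {}H := H (comb _ _ _ _ _ e1) (comb _ _ _ _ _ e2) (comb _ _ _ _ _ e3) (comb _ _ _ _ _ e4).
have p50 : p5 lam 0 = p1 lam 0 by rewrite (hp5 0).1 oppr0.
have q50 : q5 lam 0 = q1 lam 0 by rewrite (hp5 0).2 oppr0.
have dp50 : cderive (p5 lam) 0 = - cderive (p1 lam) 0.
  by apply: cderive_reflection => [k x|k x|x]; [exact: r5.1 false k x|exact: r1.1 false k x|exact: (hp5 x).1].
have dq50 : cderive (q5 lam) 0 = - cderive (q1 lam) 0.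
  by apply: cderive_reflection => [k x|k x|x]; [exact: r5.1 true k x|exact: r1.1 true k x|exact: (hp5 x).2].
have w56 := wron5 r6 b6p b6q.
have w5c : cwron (p5 lam) (q5 lam) (cderive (p5 lam)) (cderive (q5 lam)) (cj p6) (cj q6) (cjd p6) (cjd q6) 0 = 0.
  by apply: wron5 (refsol_conj r6) _ _; split; apply: rbd_conj; case: b6p; case: b6q.
have w66 := wron66; rewrite /cwron in w56 w5c w66.
have a0 : a = 0.
  move: w5c w56 hp2 hD; rewrite -e1 -e2 -e3 -e4 dp50 dq50 p50 q50 /Delta => w5c w56 hp D0.
  by apply: (mulIf D0); rewrite mul0r; apply: jost_algebra w5c w56 hp.
have b0 : b != 0.
  apply/eqP => b0; move/eqP: w66; apply; rewrite -e1 -e2 -e3 -e4 a0 b0 !mulr0 !add0r.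
  move: w56; clear; move: (p5 lam 0) (p6 lam 0) (q5 lam 0) (q6 lam 0) => x5 x6 y5 y6.
  move: (cderive (p5 lam) 0) (cderive (p6 lam) 0) (cderive (q5 lam) 0) (cderive (q6 lam) 0) => dx5 dx6 dy5 dy6 w.
  by transitivity (- c * (dx5 * x6 - x5 * dx6 + (dy5 * y6 - y5 * dy6))); [ring|rewrite w mulr0].
have sol2 (z1 z2 z5 z6 z : R[i]) : - e * z6 + (- c * z5 + (- b * z2 + (- a * z1 + z))) = 0 ->
    z2 = b^-1 * (z + (- c * z5 + - e * z6)).
  rewrite a0 => h; apply: (mulfI b0); rewrite mulrA divff // mul1r.
  by apply/eqP; rewrite -subr_eq0 -oppr_eq0 -h; apply/eqP; ring.
have bd f f5 f6 f1 f6' : (forall x, - e * f6 x + (- c * f5 x + (- b * f x + (- a * f1 x + f6' x))) = 0) ->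
    rbd f5 -> rbd f6 -> rbd f6' -> rbd f.
  move=> h h5 h6 h6'; have -> : f = fun x => b^-1 * (f6' x + (- c * f5 x + - e * f6 x)).
    by apply/funext => x; exact: sol2 (h x).
  by apply: rbdZ; apply: rbdD => //; apply: rbdD; exact: rbdZ.
have [? ?] := b5p; have [? ?] := b5q; have [? ?] := b6p; have [? ?] := b6q.
split; [|split; [|split]].
- by apply: (@bd _ (p5 lam) (p6 lam) (p1 lam) (cj p6)) => //; [move=> x; have [] := H x|exact: rbd_conj].
- by apply: (@bd _ (q5 lam) (q6 lam) (q1 lam) (cj q6)) => //; [move=> x; have [] := H x|exact: rbd_conj].
- by apply: (@bd _ (cderive (p5 lam)) (cderive (p6 lam)) (cderive (p1 lam)) (cjd p6)) => //; [move=> x; have [] := H x|exact: rbd_conj].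
- by apply: (@bd _ (cderive (q5 lam)) (cderive (q6 lam)) (cderive (q1 lam)) (cjd q6)) => //; [move=> x; have [] := H x|exact: rbd_conj].
Qed.

End JostBounded.
End Bounded.

(** * Integrals controlled by an exponential weight *)

Section DecayingIntegral.
Variables (R : realType) (gam : R).
Local Notation mu := (@lebesgue_measure R).
Hypothesis gam0 : 0 < gam.
Let E (x : R) := expR (- (gam * `|x|)).

Lemma E_continuous : continuous E.
Proof.
move=> x; apply: (@continuous_comp _ _ _ (fun x => - (gam * `|x|)) expR); last exact: continuous_expR.
by apply: cvgN; apply: cvgM; [exact: cvg_cst|exact: norm_continuous].
Qed.

Lemma int_E : (\int[mu]_x (E x)%:E = (2 / gam)%:E)%E.
Proof.
have E0 x : 0 <= E x by exact: expR_ge0.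
rewrite ge0_symfun_integralT //; [|exact: E_continuous|by move=> x /=; rewrite /E normrN].
have dF x : dv (fun x => - (gam^-1 * expR (- (gam * x)))) x (expR (- (gam * x))).
  by apply: dv_eq; [dvt|cbv beta; field; rewrite gt_eqF].
rewrite -set_itvcy (@ge0_continuous_FTC2y _ E (fun x => - (gam^-1 * expR (- (gam * x)))) 0 0) //.
- by rewrite mulr0 oppr0 expR0 -EFinB -EFinM; congr EFin; field; rewrite gt_eqF.
- by apply: continuous_subspaceT; exact: E_continuous.
- apply/cvgrPdist_le => e e0; have [X hX] := vanishZ (gam^-1) (vanish_expR gam0) e0.
  by exists X; split; [exact: num_real|move=> x /= /ltW xX; rewrite sub0r opprK; exact: hX].
- by apply: cvg_at_right_filter; exact: dv_cont (dF 0).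
- move=> x; rewrite in_itv /= andbT => x0; rewrite derive1E.
  by have [_ ->] := dF x; rewrite /E (gtr0_norm x0).
Qed.

Lemma E_integrable : mu.-integrable setT (EFin \o E).
Proof.
apply/integrableP; split.
  by apply/measurable_EFinP; apply: continuous_measurable_fun; exact: E_continuous.
under eq_integral do rewrite /= (ger0_norm (expR_ge0 _)).
by rewrite -/(E _) int_E ltry.
Qed.

Lemma seg_E x : 0 <= x -> seg_int (- x) x E = 2 / gam * (1 - expR (- (gam * x))).
Proof.
move=> x0; have x0' : - x <= 0 by rewrite oppr_le0.
have lE := li_continuous E_continuous.
have dp (u : R) : dv (fun x => - (gam^-1 * expR (- (gam * x)))) u (expR (- (gam * u))).
  by apply: dv_eq; [dvt|cbv beta; field; rewrite gt_eqF].
have dn (u : R) : dv (fun x => gam^-1 * expR (gam * x)) u (expR (gam * u)).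
  by apply: dv_eq; [dvt|cbv beta; field; rewrite gt_eqF].
have ce (s : R) : continuous (fun u : R => expR (s * u)).
  move=> u; apply: (@continuous_comp _ _ _ (fun x => s * x) expR); last exact: continuous_expR.
  by apply: cvgM; [exact: cvg_cst|exact: cvg_id].
rewrite (seg_split x0' x0 lE).
rewrite (@seg_eq _ (- x) 0 E (fun u => expR (gam * u))); last first.
  by move=> u /andP[_ u0]; rewrite /E (ler0_norm u0) mulrN opprK.
rewrite (@seg_eq _ 0 x E (fun u => expR (- (gam * u)))); last first.
  by move=> u /andP[u0 _]; rewrite /E (ger0_norm u0).
rewrite (seg_ftc x0' dn (ce gam)) (seg_ftc x0 dp); last first.
  by move=> u; have := ce (- gam) u; under eq_fun do rewrite mulNr.
by rewrite !mulr0 oppr0 expR0 mulrN; field; rewrite gt_eqF.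
Qed.

(** Monotonicity in the domain is applied to the nonnegative functions [C * E + h] and [C * E - h].
    As [C * E] is integrated exactly, both inequalities leave only its tail as error. *)
Lemma decaying_integral (h : R -> R) C : continuous h -> (forall x, `|h x| <= C * E x) ->
  mu.-integrable setT (EFin \o h) /\
  vanish (fun x => oriented_int 0 x h - oriented_int 0 (- x) h - \int[mu]_x h x).
Proof.
move=> ch hb; have C0 : 0 <= C.
  by have := le_trans (normr_ge0 _) (hb 0); rewrite /E normr0 mulr0 oppr0 expR0 mulr1.
have iCE : mu.-integrable setT (EFin \o (fun x => C * E x)).
  by have := integrableZl measurableT C E_integrable.
have ih : mu.-integrable setT (EFin \o h).
  apply: (le_integrable _ _ _ iCE) => //.
    by apply/measurable_EFinP; apply: continuous_measurable_fun.
  move=> x _ /=; rewrite lee_fin (ger0_norm (_ : 0 <= C * E x)) //.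
  by rewrite mulr_ge0 // expR_ge0.
have lE := li_continuous E_continuous; have lh := li_continuous ch.
have lCE : li (fun x => C * E x) by exact: liZ.
split=> //.
have sub u (a c : R) : (forall x, 0 <= u x) -> mu.-integrable setT (EFin \o u) -> seg_int a c u <= \int[mu]_x u x.
  move=> u0 iu; have iu' : mu.-integrable `[a, c] (EFin \o u) by apply: (@integrableS _ _ _ mu setT).
  rewrite /seg_int /Rintegral; apply: fine_le.
  - exact: integrable_fin_num.
  - exact: integrable_fin_num.
  apply: ge0_subset_integral => //; first exact: measurable_int iu.
  by move=> x _; rewrite lee_fin.
have intE : \int[mu]_x E x = 2 / gam by rewrite /Rintegral int_E.
have ZE : \int[mu]_x (C * E x) = C * (2 / gam) by rewrite RintegralZl ?intE //; exact: E_integrable.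
have h2 x : - (C * E x) <= h x <= C * E x by rewrite -ler_norml.
have := vanishZ (C * (2 / gam)) (vanish_expR gam0); apply: (vanish_le (X0 := 0)) => x x0.
have x0' : - x <= x by rewrite ge0_cp.
have -> : oriented_int 0 x h - oriented_int 0 (- x) h = seg_int (- x) x h by rewrite oint_sub.
have s1 := sub (fun x => C * E x + h x) (- x) x _ (integrableD measurableT iCE ih).
have s2 := sub (fun x => C * E x - h x) (- x) x _ (integrableB measurableT iCE ih).
have {}s1 : seg_int (- x) x (fun x => C * E x + h x) <= \int[mu]_x (C * E x + h x).
  by apply: s1 => u; have /andP[? ?] := h2 u; lra.
have {}s2 : seg_int (- x) x (fun x => C * E x - h x) <= \int[mu]_x (C * E x - h x).
  by apply: s2 => u; have /andP[? ?] := h2 u; lra.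
move: s1 s2; rewrite segD // segB // segZ // RintegralD // RintegralB // seg_E // ZE.
move=> s1 s2; rewrite [leRHS]ger0_norm; last by rewrite !mulr_ge0 ?expR_ge0 ?invr_ge0 ?(ltW gam0).
move: s1 s2; set S := seg_int _ _ _; set I := Rintegral _ _ _; set e := expR _; set q := 2 / gam.
have -> : C * (q * (1 - e)) = C * q - C * q * e by ring.
by move=> s1 s2; rewrite ler_norml; apply/andP; split; lra.
Qed.

End DecayingIntegral.

Section NonzeroPart.
Variables (R : realType) (gam : R).
Local Notation mu := (@lebesgue_measure R).
Hypothesis gam0 : 0 < gam.

(** The complex integral is assembled from four real ones, so one of them is nonzero. This is
    enough: for a purely imaginary spectral parameter each part of a solution is itself a real
    solution. *)
Lemma cint_nonzero_part (b0 : R -> R) (P W : R -> R[i]) C :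
  (forall j k, continuous (fun x => b0 x * part j (P x) * part k (W x))) ->
  (forall j k x, `|b0 x * part j (P x) * part k (W x)| <= C * expR (- (gam * `|x|))) ->
  cint (fun x => (b0 x)%:C * P x * W x) != 0 ->
  exists j k, \int[mu]_x (b0 x * part j (P x) * part k (W x)) != 0.
Proof.
move=> hc hb hne; apply: contrapT => hz.
have z j k : \int[mu]_x (b0 x * part j (P x) * part k (W x)) = 0.
  by apply/eqP; apply: contrapT => /negP h; apply: hz; exists j, k.
have i j k := (decaying_integral gam0 (hc j k) (hb j k)).1.
move/eqP: hne; apply.
have fr : (fun x => complex.Re ((b0 x)%:C * P x * W x)) =
    fun x => b0 x * part false (P x) * part false (W x) - b0 x * part true (P x) * part true (W x).
  by apply/funext => x; move: (P x) (W x) => [? ?] [? ?] /=; ring.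
have fi : (fun x => complex.Im ((b0 x)%:C * P x * W x)) =
    fun x => b0 x * part false (P x) * part true (W x) + b0 x * part true (P x) * part false (W x).
  by apply/funext => x; move: (P x) (W x) => [? ?] [? ?] /=; ring.
rewrite /cint fr fi; rewrite RintegralB // RintegralD //.
by rewrite !z subrr addr0.
Qed.

End NonzeroPart.

(** * The bifurcated wave *)

Section Assembly.
Variable R : realType.

Definition conj_fam (y : bool -> bool -> R -> R) i k x := (if k then -1 else 1) * y i k x.
Definition part_fam (j : bool) (y : bool -> bool -> R -> R) i k x := if k then 0 else y i j x.

(** Conjugating the functions replaces the spectral parameter by minus its conjugate: [t] stays and
    [rho] changes sign. *)
Lemma eigen_conj A1 A2 A3 k0 t rho a c b d1 d2 y dy z dz :
  eigen A1 A2 A3 k0 t rho a c b d1 d2 y dy z dz ->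
  eigen A1 A2 A3 k0 t (- rho) a c b d1 d2 (conj_fam y) (conj_fam dy) (conj_fam z) (conj_fam dz).
Proof.
have D f (s : R) x l : dv f x l -> dv (fun x => s * f x) x (s * l).
  by move=> hf; apply: dv_eq; [apply: dvM; [exact: dv_cst|exact: hf]|rewrite mul0r addr0].
move=> [h1 h2 h3 h4]; split.
- by move=> i k x; have [? ?] := h1 i k x; split; exact: D.
- move=> i k x; apply: dv_eq; first exact: (D _ _ _ _ (h2 i k x)).
  by rewrite /lin /shift /conj_fam; move: (base _ _ _) (sympot _ _ _ _ _) (sympot _ _ _ _ _) => e1 e2 e3; case: i; case: k => /=; ring.
- move=> i k x; apply: dv_eq; first exact: (D _ _ _ _ (h3 i k x)).
  by rewrite /shift /conj_fam; move: (sympot _ _ _ _ _) (sympot _ _ _ _ _) => e2 e3; case: i; case: k => /=; ring.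
- by move=> i k; have [? ? ? ?] := h4 i k; split; exact: vanish2Z.
Qed.

(** At [rho = 0] all coefficients are real, so the real and imaginary parts decouple. *)
Lemma eigen_part j A1 A2 A3 k0 t a c b d1 d2 y dy z dz :
  eigen A1 A2 A3 k0 t 0 a c b d1 d2 y dy z dz ->
  eigen A1 A2 A3 k0 t 0 a c b d1 d2 (part_fam j y) (part_fam j dy) (part_fam j z) (part_fam j dz).
Proof.
move=> [h1 h2 h3 h4]; split.
- by move=> i [] x; have [? ?] := h1 i j x; split=> //; exact: dv_cst.
- move=> i [] x; apply: dv_eq; [exact: dv_cst| |exact: h2 i j x|].
    by rewrite /lin /shift /part_fam; case: (_ (+) _); ring.
  by rewrite /lin /shift /part_fam; case: (_ (+) _); case: (_ (+) _); ring.
- move=> i [] x; apply: dv_eq; [exact: dv_cst| |exact: h3 i j x|].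
    by rewrite /shift /part_fam; case: (_ (+) _); ring.
  by rewrite /shift /part_fam; case: (_ (+) _); case: (_ (+) _); ring.
- move=> i k; have [? ? ? ?] := h4 i j; case: k; split=> //; exact: vanish2_0.
Qed.

Lemma ctrl_weaken (C C' : R) Sr dSr Sr' dSr' Sl dSl Sl' dSl' y dy : C <= C' ->
  ctrl C Sr dSr Sr' dSr' Sl dSl Sl' dSl' y dy -> ctrl C' Sr dSr Sr' dSr' Sl dSl Sl' dSl' y dy.
Proof.
move=> CC h B B0 h1 h2 h3 h4 i k; have [a1 a2] := h B B0 h1 h2 h3 h4 i k.
have CB : C * B <= C' * B by exact: ler_wpM2r.
by split; [exact: le_trans a1 CB|exact: le_trans a2 CB].
Qed.

Lemma det22 (M : 'M[R[i]]_2) : \det M = M 0 0 * M 1 1 - M 0 1 * M 1 0.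
Proof.
rewrite (expand_det_row M 0) !big_ord_recl big_ord0 addr0 /cofactor !det_mx11 !mxE /=.
by rewrite expr0 expr1 mul1r mulN1r mulrN; congr (_ * M _ _ - M _ _ * M _ _); apply/val_inj.
Qed.

(** A zero determinant makes the data at 0 parallel, and uniqueness extends this to the line. The
    data of [p8] are not both zero, because [p8] has limit 1 after rescaling. *)
Lemma evans_zero_proportional (A0 k0 gam v : R) (d : R -> R) (p4 p8 : R[i] -> R -> R[i]) lam nu : 0 < A0 -> 0 < gam -> 0 <= v ->
  (forall x, `|d x| <= v * expR (- (gam * `|x|))) -> evans_BC p4 p8 lam = 0 ->
  refsol A0 k0 (scalpot d) (two (p4 lam) (fun=> 0)) (two (cderive (p4 lam)) (fun=> 0)) ->
  refsol A0 k0 (scalpot d) (two (p8 lam) (fun=> 0)) (two (cderive (p8 lam)) (fun=> 0)) ->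
  asym nu 1 (p8 lam) (cderive (p8 lam)) -> 0 <= complex.Re nu ->
  exists ka, forall x, p4 lam x = ka * p8 lam x /\ cderive (p4 lam) x = ka * cderive (p8 lam) x.
Proof.
move=> A00 gam0 v0 hd hE r4 r8 a8 n0.
have hV c c' x : `|scalpot d c c' x| <= v * expR (- (gam * `|x|)).
  by rewrite /scalpot; case: (c || c') => //; rewrite normr0 mulr_ge0 ?expR_ge0.
move: hE; rewrite /evans_BC det22 !mxE /= => hE.
have [ka [h1 h2]] : exists ka, p4 lam 0 = ka * p8 lam 0 /\ cderive (p4 lam) 0 = ka * cderive (p8 lam) 0.
  have [p80|p80] := eqVneq (p8 lam 0) 0; last first.
    exists (p4 lam 0 / p8 lam 0); rewrite divfK //; split=> //.
    apply: (mulIf p80); rewrite mulrAC divfK // mulrC.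
    by apply/eqP; rewrite eq_sym -subr_eq0; apply/eqP; rewrite -[RHS]hE; ring.
  have [dp80|dp80] := eqVneq (cderive (p8 lam) 0) 0; last first.
    exists (cderive (p4 lam) 0 / cderive (p8 lam) 0); rewrite divfK //; split=> //.
    rewrite p80 mulr0; apply: (mulIf dp80); rewrite mul0r.
    by move: hE; rewrite p80 mul0r subr0.
  have z := refsol_zero_complex A00 gam0 v0 hV r8 p80 erefl dp80 erefl.
  have [X hX] := asym_nonzero a8 erefl; have := hX X (lexx X).
  by have [-> _ _ _] := z X; rewrite mulr0 cnorm0; lra.
exists ka => x.
have r := refsol_comb (- ka) r8 r4.
have q0 : - ka * 0 + 0 = 0 :> R[i] by rewrite mulr0 addr0.
have z1 : - ka * p8 lam 0 + p4 lam 0 = 0 by rewrite h1 mulNr addNr.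
have z2 : - ka * cderive (p8 lam) 0 + cderive (p4 lam) 0 = 0 by rewrite h2 mulNr addNr.
have [e1 _ e2 _] := refsol_zero_complex A00 gam0 v0 hV r z1 q0 z2 q0 x.
by split; apply/eqP; rewrite -subr_eq0 addrC -mulNr; apply/eqP.
Qed.

Lemma rbd_line (f : R -> R[i]) : rbd f -> rbd (fun x => f (- x)) ->
  exists2 K, 0 <= K & forall k x, `|part k (f x)| <= K.
Proof.
move=> [K hK] [L hL]; exists (`|K| + `|L|); first by rewrite addr_ge0.
move=> k x; apply: le_trans (part_cnorm _ _) _; have [x0|x0] := leP 0 x.
  by apply: le_trans (hK x x0) _; have := ler_norm K; have := normr_ge0 L; lra.
have x0' : 0 <= - x by rewrite oppr_ge0 ltW.
by have := hL _ x0'; rewrite opprK => h; apply: le_trans h _; have := ler_norm L; have := normr_ge0 K; lra.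
Qed.

Lemma at_rightP (P : R -> Prop) e1 : 0 < e1 -> (forall e, 0 < e -> e < e1 -> P e) -> \forall e \near 0^'+, P e.
Proof.
move=> e10 h; exists e1 => //= e; rewrite /ball /= sub0r normrN => he e0; apply: h => //.
by rewrite -(gtr0_norm e0).
Qed.

Lemma part_linear_cont (f g : R -> R) : (forall x, dv f x (g x)) -> continuous f.
Proof. by move=> h x; exact: dv_cont (h x). Qed.

End Assembly.

Section Main.
Variable R : realType.

Lemma shifted_parts (om : R) (lam : R[i]) : complex.Re lam = 0 ->
  [/\ complex.Im (om%:C - 'i%C * lam) = 0, complex.Re (om%:C - 'i%C * lam) = om + complex.Im lam,
      complex.Im (om%:C + 'i%C * lam) = 0 & complex.Re (om%:C + 'i%C * lam) = om - complex.Im lam].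
Proof.
by case: lam => a b /= ->; split; rewrite ?(mul0r, mulr0, mul1r, subr0, addr0, add0r, sub0r, oppr0, opprK).
Qed.

Lemma gamma_exists (m : R) : 0 < m -> exists2 gam, 0 < gam & 8 * gam ^+ 2 <= m.
Proof.
move=> m0; exists (Num.min 1 (m / 8)); first by rewrite lt_min ltr01 divr_gt0.
set g := Num.min _ _; have g1 : g <= 1 by rewrite ge_min lexx.
have g2 : g <= m / 8 by rewrite ge_min lexx orbT.
have g0 : 0 <= g by rewrite le_min ler01 divr_ge0 // ltW.
have : g * g <= g * 1 by exact: ler_wpM2l.
by rewrite expr2; lra.
Qed.

(* All values of the real part are reduced to the positive case and to real
   families: the conjugate of an eigenfunction belongs to [- rho], and for
   [rho = 0] the real and imaginary parts are themselves eigenfunctions. *)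
Lemma eigen_trichotomy (A1 A2 A3 k0 gam K e : R) (b : bool) (a0 c0 d0 b0 : R -> R) :
  (forall t rho eps sg a c b d1 d2 y dy z dz, `|t| <= e -> 0 < rho <= e -> 0 <= eps <= e ->
     close_pot gam K eps sg a0 c0 d0 b0 a c b d1 d2 ->
     eigen A1 A2 A3 k0 t rho a c b d1 d2 y dy z dz -> forall i k x, y i k x = 0 /\ z i k x = 0) ->
  (forall t eps sg a c b d1 d2 y dy z dz, `|t| <= e -> 0 < eps <= e -> `|sg| = 1 ->
     close_pot gam K eps sg a0 c0 d0 b0 a c b d1 d2 ->
     eigen A1 A2 A3 k0 t 0 a c b d1 d2 y dy z dz -> real_fam y -> real_fam z ->
     forall i k x, y i k x = 0 /\ z i k x = 0) ->
  forall t rho eps a c b' d1 d2 y dy z dz, `|t| <= e -> `|rho| <= e -> 0 < eps <= e ->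
     close_pot gam K eps ((-1) ^+ b) a0 c0 d0 b0 a c b' d1 d2 ->
     eigen A1 A2 A3 k0 t rho a c b' d1 d2 y dy z dz -> forall i k x, y i k x = 0 /\ z i k x = 0.
Proof.
move=> hc hr t rho eps a c b' d1 d2 y dy z dz ht hrho heps hcl he.
have heps' : 0 <= eps <= e by case/andP: heps => /ltW -> ->.
have sg1 : `|(-1) ^+ b : R| = 1 by rewrite normrX normrN1 expr1n.
have [r0|r0|r0] := ltgtP rho 0.
- have hr' : 0 < - rho <= e by rewrite oppr_gt0 r0 -(ltr0_norm r0).
  move=> i k x; have := hc _ _ _ _ _ _ _ _ _ _ _ _ _ ht hr' heps' hcl (eigen_conj he) i k x.
  rewrite /conj_fam; case: k; rewrite ?mul1r // !mulN1r => -[/eqP + /eqP].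
  by rewrite !oppr_eq0 => /eqP ? /eqP ?; split.
- have hr' : 0 < rho <= e by rewrite r0 -(gtr0_norm r0).
  exact: hc _ _ _ _ _ _ _ _ _ _ _ _ _ ht hr' heps' hcl he.
- rewrite r0 in he => i k x.
  exact: (hr _ _ _ _ _ _ _ _ _ _ _ _ ht heps sg1 hcl (eigen_part k he) (fun _ _ => erefl) (fun _ _ => erefl) i false x).
Qed.

End Main.

(** Only [omega] and [s - tau] can be the smallest of the five constants, so one rate below both
    serves everywhere. *)
Lemma gamma_bounds (R : realType) (omega s tau : R) : 0 < omega -> omega < tau -> tau < s ->
  exists2 gam, 0 < gam & [/\ 4 * gam ^+ 2 <= omega, 4 * gam ^+ 2 <= s, 8 * gam ^+ 2 <= omega + tau,
    8 * gam ^+ 2 <= s + tau & 8 * gam ^+ 2 <= s - tau].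
Proof.
move=> om0 h1 h2; have [gam gam0 h] : exists2 gam, 0 < gam & 8 * gam ^+ 2 <= Num.min omega (s - tau).
  by apply: gamma_exists; rewrite lt_min om0 subr_gt0.
have g1 : 8 * gam ^+ 2 <= omega by apply: le_trans h _; rewrite ge_min lexx.
have g3 : 8 * gam ^+ 2 <= s - tau by apply: le_trans h _; rewrite ge_min lexx orbT.
by exists gam => //; have := sqr_ge0 gam; split; lra.
Qed.

Lemma scalar_zero (R : realType) (A0 gam v : R) (d W dW : R -> R) : 0 < A0 -> 0 < gam -> 0 <= v ->
  (forall x, `|d x| <= v * expR (- (gam * `|x|))) ->
  (forall x, dv W x (dW x)) -> (forall x, dv dW x (A0 * W x - d x * W x)) ->
  W 0 ^+ 2 + dW 0 ^+ 2 = 0 -> forall x, W x = 0.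
Proof.
move=> A00 gam0 v0 hd d1 d2 /eqP; rewrite paddr_eq0 ?sqr_ge0 // !sqrf_eq0 => /andP[/eqP w0 /eqP dw0] x.
pose S (f : R -> R) (c k : bool) x := if c || k then 0 else f x.
have hV c c' u : `|scalpot d c c' u| <= v * expR (- (gam * `|u|)).
  by rewrite /scalpot; case: (c || c') => //; rewrite normr0 mulr_ge0 ?expR_ge0.
have r : refsol A0 1 (scalpot d) (S W) (S dW).
  split=> -[] [] u; rewrite /S /lin /base /scalpot /=; try exact: dv_cst.
  - exact: d1.
  - by apply: dv_eq; [exact: dv_cst|rewrite ?(mulr0, mul0r, subr0)].
  - by apply: dv_eq; [exact: dv_cst|rewrite ?(mulr0, mul0r, subr0)].
  - by apply: dv_eq; [exact: dv_cst|rewrite ?(mulr0, mul0r, subr0)].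
  - by apply: dv_eq; [exact: d2|rewrite ?(mulr0, mul0r, subr0)].
have z c k : S W c k 0 = 0 /\ S dW c k 0 = 0 by rewrite /S; case: (c || k); rewrite ?w0 ?dw0.
by have [] := refsol_zero A00 gam0 v0 hV r z false false x.
Qed.

Lemma vanish_scale (R : realType) (ka : R[i]) (f g : R -> R[i]) : (forall k, vanish (fun x => part k (f x))) ->
  (forall x, g x = ka * f x) -> forall k, vanish (fun x => part k (g x)).
Proof.
move=> h e k; have := vanishD (vanishZ (part false ka) (h k)) (vanishZ (if k then part true ka else - part true ka) (h (~~ k))).
apply: (vanish_le (X0 := 0)) => x _; rewrite e -[ka * f x]addr0 part_comb.
by have -> : part k (0 : R[i]) = 0 by [case: k]; rewrite addr0.
Qed.

Theorem theorem2p9 (R : realType) (F : R -> R -> R -> R) (omega s : R)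
  (omega_gt0 : 0 < omega) (s_gt0 : 0 < s) (omega_lt_s : omega < s)
  (hF : nonlinearity F)
  (U0 : R -> R -> R)
  (hU0 : \forall w \near omega, fundamental_wave F w (U0 w))
  (V1 : R -> R)
  (hV1 : bounded_mode F s (U0 omega) V1)
  (phi11 phi12 : R -> R)
  (hphi11 : variational_sol F omega (U0 omega) phi11)
  (hphi11_0 : phi11 0 = 1 /\ phi11^`()%classic 0 = 0)
  (hphi12 : variational_sol F omega (U0 omega) phi12)
  (hphi12_0 : phi12 0 = 0 /\ phi12^`()%classic 0 = 1)
  (ha2 : a2bar F (U0 omega) V1 != 0)
  (hb2 : b2bar F (U0 omega) V1 phi11 phi12 != 0)
  (b : bool) (Ueps Veps : R -> R -> R)
  (hUV : bifurcated_waves F omega s (U0 omega) V1 phi11 phi12 b Ueps Veps)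
  (hnorm_derivable : derivable (fun w => L2_norm_sq (U0 w)) omega 1)
  (hnorm : 0 < (fun w => L2_norm_sq (U0 w))^`() omega)
  (lam0 : R[i])
  (hlam0 : [/\ complex.Re lam0 = 0, omega < complex.Im lam0
             & complex.Im lam0 < s])
  (nu1 nu2 nu3 nu4 : R[i] -> R[i])
  (hnu : \forall lam \near (lam0 : R[i]^o),
    [/\ sqrt_branch (- (3 * pi / 4)) (pi / 4) (omega%:C - 'i%C * lam) (nu1 lam),
        sqrt_branch (- (pi / 4)) (3 * pi / 4) (omega%:C + 'i%C * lam) (nu2 lam),
        sqrt_branch (- (3 * pi / 4)) (pi / 4) (s%:C - 'i%C * lam) (nu3 lam) &
        sqrt_branch (- (pi / 4)) (3 * pi / 4) (s%:C + 'i%C * lam) (nu4 lam)])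
  (p1 q1 p2 q2 p5 q5 p6 q6 p3 p7 p4 p8 : R[i] -> R -> R[i])
  (hA : jost_solutions_A F omega (U0 omega) lam0 nu1 nu2
          p1 q1 p2 q2 p5 q5 p6 q6)
  (hB : jost_solutions_BC F s (U0 omega) lam0 (fun lam => - ('i%C * lam)) nu4
          p4 p8)
  (hC : jost_solutions_BC F s (U0 omega) lam0 (fun lam => 'i%C * lam) nu3 p3 p7)
  (hp5 : forall x : R,
    p5 lam0 x = p1 lam0 (- x) /\ q5 lam0 x = q1 lam0 (- x))
  (hp2 : forall x : R,
    cderive (p2 lam0) x * p5 lam0 x + cderive (q2 lam0) x * q5 lam0 x
    - p2 lam0 x * cderive (p5 lam0) x - q2 lam0 x * cderive (q5 lam0) x = 0)
  (hEB : simple_zero (evans_BC p4 p8) lam0)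
  (hEA : evans_A p1 q1 p2 q2 p5 q5 p6 q6 lam0 != 0)
  (hEC : evans_BC p3 p7 lam0 != 0)
  (hDelta1 : Delta p1 q1 lam0 != 0)
  (hI2 : I_integral F (U0 omega) V1 p2 q2 p4 lam0 != 0) :
  exists2 N : set R[i], nbhs (lam0 : R[i]^o) N &
    \forall eps \near (0 : R)^'+, forall lam : R[i], N lam ->
      ~ linearized_eigenvalue F omega s
          (mubar F (U0 omega) V1 phi11 phi12 * eps ^+ 2)
          (Ueps eps) (Veps eps) lam.
Proof.
case: hlam0 => l0 l1 l2; set tau0 := complex.Im lam0 in l1 l2.
have [gam gam0 [g4o g4s gA1 gA2 gA3]] := gamma_bounds omega_gt0 l1 l2.
have [A10 A20 A30 B0] : [/\ 0 < omega + tau0, 0 < s + tau0, 0 < s - tau0 & omega - tau0 < 0].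
  by move: omega_gt0 s_gt0 l1 l2; clear; split; lra.
have hF3 : Ck 3 F by case: hF.
have hwave : fundamental_wave F omega (U0 omega) := nbhs_singleton hU0.
have [tU0 _ _ _ _] := hwave; have [tV1 _ _ _ _] := hV1.
have [C0 hUV'] := hUV; have [e4 e40 hw] := at_right_ex hUV'.
have [b1 b2 b3 b4] := nbhs_singleton hnu.
have [z1 z2 z3 z4] := shifted_parts omega l0; have [z5 z6 z7 z8] := shifted_parts s l0.
have n1 : 0 < complex.Re (nu1 lam0).
  by apply: sqrt_branch_right b1 z1 _; rewrite z2.
(* At lambda_0 the number omega + i lambda_0 = omega - tau0 is negative: [nu2] is the only one of
   the four exponents without decay. *)
have [n2 k00 k2] : [/\ nu2 lam0 = 0 +i* complex.Im (nu2 lam0), 0 < complex.Im (nu2 lam0) &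
    complex.Im (nu2 lam0) ^+ 2 = - (omega - tau0)].
  by rewrite -z4; apply: sqrt_branch_imag b2 z3 _; rewrite z4.
set k0 := complex.Im (nu2 lam0) in n2 k00 k2.
have {k2}k02 : k0 ^+ 2 = tau0 - omega by rewrite k2 opprB.
have n3 : 0 < complex.Re (nu3 lam0).
  by apply: sqrt_branch_right b3 z5 _; rewrite z6.
have n4 : 0 < complex.Re (nu4 lam0).
  by apply: sqrt_branch_left b4 z7 _; rewrite z8.
have n2' : 0 <= complex.Re (nu2 lam0) by rewrite n2.
have el : 'i%C * lam0 = (- tau0)%:C.
  by move: l0; rewrite /tau0; case: (lam0) => x y /= ->; apply/eqP; rewrite eq_complex /= !(mul0r, mulr0, mul1r, addr0, sub0r) !eqxx.
have [/nbhs_singleton[[s1 al1 al1'] [s2 al2 al2']] /nbhs_singleton[[s5 ar5 ar5'] [s6 ar6 ar6']] _ _] := hA.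
have [/nbhs_singleton[s4 al4 s8 ar8] _ _] := hB.
have [/nbhs_singleton[s3 al3 s7 ar7] _ _] := hC.
rewrite el in s4 s8 s3 s7.
have {}s4 : solution_BC F s (U0 omega) (- - tau0)%:C (p4 lam0) by rewrite rmorphN.
have {}s8 : solution_BC F s (U0 omega) (- - tau0)%:C (p8 lam0) by rewrite rmorphN.
have [v [K [e3 [v0 K0 e30 hdec hclose]]]] :=
  potentials_close omega_gt0 s_gt0 gam0 g4o g4s hF hwave hV1 hUV.
set a0 := ref_a F (U0 omega) in hdec hclose; set c0 := ref_c F (U0 omega) in hdec hclose.
set d0 := ref_d F (U0 omega) in hdec hclose; set b0 := ref_b F (U0 omega) V1 in hdec hclose.
have ha0 x : `|a0 x| <= v * expR (- (gam * `|x|)) by have [] := hdec x.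
have hc0 x : `|c0 x| <= v * expR (- (gam * `|x|)) by have [] := hdec x.
have hd0 x : `|d0 x| <= v * expR (- (gam * `|x|)) by have [] := hdec x.
have hb0 x : `|b0 x| <= v * expR (- (gam * `|x|)) by have [] := hdec x.
have r1 := solution_A_refsol l0 k02 s1; have r2 := solution_A_refsol l0 k02 s2.
have r5 := solution_A_refsol l0 k02 s5; have r6 := solution_A_refsol l0 k02 s6.
rewrite -/tau0 -/a0 -/c0 in r1 r2 r5 r6.
have r3 := solution_C_refsol k0 s3; have r7 := solution_C_refsol k0 s7.
have r4 := solution_C_refsol k0 s4; have r8 := solution_C_refsol k0 s8.
rewrite -/d0 in r3 r4 r7 r8.
have zasym nu : asym nu 0 (fun=> 0 : R[i]) (fun=> 0 : R[i]).
  by move=> e e0; exists 0 => x _; rewrite mulr0 subr0 mul0r addr0 cnorm0 ltW.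
have left1 := left_asym al1; have left1' := left_asym al1'.
have left2 := left_asym al2; have left2' := left_asym al2'.
have right5 := right_asym ar5; have right5' := right_asym ar5'.
have right6 := right_asym ar6; have right6' := right_asym ar6'.
have left3 := left_asym al3; have right7 := right_asym ar7.
have left4 := left_asym al4; have right8 := right_asym ar8.
have h15 : outgoing_ref (omega + tau0) k0 (sympot a0 c0) (two (p5 lam0) (q5 lam0))
    (two (cderive (p5 lam0)) (cderive (q5 lam0))) (two (p1 lam0) (q1 lam0)) (two (cderive (p1 lam0)) (cderive (q1 lam0))).
  split=> //; first exact: outgoing_fast n1 r5 right5 right5'.
  have := refsol_refl r1; rewrite refl_two reflN_two => r; exact: outgoing_fast n1 r left1 left1'.
have h26 : outgoing_ref (omega + tau0) k0 (sympot a0 c0) (two (p6 lam0) (q6 lam0))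
    (two (cderive (p6 lam0)) (cderive (q6 lam0))) (two (p2 lam0) (q2 lam0)) (two (cderive (p2 lam0)) (cderive (q2 lam0))).
  split=> //; first by rewrite n2 in right6 right6'; exact: outgoing_slow r6 right6 right6'.
  have := refsol_refl r2; rewrite refl_two reflN_two => r.
  by rewrite n2 in left2 left2'; exact: outgoing_slow r left2 left2'.
have h37 : outgoing_ref (s + tau0) k0 (scalpot d0) (two (p7 lam0) (fun=> 0))
    (two (cderive (p7 lam0)) (fun=> 0)) (two (p3 lam0) (fun=> 0)) (two (cderive (p3 lam0)) (fun=> 0)).
  split=> //; first exact: outgoing_fast n3 r7 right7 (zasym _).
  have := refsol_refl r3; rewrite refl_two reflN_two => r.
  apply: outgoing_fast n3 r left3 _; have -> : (fun _ : R => - (0 : R[i])) = fun=> 0 by apply/funext => x; rewrite oppr0.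
  exact: zasym.
have [CA CA0 hCA] := evans_A_ctrl hEA; have [CC CC0 hCC] := evans_C_ctrl hEC.
pose Cd := CA + CC; have Cd0 : 0 <= Cd by rewrite addr_ge0.
have hCACd : CA <= Cd by rewrite lerDl.
have hCCCd : CC <= Cd by rewrite lerDr.
have hctrlA y dy := ctrl_weaken hCACd (hCA y dy).
have hctrlC u du := ctrl_weaken hCCCd (hCC u du).
have [e1 /andP[e10 e11] Hcomplex] := no_complex_eigen b0 A10 A20 A30 k00 gam0 gA1 gA2 v0 K0 ha0 hc0 hd0 Cd0 h15 h26 hctrlA h37 hctrlC.
have v20 : 0 <= v + v by rewrite addr_ge0.
have hV c c' x : `|sympot a0 c0 c c' x| <= (v + v) * expR (- (gam * `|x|)).
  rewrite /sympot mulrDl; case: (c == c').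
    by apply: le_trans (ler_normD _ _) _; apply: lerD.
  by apply: le_trans (ha0 x) _; rewrite lerDl mulr_ge0 // expR_ge0.
(* On the left (p2, q2) is bounded by its own asymptotics; on the right the normalization and
   [hDelta1] are what exclude exponential growth. *)
have [rp2 [rq2 [rdp2 rdq2]]] : rbd (p2 lam0) /\ rbd (q2 lam0) /\ rbd (cderive (p2 lam0)) /\ rbd (cderive (q2 lam0)).
  rewrite n2 in right6 right6'.
  exact: (jost2_bounded A10 k00 gam0 v20 hV (fun=> erefl) r1 r2 r5 r6 hEA n1 right5 right5' right6 right6' hp5 (hp2 0) hDelta1).
have rr2 := refsol_refl r2; rewrite refl_two reflN_two in rr2.
have [lp2 ldp2] := asym_rbd n2' left2 (rr2.1 false) (rr2.2 false).
have [lq2 ldq2] := asym_rbd n2' left2' (rr2.1 true) (rr2.2 true).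
have rN (f : R -> R[i]) : rbd (fun x => - f (- x)) -> rbd (fun x => f (- x)).
  by move=> /(rbdZ (-1)); under eq_fun do rewrite mulN1r opprK.
have [K1 K10 hK1] := rbd_line rp2 lp2; have [K2 K20 hK2] := rbd_line rq2 lq2.
have [K3 K30 hK3] := rbd_line rdp2 (rN _ ldp2); have [K4 K40 hK4] := rbd_line rdq2 (rN _ ldq2).
pose Kb := K1 + K2 + K3 + K4.
have Kb0 : 0 <= Kb by rewrite /Kb !addr_ge0.
have hKb i k x : `|two (p2 lam0) (q2 lam0) i k x| <= Kb /\ `|two (cderive (p2 lam0)) (cderive (q2 lam0)) i k x| <= Kb.
  have := hK1 k x; have := hK2 k x; have := hK3 k x; have := hK4 k x; rewrite /two /Kb.
  by move: K10 K20 K30 K40; clear; case: i; split; lra.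
have hE4 : evans_BC p4 p8 lam0 = 0 by case: hEB.
(* The zero of E_B makes [p4] a multiple of [p8], so it decays at both ends. *)
have [ka hka] := evans_zero_proportional A30 gam0 v0 hd0 hE4 r4 r8 right8 (ltW n4).
have v8 k := asym_vanish (ltW n4) right8 k (or_introl n4).
have v4 k := asym_vanish (ltW n4) left4 k (or_introl n4).
have vW k : vanish2 (fun x => part k (p4 lam0 x)).
  by split; [exact: (vanish_scale (fun k => (v8 k).1) (fun x => (hka x).1))|exact: (v4 k).1].
have vdW k : vanish2 (fun x => part k (cderive (p4 lam0) x)).
  split; first exact: (vanish_scale (fun k => (v8 k).2) (fun x => (hka x).2)).
  by have := vanishN (v4 k).2; apply: (vanish_le (X0 := 0)) => x _; rewrite partN opprK.
have dvW k x : dv (fun x => part k (p4 lam0 x)) x (part k (cderive (p4 lam0) x)) := (solution_BC_dv s4 k x).1.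
have dvdW k x : dv (fun x => part k (cderive (p4 lam0) x)) x
    ((s - tau0) * part k (p4 lam0 x) - d0 x * part k (p4 lam0 x)).
  by have := (solution_BC_dv s4 k x).2; rewrite opprK.
have cW k : continuous (fun x => part k (p4 lam0 x)) := part_linear_cont (dvW k).
pose P x := p2 lam0 x + q2 lam0 x.
have cP j : continuous (fun x => part j (P x)).
  have -> : (fun x => part j (P x)) = fun x => two (p2 lam0) (q2 lam0) false j x + two (p2 lam0) (q2 lam0) true j x.
    by apply/funext => x; rewrite /P partD.
  by move=> x; apply: cvgD; [exact: part_linear_cont (r2.1 false j) x|exact: part_linear_cont (r2.1 true j) x].
have cb0 : continuous b0.
  have CD12 : Ck 1 (D1 (D2 F)).
    by case: hF3 => _ [_ [_ h _]]; case: h => _ [_ [h' _ _]]; exact: h'.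
  have cU0 := part_linear_cont (twice_dv tU0).1; have cV1 := part_linear_cont (twice_dv tV1).1.
  have cz : continuous (fun _ : R => 0 : R) by move=> x; exact: cvg_cst.
  have := @comp_continuous3 R (D1 (D2 F)) 1 (U0 omega) (fun=> 0) 0 CD12 cU0 cz; rewrite expr0n /= => c12.
  move=> x; apply: cvgM; last exact: cV1.
  apply: cvgM; last exact: cU0.
  exact: c12.
have [W1 W10 hW1] := vanish2_bounded (dvW true) (vW true).1 (vW true).2.
have [W2 W20 hW2] := vanish2_bounded (dvW false) (vW false).1 (vW false).2.
have hW k x : `|part k (p4 lam0 x)| <= W1 + W2.
  by have := hW1 x; have := hW2 x; move: W10 W20; clear; case: k; lra.
have hP j x : `|part j (P x)| <= Kb + Kb.
  rewrite /P partD; apply: le_trans (ler_normD _ _) _.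
  by apply: lerD; [exact: (hKb false j x).1|exact: (hKb true j x).1].
pose C := v * (Kb + Kb) * (W1 + W2).
have hb j k x : `|b0 x * part j (P x) * part k (p4 lam0 x)| <= C * expR (- (gam * `|x|)).
  have -> : C * expR (- (gam * `|x|)) = v * expR (- (gam * `|x|)) * (Kb + Kb) * (W1 + W2).
    by rewrite /C; move: (expR _) => E; ring.
  exact: mul_le (mul_le (hb0 x) (hP j x)) (hW k x).
have hc j k : continuous (fun x => b0 x * part j (P x) * part k (p4 lam0 x)).
  by move=> x; apply: cvgM; [apply: cvgM; [exact: cb0|exact: cP]|exact: cW].
(* From here on part [k] of [p4] is the profile of w and part [j] of (p2, q2) is the solution it is
   tested against. *)
have [j [k hI]] := cint_nonzero_part gam0 hc hb hI2.
have [_ vJ] := decaying_integral gam0 (hc j k) (hb j k).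
have dvJ x : dv (fun x => oriented_int 0 x (fun x => b0 x * part j (P x) * part k (p4 lam0 x))) x
    (b0 x * (two (p2 lam0) (q2 lam0) false j x + two (p2 lam0) (q2 lam0) true j x) * part k (p4 lam0 x)).
  by apply: dv_eq; [exact: oint_dv (hc j k)|rewrite /P partD].
have W0 : part k (p4 lam0 0) ^+ 2 + part k (cderive (p4 lam0) 0) ^+ 2 != 0.
  apply/eqP => h0; move/eqP: hI; apply.
  have z := scalar_zero A30 gam0 v0 hd0 (dvW k) (dvdW k) h0.
  rewrite (_ : (fun x => _) = cst 0); last by apply/funext => x; rewrite z mulr0.
  by rewrite Rintegral_cst // mul0r.
have [e2 /andP[e20 e21] Hreal] := no_real_eigen A10 A20 A30 k00 gam0 gA1 gA2 gA3 v0 K0 ha0 hc0 hd0 hb0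
  Cd0 h15 h26 hctrlA h37 hctrlC (dvW k) (dvdW k) (vW k) (vdW k) W0 Kb0 hKb dvJ vJ hI.
pose thr := Num.min e1 e2; have thr0 : 0 < thr by rewrite lt_min e10.
have t1 : thr <= e1 by rewrite ge_min lexx.
have t2 : thr <= e2 by rewrite ge_min lexx orbT.
clearbody thr.
have tri := @eigen_trichotomy R (omega + tau0) (s + tau0) (s - tau0) k0 gam K thr b a0 c0 d0 b0 _ _.
have {}tri : forall t rho eps a c b' d1 d2 y dy z dz, `|t| <= thr -> `|rho| <= thr -> 0 < eps <= thr ->
     close_pot gam K eps ((-1) ^+ b) a0 c0 d0 b0 a c b' d1 d2 ->
     eigen (omega + tau0) (s + tau0) (s - tau0) k0 t rho a c b' d1 d2 y dy z dz -> forall i k x, y i k x = 0 /\ z i k x = 0.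
  apply: tri => t.
    move=> rho eps sg a c b' d1 d2 y dy z dz ht /andP[rho0 hr] /andP[ep0 hep] hcl he.
    have h1 : 0 < rho <= e1 by rewrite rho0 (le_trans hr t1).
    have h2 : 0 <= eps <= e1 by rewrite ep0 (le_trans hep t1).
    exact: (Hcomplex _ _ _ _ _ _ _ _ _ _ _ _ _ (le_trans ht t1) h1 h2 hcl he).
  move=> eps sg a c b' d1 d2 y dy z dz ht /andP[ep0 hep] hsg hcl he.
  have h2 : 0 < eps <= e2 by rewrite ep0 (le_trans hep t2).
  exact: (Hreal _ _ _ _ _ _ _ _ _ _ _ _ (le_trans ht t2) h2 hsg hcl he).
(* A closed square of half-side [thr] contains the ball of that radius, and its two conditions are
   those of [tri] on [t] and [rho]. *)
exists [set lam | `|complex.Re lam| <= thr /\ `|complex.Im lam - tau0| <= thr].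
  have thrC : 0 < thr%:C by rewrite ltcR.
  apply: filterS (nbhsx_ballx (lam0 : R[i]^o) _ thrC) => lam; rewrite /ball /= cnormE ltcR => /ltW hl.
  have := le_trans (part_cnorm false _) hl; have := le_trans (part_cnorm true _) hl.
  rewrite /part; move: l0; rewrite /tau0; case: (lam0) (lam) => x1 y1 [x2 y2] /= -> h1 h2.
  by rewrite sub0r normrN in h2; rewrite distrC in h1.
apply: (at_rightP (e1 := Num.min (Num.min e3 e4) thr)); first by rewrite !lt_min e30 e40 thr0.
move=> eps eps0; rewrite !lt_min => /andP[/andP[h3 h4] h5] lam [hre him] hev.
have [[[tU tV] _ _ _] _] := hw eps eps0 h4.
have [y [dy [z [dz [he hnz]]]]] := eigen_classical hF3 (part_linear_cont (twice_dv tU).1)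
  (part_linear_cont (twice_dv tV).1) k02 hev.
have h6 : 0 < eps <= thr by rewrite eps0 ltW.
have h7 : 0 < eps <= e3 by rewrite eps0 ltW.
exact: hnz (tri _ _ _ _ _ _ _ _ _ _ _ _ him hre h6 (hclose eps h7) he).
Qed.
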